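(* Let $d=2$ and assume that $\varphi$ is smooth and elliptic. Assume also that $E^0\subset\mathbb R^2$ is a bounded convex set. Then the limit flow $E(t)$ of the geometric $L^1$-minimizing movement scheme for $P_\varphi$ starting from $E^0$ is given by a decreasing family of convex subsets of $E^0$.
   Context: $\varphi$ is a norm on $\mathbb R^d$; it is called smooth (resp. elliptic) if $\varphi^2/2$ is smooth (resp. strongly convex). The anisotropic perimeter is $P_\varphi(E)=\int_{\partial E}\varphi(\nu)\,d\mathcal H^{d-1}$ ($\nu$ the unit normal, $\partial E$ the reduced boundary). Geometric scheme: given $\tau>0$ and $E\subset\mathbb R^d$, $T_\tau E$ denotes a (possibly non-unique) minimizer of $\min_F P_\varphi(F)+\frac1{2\tau}|E\triangle F|^2$ over $F\subset\mathbb R^d$. Given $E^0$, $E^n:=T_\tau^nE^0$ and $E_\tau(t):=E^{\lfloor t/\tau\rfloor}$. A limit flow is a family $(E(t))_{t\ge 0}$ such that for some sequence $\tau_k\to0$, $\sup_{t\in[0,T]}|E(t)\triangle E_{\tau_k}(t)|\to0$ for all $T>0$. *)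

(* Defs.v *)
From HB Require Import structures.
From mathcomp Require Import all_boot all_order all_algebra.
From mathcomp Require Import all_classical all_reals all_analysis.
Set Implicit Arguments.
Unset Strict Implicit.
Unset Printing Implicit Defensive.
Import Order.TTheory GRing.Theory Num.Theory.
Import numFieldNormedType.Exports.
Local Open Scope classical_set_scope.
Local Open Scope ring_scope.

(* [measurableTypeR R] is the copy of [R] that carries [lebesgue_measure]. The
   library norm on [plane R] is the sup norm, which induces the usual topology;
   Euclidean quantities are written with [enorm]. *)
Notation plane R := (measurableTypeR R * measurableTypeR R)%type.

Section Plane.
Context {R : realType}.

Local Notation plane := (plane R).
Implicit Types (E F A : set plane) (f phi : plane -> R) (x y w : plane).

Definition enorm x : R := Num.sqrt (x.1 ^+ 2 + x.2 ^+ 2).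

Definition eball x (r : R) : set plane := [set y | enorm (y - x) < r].

(* Lebesgue measure: the Caratheodory completion of the product measure, so
   that its measurable sets are all the Lebesgue measurable sets. *)
Definition borel_area : {measure set plane -> \bar R} :=
  (@lebesgue_measure R \x @lebesgue_measure R)%E.

Definition area :
    {measure set (caratheodory_type (borel_area^*)%mu) -> \bar R} :=
  @completed_measure_extension _ _ _ borel_area.

Definition lmeasurable E : Prop :=
  ((borel_area^*)%mu).-cara.-measurable E.

Definition is_norm phi : Prop :=
  [/\ forall x, phi x = 0 -> x = 0,
      forall (a : R) x, phi (a *: x) = `|a| * phi x &
      forall x y, phi (x + y) <= phi x + phi y].

Fixpoint continuously_derivable (k : nat) (U : set plane) f : Prop :=
  (forall x, U x -> {for x, continuous f}) /\
  match k with
  | 0%N => True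
  | k'.+1 => (forall x v, U x -> derivable f x v) /\
             (forall v, continuously_derivable k' U ('D_v f))
  end.

(* [phi ^ 2 / 2] is positively 2-homogeneous: were it C^2 at the origin it
   would be a quadratic form. As usual for anisotropies, smoothness is
   therefore required away from the origin. *)
Definition smooth_norm phi : Prop :=
  forall k, continuously_derivable k [set x | x != 0]
    (fun x => phi x ^+ 2 / 2).

Definition elliptic_norm phi : Prop :=
  exists2 c : R, 0 < c &
    convex_function (E := plane) [set: plane]
      (fun x => phi x ^+ 2 / 2 - c / 2 * enorm x ^+ 2).

(* One-dimensional Hausdorff (outer) measure, built from Euclidean diameters.
   The library integral only evaluates it on Borel sets, where it is
   countably additive. *)

Definition diam A : \bar R :=
  ereal_sup [set d | d = 0%E \/
    exists x y, [/\ A x, A y & d = (enorm (x - y))%:E]].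

Definition hausdorff1_delta (delta : R) A : \bar R :=
  ereal_inf [set (\sum_(k <oo) diam (U k))%E | U in
    [set U : (set plane)^nat |
      (forall k, (diam (U k) <= delta%:E)%E) /\ A `<=` \bigcup_k U k]].

Definition hausdorff1 A : \bar R :=
  ereal_sup [set hausdorff1_delta delta A | delta in
    [set delta : R | 0 < delta]].

Definition test_function (u : plane -> R) : Prop :=
  continuously_derivable 1 setT u /\ compact (closure [set x | u x != 0]).

(* [nu m] is minus the distributional gradient of the indicator of [E], in
   polar form: [m] is its total variation. Such a pair [(m, nu)] is unique up
   to modifying [nu] on an [m]-negligible set. *)
Definition perimeter_polar E (m : {finite_measure set plane -> \bar R})
    (nu : plane -> plane) : Prop :=
  [/\ measurable_fun setT nu,
      {ae m, forall x, enorm (nu x) = 1} &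
      forall u v, test_function u -> test_function v ->
        (\int[area]_(x in E) ('D_(1, 0) u x + 'D_(0, 1) v x)%:E =
         \int[m]_x (u x * (nu x).1 + v x * (nu x).2)%:E)%E].

Definition finite_perimeter E : Prop :=
  exists m nu, perimeter_polar E m nu.

(* De Giorgi: [x] is in the reduced boundary when the averages of [nu] on
   shrinking balls converge to a unit vector. *)
Definition outer_normal_at E x w : Prop :=
  exists (m : {finite_measure set plane -> \bar R}) nu,
    [/\ perimeter_polar E m nu,
        forall r : R, 0 < r -> (0 < m (eball x r))%E,
        (\int[m]_(y in eball x r) (nu y).1) / fine (m (eball x r))
          @[r --> 0^'+] --> w.1,
        (\int[m]_(y in eball x r) (nu y).2) / fine (m (eball x r))
          @[r --> 0^'+] --> w.2 &
        enorm w = 1].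

Definition reduced_boundary E : set plane :=
  [set x | exists w, outer_normal_at E x w].

Definition outer_normal E x : plane := xget 0 [set w | outer_normal_at E x w].

Definition aniso_perimeter phi E : \bar R :=
  if `[< finite_perimeter E >] then
    (\int[hausdorff1]_(x in reduced_boundary E) (phi (outer_normal E x))%:E)%E
  else +oo%E.

Definition scheme_energy phi (tau : R) E F : \bar R :=
  (aniso_perimeter phi F +
    ((2 * tau)^-1)%:E * area (E `+` F) ^+ 2)%E.

Definition scheme_minimizer phi (tau : R) E F : Prop :=
  lmeasurable F /\
  forall G, lmeasurable G ->
    (scheme_energy phi tau E F <= scheme_energy phi tau E G)%E.

(* Minimizers need not be unique: any choice is allowed at each step. *)
Definition discrete_flow phi (tau : R) E0 (S : nat -> set plane) : Prop :=
  S 0%N = E0 /\ forall n, scheme_minimizer phi tau (S n) (S n.+1).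

Definition limit_flow phi E0 (E : R -> set plane) : Prop :=
  (forall t, 0 <= t -> lmeasurable (E t)) /\
  exists (tau : nat -> R) (S : nat -> nat -> set plane),
    [/\ forall k, 0 < tau k,
        tau @ \oo --> 0,
        forall k, discrete_flow phi (tau k) E0 (S k) &
        forall T : R, 0 < T ->
          ereal_sup [set area (E t `+` S k (Num.truncn (t / tau k)))
                    | t in `[0, T]] @[k --> \oo] --> 0%E].

End Plane.

(* Main.v *)
(** Let [F] minimize one step of the scheme from a convex set [E]. Writing the
    norm approximately as a finite sum [phi x ~ \sum_i a_i |<x, theta_i>|]
    (zonotopes are dense among planar symmetric convex bodies), the perimeter
    of a convex set becomes a weighted sum of its widths, [wperimeter].

    Lower bound: Besicovitch covering and Lebesgue points of the normal bound
    [aniso_perimeter phi F] below by the total variation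
    [\int phi (nu x) dm]. Mollifying the indicator of [F] and using the
    coarea formula along lines, some superlevel set splits into finitely many
    connected pieces whose total weighted width is at most this integral, up
    to a small error. Replacing each piece by its convex hull intersected with
    [E] decreases the widths. Two disjoint convex pieces are translated inside
    [E] until they touch, where taking the hull gains a definite amount of
    perimeter or area; so all pieces of non-negligible area merge into one
    convex [K] inside [E].

    Upper bound: polygons inscribed in [K] are competitors, by Gauss-Green on
    triangles. Minimality of [F] then leaves no room for the gain, and [F] is a.e.
    a limit of convex subsets of [E]. The discrete flows thus have nested convex
    representatives, and the set-theoretic lower limit along a rapidly
    converging subsequence is the required representative of the limit flow. *)
Require Import Defs.
From HB Require Import structures.
From mathcomp Require Import all_boot all_order all_algebra.
From mathcomp Require Import all_classical all_reals all_analysis.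
From mathcomp Require Import measurable_realfun ring lra.
Set Implicit Arguments.
Unset Strict Implicit.
Unset Printing Implicit Defensive.
Import Order.TTheory GRing.Theory Num.Theory.
Import numFieldNormedType.Exports.
Local Open Scope classical_set_scope.
Local Open Scope ring_scope.
Import HBNNSimple.

(** A minimizer [F] is merely a Lebesgue measurable set of finite perimeter, so perimeters are only
    compared through two one-sided bounds: [perimeter_lower] for arbitrary sets and
    [edges_perimeter] for polygons. They fit together because the competing polygon lies inside the
    convex set extracted from [F]. Widths are the right substitute for perimeter because they are
    monotone, insensitive to convex hulls and translations, and can be followed one direction at a
    time while pieces are merged. Two constants make the limit possible. The gain of a merge,
    [gain], depends on bounds for the norm, on the size of [E] and on an area threshold, but not on
    the approximation errors, so small errors turn it into a contradiction with minimality. Pieces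
    below the threshold [kappa ^+ 2 / L ^+ 2] have no uniform gain, but their perimeter is at least
    [L] times their area. With [L] above the rate at which the quadratic term of the energy can
    change, discarding them always pays, and minimality bounds their total area. *)

Lemma ge0_integralZlT d (T : measurableType d) (R : realType)
    (mu : {measure set T -> \bar R}) (f : T -> \bar R) (k : R) : 0 <= k ->
  measurable_fun setT f -> (forall x, 0 <= f x)%E ->
  (\int[mu]_x (k%:E * f x) = k%:E * \int[mu]_x f x)%E.
Proof. by move=> k0 mf f0; rewrite ge0_integralZl_EFin. Qed.

(** * Plane measure *)

Section PlaneBase.
Context {R : realType}.
Local Notation plane := (plane R).
Local Notation lam := (@lebesgue_measure R).

Lemma ballRE (a r b : R) : ball a r b <-> a - r < b /\ b < a + r.
Proof.
rewrite /ball/= ltr_norml; split=> [/andP[? ?]|[? ?]]; first by split; lra.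
by apply/andP; split; lra.
Qed.

(** The product sigma-algebra is generated by rectangles, so an open set is written as a countable
    union of squares with rational centres and half-sides [1/(n+1)]. *)
Lemma open_plane_measurable (U : set plane) : open U -> measurable U.
Proof.
move=> oU.
pose B (q : rat * rat * nat) : set plane :=
  ball (ratr q.1.1 : R) q.2.+1%:R^-1 `*` ball (ratr q.1.2 : R) q.2.+1%:R^-1.
pose G q := if `[< B q `<=` U >] then B q else set0.
have -> : U = \bigcup_q G q.
  apply/seteqP; split=> [x Ux|x [q _]]; last first.
    by rewrite /G; case: asboolP => // + Bx; exact.
  have /nbhs_ballP[e/= e0 eU] := oU _ Ux.
  have [n [d n0 [dE ne]]] : exists n : nat, exists2 d : R, 0 < d & d = n.+1%:R^-1 /\ 2 * d < e.
    have e20 : 0 < e / 2 by rewrite divr_gt0.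
    exists (Num.truncn (e / 2)^-1); exists (Num.truncn (e / 2)^-1).+1%:R^-1.
      by rewrite invr_gt0.
    split=> //.
    rewrite mulrC -ltr_pdivlMr// invf_plt ?posrE//; exact: truncnS_gt.
  have [p1 /andP[p1a p1b]] : exists p : rat, x.1 - d < ratr p < x.1 + d.
    have [|p] := @rat_in_itvoo R (x.1 - d) (x.1 + d); first by lra.
    by rewrite in_itv/= => ?; exists p.
  have [p2 /andP[p2a p2b]] : exists p : rat, x.2 - d < ratr p < x.2 + d.
    have [|p] := @rat_in_itvoo R (x.2 - d) (x.2 + d); first by lra.
    by rewrite in_itv/= => ?; exists p.
  exists ((p1, p2), n) => //.
  have Bx : B ((p1, p2), n) x.
    by rewrite /B/= -dE; split; apply/ballRE => /=; split; lra.
  rewrite /G; case: asboolP => [//|nB]; exfalso; apply: nB; rewrite /B/= -dE.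
  have key (a b c : R) : a - d < c -> c < a + d ->
      ball c d b -> ball a e b.
    by move=> ac ca /ballRE[? ?]; apply/ballRE; split; lra.
  move=> z [/= z1 z2]; apply: eU.
  by split; [exact: key z1|exact: key z2].
apply: countable_bigcupT_measurable => // q.
rewrite /G; case: asboolP => _ //.
by apply: measurableX; apply: open_measurable; exact: ball_open.
Qed.

Lemma closed_plane_measurable (U : set plane) : closed U -> measurable U.
Proof.
move=> cU; rewrite -[U]setCK; apply: measurableC; apply: open_plane_measurable.
exact: closed_openC.
Qed.

Lemma continuous_plane_measurable (f : plane -> R) :
  continuous f -> measurable_fun setT f.
Proof.
move=> cf; apply: (measurability _ (RGenOpens.measurableE R)).
move=> _ [_ [a [b ->] <-]]; rewrite setTI.
apply: open_plane_measurable; move/continuousP : cf => /(_ `]a, b[%classic); apply.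
exact: interval_open.
Qed.

Lemma measurable_pair (f g : plane -> R) : measurable_fun setT f ->
  measurable_fun setT g -> measurable_fun setT (fun x => (f x, g x) : plane).
Proof. by move=> mf mg; apply/measurable_fun_pairP. Qed.

Lemma ge0_integral_affine (f : R -> \bar R) (a b : R) : a != 0 ->
  measurable_fun setT f -> (forall x, 0 <= f x)%E ->
  (\int[lam]_x f (a * x + b)%R = `|a|%R^-1%:E * \int[lam]_x f x)%E.
Proof.
move=> a0 mf f0.
pose h (x : measurableTypeR R) : measurableTypeR R := a * x + b.
have mh : measurable_fun [set: measurableTypeR R] h.
  apply: measurable_funD; last exact: measurable_cst.
  by apply: measurable_funM => //; exact: measurable_cst.
have na0 : 0 < `|a| by rewrite normr_gt0.
pose mu := pushforward lam h : set (measurableTypeR R) -> _.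
pose k : {nonneg R} := NngNum (normr_ge0 a).
(* By uniqueness of Lebesgue measure the identity is tested on intervals []u, v]] only. For negative
   [a] their preimages are closed at the other end, with the same length. *)
have E A : measurable A -> lam A = mscale k (pushforward lam h) A.
  move=> mA; apply: lebesgue_measure_unique => // _ [[u v] /= _ <-].
  rewrite /mscale/= /pushforward.
  have [lt0|gt0|/eqP] := ltgtP a 0; last by rewrite (negbTE a0).
    have -> : h @^-1` `]u, v] = `[(v - b) / a, (u - b) / a[%classic.
      apply/seteqP; split=> x /=; rewrite !in_itv/= /h.
        by rewrite ler_ndivrMr// ltr_ndivlMr// => /andP[? ?]; apply/andP; split; lra.
      by rewrite ler_ndivrMr// ltr_ndivlMr// => /andP[? ?]; apply/andP; split; lra.
    rewrite !lebesgue_measure_itv/= !lte_fin ltr_nM2r ?invr_lt0// ltrD2r.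
    case: ifPn => _; last by rewrite mule0.
    rewrite -!EFinB -EFinM; congr EFin; rewrite ltr0_norm//.
    by field.
  have -> : h @^-1` `]u, v] = `](u - b) / a, (v - b) / a]%classic.
    apply/seteqP; split=> x /=; rewrite !in_itv/= /h.
      by rewrite ler_pdivlMr// ltr_pdivrMr// => /andP[? ?]; apply/andP; split; lra.
    by rewrite ler_pdivlMr// ltr_pdivrMr// => /andP[? ?]; apply/andP; split; lra.
  rewrite !lebesgue_measure_itv/= !lte_fin ltr_pM2r ?invr_gt0// ltrD2r.
  case: ifPn => _; last by rewrite mule0.
  rewrite -!EFinB -EFinM; congr EFin; rewrite gtr0_norm//.
  by field.
rewrite [in RHS](eq_measure_integral (mscale k (pushforward lam h))); last first.
  by move=> A mA _; exact: (E mh).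
rewrite [in RHS](ge0_integral_mscale _ measurableT)//.
rewrite [in RHS](ge0_integral_pushforward mh)//=.
by rewrite muleA -EFinM mulVf ?gt_eqF// mul1e preimage_setT.
Qed.

Lemma integral_plane_xy (f : plane -> \bar R) : measurable_fun setT f ->
  (forall x, 0 <= f x)%E ->
  (\int[borel_area]_z f z = \int[lam]_x \int[lam]_y f (x, y))%E.
Proof. by move=> mf f0; rewrite /borel_area fubini_tonelli1. Qed.

Lemma integral_plane_yx (f : plane -> \bar R) : measurable_fun setT f ->
  (forall x, 0 <= f x)%E ->
  (\int[borel_area]_z f z = \int[lam]_y \int[lam]_x f (x, y))%E.
Proof. by move=> mf f0; rewrite /borel_area fubini_tonelli2. Qed.

Lemma measurable_affine2 (a b c d p q : R) : measurable_fun setT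
  (fun x => (a * x.1 + b * x.2 + p, c * x.1 + d * x.2 + q) : plane).
Proof.
apply: measurable_pair; (apply: measurable_funD; last exact: measurable_cst);
  apply: measurable_funD; apply: measurable_funM; try exact: measurable_cst;
  first [exact: measurable_fst|exact: measurable_snd].
Qed.

Lemma measurable_int_x (f : plane -> \bar R) : measurable_fun setT f ->
  (forall x, 0 <= f x)%E ->
  measurable_fun setT (fun y : measurableTypeR R => \int[lam]_x f (x, y))%E.
Proof. move=> mf f0. exact (@measurable_fun_fubini_tonelli_G _ _ _ _ R lam f mf f0). Qed.

Lemma measurable_int_y (f : plane -> \bar R) : measurable_fun setT f ->
  (forall x, 0 <= f x)%E ->
  measurable_fun setT (fun x : measurableTypeR R => \int[lam]_y f (x, y))%E.
Proof. move=> mf f0. exact (@measurable_fun_fubini_tonelli_F _ _ _ _ R lam f mf f0). Qed.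

(** Gaussian elimination: for nonzero [a] the map is a scaling by [a] along horizontal lines
    followed by a shear with vertical factor [e], the determinant divided by [a]. Each factor is a
    one-dimensional change of variables under Tonelli. For [a = 0] the two coordinates exchange
    their roles. *)
Lemma ge0_integral_affine2 (f : plane -> \bar R) (a b c d p q : R) :
  a * d - b * c != 0 -> measurable_fun setT f -> (forall x, 0 <= f x)%E ->
  (\int[borel_area]_x f (a * x.1 + b * x.2 + p, c * x.1 + d * x.2 + q)%R =
   `|a * d - b * c|%R^-1%:E * \int[borel_area]_x f x)%E.
Proof.
move=> D0 mf f0.
have mg := measurableT_comp mf (measurable_affine2 a b c d p q).
rewrite integral_plane_yx//=.
have [a0|a0] := eqVneq a 0.
  have b0 : b != 0 by apply: contra_neq D0 => ->; rewrite a0; ring.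
  have c0 : c != 0 by apply: contra_neq D0 => ->; rewrite a0; ring.
  transitivity (\int[lam]_y (`|c|%R^-1%:E * \int[lam]_x f (b * y + p, x)%R))%E.
    apply: eq_integral => y _.
    rewrite -(@ge0_integral_affine (fun x => f (b * y + p, x)) c (d * y + q))//.
      by apply: eq_integral => x _; rewrite a0 mul0r add0r addrA.
    exact: measurableT_comp mf (pair1_measurable _).
  have mi := measurable_int_y mf f0.
  rewrite ge0_integralZlT//; first last.
  - by move=> y; exact: integral_ge0.
  - apply: (measurableT_comp mi).
    apply: measurable_funD; last exact: measurable_cst.
    by apply: measurable_funM => //; exact: measurable_cst.
  rewrite (@ge0_integral_affine (fun y => \int[lam]_x f (y, x))%E b p)//; last first.
    by move=> y; exact: integral_ge0.
  rewrite -integral_plane_xy// muleA -EFinM -invfM -normrM a0 mul0r sub0r normrN.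
  by rewrite mulrC [b * c]mulrC mulrC.
pose k := c / a; pose e := (a * d - b * c) / a.
have e0 : e != 0 by rewrite mulf_neq0// invr_eq0.
pose g (z : plane) := f (z.1, k * z.1 + e * z.2 + (q - k * p)).
have mg' : measurable_fun setT g.
  have := measurableT_comp mf (measurable_affine2 1 0 k e 0 (q - k * p)).
  by apply: eq_measurable_fun => z _ /=; rewrite mul1r mul0r !addr0.
have g0 z : (0 <= g z)%E by exact: f0.
transitivity (\int[lam]_y (`|a|%R^-1%:E * \int[lam]_x g (x, y)))%E.
  apply: eq_integral => y _.
  rewrite -(@ge0_integral_affine (fun x => g (x, y)) a (b * y + p))//.
    apply: eq_integral => x _; rewrite /g/= addrA; congr (f (_, _)).
    by rewrite /k /e; field.
  exact: measurableT_comp mg' (pair2_measurable _).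
rewrite ge0_integralZlT//; first last.
- by move=> y; exact: integral_ge0.
- exact (measurable_int_x mg' g0).
rewrite -integral_plane_yx// integral_plane_xy//.
transitivity (`|a|%R^-1%:E * \int[lam]_x (`|e|%R^-1%:E * \int[lam]_y f (x, y)))%E.
  congr (_ * _)%E; apply: eq_integral => x _.
  rewrite -(@ge0_integral_affine (fun y => f (x, y)) e (k * x + (q - k * p)))//.
    by apply: eq_integral => y _; rewrite /g/=; congr (f (_, _)); ring.
  exact: measurableT_comp mf (pair1_measurable _).
rewrite ge0_integralZlT//; first last.
- by move=> y; exact: integral_ge0.
- exact (measurable_int_y mf f0).
rewrite -integral_plane_xy// muleA -EFinM -invfM -normrM.
by rewrite /e mulrC divfK.
Qed.

End PlaneBase.

Section AreaBase.
Context {R : realType}.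
Local Notation plane := (plane R).
Implicit Types (A B E F : set plane).
Local Notation mustar := ((@borel_area R)^*)%mu.

Lemma area_borel A : measurable A -> area A = borel_area A.
Proof. by move=> mA; exact: (measurable_mu_extE (@borel_area R) mA). Qed.

Lemma borel_lmeasurable A : measurable A -> lmeasurable A.
Proof. by move=> mA; exact (@caratheodory_measurable_mu_ext _ R _ borel_area A mA). Qed.

Lemma le_area A B : A `<=` B -> (area A <= area B)%E.
Proof. by move=> AB; exact (@le_mu_ext _ _ R borel_area A B AB). Qed.

Lemma area_ge0 A : (0 <= area A)%E.
Proof. exact (@mu_ext_ge0 _ _ R borel_area (measure_ge0 _) A). Qed.

Lemma area0 : area (@set0 plane) = 0%E.
Proof. exact (@mu_ext0 _ _ R borel_area (measure0 _) (measure_ge0 _)). Qed.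

Lemma areaU A B : (area (A `|` B) <= area A + area B)%E.
Proof. exact: (outer_measureU2 mustar A B). Qed.

Lemma area_bigcup (F : (set plane)^nat) :
  (area (\bigcup_k F k) <= \sum_(k <oo) area (F k))%E.
Proof. exact: (outer_measure_sigma_subadditive mustar). Qed.

Lemma lmeasurableC E : lmeasurable E -> lmeasurable (~` E).
Proof. by move=> mE; exact: (measurableC (mE : measurable (E : set (caratheodory_type mustar)))). Qed.

Lemma lmeasurableU E F : lmeasurable E -> lmeasurable F -> lmeasurable (E `|` F).
Proof. by move=> mE mF; exact: (measurableU (E : set (caratheodory_type mustar)) F). Qed.

Lemma lmeasurableI E F : lmeasurable E -> lmeasurable F -> lmeasurable (E `&` F).
Proof. by move=> mE mF; exact: (measurableI (E : set (caratheodory_type mustar)) F). Qed.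

Lemma lmeasurableD E F : lmeasurable E -> lmeasurable F -> lmeasurable (E `\` F).
Proof. by move=> mE mF; rewrite setDE; apply: lmeasurableI => //; exact: lmeasurableC. Qed.

Lemma areaD_split E X : lmeasurable E ->
  area X = (area (X `&` E) + area (X `\` E))%E.
Proof. by move=> mE; rewrite setDE; exact: (mE X). Qed.

Lemma area0_lmeasurable E : area E = 0%E -> lmeasurable E.
Proof.
move=> E0; apply: le_caratheodory_measurable => X.
rewrite -[leRHS]add0e; apply: leeD; last exact: (le_area (@subIsetl _ _ _)).
by rewrite -E0; exact: (le_area (@subIsetr _ _ _)).
Qed.

Lemma area_setY_sub A B C :
  (area (A `+` C) <= area (A `+` B) + area (B `+` C))%E.
Proof.
apply: le_trans (areaU _ _); apply: le_area => x.
rewrite /setY /setD /=.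
by case: (pselect (B x)); tauto.
Qed.

Lemma area_le_setY A B : (area A <= area B + area (A `+` B))%E.
Proof.
apply: le_trans (areaU _ _); apply: le_area => x Ax /=.
by have [Bx|nBx] := pselect (B x); [left|right; left].
Qed.

Lemma eqA_area A B : area (A `+` B) = 0%E -> area A = area B.
Proof.
move=> AB; apply/eqP; rewrite eq_le.
have := area_le_setY A B; rewrite AB adde0 => ->/=.
by have := area_le_setY B A; rewrite setYC AB adde0.
Qed.

Lemma subset_area0 A B : A `<=` B -> area B = 0%E -> area A = 0%E.
Proof.
by move=> AB B0; apply/eqP; rewrite eq_le area_ge0 andbT -B0; exact: le_area.
Qed.

Lemma eqA_lmeasurable A B : lmeasurable B -> area (A `+` B) = 0%E -> lmeasurable A.
Proof.
move=> mB AB.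
have -> : A = (B `\` (B `\` A)) `|` (A `\` B).
  apply/seteqP; split=> x /=; case: (pselect (A x)); case: (pselect (B x)); tauto.
have sub X : X `<=` A `+` B -> lmeasurable X.
  by move=> X0; apply: area0_lmeasurable; exact: subset_area0 X0 AB.
apply: lmeasurableU; last by apply: sub => x; left.
by apply: lmeasurableD => //; apply: sub => x; right.
Qed.

(** [area] is an infimum over countable Borel covers. Intersecting covers of excess [1/(n+1)] gives
    a Borel superset of equal area, and finiteness turns equal area into a null difference. *)
Lemma lmeasurable_borel E : lmeasurable E -> (area E < +oo)%E ->
  exists2 B, measurable B & area (E `+` B) = 0%E.
Proof.
move=> mE finE.
have finE' : area E \is a fin_num by rewrite ge0_fin_numE// area_ge0.
have H n : exists B : set plane, [/\ measurable B, E `<=` B &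
    (area B <= area E + n.+1%:R^-1%:E)%E].
  have /ereal_inf_lt[_ [C [mC EC] <-] HC] : (area E < area E + (n.+1%:R^-1)%:E)%E.
    by rewrite lteDl// lte_fin invr_gt0.
  exists (\bigcup_k C k); split=> //; first exact: bigcupT_measurable.
  apply: le_trans (ltW HC); apply: le_trans (area_bigcup _) _.
  by apply: lee_nneseries => k *; [exact: area_ge0|rewrite area_borel].
have {H}[B HB] := choice H.
exists (\bigcap_n B n); first by apply: bigcapT_measurable => n; case: (HB n).
have EB : E `<=` \bigcap_n B n by move=> x Ex n _; have [_ + _] := HB n; exact.
have -> : E `+` \bigcap_n B n = \bigcap_n B n `\` E.
  by rewrite /setY; apply/seteqP; split=> x /=; [case=> [[/EB]|]|right].
have le n : (area (\bigcap_n B n) <= area E + n.+1%:R^-1%:E)%E.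
  have [_ _] := HB n; apply: le_trans.
  by apply: le_area => x; exact.
have EE : area (\bigcap_n B n) = (area E + area (\bigcap_n B n `\` E))%E.
  by rewrite [LHS](areaD_split _ mE); congr (area _ + _)%E; rewrite setIC; apply/setIidl.
apply/eqP; rewrite eq_le area_ge0 andbT; apply/lee_addgt0Pr => e e0; rewrite add0e.
have [n ne] : exists n : nat, n.+1%:R^-1 <= e.
  exists (Num.truncn e^-1); rewrite invf_ple ?posrE//; exact/ltW/truncnS_gt.
have := le n; rewrite EE leeD2lE// => /le_trans; apply.
by rewrite lee_fin.
Qed.

Let idc : caratheodory_type mustar -> plane := id.

Let midc : measurable_fun setT idc.
Proof. by move=> _ A mA; rewrite setTI; exact: borel_lmeasurable. Qed.

(** [perimeter_polar] integrates against the completion, whereas Fubini and changes of variables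
    concern the product measure. The identity is measurable from the completed space to the Borel
    one and pushes [area] to [borel_area]. *)
Lemma integral_area_borel E B (f : plane -> \bar R) : lmeasurable E ->
  measurable B -> area (E `+` B) = 0%E -> measurable_fun setT f ->
  (\int[area]_(x in E) f x = \int[borel_area]_(x in B) f x)%E.
Proof.
move=> mE mB EB mf.
have H (g : plane -> \bar R) : measurable_fun setT g -> (forall x, 0 <= g x)%E ->
    (\int[area]_(x in E) g x = \int[borel_area]_(x in B) g x)%E.
  move=> mg g0.
  have mgE : measurable_fun setT (g \o idc) by exact: (measurableT_comp mg).
  transitivity (\int[area]_(x in B) (g \o idc) x)%E.
    have mEB : (mustar).-cara.-measurable (E `&` B) by exact: lmeasurableI (borel_lmeasurable mB).
    have mBc := borel_lmeasurable mB.
    have mX := eqA_lmeasurable (borel_lmeasurable measurable0) (A := E `+` B).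
    have {}mX : lmeasurable (E `+` B) by apply: mX; rewrite setY0.
    rewrite [LHS](@ge0_negligible_integral _ _ _ area E (E `+` B))//; last first.
      exact: measurable_funTS.
    rewrite [RHS](@ge0_negligible_integral _ _ _ area B (E `+` B))//; last first.
      exact: measurable_funTS.
    suff -> : E `\` (E `+` B) = B `\` (E `+` B) by [].
    rewrite /setY; apply/seteqP; split=> x /=; case: (pselect (B x)); case: (pselect (E x)); tauto.
  rewrite -(ge0_integral_pushforward midc)//; last exact: measurable_funTS.
  apply: eq_measure_integral => A mA AB.
  by rewrite -(area_borel mA).
rewrite integralE [RHS]integralE; congr (_ - _)%E; apply: H.
- exact: measurable_funepos.
- by move=> x; exact: funepos_ge0.
- exact: measurable_funeneg.
- by move=> x; exact: funeneg_ge0.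
Qed.

End AreaBase.

(** * Test functions *)

Section TestFunctions.
Context {R : realType}.
Local Notation plane := (plane R).

(** The remainder bound is asked for every [h]. Piecewise quadratic functions satisfy it globally,
    which spares a case analysis of derivatives at the knots. *)
Lemma is_derive_quad (V : normedModType R) (f : V -> R) (x v : V) (l C : R) :
  (forall h : R, `|f (h *: v + x) - f x - l * h| <= C * h ^+ 2) ->
  is_derive x v f l.
Proof.
move=> H.
have C0 : 0 <= C by have := le_trans (normr_ge0 _) (H 1); rewrite expr1n mulr1.
suff L : h^-1 *: ((f \o shift x) (h *: v) - f x) @[h --> 0^'] --> (l : R^o).
  by apply: DeriveDef; [apply/cvg_ex; exists l|exact: cvg_lim].
apply/cvgrPdist_le => e e0.
near=> h.
have h0 : h != 0 by near: h; exact: nbhs_dnbhs_neq.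
rewrite /= /shift/=.
have -> : l - h^-1 * (f (h *: v + x) - f x) =
    - (h^-1 * (f (h *: v + x) - f x - l * h)) by field.
rewrite normrN normrM normfV ler_pdivrMl ?normr_gt0//.
apply: le_trans (H h) _.
have -> : C * h ^+ 2 = `|h| * (C * `|h|).
  by rewrite -[h ^+ 2]ger0_norm ?sqr_ge0// normrX; ring.
rewrite ler_wpM2l//.
have : `|h| <= e / (C + 1).
  near: h; apply: dnbhs0_le; rewrite divr_gt0//; lra.
rewrite ler_pdivlMr; last lra.
by apply: le_trans; rewrite mulrDr mulr1 mulrC lerDl.
Unshelve. all: by end_near. Qed.

Definition mx0 (r : R) := (r + `|r|) / 2.

Lemma mx0_pos r : 0 <= r -> mx0 r = r.
Proof. by move=> r0; rewrite /mx0 ger0_norm//; field. Qed.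

Lemma mx0_neg r : r <= 0 -> mx0 r = 0.
Proof. by move=> r0; rewrite /mx0 ler0_norm// subrr mul0r. Qed.

Lemma mx0_quad r h : `|mx0 (h + r) ^+ 2 - mx0 r ^+ 2 - 2 * mx0 r * h| <= h ^+ 2.
Proof.
rewrite ler_norml.
have [r0|r0] := lerP 0 r; have [hr|hr] := lerP 0 (h + r).
- by rewrite !mx0_pos//; apply/andP; split; nra.
- by rewrite (mx0_pos r0) (mx0_neg (ltW hr)); apply/andP; split; nra.
- by rewrite (mx0_pos hr) (mx0_neg (ltW r0)); apply/andP; split; nra.
- by rewrite (mx0_neg (ltW hr)) (mx0_neg (ltW r0)); apply/andP; split; nra.
Qed.

Lemma mx0_continuous : continuous mx0.
Proof.
by move=> r; apply: cvgM; [apply: cvgD; [exact: cvg_id|exact: cvg_norm]|exact: cvg_cst].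
Qed.

(* Quadratic B-spline primitive: a C^1 nondecreasing step from 0 to 1. *)
Definition step1 (r : R) := 2 * mx0 r ^+ 2 - 4 * mx0 (r - 2^-1) ^+ 2 + 2 * mx0 (r - 1) ^+ 2.
Definition dstep1 (r : R) := 4 * mx0 r - 8 * mx0 (r - 2^-1) + 4 * mx0 (r - 1).

Lemma step1_quad r h : `|step1 (h + r) - step1 r - dstep1 r * h| <= 8 * h ^+ 2.
Proof.
have := mx0_quad r h; have := mx0_quad (r - 2^-1) h; have := mx0_quad (r - 1) h.
rewrite !addrA /step1 /dstep1 !ler_norml.
move=> /andP[? ?] /andP[? ?] /andP[? ?]; apply/andP; split; nra.
Qed.

Lemma step1_le0 r : r <= 0 -> step1 r = 0.
Proof. by move=> r0; rewrite /step1 !mx0_neg; [ring|lra..]. Qed.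

Lemma step1_ge1 r : 1 <= r -> step1 r = 1.
Proof. by move=> r0; rewrite /step1 !mx0_pos; [field|lra..]. Qed.

Lemma step1_01 r : 0 <= step1 r <= 1.
Proof.
have [r0|r0] := lerP r 0; first by rewrite step1_le0// lexx ler01.
have [r1|r1] := lerP 1 r; first by rewrite step1_ge1// lexx ler01.
rewrite /step1 (mx0_pos (ltW r0)) [mx0 (r - 1)]mx0_neg; last lra.
have [h|h] := lerP r 2^-1.
  by rewrite mx0_neg; [apply/andP; split; nra|lra].
by rewrite mx0_pos; [apply/andP; split; nra|lra].
Qed.

Lemma dstep1_ge0 r : 0 <= dstep1 r.
Proof.
rewrite /dstep1.
have [r0|r0] := lerP r 0; first by rewrite !mx0_neg; lra.
have [r1|r1] := lerP 1 r; first by rewrite !mx0_pos; lra.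
rewrite (mx0_pos (ltW r0)) [mx0 (r - 1)]mx0_neg; last lra.
have [h|h] := lerP r 2^-1; first by rewrite mx0_neg; lra.
by rewrite mx0_pos; lra.
Qed.

Lemma dstep1_out r : r <= 0 \/ 1 <= r -> dstep1 r = 0.
Proof. by rewrite /dstep1 => -[r0|r0]; [rewrite !mx0_neg; lra|rewrite !mx0_pos; lra]. Qed.

Lemma step1_continuous : continuous step1.
Proof.
have H c : continuous (fun r : R => mx0 (r - c)).
  move=> r; apply: (cvg_comp (fun r => r - c)); last exact: mx0_continuous.
  by apply: cvgB; [exact: cvg_id|exact: cvg_cst].
move=> r; rewrite /step1; apply: cvgD; [apply: cvgB|]; apply: cvgM;
  try exact: cvg_cst; apply: cvgM; first [exact: mx0_continuous|exact: H].
Qed.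

Lemma dstep1_continuous : continuous dstep1.
Proof.
have H c : continuous (fun r : R => mx0 (r - c)).
  move=> r; apply: (cvg_comp (fun r => r - c)); last exact: mx0_continuous.
  by apply: cvgB; [exact: cvg_id|exact: cvg_cst].
move=> r; rewrite /dstep1; apply: cvgD; [apply: cvgB|]; apply: cvgM;
  try exact: cvg_cst; first [exact: mx0_continuous|exact: H].
Qed.

Lemma is_derive_step1 (r : R) : is_derive r (1 : R) step1 (dstep1 r).
Proof.
apply: (@is_derive_quad _ step1 r 1 (dstep1 r) 8) => h.
by have := step1_quad r h; rewrite -[h *: 1]/(h * 1) mulr1.
Qed.

Lemma continuous_compR (f : plane -> R) (g : R -> R) :
  continuous f -> continuous g -> continuous (fun x => g (f x)).
Proof. by move=> cf cg x; exact (continuous_comp (cf x) (cg (f x))). Qed.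

Definition lin (p x : plane) : R := p.1 * x.1 + p.2 * x.2.

Lemma linD p x y : lin p (x + y) = lin p x + lin p y.
Proof. by rewrite /lin/=; ring. Qed.
Lemma linB p x y : lin p (x - y) = lin p x - lin p y.
Proof. by rewrite /lin/=; ring. Qed.
Lemma linZ p a x : lin p (a *: x) = a * lin p x.
Proof. by rewrite /lin/= /GRing.scale/=; ring. Qed.

Lemma lin_continuous p : continuous (lin p).
Proof.
move=> x; apply: cvgD; apply: cvgM; try exact: cvg_cst; [exact: cvg_fst|exact: cvg_snd].
Qed.

Definition C1 (f : plane -> R) := continuously_derivable 1 setT f.

Lemma C1P (f : plane -> R) : continuous f ->
  (forall x v, derivable f x v) -> (forall v, continuous ('D_v f)) -> C1 f.
Proof. by move=> cf df cdf; split=> // [x _|]; [exact: cf|split=> // v]; split=> // x _; exact: cdf. Qed.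

Lemma C1_cont f : C1 f -> continuous f.
Proof. by case=> cf _ x; exact: cf. Qed.

Lemma C1_der f x v : C1 f -> derivable f x v.
Proof. by case=> _ [+ _]; exact. Qed.

Lemma C1_dcont f v : C1 f -> continuous ('D_v f).
Proof. by case=> _ [_ /(_ v)[+ _]] x; exact. Qed.

Lemma C1M f g : C1 f -> C1 g -> C1 (fun x => f x * g x).
Proof.
move=> Cf Cg; apply: C1P => [x|x v|v].
- by apply: cvgM; apply: C1_cont.
- by apply: derivableM; apply: C1_der.
- rewrite [X in continuous X](_ : _ = fun x => f x * 'D_v g x + g x * 'D_v f x).
    by move=> x; apply: cvgD; apply: cvgM; first [exact: C1_cont|exact: C1_dcont].
  by apply/funext => x; rewrite (@deriveM _ _ f g)//; apply: C1_der.
Qed.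

Lemma C1_cst (c : R) : C1 (fun=> c).
Proof.
apply: C1P => [x|x v|v]; [exact: cvg_cst|exact: derivable_cst|].
rewrite [X in continuous X](_ : _ = fun x => 0); first by move=> x; exact: cvg_cst.
by apply/funext => x; rewrite derive_cst.
Qed.

Lemma C1D f g : C1 f -> C1 g -> C1 (fun x => f x + g x).
Proof.
move=> Cf Cg; apply: C1P => [x|x v|v].
- by apply: cvgD; apply: C1_cont.
- by apply: derivableD; apply: C1_der.
- rewrite [X in continuous X](_ : _ = fun x => 'D_v f x + 'D_v g x).
    by move=> x; apply: cvgD; exact: C1_dcont.
  by apply/funext => x; rewrite (@deriveD _ _ _ f g)//; apply: C1_der.
Qed.

Lemma is_derive_step1_lin (p : plane) (c : R) x v :
  is_derive x v (fun x => step1 (lin p x + c)) (dstep1 (lin p x + c) * lin p v).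
Proof.
apply: (@is_derive_quad _ (fun x => step1 (lin p x + c)) x v _ (8 * lin p v ^+ 2)) => h.
have := step1_quad (lin p x + c) (h * lin p v).
rewrite linD linZ addrA (_ : _ * _ * h = dstep1 (lin p x + c) * (h * lin p v)); last ring.
by move=> /le_trans; apply; rewrite exprMn; lra.
Qed.

Lemma C1_step1_lin p c : C1 (fun x => step1 (lin p x + c)).
Proof.
have cl : continuous (fun x => lin p x + c).
  by move=> x; apply: cvgD; [exact: lin_continuous|exact: cvg_cst].
apply: C1P => [x|x v|v].
- exact: (continuous_compR cl step1_continuous).
- by have [] := is_derive_step1_lin p c x v.
- rewrite [X in continuous X](_ : _ = fun x => dstep1 (lin p x + c) * lin p v).
    move=> x; apply: cvgM; last exact: cvg_cst.
    exact: (continuous_compR cl dstep1_continuous).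
  by apply/funext => x; have [_ ->] := is_derive_step1_lin p c x v.
Qed.

Lemma compact_box (M : R) : compact [set x : plane | `|x.1| <= M /\ `|x.2| <= M].
Proof.
have -> : [set x : plane | `|x.1| <= M /\ `|x.2| <= M] =
    (`[- M, M]%classic : set R) `*` (`[- M, M]%classic : set R).
  by apply/seteqP; split=> x /=; rewrite !in_itv/= !ler_norml => -[? ?]; split.
by apply: compact_setX; exact: segment_compact.
Qed.

Lemma bounded_compact_closure (A : set plane) (M : R) :
  A `<=` [set x | `|x.1| <= M /\ `|x.2| <= M] -> compact (closure A).
Proof.
move=> AM; have cb := @compact_box M.
have clb : closed [set x : plane | `|x.1| <= M /\ `|x.2| <= M].
  by exact (compact_closed (@norm_hausdorff _ _) cb).
apply: (subclosed_compact _ cb); first exact: closed_closure.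
by move=> x /(closure_subset AM); rewrite -((closure_id _).1 clb).
Qed.

Lemma test_functionP (f : plane -> R) (M : R) : C1 f ->
  (forall x, f x != 0 -> `|x.1| <= M /\ `|x.2| <= M) -> test_function f.
Proof. by move=> Cf H; split=> //; apply: (@bounded_compact_closure _ M) => x /H. Qed.

Lemma test_functionE (f : plane -> R) : test_function f ->
  C1 f /\ exists2 M, 0 < M & forall x, M <= `|x.1| \/ M <= `|x.2| -> f x = 0.
Proof.
move=> [Cf /compact_bounded[M [Mr HM]]]; split=> //.
exists (Num.max M 0 + 2); first by rewrite ltr_wpDl// le_max lexx orbT.
move=> x Mx; apply/eqP/negPn/negP => fx.
have : `|x| <= Num.max M 0 + 1.
  apply: (HM (Num.max M 0 + 1)); first by rewrite ltr_pwDr// le_max lexx.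
  exact: subset_closure.
rewrite [`|x|]/(Num.max _ _) ge_max => /andP[? ?].
by case: Mx; lra.
Qed.

Lemma test_functionM (f g : plane -> R) : test_function f -> C1 g ->
  test_function (fun x => f x * g x).
Proof.
move=> /test_functionE[Cf [M M0 HM]] Cg; apply: (@test_functionP _ M); first exact: C1M.
move=> x fg; split; rewrite leNgt; apply/negP => Mx; move: fg; rewrite HM ?mul0r ?eqxx//.
  by left; exact: ltW.
by right; exact: ltW.
Qed.

Lemma test_functionD (f g : plane -> R) : test_function f -> test_function g ->
  test_function (fun x => f x + g x).
Proof.
move=> /test_functionE[Cf [M M0 HM]] /test_functionE[Cg [N N0 HN]].
apply: (@test_functionP _ (M + N)); first exact: C1D.
move=> x fg; split; rewrite leNgt; apply/negP => Mx; move: fg;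
  rewrite HM ?HN ?add0r ?eqxx//; try (left; lra); try (right; lra).
Qed.

End TestFunctions.

(** * Bounded measurable functions against finite measures *)

Section FiniteIntegrals.
Context d (T : measurableType d) {R : realType} (m : {finite_measure set T -> \bar R}).
Implicit Types f g : T -> R.

(** This class is integrable for every finite measure and closed under all operations used below, so
    real-valued integrals can be handled without separate integrability conditions. *)
Definition bmf f := measurable_fun setT f /\ exists C, forall x, `|f x| <= C.

Lemma bmf_cst c : bmf (cst c).
Proof. by split; [exact: measurable_cst|exists `|c|]. Qed.

Lemma bmfD f g : bmf f -> bmf g -> bmf (fun x => f x + g x).
Proof.
move=> [mf [C fC]] [mg [D gD]]; split; first exact: measurable_funD.
by exists (C + D) => x; rewrite (le_trans (ler_normD _ _))// lerD.
Qed.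

Lemma bmfM f g : bmf f -> bmf g -> bmf (fun x => f x * g x).
Proof.
move=> [mf [C fC]] [mg [D gD]]; split; first exact: measurable_funM.
by exists (C * D) => x; rewrite normrM ler_pM.
Qed.

Lemma bmfZ c f : bmf f -> bmf (fun x => c * f x).
Proof. by move=> bf; apply: bmfM => //; exact: bmf_cst. Qed.

Lemma bmfN f : bmf f -> bmf (fun x => - f x).
Proof.
move=> [mf [C fC]]; split; first exact: measurable_funN.
by exists C => x; rewrite normrN.
Qed.

Lemma bmfB f g : bmf f -> bmf g -> bmf (fun x => f x - g x).
Proof. by move=> bf bg; apply: bmfD => //; exact: bmfN. Qed.

Lemma bmf_norm f : bmf f -> bmf (fun x => `|f x|).
Proof.
move=> [mf [C fC]]; split; first exact: measurableT_comp.
by exists C => x; rewrite normr_id.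
Qed.

Lemma bmf_indic (A : set T) : measurable A -> bmf (\1_A : T -> R).
Proof.
move=> mA; split; first exact: measurable_indic.
by exists 1 => x; rewrite indicE; case: (_ \in _); rewrite ?normr1 ?normr0.
Qed.

Lemma bmf_int A f : measurable A -> bmf f -> m.-integrable A (EFin \o f).
Proof.
move=> mA [mf [C fC]]; apply: measurable_bounded_integrable => //.
- by rewrite ltey_eq fin_num_measure.
- exact: measurable_funTS.
- exists C; split; first exact: num_real.
  by move=> y Cy x _; exact: le_trans (fC x) (ltW Cy).
Qed.

Lemma rI_D f g : bmf f -> bmf g ->
  \int[m]_x (f x + g x) = \int[m]_x f x + \int[m]_x g x.
Proof. by move=> bf bg; rewrite RintegralD//; exact: bmf_int. Qed.

Lemma rI_B f g : bmf f -> bmf g ->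
  \int[m]_x (f x - g x) = \int[m]_x f x - \int[m]_x g x.
Proof. by move=> bf bg; rewrite RintegralB//; exact: bmf_int. Qed.

Lemma rI_Z c f : bmf f -> \int[m]_x (c * f x) = c * \int[m]_x f x.
Proof. by move=> bf; rewrite RintegralZl//; exact: bmf_int. Qed.

Lemma rI_le f g : bmf f -> bmf g -> (forall x, f x <= g x) ->
  \int[m]_x f x <= \int[m]_x g x.
Proof. by move=> bf bg fg; apply: le_Rintegral => //; exact: bmf_int. Qed.

Lemma rI_abs f : bmf f -> `|\int[m]_x f x| <= \int[m]_x `|f x|.
Proof. by move=> bf; apply: le_normr_Rintegral => //; exact: bmf_int. Qed.

Lemma rI_E f : bmf f -> (\int[m]_x (f x)%:E = (\int[m]_x f x)%:E)%E.
Proof. by move=> bf; rewrite fineK// integrable_fin_num//; exact: bmf_int. Qed.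

Lemma rI_indic (A : set T) : measurable A -> \int[m]_x \1_A x = fine (m A).
Proof. by move=> mA; rewrite /Rintegral integral_indic// setIT. Qed.

Lemma rI_indicM (A : set T) f : measurable A -> bmf f ->
  \int[m]_x (\1_A x * f x) = \int[m]_(x in A) f x.
Proof.
move=> mA bf; rewrite [RHS]Rintegral_mkcond; apply: eq_Rintegral => x _.
by rewrite patchE indicE; case: ifPn => _; rewrite ?mul1r ?mul0r.
Qed.

Lemma rI_triangle f g h : bmf f -> bmf g -> bmf h ->
  \int[m]_x `|f x - h x| <= \int[m]_x `|f x - g x| + \int[m]_x `|g x - h x|.
Proof.
move=> bf bg bh; rewrite -rI_D; try by apply/bmf_norm/bmfB.
apply: rI_le; first by apply/bmf_norm/bmfB.
  by apply: bmfD; apply/bmf_norm/bmfB.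
by move=> x; exact: ler_distD.
Qed.

Lemma rI_dc (f_ : nat -> T -> R) f C : (forall n, measurable_fun setT (f_ n)) ->
  (forall n x, `|f_ n x| <= C) -> bmf f ->
  (forall x, f_ n x @[n --> \oo] --> f x) ->
  forall e, 0 < e -> exists n, \int[m]_x `|f x - f_ n x| <= e.
Proof.
move=> mf_ fC bf cf e e0.
have b_ n : bmf (f_ n) by split => //; exists C.
have [|||||_ + _] := @dominated_convergence _ T R m setT measurableT
   (fun n => EFin \o f_ n) (EFin \o f) (cst C%:E).
- by move=> n; apply/measurable_EFinP.
- by apply/measurable_EFinP; case: bf.
- by apply: aeW => x _; apply: cvg_EFin; [exact: nearW|exact: cf].
- by apply: (bmf_int measurableT (bmf_cst C)).
- by apply: aeW => x n _; rewrite lee_fin.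
move=> /fine_cvgP[_ /cvgrPdist_le/(_ _ e0)[N _ /(_ N (leqnn N))]].
rewrite sub0r normrN /= => H; exists N.
rewrite (_ : \int[m]_x `|f x - f_ N x| = fine (\int[m]_x `|(f_ N x)%:E - (f x)%:E|)%E).
  by apply: le_trans H; exact: ler_norm.
by congr fine; apply: eq_integral => x _; rewrite distrC.
Qed.

End FiniteIntegrals.

(** * Indicators as limits of test functions in mean *)

Section Density.
Context {R : realType} (m : {finite_measure set (plane R) -> \bar R}).
Local Notation plane := (plane R).
Implicit Types f g : plane -> R.

Lemma C1_measurable f : C1 f -> measurable_fun setT f.
Proof. by move=> Cf; apply: continuous_plane_measurable; exact: C1_cont. Qed.

Definition e1 : plane := (1, 0).
Definition e2 : plane := (0, 1).

Definition cutoff (M : R) (x : plane) : R :=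
  step1 (lin e1 x + M) * step1 (lin (- e1) x + M) *
  (step1 (lin e2 x + M) * step1 (lin (- e2) x + M)).

Lemma cutoff_test M : test_function (cutoff M).
Proof.
apply: (@test_functionP _ _ M).
  by apply: C1M; apply: C1M; exact: C1_step1_lin.
move=> x; rewrite /cutoff /lin /=.
have H r : step1 r != 0 -> 0 <= r.
  by apply: contraNT; rewrite -ltNge => /ltW ?; rewrite step1_le0.
rewrite !mulf_eq0 !negb_or => /andP[/andP[/H a /H b] /andP[/H c /H e]].
by split; rewrite ler_norml; apply/andP; split; lra.
Qed.

Lemma cutoff_01 M x : 0 <= cutoff M x <= 1.
Proof.
rewrite /cutoff.
have H (a b : R) : 0 <= a <= 1 -> 0 <= b <= 1 -> 0 <= a * b <= 1.
  by move=> /andP[? ?] /andP[? ?]; apply/andP; split; nra.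
by apply: (H); apply: (H); exact: step1_01.
Qed.

Lemma cutoff_1 M x : `|x.1| <= M - 1 -> `|x.2| <= M - 1 -> cutoff M x = 1.
Proof.
rewrite !ler_norml => /andP[a b] /andP[c e].
by rewrite /cutoff /lin/= !step1_ge1 ?mulr1//; lra.
Qed.

Lemma cutoff_cvg x : cutoff n%:R x @[n --> \oo] --> (1 : R).
Proof.
apply: cvg_near_cst; exists (Num.truncn (`|x.1| + `|x.2| + 1)).+1 => // n /= nN.
have : `|x.1| + `|x.2| + 1 <= n%:R.
  apply: ltW; apply: lt_le_trans (truncnS_gt _) _.
  by rewrite ler_nat.
have := normr_ge0 x.1; have := normr_ge0 x.2 => *.
by apply: cutoff_1; lra.
Qed.

(** The sets with this property contain the half-planes and form a sigma-algebra. Keeping the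
    approximations between 0 and 1 makes products and complements stay in the class. *)
Definition approx A := forall e : R, 0 < e -> exists f,
  [/\ test_function f, forall x, 0 <= f x <= 1 & \int[m]_x `|\1_A x - f x| <= e].

Lemma test_bmf f : test_function f -> (forall x, 0 <= f x <= 1) -> bmf f.
Proof.
move=> [Cf _] f01; split; first exact: C1_measurable.
by exists 1 => x; have /andP[? ?] := f01 x; rewrite ger0_norm.
Qed.

Lemma approx_lim (A : set plane) (f_ : nat -> plane -> R) : measurable A ->
  (forall n, test_function (f_ n)) -> (forall n x, 0 <= f_ n x <= 1) ->
  (forall x, f_ n x @[n --> \oo] --> (\1_A x : R)) -> approx A.
Proof.
move=> mA tf f01 cf e e0.
have [|||n ne] := @rI_dc _ _ _ m f_ (\1_A) 1 _ _ _ cf e e0.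
- by move=> n; have [+ _] := tf n; exact: C1_measurable.
- by move=> n x; have /andP[? ?] := f01 n x; rewrite ger0_norm.
- exact: bmf_indic.
- by exists (f_ n).
Qed.

Lemma indic_01 (A : set plane) x : 0 <= (\1_A x : R) <= 1.
Proof. by rewrite indicE; case: (_ \in _); rewrite ?lexx ?ler01. Qed.

Lemma approxI (A B : set plane) : measurable A -> measurable B ->
  approx A -> approx B -> approx (A `&` B).
Proof.
move=> mA mB aA aB e e0.
have e20 : 0 < e / 2 by rewrite divr_gt0.
have [f [tf f01 fe]] := aA _ e20; have [g [tg g01 ge]] := aB _ e20.
have bf := test_bmf tf f01; have bg := test_bmf tg g01.
have bA := bmf_indic (R := R) mA; have bB := bmf_indic (R := R) mB.
have mAB := measurableI _ _ mA mB.
exists (fun x => f x * g x); split.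
- by apply: test_functionM => //; case: tg.
- by move=> x; have /andP[? ?] := f01 x; have /andP[? ?] := g01 x; apply/andP; split; nra.
- apply: le_trans (_ : \int[m]_x (`|\1_A x - f x| + `|\1_B x - g x|) <= _); last first.
    by rewrite rI_D; [lra|apply/bmf_norm/bmfB..].
  apply: rI_le; first by apply/bmf_norm/bmfB; [exact: bmf_indic|exact: bmfM].
    by apply: bmfD; apply/bmf_norm/bmfB.
  move=> x; rewrite indicI/=.
  have /andP[a b] := f01 x; have /andP[c dd] := indic_01 B x.
  rewrite (_ : _ - _ = (\1_A x - f x) * \1_B x + f x * (\1_B x - g x)); last ring.
  rewrite (le_trans (ler_normD _ _))// !normrM lerD//.
    by rewrite ler_piMr// ger0_norm.
  by rewrite ler_piMl// ger0_norm.
Qed.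

Lemma approxT : approx setT.
Proof.
apply: (@approx_lim setT (fun n => cutoff n%:R)) => //.
- by move=> n; exact: cutoff_test.
- by move=> n x; exact: cutoff_01.
- by move=> x; rewrite indicT; exact: cutoff_cvg.
Qed.

Lemma approxC (A : set plane) : measurable A -> approx A -> approx (~` A).
Proof.
move=> mA aA e e0.
have e20 : 0 < e / 2 by rewrite divr_gt0.
have [f [tf f01 fe]] := aA _ e20; have [g [tg g01 ge]] := approxT e20.
have bf := test_bmf tf f01; have bg := test_bmf tg g01.
have bA := bmf_indic (R := R) mA.
have bT : bmf (\1_[set: plane] : plane -> R) by exact: bmf_indic.
have mAB := measurableC mA.
exists (fun x => g x * (1 + (- 1) * f x)); split.
- apply: test_functionM => //; apply: C1D; first exact: C1_cst.
  by apply: C1M; [exact: C1_cst|case: tf].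
- by move=> x; have /andP[? ?] := f01 x; have /andP[? ?] := g01 x; apply/andP; split; nra.
- apply: le_trans (_ : \int[m]_x (`|\1_A x - f x| + `|\1_setT x - g x|) <= _); last first.
    by rewrite rI_D; [lra|apply/bmf_norm/bmfB..].
  apply: rI_le; first (apply/bmf_norm/bmfB; [exact: bmf_indic|]).
    by apply: bmfM => //; apply: bmfD; [exact: bmf_cst|exact: bmfZ].
    by apply: bmfD; apply/bmf_norm/bmfB.
  move=> x; rewrite indicC indicT/=.
  have -> : (x \notin A)%:R = 1 - \1_A x :> R.
    by rewrite indicE; case: (_ \in _); rewrite ?subr0 ?subrr.
  have /andP[a b] := f01 x; have /andP[c dd] := g01 x.
  rewrite (_ : _ - _ = - (\1_A x - f x) + (1 - f x) * (1 - g x)); last ring.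
  rewrite (le_trans (ler_normD _ _))// normrN lerD2l normrM ler_piMl//.
  by rewrite ger0_norm; lra.
Qed.

(** The finite intersections [G n] of complements decrease to the complement of the union. Dominated
    convergence therefore reduces the countable union to some [G n]. *)
Lemma approx_bigcup (F : (set plane)^nat) : (forall n, measurable (F n)) ->
  (forall n, approx (F n)) -> approx (\bigcup_n F n).
Proof.
move=> mF aF e e0.
pose G n := \big[setI/setT]_(i < n) ~` F i.
have mG n : measurable (G n) by apply: bigsetI_measurable => i _; exact: measurableC.
have aG n : approx (G n).
  rewrite /G; elim: n => [|n IH]; first by rewrite big_ord0; exact: approxT.
  rewrite big_ord_recr/=; apply: approxI => //; first exact: mG.
    exact: measurableC.
  exact: approxC.
have e20 : 0 < e / 2 by rewrite divr_gt0.
have mU : measurable (\bigcup_n F n) by exact: bigcupT_measurable.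
have [||||n ne] := @rI_dc _ _ _ m (fun n => \1_(~` G n)) (\1_(\bigcup_n F n)) 1 _ _ _ _ _ e20.
- by move=> n; apply: measurable_indic; exact: measurableC.
- by move=> n x; have /andP[? ?] := indic_01 (~` G n) x; rewrite ger0_norm.
- exact: bmf_indic.
- move=> x; apply: cvg_near_cst.
  have [[k _ Fk]|nF] := pselect ((\bigcup_n F n) x).
    exists k.+1 => // n /= kn; rewrite !indicE (mem_set (_ : (\bigcup_n F n) x)); last by exists k.
    rewrite mem_set// /G => Gx.
    suff : (~` F k) x by [].
    by move: Gx; rewrite (bigD1 (Ordinal kn))//= => -[].
  exists 0%N => // n _; rewrite [RHS]indicE [in RHS]memNset// indicE memNset//=.
  apply; rewrite /G; elim/big_ind : _ => // i _ Fi; apply: nF; by exists i.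
have [f [tf f01 fe]] := approxC (mG n) (aG n) e20.
exists f; split=> //.
have bf := test_bmf tf f01.
apply: le_trans (rI_triangle m (bmf_indic (R := R) mU)
  (bmf_indic (R := R) (measurableC (mG n))) bf) _.
lra.
Qed.

Lemma approx_measurable (A : set plane) : measurable A -> approx A.
Proof.
move=> mA; suff [] : measurable A /\ approx A by [].
have Srays (p : plane) (c : R) : measurable [set x | c < lin p x] /\ approx [set x | c < lin p x].
  have mS : measurable [set x | c < lin p x].
    apply: open_plane_measurable; rewrite -[X in open X]/(lin p @^-1` [set y | c < y]).
    by apply: open_comp; [move=> x _; exact: lin_continuous|exact: open_gt].
  (* The ramps [step1 (n (<p, x> - c))] converge pointwise to the indicator of the open half-plane,
     with value 0 on its boundary; the cutoff makes them compactly supported. *)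
  split=> //; apply: (@approx_lim _ (fun n x => cutoff n%:R x * step1 (lin (n%:R *: p) x + - (n%:R * c)))) => //.
  - by move=> n; apply: test_functionM; [exact: cutoff_test|exact: C1_step1_lin].
  - move=> n x; have /andP[? ?] := cutoff_01 n%:R x.
    have /andP[? ?] := step1_01 (lin (n%:R *: p) x + - (n%:R * c)).
    by apply/andP; split; nra.
  - move=> x; rewrite -[\1_ _ x]mul1r; apply: cvgM; first exact: cutoff_cvg.
    have E n : lin (n%:R *: p) x + - (n%:R * c) = n%:R * (lin p x - c).
      by rewrite /lin /= /GRing.scale/=; ring.
    rewrite indicE; have [cx|cx] := ltP c (lin p x).
      rewrite mem_set//; apply: cvg_near_cst.
      exists (Num.truncn (lin p x - c)^-1).+1 => // n /= nN.
      rewrite E step1_ge1// -ler_pdivrMr ?subr_gt0// div1r; apply: ltW.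
      by apply: lt_le_trans (truncnS_gt _) _; rewrite ler_nat.
    rewrite memNset//=; last by rewrite ltNge cx.
    apply: cvg_near_cst; exists 0%N => // n _.
    by rewrite E step1_le0// mulr_ge0_le0// subr_le0.
pose Good := [set A : set plane | measurable A /\ approx A].
have sG : sigma_algebra setT Good.
  split=> [|B [mB aB]|F GF].
  - by split=> //; rewrite -setCT; apply: approxC => //; exact: approxT.
  - by rewrite setTD; split; [exact: measurableC|exact: approxC].
  - by split; [apply: bigcupT_measurable => n|apply: approx_bigcup => n]; case: (GF n).
have sub (h : plane -> R) : (forall c, Good [set x | c < h x]) ->
    forall B : set R, measurable B -> Good (h @^-1` B).
  move=> Hh B mB.
  suff : <<s (@RGenOInfty.G R) >> `<=` [set B | Good (h @^-1` B)].
    by apply; move: mB; rewrite -[X in X -> _]/((R.-ocitv.-measurable).-sigma.-measurable B) RGenOInfty.measurableE.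
  apply: smallest_sub.
    case: sG => s0 sC sU; split=> [|C GC|F GF] /=.
    - by rewrite preimage_set0.
    - by rewrite setTD preimage_setC -setTD; exact: sC.
    - by rewrite preimage_bigcup; exact: sU.
  move=> _ [c ->] /=.
  rewrite (_ : _ @^-1` _ = [set x | c < h x])//.
  by apply/seteqP; split=> x /=; rewrite in_itv/= andbT.
move: A mA; apply: smallest_sub => // A [] [B mB <-]; rewrite setTI.
  apply: (sub fst) => // c; have := Srays e1 c.
  by rewrite (_ : [set x | c < lin e1 x] = [set x | c < x.1])//; apply/seteqP; split=> x /=; rewrite /lin/= mul1r mul0r addr0.
apply: (sub snd) => // c; have := Srays e2 c.
by rewrite (_ : [set x | c < lin e2 x] = [set x | c < x.2])//; apply/seteqP; split=> x /=; rewrite /lin/= mul1r mul0r add0r.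
Qed.

End Density.

(** * Derivatives along lines *)

Section Lines.
Context {R : realType}.
Local Notation plane := (plane R).
Local Notation lam := (@lebesgue_measure R).
Implicit Types f g : plane -> R.

Lemma C1_line f (y w : plane) (t : R) : C1 f ->
  is_derive t (1 : R) (fun t : R => f (y + t *: w)) ('D_w f (y + t *: w)).
Proof.
move=> Cf; have := @C1_der R f (y + t *: w) w Cf.
have E : (fun h : R => h^-1 *: (((fun t : R => f (y + t *: w)) \o shift t) (h *: (1 : R)) - f (y + t *: w))) =
    (fun h : R => h^-1 *: ((f \o shift (y + t *: w)) (h *: w) - f (y + t *: w))).
  apply/funext => h /=; congr (_ *: (f _ - _)); rewrite /shift/=.
  by rewrite scalerDl addrCA -[h *: 1]/(h * 1) mulr1.
move=> D; split; first by rewrite /derivable E.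
by rewrite /derive E.
Qed.

Lemma line_continuous (y w : plane) : continuous (fun t : R => y + t *: w).
Proof.
move=> t; apply: cvgD; first exact: cvg_cst.
by apply: cvgZl; exact: cvg_id.
Qed.

Lemma continuous_line f (y w : plane) : continuous f ->
  continuous (fun t : R => f (y + t *: w)).
Proof.
move=> cf t; exact (continuous_comp (@line_continuous y w t) (cf _)).
Qed.

Lemma C1_FTC f (y w : plane) (a b : R) : C1 f -> a <= b ->
  (\int[lam]_(t in `[a, b]) ('D_w f (y + t *: w))%:E =
   (f (y + b *: w) - f (y + a *: w))%:E)%E.
Proof.
move=> Cf; rewrite le_eqVlt => /predU1P[->|ab].
  by rewrite set_itv1 integral_set1 subrr.
have D t := C1_line y w t Cf.
have cF : continuous (fun t : R => f (y + t *: w)) by exact: continuous_line (C1_cont Cf).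
rewrite (@continuous_FTC2 _ _ (fun t : R => f (y + t *: w)) _ _ ab); [by []| | |].
- apply: continuous_subspaceT; exact (@continuous_line _ y w (@C1_dcont R f w Cf)).
- split.
  + by move=> t _; have [] := D t.
  + by apply: cvg_at_right_filter; exact: cF.
  + by apply: cvg_at_left_filter; exact: cF.
- by move=> t _; rewrite derive1E; have [_ ->] := D t.
Qed.

Lemma C1_MVT f (y w : plane) (h : R) : C1 f ->
  exists2 t : R, `|t| <= `|h| & f (y + h *: w) - f y = 'D_w f (y + t *: w) * h.
Proof.
move=> Cf; have D t := C1_line y w t Cf.
have cF : continuous (fun t : R => f (y + t *: w)) by exact: continuous_line (C1_cont Cf).
have [h0|h0] := lerP 0 h.
  have [|t] := @MVT_segment R (fun t : R => f (y + t *: w)) (fun t => 'D_w f (y + t *: w)) 0 h h0.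
    exact: continuous_subspaceT.
  rewrite in_itv/= scale0r addr0 subr0 => /andP[t0 th] E; exists t => //.
  by rewrite !ger0_norm.
have [|t] := @MVT_segment R (fun t : R => f (y + t *: w)) (fun t => 'D_w f (y + t *: w)) h 0 (ltW h0).
  exact: continuous_subspaceT.
rewrite in_itv/= scale0r addr0 sub0r => /andP[t0 th] E; exists t => //.
  by rewrite !ler0_norm ?lerN2// ltW.
by rewrite -opprB E; ring.
Qed.

(** The definition of [C1] gives directional derivatives one at a time. Linearity in the direction
    comes from two mean value theorems, along a horizontal and then a vertical segment, and
    continuity of the partial derivatives. *)
Lemma C1_derive_lin f (x v : plane) : C1 f ->
  'D_v f x = v.1 * 'D_e1 f x + v.2 * 'D_e2 f x.
Proof.
move=> Cf; have := C1_line x v 0 Cf; rewrite scale0r addr0 => -[D <-].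
apply: cvg_lim => //; apply/cvgrPdist_le => e e0.
pose K := `|v.1| + `|v.2| + 1.
have K0 : 0 < K by rewrite ltr_wpDl// addr_ge0.
have eK : 0 < e / K by rewrite divr_gt0.
have /cvgrPdist_le/(_ _ eK)/nbhs_ballP[d1 /= d10 H1] := @C1_dcont R f e1 Cf x.
have /cvgrPdist_le/(_ _ eK)/nbhs_ballP[d2 /= d20 H2] := @C1_dcont R f e2 Cf x.
pose d := Num.min d1 d2 / K.
have d0 : 0 < d by rewrite divr_gt0// lt_min d10.
near=> h.
have h0 : h != 0 by near: h; exact: nbhs_dnbhs_neq.
have hd : `|h| < d by near: h; apply: dnbhs0_lt.
rewrite /shift/= scale0r !addr0.
have [s sh Es] := C1_MVT x e1 (h * v.1) Cf.
have [t th Et] := C1_MVT (x + (h * v.1) *: e1) e2 (h * v.2) Cf.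
have -> : x + (h *: (1 : R)) *: v = x + (h * v.1) *: e1 + (h * v.2) *: e2.
  rewrite -[h *: 1]/(h * 1) mulr1 -addrA; congr (_ + _).
  rewrite {1}(surjective_pairing v).
  by congr (_, _); rewrite /= /GRing.scale/= ?mulr1 ?mulr0 ?addr0 ?add0r.
have -> : h^-1 *: (f (x + (h * v.1) *: e1 + (h * v.2) *: e2) - f x) =
    v.1 * 'D_e1 f (x + s *: e1) + v.2 * 'D_e2 f (x + (h * v.1) *: e1 + t *: e2).
  rewrite -[LHS]/(h^-1 * _).
  rewrite -(subrK (f (x + (h * v.1) *: e1)) (f (x + (h * v.1) *: e1 + (h * v.2) *: e2))).
  by rewrite -addrA Et Es; field.
have hK : `|h| * K < Num.min d1 d2 by rewrite -ltr_pdivlMr.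
have hv1 : `|h| * `|v.1| <= `|h| * K by rewrite ler_wpM2l// /K -addrA lerDl addr_ge0.
have hv2 : `|h| * `|v.2| <= `|h| * K by rewrite ler_wpM2l// /K [X in _ <= X + _]addrC -addrA lerDl addr_ge0.
move: sh th; rewrite !normrM => sh th.
have L1 := le_lt_trans (le_trans sh hv1) hK; have L2 := le_lt_trans (le_trans th hv2) hK.
have L3 := le_lt_trans hv1 hK; rewrite !lt_min in L1 L2 L3.
move: L1 L2 L3 => /andP[L1 L1'] /andP[L2 L2'] /andP[L3 L3'].
have B1 : `|'D_e1 f x - 'D_e1 f (x + s *: e1)| <= e / K.
  apply: H1; split; rewrite /ball/= /GRing.scale/= ?mulr1 ?mulr0 ?addr0 ?subrr ?normr0//.
  by rewrite opprD addNKr normrN.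
have B2 : `|'D_e2 f x - 'D_e2 f (x + (h * v.1) *: e1 + t *: e2)| <= e / K.
  apply: H2; split; rewrite /ball/= /GRing.scale/= ?mulr1 ?mulr0 ?addr0.
    by rewrite opprD addNKr normrN normrM.
  by rewrite opprD addNKr normrN.
have -> : forall a b c g : R, v.1 * a + v.2 * b - (v.1 * c + v.2 * g) =
   v.1 * (a - c) + v.2 * (b - g) by move=> *; ring.
apply: le_trans (ler_normD _ _) _; rewrite !normrM.
apply: le_trans (_ : `|v.1| * (e / K) + `|v.2| * (e / K) <= _).
  by apply: lerD; apply: ler_wpM2l.
rewrite -mulrDl mulrA ler_pdivrMr// mulrC ler_wpM2l//; first exact: ltW.
by rewrite /K lerDl.
Unshelve. all: by end_near. Qed.

End Lines.

Lemma measurable_superlevel d (T : measurableType d) (R : realType) (f : T -> R) (c : R) :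
  measurable_fun setT f -> measurable [set x | c <= f x].
Proof.
move=> mf; rewrite (_ : [set x | _] = setT `&` f @^-1` `[c, +oo[).
  by apply: mf => //; exact: measurable_itv.
by rewrite setTI; apply/seteqP; split=> x /=; rewrite in_itv/= andbT.
Qed.

Section FiniteSum.
Context d (T : measurableType d) (R : realType) (m m' : {finite_measure set T -> \bar R}).

(** The sum of two measures lets one test function be close in mean for both of them at once. *)
Definition fmeasure_add : set T -> \bar R := measure_add m m'.
HB.instance Definition _ := Measure.on fmeasure_add.

Let fin : fin_num_fun fmeasure_add.
Proof.
move=> A mA; rewrite /fmeasure_add measure_addE fin_numD; apply/andP; split;
  exact: fin_num_measure.
Qed.
HB.instance Definition _ := Measure_isFinite.Build _ T R fmeasure_add fin.
End FiniteSum.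

(** * Density for bounded functions and uniqueness of the polar pair *)

Section Polar.
Context {R : realType}.
Local Notation plane := (plane R).
Local Notation lam := (@lebesgue_measure R).
Implicit Types f g : plane -> R.

(** Binary digits: with [A] the set where [f] is at least 1/2, [f] is half of [1_A] plus half of
    [2 f - 1_A], which again takes values in the unit interval. Each digit halves the remaining
    error, and the digit errors, weighted by powers of 1/2, add up to at most [e / 2]. *)
Lemma density01 (m : {finite_measure set plane -> \bar R}) f :
  measurable_fun setT f -> (forall x, 0 <= f x <= 1) -> forall e, 0 < e ->
  exists g, [/\ test_function g, forall x, 0 <= g x <= 1 & \int[m]_x `|f x - g x| <= e].
Proof.
move=> mf f01 e e0.
pose M := \int[m]_x (1 : R).
have b1 : bmf (fun _ : plane => 1 : R) by exact: bmf_cst.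
have M0 : 0 <= M by apply: Rintegral_ge0.
have H n : forall f, measurable_fun setT f -> (forall x, 0 <= f x <= 1) ->
    exists g, [/\ test_function g, forall x, 0 <= g x <= 1 &
      \int[m]_x `|f x - g x| <= e / 2 + 2^-1 ^+ n * M].
  elim: n => [|n IH] {f01 mf} f mf f01.
    exists (fun x => cutoff 1 x * 0); split.
    - by apply: test_functionM; [exact: cutoff_test|exact: C1_cst].
    - by move=> x; rewrite mulr0 lexx ler01.
    - rewrite expr0 mul1r (le_trans (_ : _ <= M))//; last by rewrite lerDr divr_ge0// ltW.
      have bf : bmf f.
        by split=> //; exists 1 => x; have /andP[? ?] := f01 x; rewrite ger0_norm.
      apply: rI_le => //.
        by apply/bmf_norm/bmfB => //; apply: bmfM; [|exact: bmf_cst]; apply: test_bmf; [exact: cutoff_test|exact: cutoff_01].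
      by move=> x; have /andP[? ?] := f01 x; rewrite mulr0 subr0 ger0_norm.
  have mA : measurable [set x | 2^-1 <= f x].
    exact: measurable_superlevel.
  pose A := [set x | 2^-1 <= f x].
  have e20 : 0 < e / 2 by rewrite divr_gt0.
  have [gA [tA gA01 HA]] := approx_measurable m mA e20.
  pose f2 x := 2 * f x - \1_A x.
  have [||g2 [t2 g201 H2]] := IH f2.
  - apply: measurable_funB; last exact: measurable_indic.
    by apply: measurable_funM => //; exact: measurable_cst.
  - move=> x; have /andP[? ?] := f01 x; rewrite /f2 indicE.
    have [Ax|nAx] := lerP 2^-1 (f x).
      by rewrite mem_set//=; apply/andP; split; lra.
    rewrite memNset /A/= ?leNgt ?nAx//.
    by apply/andP; split; lra.
  exists (fun x => gA x * 2^-1 + g2 x * 2^-1); split.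
  - by apply: test_functionD; [apply: (test_functionM tA)|apply: (test_functionM t2)]; exact: C1_cst.
  - by move=> x; have /andP[? ?] := gA01 x; have /andP[? ?] := g201 x; apply/andP; split; lra.
  - have bf : bmf f.
      by split=> //; exists 1 => x; have /andP[? ?] := f01 x; rewrite ger0_norm.
    have bA := bmf_indic (R := R) mA.
    have bgA := test_bmf tA gA01; have bg2 := test_bmf t2 g201.
    have bf2 : bmf f2 by apply: bmfB => //; exact: bmfZ.
    apply: le_trans (_ : \int[m]_x (2^-1 * `|\1_A x - gA x| + 2^-1 * `|f2 x - g2 x|) <= _).
      apply: rI_le.
      + by apply/bmf_norm/bmfB => //; apply: bmfD; apply: bmfM => //; exact: bmf_cst.
      + by apply: bmfD; apply/bmfZ/bmf_norm/bmfB.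
      + move=> x.
        rewrite (_ : f x - _ = 2^-1 * (\1_A x - gA x) + 2^-1 * (f2 x - g2 x)); last by rewrite /f2; field.
        apply: le_trans (ler_normD _ _) _.
        by rewrite !normrM [X in X * _]ger0_norm ?invr_ge0// [`|2^-1|]ger0_norm ?invr_ge0.
    rewrite rI_D; try by apply/bmfZ/bmf_norm/bmfB.
    rewrite !rI_Z; try by apply/bmf_norm/bmfB.
    by rewrite exprS; lra.
have [n nM] : exists n : nat, 2^-1 ^+ n * M <= e / 2.
  have c : 2^-1 ^+ n * M @[n --> \oo] --> 0 * M.
    apply: cvgM; last exact: cvg_cst.
    by apply: cvg_expr; rewrite ger0_norm ?invr_ge0// invf_lt1// ltr1n.
  have e20 : 0 < e / 2 by rewrite divr_gt0.
  move: c; rewrite mul0r => /cvgrPdist_le/(_ _ e20)[N _ /(_ N (leqnn N))].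
  rewrite sub0r normrN => H'; exists N; apply: le_trans H'; exact: ler_norm.
have [g [tg g01 Hg]] := H n f mf f01.
by exists g; split=> //; lra.
Qed.

Lemma density (m : {finite_measure set plane -> \bar R}) f :
  measurable_fun setT f -> (forall x, `|f x| <= 1) -> forall e, 0 < e ->
  exists g, [/\ test_function g, forall x, `|g x| <= 1 & \int[m]_x `|f x - g x| <= e].
Proof.
move=> mf f1 e e0.
have e20 : 0 < e / 2 by rewrite divr_gt0.
pose fp x := mx0 (f x); pose fn x := mx0 (- f x).
have mm : measurable_fun setT (@mx0 R) by apply: continuous_measurable_fun; exact: mx0_continuous.
have mfp : measurable_fun setT fp by exact: (measurableT_comp mm mf).
have mfn : measurable_fun setT fn by apply: (measurableT_comp mm); exact: measurable_funN.
have fp01 x : 0 <= fp x <= 1.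
  rewrite /fp; have := f1 x; rewrite ler_norml => /andP[? ?].
  by have [?|?] := lerP 0 (f x); [rewrite mx0_pos//; apply/andP; split|rewrite mx0_neg ?lexx ?ler01//; exact: ltW].
have fn01 x : 0 <= fn x <= 1.
  rewrite /fn; have := f1 x; rewrite ler_norml => /andP[? ?].
  by have [?|?] := lerP 0 (- f x); [rewrite mx0_pos//; apply/andP; split; lra|rewrite mx0_neg ?lexx ?ler01//; exact: ltW].
have [g1 [t1 g101 H1]] := density01 m mfp fp01 e20.
have [g2 [t2 g201 H2]] := density01 m mfn fn01 e20.
exists (fun x => g1 x + g2 x * -1); split.
- by apply: (test_functionD t1); apply: (test_functionM t2); exact: C1_cst.
- by move=> x; have /andP[? ?] := g101 x; have /andP[? ?] := g201 x; rewrite ler_norml; apply/andP; split; lra.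
- have bf : bmf f by split=> //; exists 1.
  have b1 := test_bmf t1 g101; have b2 := test_bmf t2 g201.
  have bfp : bmf fp by split=> //; exists 1 => x; have /andP[? ?] := fp01 x; rewrite ger0_norm.
  have bfn : bmf fn by split=> //; exists 1 => x; have /andP[? ?] := fn01 x; rewrite ger0_norm.
  apply: le_trans (_ : \int[m]_x (`|fp x - g1 x| + `|fn x - g2 x|) <= _); last first.
    by rewrite rI_D; [lra|apply/bmf_norm/bmfB..].
  apply: rI_le.
  + by apply/bmf_norm/bmfB => //; apply: bmfD => //; apply: bmfM => //; exact: bmf_cst.
  + by apply: bmfD; apply/bmf_norm/bmfB.
  + move=> x; rewrite -(normrN (fn x - g2 x)); apply: le_trans (ler_normD _ _).
    rewrite le_eqVlt; apply/orP; left; apply/eqP; congr `|_|.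
    by rewrite /fp /fn /mx0 normrN; field.
Qed.

(** Unit length is demanded everywhere instead of almost everywhere; [polar_normalize] reaches this
    form by changing [nu] on a null set. *)
Definition unit_polar (E : set plane) (m : {finite_measure set plane -> \bar R})
    (nu : plane -> plane) :=
  perimeter_polar E m nu /\ forall x, enorm (nu x) = 1.

Lemma enorm_continuous : continuous (@enorm R).
Proof.
move=> x; rewrite /enorm.
have c : continuous (fun x : plane => x.1 ^+ 2 + x.2 ^+ 2).
  by move=> y; apply: cvgD; apply: cvgM; [exact: cvg_fst|exact: cvg_fst|exact: cvg_snd|exact: cvg_snd].
exact (continuous_compR c (@sqrt_continuous R) (x := x)).
Qed.

Lemma enorm_ge0 (x : plane) : 0 <= enorm x.
Proof. exact: sqrtr_ge0. Qed.

Lemma enorm_sqr (x : plane) : enorm x ^+ 2 = x.1 ^+ 2 + x.2 ^+ 2.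
Proof. by rewrite sqr_sqrtr// addr_ge0// sqr_ge0. Qed.

Lemma polar_normalize E m nu : perimeter_polar E m nu ->
  exists2 nu', unit_polar E m nu' & {ae m, forall x, nu' x = nu x}.
Proof.
move=> [mnu nu1 H].
pose nu' x := if enorm (nu x) == 1 then nu x else e1.
have mb : measurable_fun setT (fun x => enorm (nu x) == 1).
  apply: measurable_fun_eqr; last exact: measurable_cst.
  by apply: (measurableT_comp _ mnu); apply: continuous_plane_measurable; exact: enorm_continuous.
have mnu' : measurable_fun setT nu' by apply: measurable_fun_ifT.
have ae' : {ae m, forall x, nu' x = nu x}.
  by apply: filterS nu1 => x x1; rewrite /nu' x1 eqxx.
have u1 x : enorm (nu' x) = 1.
  rewrite /nu'; case: ifPn => [/eqP//|_].
  by rewrite /enorm/= expr1n expr0n addr0 sqrtr1.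
exists nu' => //; split => //; split=> //.
  by apply: filterS nu1 => x _; exact: u1.
move=> u v tu tv; rewrite H//.
have [Cu _] := tu; have [Cv _] := tv.
have me (n : plane -> plane) : measurable_fun setT n ->
    measurable_fun setT (fun x => (u x * (n x).1 + v x * (n x).2)%:E).
  move=> mn; apply/measurable_EFinP; apply: measurable_funD; apply: measurable_funM.
  - exact: C1_measurable Cu.
  - by apply: (measurableT_comp measurable_fst mn).
  - exact: C1_measurable Cv.
  - by apply: (measurableT_comp measurable_snd mn).
apply: ae_eq_integral => //; [exact: me|exact: me|].
by apply: filterS ae' => x -> _.
Qed.

Lemma unit_polar_le E m nu x : unit_polar E m nu ->
  `|(nu x).1| <= 1 /\ `|(nu x).2| <= 1.
Proof.
move=> [_ /(_ x) n1]; have := enorm_sqr (nu x); rewrite n1 expr1n => n2.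
have s1 := sqr_ge0 (nu x).1; have s2 := sqr_ge0 (nu x).2.
by split; rewrite ler_norml; apply/andP; split; nra.
Qed.

Lemma unit_polar_measurable E m nu : unit_polar E m nu ->
  [/\ measurable_fun setT nu, bmf (fun x => (nu x).1) & bmf (fun x => (nu x).2)].
Proof.
move=> U; have [[mnu _ _] _] := U; split=> //; split.
- exact: (measurableT_comp measurable_fst mnu).
- by exists 1 => x; have [] := unit_polar_le x U.
- exact: (measurableT_comp measurable_snd mnu).
- by exists 1 => x; have [] := unit_polar_le x U.
Qed.

Lemma test_bounded f : test_function f -> bmf f.
Proof.
move=> tf; have [Cf [M M0 HM]] := test_functionE tf; split; first exact: C1_measurable.
have /compact_bounded[N [_ HN]] : compact (f @` [set x : plane | `|x.1| <= M /\ `|x.2| <= M]).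
  apply: continuous_compact; last exact: compact_box.
  by apply: continuous_subspaceT; exact: C1_cont.
exists (`|N| + 1) => x.
have [[a b]|nab] := pselect (`|x.1| <= M /\ `|x.2| <= M).
  by apply: (HN (`|N| + 1)); [rewrite ltr_pwDr// ler_norm|exists x].
rewrite HM ?normr0 ?addr_ge0//.
by have [|] := lerP M `|x.1|; [left|right; rewrite leNgt; apply/negP => ?; apply: nab; split; exact: ltW].
Qed.

Lemma unit_polar_test E m nu f (e : plane) : unit_polar E m nu -> test_function f ->
  (\int[area]_(x in E) ('D_e f x)%:E = (\int[m]_x (f x * lin e (nu x)))%:E)%E.
Proof.
move=> U tf; have [[mnu nu1 H] _] := U; have [Cf _] := tf.
have [_ b1 b2] := unit_polar_measurable U; have bf := test_bounded tf.
have t1 : test_function (fun x => f x * e.1) by exact (test_functionM tf (C1_cst _)).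
have t2 : test_function (fun x => f x * e.2) by exact (test_functionM tf (C1_cst _)).
have {t1 t2} := H _ _ t1 t2.
have EI : (\int[area]_(x in E) ('D_e f x)%:E =
    \int[area]_(x in E) ('D_(1, 0) (fun x => f x * e.1) x + 'D_(0, 1) (fun x => f x * e.2) x)%:E)%E.
  apply: eq_integral => x _; congr EFin; rewrite C1_derive_lin//.
  have D c w : 'D_w (fun x => f x * c) x = c * 'D_w f x.
    rewrite (_ : (fun x => f x * c) = c \*: f); last by apply/funext => y; rewrite /= mulrC.
    by rewrite deriveZ//; exact: C1_der.
  by rewrite !D.
rewrite EI => ->.
rewrite -rI_E; last first.
  apply: bmfM => //; rewrite /lin; apply: bmfD; exact: bmfZ.
by apply: eq_integral => x _; congr EFin; rewrite /lin; ring.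
Qed.

(** Both sides are the same distribution when [f] is a test function. A bounded [f] is approximated
    in mean for [m + m'] simultaneously, and [|lin e (nu x)|] is bounded by [K]. *)
Lemma unit_polar_unique E m nu m' nu' f e : unit_polar E m nu -> unit_polar E m' nu' ->
  measurable_fun setT f -> (forall x, `|f x| <= 1) ->
  \int[m]_x (f x * lin e (nu x)) = \int[m']_x (f x * lin e (nu' x)).
Proof.
move=> U U' mf f1.
have [mnu b1 b2] := unit_polar_measurable U; have [mnu' b1' b2'] := unit_polar_measurable U'.
have bf : bmf f by split=> //; exists 1.
pose K := `|e.1| + `|e.2|.
have K0 : 0 <= K by rewrite addr_ge0.
have bl : bmf (fun x => lin e (nu x)) by apply: bmfD; exact: bmfZ.
have bl' : bmf (fun x => lin e (nu' x)) by apply: bmfD; exact: bmfZ.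
have lK E0 mm n x : unit_polar E0 mm n -> `|lin e (n x)| <= K.
  move=> U0; have [a b] := unit_polar_le x U0.
  by rewrite /lin (le_trans (ler_normD _ _))// !normrM lerD// ler_piMr.
apply/eqP; rewrite -subr_eq0 -normr_le0; apply/ler_addgt0Pr => d d0; rewrite add0r.
pose mu : {finite_measure set plane -> \bar R} := fmeasure_add m m'.
have dK : 0 < d / (K + 1) by rewrite divr_gt0// ltr_pwDr.
have [g [tg g1 Hg]] := density mu mf f1 dK.
have bg : bmf g by split; [apply: C1_measurable; case: tg|exists 1].
have Eg : \int[m]_x (g x * lin e (nu x)) = \int[m']_x (g x * lin e (nu' x)).
  by apply: EFin_inj; rewrite -(unit_polar_test e U tg) -(unit_polar_test e U' tg).
have bd : bmf (fun x => `|f x - g x|) by apply/bmf_norm/bmfB.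
have Hmu : \int[mu]_x `|f x - g x| = \int[m]_x `|f x - g x| + \int[m']_x `|f x - g x|.
  apply: EFin_inj; rewrite EFinD -!rI_E//.
  apply: (ge0_integral_measure_add _ _ measurableT) => //.
  by apply/measurable_EFinP; case: bd.
have P E0 mm n : unit_polar E0 mm n ->
    `|\int[mm]_x (f x * lin e (n x)) - \int[mm]_x (g x * lin e (n x))| <=
    K * \int[mm]_x `|f x - g x|.
  move=> U0; have [mn c1 c2] := unit_polar_measurable U0.
  have bl0 : bmf (fun x => lin e (n x)) by apply: bmfD; exact: bmfZ.
  rewrite -rI_B; try exact: bmfM.
  apply: le_trans (rI_abs _ _) _; first by apply: bmfB; exact: bmfM.
  rewrite -rI_Z//; apply: rI_le.
  - by apply/bmf_norm/bmfB; exact: bmfM.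
  - exact: bmfZ.
  - by move=> x; rewrite -mulrBl normrM mulrC ler_wpM2r//; exact: lK U0.
have := P _ _ _ U; have := P _ _ _ U'; rewrite Eg.
set a := \int[m']_x (g x * _) => Q1 Q2.
rewrite (_ : _ - _ = (\int[m]_x (f x * lin e (nu x)) - a) - (\int[m']_x (f x * lin e (nu' x)) - a)); last ring.
apply: le_trans (ler_normB _ _) _.
apply: le_trans (lerD Q2 Q1) _.
rewrite -mulrDr -Hmu; apply: le_trans (ler_wpM2l K0 Hg) _.
rewrite mulrA ler_pdivrMr ?ltr_pwDr// mulrC ler_wpM2l//; first exact: ltW.
by rewrite lerDl.
Qed.

End Polar.

(** * Besicovitch covering and Lebesgue points *)

Section Balls.
Context {R : realType}.
Local Notation plane := (plane R).
Implicit Types (x y : plane).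

Lemma enormN x : enorm (- x) = enorm x.
Proof. by rewrite /enorm/= !sqrrN. Qed.

Lemma enormB x y : enorm (x - y) = enorm (y - x).
Proof. by rewrite -enormN opprB. Qed.

Lemma enorm0 : enorm (0 : plane) = 0.
Proof. by rewrite /enorm/= expr0n/= addr0 sqrtr0. Qed.

Lemma le_enorm1 x : `|x.1| <= enorm x.
Proof. by rewrite -sqrtr_sqr ler_wsqrtr// lerDl sqr_ge0. Qed.

Lemma le_enorm2 x : `|x.2| <= enorm x.
Proof. by rewrite -sqrtr_sqr ler_wsqrtr// lerDr sqr_ge0. Qed.

Lemma enorm_le x : enorm x <= `|x.1| + `|x.2|.
Proof.
rewrite -[leRHS]ger0_norm ?addr_ge0// -sqrtr_sqr ler_wsqrtr//.
rewrite sqrrD !real_normK ?num_real// addrAC lerDl mulrn_wge0// mulr_ge0//.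
Qed.

Lemma lin_le x y : lin x y <= enorm x * enorm y.
Proof.
apply: le_trans (ler_norm _) _.
rewrite -(@ler_sqr R) ?nnegrE ?mulr_ge0 ?enorm_ge0//.
rewrite real_normK ?num_real// exprMn !enorm_sqr /lin.
have := sqr_ge0 (x.1 * y.2 - x.2 * y.1); nra.
Qed.

Lemma linN x y : lin x (- y) = - lin x y.
Proof. by rewrite /lin/=; ring. Qed.

Lemma enorm_le_box x (M : R) : `|x.1| <= M -> `|x.2| <= M -> enorm x <= 2 * M.
Proof. by have := enorm_le x; lra. Qed.

Lemma enormD x y : enorm (x + y) <= enorm x + enorm y.
Proof.
rewrite -(@ler_sqr R) ?nnegrE ?addr_ge0 ?enorm_ge0//.
rewrite sqrrD !enorm_sqr/=.
have := lin_le x y; rewrite /lin; nra.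
Qed.

Lemma enormZ (a : R) x : enorm (a *: x) = `|a| * enorm x.
Proof.
by rewrite /enorm/= /GRing.scale/= !exprMn -mulrDr sqrtrM ?sqr_ge0// sqrtr_sqr.
Qed.

Lemma eball_open x (r : R) : open (eball x r).
Proof.
rewrite (_ : eball x r = (fun y => enorm (y - x)) @^-1` [set t | t < r])//.
apply: open_comp; last exact: open_lt.
move=> y _; have c : continuous (fun y : plane => y - x).
  by move=> z; apply: cvgB; [exact: cvg_id|exact: cvg_cst].
exact (continuous_comp (c y) (@enorm_continuous R _)).
Qed.

Lemma eball_measurable x (r : R) : measurable (eball x r).
Proof. by apply: open_plane_measurable; exact: eball_open. Qed.

Lemma le_eball x (r s : R) : r <= s -> eball x r `<=` eball x s.
Proof. by move=> rs y /= /lt_le_trans; apply. Qed.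

(** Two vectors in the same octant make an angle of at most 45 degrees, below 60, so their distance
    does not exceed the longer of the two. The octant is encoded by two signs and by which
    coordinate dominates. *)
Lemma octant_dist (a b a' b' s : R) : (0 <= a) = (0 <= a') -> (0 <= b) = (0 <= b') ->
  (`|a| <= `|b|) = (`|a'| <= `|b'|) -> a ^+ 2 + b ^+ 2 < s -> a' ^+ 2 + b' ^+ 2 < s ->
  (a' - a) ^+ 2 + (b' - b) ^+ 2 < s.
Proof.
have key (p q p' q' : R) : 0 <= p * p' -> 0 <= q * q' -> p ^+ 2 <= q ^+ 2 -> p' ^+ 2 <= q' ^+ 2 ->
    p ^+ 2 + q ^+ 2 < s -> p' ^+ 2 + q' ^+ 2 < s -> (p' - p) ^+ 2 + (q' - q) ^+ 2 < s.
  wlog le : p q p' q' / p' ^+ 2 + q' ^+ 2 <= p ^+ 2 + q ^+ 2.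
    move=> H; have [le|/ltW le] := lerP (p' ^+ 2 + q' ^+ 2) (p ^+ 2 + q ^+ 2); first exact: H.
    move=> pp qq pq pq' s1 s2; rewrite -sqrrN opprB -[(q' - q) ^+ 2]sqrrN opprB.
    by apply: H => //; rewrite mulrC.
  move=> pp qq pq pq' s1 s2.
  have : q' ^+ 2 + p' ^+ 2 <= 2 * (q * q').
    rewrite -(@ler_sqr R) ?nnegrE; first last.
    - by rewrite mulr_ge0.
    - by rewrite addr_ge0 ?sqr_ge0.
    rewrite !exprMn; move: pq pq' le (sqr_ge0 p) (sqr_ge0 q) (sqr_ge0 p') (sqr_ge0 q').
    move: (p ^+ 2) (q ^+ 2) (p' ^+ 2) (q' ^+ 2) => P Q P' Q' *; nra.
  nra.
have sgn (p q : R) : (0 <= p) = (0 <= q) -> 0 <= p * q.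
  have [p0|p0] := lerP 0 p => /esym; first by move=> q0; rewrite mulr_ge0.
  by move/negbT; rewrite -ltNge => q0; rewrite ltW// nmulr_lgt0.
move=> /sgn aa /sgn bb ab s1 s2.
have [h|h] := lerP `|a| `|b|.
  apply: key => //; rewrite -real_normK ?num_real// -[leRHS]real_normK ?num_real//.
    by rewrite ler_sqr ?nnegrE.
  by rewrite ler_sqr ?nnegrE// -ab.
rewrite addrC; apply: key => //; try by rewrite addrC.
  by rewrite -real_normK ?num_real// -[leRHS]real_normK ?num_real// ler_sqr ?nnegrE// ltW.
rewrite -real_normK ?num_real// -[leRHS]real_normK ?num_real// ler_sqr ?nnegrE//.
by move: ab; rewrite leNgt h/= => /esym/negbT; rewrite -ltNge => /ltW.
Qed.

(* A family of (centre, radius) pairs listed by decreasing radius, no centre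
   lying in an earlier ball. *)
Definition besrel (a b : plane * R) :=
  (b.2 <= a.2) && (a.2 <= enorm (b.1 - a.1)).

(** Around [x] each of the eight octants holds at most one centre: for two of them in one octant,
    [octant_dist] would put the later centre inside the earlier ball. *)
Lemma besicovitch_overlap (l : seq (plane * R)) x : pairwise besrel l ->
  (count (fun a => (enorm (x - a.1) < a.2)%R) l <= 8)%N.
Proof.
move=> pl; rewrite -size_filter.
set l' := seq.filter _ l.
have pl' : pairwise besrel l' by exact: pairwise_filter.
have al' : all (fun a => (enorm (x - a.1) < a.2)%R) l' by exact: filter_all.
pose oct (a : plane * R) : bool * bool * bool :=
  ((0 <= (a.1 - x).1), (0 <= (a.1 - x).2), `|(a.1 - x).1| <= `|(a.1 - x).2|).
have : uniq (map oct l').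
  rewrite uniq_pairwise pairwise_map.
  apply: sub_in_pairwise al' pl' => a b.
  rewrite !unfold_in => xa xb /andP[ba ab].
  apply/eqP => -[h1 h2 h3].
  move: ab; apply/negP; rewrite -ltNge.
  have a0 : 0 < a.2 by apply: le_lt_trans xa; exact: enorm_ge0.
  rewrite -(@ltr_sqr R) ?nnegrE ?enorm_ge0 ?ltW// enorm_sqr.
  rewrite (_ : (b.1 - a.1).1 = (b.1 - x).1 - (a.1 - x).1); last by rewrite /=; ring.
  rewrite (_ : (b.1 - a.1).2 = (b.1 - x).2 - (a.1 - x).2); last by rewrite /=; ring.
  have sq c : enorm (x - c) < a.2 -> (c - x).1 ^+ 2 + (c - x).2 ^+ 2 < a.2 ^+ 2.
    by move=> H; rewrite -enorm_sqr ltr_sqr ?nnegrE ?enorm_ge0 ?ltW// enormB.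
  apply: octant_dist => //; apply: sq => //.
  exact: lt_le_trans xb ba.
move=> /card_uniqP; rewrite size_map => <-.
by apply: leq_trans (max_card _) _; rewrite !card_prod !card_bool.
Qed.

(** Pigeonhole on a grid of mesh [rho / 2]: two centres in one cell would be at distance less than
    [rho], while [besrel] keeps them at least that far apart. *)
Lemma besicovitch_pack (M rho : R) : 0 < rho -> exists N : nat, forall l : seq (plane * R),
  pairwise besrel l -> (forall a, a \in l -> rho <= a.2 /\ (`|a.1.1| <= M /\ `|a.1.2| <= M)) ->
  (size l <= N)%N.
Proof.
move=> rho0.
pose h := rho / 2; have h0 : 0 < h by rewrite divr_gt0.
pose K := (Num.truncn ((M + M) / h)).+1.
pose cell (t : R) := Num.truncn ((t + M) / h).
have cellK t : `|t| <= M -> (cell t < K)%N.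
  rewrite ler_norml => /andP[a b]; rewrite /K ltnS /cell; apply: le_truncn.
  by rewrite ler_pM2r ?invr_gt0//; lra.
have cell_dist s t : `|s| <= M -> `|t| <= M -> cell s = cell t -> `|s - t| < h.
  rewrite !ler_norml => /andP[a b] /andP[c d] E.
  have p u : - M <= u -> (cell u)%:R <= (u + M) / h < (cell u).+1%:R.
    by move=> u0; apply: truncn_itv; apply: divr_ge0; [lra|exact: ltW].
  have := p s a; have := p t c; rewrite E -natr1 !ler_pdivlMr// !ltr_pdivrMr//.
  set k := (cell t)%:R => /andP[e1 e2] /andP[e3 e4].
  by rewrite ltr_norml; apply/andP; split; lra.
exists (#|{: 'I_K * 'I_K}|) => l pl Hl.
pose f (a : plane * R) : 'I_K * 'I_K := (inord (cell a.1.1), inord (cell a.1.2)).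
have : uniq (map f l).
  rewrite uniq_pairwise pairwise_map.
  have al : all (fun a => a \in l) l by apply/allP.
  apply: sub_in_pairwise al pl => a b; rewrite !unfold_in => la lb /andP[ba ab].
  have [ra [a1 a2]] := Hl a la; have [rb [b1 b2]] := Hl b lb.
  apply/eqP => -[] /(congr1 val) /= + /(congr1 val) /=.
  rewrite !inordK ?cellK// => c1 c2.
  have d1 := cell_dist _ _ b1 a1 (esym c1); have d2 := cell_dist _ _ b2 a2 (esym c2).
  have := le_trans ra (le_trans ab (enorm_le _)); rewrite leNgt => /negP; apply.
  by rewrite /=; move: d1 d2; rewrite /h; lra.
by move=> /card_uniqP; rewrite size_map => <-; exact: max_card.
Qed.

(** Greedy choice, radius by radius in decreasing order. Finitely many radii and the packing bound
    make the choice finite. *)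
Lemma besicovitch_select (M : R) (bad : plane -> R -> Prop) (rs : seq R) :
  all (fun r : R => 0 < r) rs -> sorted (fun s t : R => t <= s) rs ->
  exists l : seq (plane * R), [/\ pairwise besrel l,
    forall a, a \in l -> [/\ bad a.1 a.2, a.2 \in rs & `|a.1.1| <= M /\ `|a.1.2| <= M] &
    forall x r, r \in rs -> `|x.1| <= M /\ `|x.2| <= M -> bad x r ->
      exists2 a, a \in l & enorm (x - a.1) < a.2].
Proof.
elim/last_ind: rs => [|rs r IH]; first by exists [::]; split.
rewrite all_rcons => /andP[r0 ars] srs.
have tr : transitive (fun s t : R => t <= s) by move=> a b c ab bc; exact: le_trans bc ab.
have : pairwise (fun s t : R => t <= s) (rcons rs r) by rewrite -sorted_pairwise.
rewrite pairwise_rcons => /andP[/allP ler prs].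
have [l [pl Hl cl]] : exists l : seq (plane * R), [/\ pairwise besrel l,
    forall a, a \in l -> [/\ bad a.1 a.2, a.2 \in rs & `|a.1.1| <= M /\ `|a.1.2| <= M] &
    forall x r, r \in rs -> `|x.1| <= M /\ `|x.2| <= M -> bad x r ->
      exists2 a, a \in l & enorm (x - a.1) < a.2].
  by apply: IH => //; rewrite sorted_pairwise.
have [N HN] := besicovitch_pack M r0.
pose ok (l2 : seq (plane * R)) := pairwise besrel (l ++ l2) /\
   forall a, a \in l2 -> [/\ bad a.1 r, a.2 = r & `|a.1.1| <= M /\ `|a.1.2| <= M].
pose cov (l2 : seq (plane * R)) := forall x, `|x.1| <= M /\ `|x.2| <= M -> bad x r ->
   exists2 a, a \in l ++ l2 & enorm (x - a.1) < a.2.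
have [[l2 [[p2 H2] c2]]|ncov] := pselect (exists l2, ok l2 /\ cov l2).
  exists (l ++ l2); split=> //.
  - move=> a; rewrite mem_cat => /orP[/Hl[? ? ?]|/H2[? E ?]].
      by split=> //; rewrite mem_rcons inE; apply/orP; right.
    by split=> //; rewrite E// mem_rcons mem_head.
  - move=> x s; rewrite mem_rcons inE => /predU1P[->|srs'] xM bx; first exact: c2.
    by have [a al ?] := cl x s srs' xM bx; exists a => //; rewrite mem_cat al.
(* If no finite choice covers the bad points of radius [r], a further ball can always be added;
   having [N.+1] of them contradicts [besicovitch_pack]. *)
have [l2 [[p2 H2] s2]] : exists l2, ok l2 /\ size l2 = N.+1.
  elim: N.+1 => [|n [l2 [[p2 H2] s2]]]; first by exists [::]; split=> //; split; rewrite ?cats0.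
  have [x [xM bx nx]] : exists x, [/\ `|x.1| <= M /\ `|x.2| <= M, bad x r &
      forall a, a \in l ++ l2 -> a.2 <= enorm (x - a.1)].
    apply: contrapT => nx; apply: ncov; exists l2; split=> // x xM bx.
    apply: contrapT => nc; apply: nx; exists x; split=> // a al.
    by rewrite leNgt; apply/negP => H; apply: nc; exists a.
  exists (rcons l2 (x, r)); rewrite size_rcons s2; split=> //; split.
    rewrite -rcons_cat pairwise_rcons p2 andbT; apply/allP => a al.
    rewrite /besrel/= nx// andbT.
    by move: al; rewrite mem_cat => /orP[/Hl[_ /ler]|/H2[_ ->]].
  by move=> a; rewrite mem_rcons inE => /predU1P[->|/H2].
have : (size (l ++ l2) <= N)%N.
  apply: HN p2 _ => a; rewrite mem_cat => /orP[/Hl[_ /ler ? ?]|/H2[_ -> ?]]; by split.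
by rewrite size_cat s2 addnS ltnNge leq_addl.
Qed.

End Balls.

Lemma measurable_sublevel d (T : measurableType d) (R : realType) (f : T -> R) (c : R) :
  measurable_fun setT f -> measurable [set x | f x < c].
Proof.
move=> mf; rewrite (_ : [set x | _] = setT `&` f @^-1` `]-oo, c[).
  by apply: mf => //; exact: measurable_itv.
by rewrite setTI; apply/seteqP; split=> x /=; rewrite in_itv.
Qed.

Section Differentiation.
Context {R : realType} (m : {finite_measure set (plane R) -> \bar R}).
Local Notation plane := (plane R).
Implicit Types (f g : plane -> R).

(** Averages over balls are kept unnormalised and compared with [bm], so balls of zero mass need no
    special treatment. *)
Definition bI g x (r : R) := \int[m]_y (\1_(eball x r) y * g y).
Definition bm x (r : R) := \int[m]_y \1_(eball x r) y.

Lemma bmE x r : bm x r = fine (m (eball x r)).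
Proof. by rewrite /bm rI_indic//; exact: eball_measurable. Qed.

Lemma bmf_ball x (r : R) : bmf (\1_(eball x r) : plane -> R).
Proof. by apply: bmf_indic; exact: eball_measurable. Qed.

Lemma bmf_ballM x (r : R) g : bmf g -> bmf (fun y => \1_(eball x r) y * g y).
Proof. by move=> bg; apply: bmfM => //; exact: bmf_ball. Qed.

(** The integrand may depend on the centre as well; [gset_measurable] needs this for integrands
    comparing [nu y] with [nu x]. *)
Lemma measurable_bI2 (h : plane * plane -> R) (r : R) : measurable_fun setT h ->
  (forall z, 0 <= h z) -> measurable_fun setT (fun x => bI (fun y => h (x, y)) x r).
Proof.
move=> mh h0.
pose F (z : plane * plane) : \bar R := (\1_(eball z.1 r) z.2 * h z)%:E.
have m1 : measurable_fun setT (fun z : plane * plane => \1_(eball z.1 r) z.2 : R).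
  have -> : (fun z : plane * plane => \1_(eball z.1 r) z.2 : R) =
      \1_[set z : plane * plane | enorm (z.2 - z.1) < r].
    by apply/funext => z; rewrite !indicE; congr (_%:R); apply/idP/idP; rewrite !inE.
  apply: measurable_indic; apply: measurable_sublevel.
  have mE : measurable_fun setT (@enorm R).
    by apply: continuous_plane_measurable; exact: enorm_continuous.
  have md : measurable_fun setT (fun z : plane * plane => z.2 - z.1 : plane).
    apply/measurable_fun_pairP; split.
      rewrite (_ : fst \o _ = fun z : plane * plane => z.2.1 - z.1.1)//.
      by apply: measurable_funB; apply: (measurableT_comp measurable_fst);
        [exact: measurable_snd|exact: measurable_fst].
    rewrite (_ : snd \o _ = fun z : plane * plane => z.2.2 - z.1.2)//.
    by apply: measurable_funB; apply: (measurableT_comp measurable_snd);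
      [exact: measurable_snd|exact: measurable_fst].
  exact: measurableT_comp mE md.
have mF : measurable_fun setT F.
  by apply/measurable_EFinP; apply: measurable_funM.
have F0 z : (0 <= F z)%E by rewrite lee_fin mulr_ge0// indicE.
have mFF := @measurable_fun_fubini_tonelli_F _ _ plane plane R m F mF F0.
exact (measurableT_comp (@fine_measurable R setT measurableT) mFF).
Qed.

Lemma measurable_bI_ge0 g (r : R) : bmf g -> (forall x, 0 <= g x) ->
  measurable_fun setT (fun x => bI g x r).
Proof.
move=> [mg _] g0; apply: (@measurable_bI2 (fun z => g z.2)) => //.
exact: measurableT_comp mg measurable_snd.
Qed.

Lemma measurable_bm (r : R) : measurable_fun setT (fun x => bm x r).
Proof.
have -> : (fun x => bm x r) = (fun x => bI (fun=> 1) x r).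
  by apply/funext => x; apply: eq_Rintegral => y _; rewrite mulr1.
by apply: measurable_bI_ge0 => //; exact: bmf_cst.
Qed.

Lemma measurable_bI g (r : R) : bmf g -> measurable_fun setT (fun x => bI g x r).
Proof.
move=> [mg [C gC]].
have bg : bmf g by split=> //; exists C.
have bgC : bmf (fun x => g x + C) by apply: bmfD => //; exact: bmf_cst.
have -> : (fun x => bI g x r) = (fun x => bI (fun x => g x + C) x r - C * bm x r).
  apply/funext => x; rewrite /bI /bm -rI_Z; last exact: bmf_ball.
  rewrite -rI_B; [|exact: bmf_ballM|by apply: bmfZ; exact: bmf_ball].
  by apply: eq_Rintegral => y _; ring.
apply: measurable_funB.
  apply: measurable_bI_ge0 => // x.
  by have := gC x; rewrite ler_norml => /andP[]; lra.
by apply: measurable_funM; [exact: measurable_cst|exact: measurable_bm].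
Qed.

Lemma ball_approx (x : plane) (r e : R) : 0 < e -> exists2 s, s < r &
  \int[m]_y `|\1_(eball x r) y - \1_(eball x s) y| <= e.
Proof.
move=> e0.
have [||||n ne] := @rI_dc _ _ _ m (fun n => \1_(eball x (r - n.+1%:R^-1))) (\1_(eball x r)) 1 _ _ _ _ _ e0.
- by move=> n; apply: measurable_indic; exact: eball_measurable.
- by move=> n y; have /andP[? ?] := indic_01 (eball x (r - n.+1%:R^-1)) y; rewrite ger0_norm.
- exact: bmf_ball.
- move=> y; apply: cvg_near_cst.
  have [yr|yr] := ltP (enorm (y - x)) r.
    exists (Num.truncn (r - enorm (y - x))^-1) => // n /= nN.
    rewrite !indicE !mem_set//= /eball/=.
    suff : n.+1%:R^-1 < r - enorm (y - x) by set k := _^-1; lra.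
    rewrite invf_plt ?posrE ?subr_gt0//.
    by apply: lt_le_trans (truncnS_gt _) _; rewrite ler_nat.
  exists 0%N => // n _; rewrite !indicE !memNset//= /eball/= => H.
    by move: yr; rewrite leNgt H.
  have n0 : 0 < n.+1%:R^-1 :> R by rewrite invr_gt0.
  by move: yr H n0; set k := n.+1%:R^-1; lra.
exists (r - n.+1%:R^-1) => //.
by rewrite ltrBlDr ltrDl invr_gt0.
Qed.

Lemma bI_approx g C (x : plane) (r e : R) : measurable_fun setT g ->
  (forall y, `|g y| <= C) -> 0 < e -> exists2 s, s < r &
  forall q, s <= q -> q <= r -> `|bI g x r - bI g x q| <= e /\ `|bm x r - bm x q| <= e.
Proof.
move=> mg gC e0.
have C0 : 0 <= C by apply: le_trans (gC x).
have eC : 0 < e / (C + 1) by rewrite divr_gt0// ltr_pwDr.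
have [s sr Hs] := ball_approx x r eC; exists s => // q sq qr.
have bg : bmf g by split=> //; exists C.
have H : \int[m]_y `|\1_(eball x r) y - \1_(eball x q) y| <= e / (C + 1).
  apply: le_trans Hs; apply: rI_le; try by apply/bmf_norm/bmfB; exact: bmf_ball.
  move=> y; rewrite !indicE; case: (boolP (y \in eball x r)); case: (boolP (y \in eball x q));
    case: (boolP (y \in eball x s)) => //=; rewrite !inE ?notin_setE/= => h1 h2 h3;
    rewrite ?subrr ?normr0 ?subr0 ?normr1 ?sub0r ?normrN1//.
  - by case: h2; exact: le_eball h1.
  - by case: h3; exact: le_eball h2.
split; last first.
  rewrite /bm -rI_B; try exact: bmf_ball.
  apply: le_trans (rI_abs _ _) _; first by apply: bmfB; exact: bmf_ball.
  apply: le_trans H _; rewrite ler_pdivrMr ?ltr_pwDr//.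
  by rewrite mulrDr mulr1 lerDr mulr_ge0// ltW.
rewrite /bI -rI_B; try exact: bmf_ballM.
apply: le_trans (rI_abs _ _) _; first by apply: bmfB; exact: bmf_ballM.
apply: le_trans (_ : \int[m]_y (C * `|\1_(eball x r) y - \1_(eball x q) y|) <= _).
  apply: rI_le.
  - by apply/bmf_norm/bmfB; exact: bmf_ballM.
  - by apply/bmfZ/bmf_norm/bmfB; exact: bmf_ball.
  - by move=> y; rewrite -mulrBl normrM mulrC ler_wpM2r.
rewrite rI_Z; last by apply/bmf_norm/bmfB; exact: bmf_ball.
apply: le_trans (ler_wpM2l C0 H) _.
by rewrite mulrA ler_pdivrMr ?ltr_pwDr// mulrC ler_wpM2l ?ltW// ltrDl.
Qed.

(** An open ball is an increasing union of smaller ones, so both sides are left continuous in the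
    radius. Countably many radii then suffice for maximal functions and for [gset]. *)
Lemma bI_rat g x (r lambda : R) : bmf g -> 0 < r ->
  (forall q : rat, 0 < (ratr q : R) -> ratr q <= r -> bI g x (ratr q) <= lambda * bm x (ratr q)) ->
  bI g x r <= lambda * bm x r.
Proof.
move=> [mg [C gC]] r0 H; apply/ler_addgt0Pr => e e0.
have eC : 0 < e / (`|lambda| + 1) by rewrite divr_gt0// ltr_pwDr.
have [s sr Hs] := bI_approx x r mg gC eC.
have [|q] := @rat_in_itvoo R (Num.max s 0) r; first by rewrite gt_max sr.
rewrite in_itv/= gt_max => /andP[/andP[sq q0] qr].
have [] := Hs _ (ltW sq) (ltW qr); rewrite !ler_norml => /andP[h1 h2] /andP[h3 h4].
have h := H q q0 (ltW qr).
have l1 : lambda * bm x (ratr q) - lambda * bm x r <= `|lambda| * (e / (`|lambda| + 1)).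
  rewrite -mulrBr; apply: le_trans (ler_norm _) _; rewrite normrM ler_wpM2l//.
  by rewrite ler_norml; clear -h1 h2 h3 h4; apply/andP; split; lra.
have l2 : `|lambda| * (e / (`|lambda| + 1)) + e / (`|lambda| + 1) = e.
  by field; rewrite gt_eqF// ltr_pwDr.
lra.
Qed.

Lemma rI_sum (I : eqType) (l : seq I) (F : I -> plane -> R) : (forall i, bmf (F i)) ->
  bmf (fun x => \sum_(i <- l) F i x) /\
  \int[m]_x (\sum_(i <- l) F i x) = \sum_(i <- l) \int[m]_x F i x.
Proof.
move=> bF; elim: l => [|a l [bl IH]].
  split; first by under eq_fun do rewrite big_nil; exact: bmf_cst.
  rewrite big_nil; under eq_Rintegral do rewrite big_nil.
  by rewrite Rintegral_cst// mul0r.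
split; first by under eq_fun do rewrite big_cons; exact: bmfD.
by rewrite big_cons; under eq_Rintegral do rewrite big_cons; rewrite rI_D// IH.
Qed.

(** The selected balls cover [X], each carries mass below [bI / lambda], and no point lies in more
    than eight of them. *)
Lemma maximal_finite g (lambda M : R) (rs : seq R) : bmf g -> (forall x, 0 <= g x) ->
  0 < lambda -> all (fun r : R => 0 < r) rs -> sorted (fun s t : R => t <= s) rs ->
  forall X : set plane, measurable X ->
  (forall x, X x -> (`|x.1| <= M /\ `|x.2| <= M) /\
     exists2 r, r \in rs & lambda * bm x r < bI g x r) ->
  lambda * fine (m X) <= 8 * \int[m]_x g x.
Proof.
move=> bg g0 l0 ars srs X mX HX.
have [l [pl Hl cl]] := besicovitch_select M (fun x r => lambda * bm x r < bI g x r) ars srs.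
pose F (a : plane * R) (x : plane) : R := \1_(eball a.1 a.2) x.
have [bS SE] := @rI_sum _ l F (fun a => bmf_ball a.1 a.2).
have [bSg SgE] := @rI_sum _ l (fun a y => F a y * g y) (fun a => bmf_ballM a.1 a.2 bg).
rewrite -rI_indic//.
apply: le_trans (_ : lambda * \int[m]_x \sum_(a <- l) F a x <= _).
  rewrite ler_pM2l//; apply: rI_le => //; first exact: bmf_indic.
  move=> x; rewrite indicE; case: (boolP (x \in X)) => [|_]; last first.
    by apply: sumr_ge0 => a _; rewrite /F indicE.
  rewrite inE => /HX[xM [r rrs bx]].
  have [a al xa] := cl x r rrs xM bx.
  rewrite (big_rem a)//= /F indicE mem_set//= lerDl.
  by apply: sumr_ge0 => b _; rewrite indicE.
rewrite SE mulr_sumr.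
apply: le_trans (_ : \sum_(a <- l) \int[m]_y (F a y * g y) <= _).
  rewrite !big_seq; apply: ler_sum => a al.
  by have [/ltW] := Hl a al.
rewrite -SgE -rI_Z//; apply: rI_le => //; first exact: bmfZ.
move=> x; rewrite -mulr_suml ler_wpM2r//.
have -> : \sum_(a <- l) F a x = (count (fun a => (enorm (x - a.1) < a.2)%R) l)%:R.
  elim: l {pl Hl cl bS SE bSg SgE} => [|a l' IH]; first by rewrite big_nil.
  rewrite big_cons IH /= natrD; congr (_ + _).
  rewrite /F indicE; have [xa|xa] := ltP (enorm (x - a.1)) a.2; first by rewrite mem_set.
  by rewrite memNset//= /eball/= ltNge xa.
by rewrite (ler_nat _ _ 8); exact: besicovitch_overlap.
Qed.

(* The maximal function is controlled by its rational radii. *)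
Lemma maximal_ineq g (lambda : R) : bmf g -> (forall x, 0 <= g x) -> 0 < lambda ->
  exists2 X : set plane, measurable X & lambda * fine (m X) <= 8 * \int[m]_x g x /\
   forall x r, 0 < r -> lambda * bm x r < bI g x r -> X x.
Proof.
move=> bg g0 l0.
pose rad (n : nat) : R := if unpickle n is Some q then ratr (q : rat) else 0.
pose rs n := sort (fun s t : R => t <= s) [seq r <- map rad (iota 0 n) | 0 < r].
have rs0 n : all (fun r : R => 0 < r) (rs n) by rewrite all_sort filter_all.
have rss n : sorted (fun s t : R => t <= s) (rs n).
  by apply: sort_sorted => s t; rewrite orbC; exact: le_total.
pose bad r := [set x : plane | lambda * bm x r < bI g x r].
have mbad r : measurable (bad r).
  rewrite (_ : bad r = [set x | lambda * bm x r - bI g x r < 0]); last first.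
    by apply/seteqP; split=> x /=; rewrite subr_lt0.
  apply: measurable_sublevel; apply: measurable_funB; last exact: measurable_bI.
  by apply: measurable_funM; [exact: measurable_cst|exact: measurable_bm].
pose X n := [set x : plane | `|x.1| <= n%:R /\ `|x.2| <= n%:R] `&`
   \big[setU/set0]_(r <- rs n) bad r.
have mX n : measurable (X n).
  apply: measurableI; last exact: bigsetU_measurable.
  apply: closed_plane_measurable.
  exact (compact_closed (@norm_hausdorff _ _) (@compact_box R n%:R)).
have ndX : nondecreasing_seq X.
  move=> i j ij; apply/subsetPset => x [[x1 x2]]; rewrite -bigcup_seq => -[r /= rr bx].
  split; first by split; rewrite (le_trans x1, le_trans x2)// ler_nat.
  rewrite -bigcup_seq; exists r => //=; move: rr; rewrite !mem_sort !mem_filter.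
  move=> /andP[-> /mapP[k]]; rewrite mem_iota add0n => /andP[_ ki] ->.
  by apply/mapP; exists k => //; rewrite mem_iota add0n (leq_trans ki ij).
have mXU : measurable (\bigcup_n X n) by exact: bigcupT_measurable.
exists (\bigcup_n X n) => //; split.
  have cX := nondecreasing_cvg_mu (mu := m) mX mXU ndX.
  have fin : m (\bigcup_n X n) \is a fin_num by exact: fin_num_measure.
  have cf : fine (m (X n)) @[n --> \oo] --> fine (m (\bigcup_n X n)).
    by apply: fine_cvg; rewrite (fineK fin); exact: cX.
  have cl : lambda * fine (m (X n)) @[n --> \oo] --> lambda * fine (m (\bigcup_n X n)).
    by apply: cvgM => //; exact: cvg_cst.
  rewrite -(cvg_lim _ cl)//; apply: limr_le; first by apply/cvg_ex; eexists; exact: cl.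
  apply: nearW => n.
  apply: (@maximal_finite g lambda n%:R (rs n)) => // x [xn].
  by rewrite -bigcup_seq => -[r /= rr bx]; split=> //; exists r.
move=> x r r0 bx.
have [q q0 bq] : exists2 q : rat, 0 < (ratr q : R) & bad (ratr q) x.
  apply: contrapT => H; move: bx; rewrite ltNge => /negP; apply.
  apply: bI_rat => // q q0 _; rewrite leNgt; apply/negP => bq.
  by apply: H; exists q.
pose n := (pickle q + (Num.truncn (`|x.1| + `|x.2|)))%N.+1.
have nx : `|x.1| + `|x.2| <= n%:R.
  apply: ltW; apply: lt_le_trans (truncnS_gt _) _; rewrite ler_nat /n.
  by rewrite ltnS leq_addl.
exists n => //; split.
  by split; apply: le_trans nx; [rewrite lerDl|rewrite lerDr].
rewrite -bigcup_seq; exists (ratr q) => //=.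
rewrite mem_sort mem_filter q0 andTb; apply/mapP; exists (pickle q).
  by rewrite mem_iota add0n /n ltnS leq_addr.
by rewrite /rad pickleK.
Qed.

Lemma lebesgue_point g (e : R) : measurable_fun setT g -> (forall x, `|g x| <= 1) -> 0 < e ->
  {ae m, forall x, exists2 d : R, 0 < d & forall r, 0 < r -> r < d ->
    bI (fun y => `|g y - g x|) x r <= e * bm x r}.
Proof.
move=> mg g1 e0.
have bg : bmf g by split=> //; exists 1.
pose good x := exists2 d : R, 0 < d & forall r, 0 < r -> r < d ->
    bI (fun y => `|g y - g x|) x r <= e * bm x r.
have e30 : 0 < e / 3 by rewrite divr_gt0.
have H (eta : R) : 0 < eta -> exists2 W : set plane, measurable W &
    fine (m W) <= eta /\ forall x, ~ good x -> W x.
  move=> eta0.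
  (* The maximal inequality costs a factor 8 and Chebyshev's inequality a factor 1, whence the 9.
     The thresholds [e / 3] leave room for the third term, the oscillation of [f]. *)
  pose d := eta * (e / 3) / 9.
  have d0 : 0 < d by rewrite !mulr_gt0.
  have [f [tf f1 Hf]] := density m mg g1 d0.
  have bf : bmf f by exact: test_bounded.
  have bd : bmf (fun x => `|g x - f x|) by apply/bmf_norm/bmfB.
  have [X mX [HX cX]] := maximal_ineq bd (fun x => normr_ge0 _) e30.
  pose Z := [set x | e / 3 <= `|g x - f x|].
  have mZ : measurable Z by apply: measurable_superlevel; case: bd.
  have HZ : (e / 3) * fine (m Z) <= \int[m]_x `|g x - f x|.
    rewrite -rI_indic// -rI_Z; last exact: bmf_indic.
    apply: rI_le => //; first by apply: bmfZ; exact: bmf_indic.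
    move=> x; rewrite indicE; case: (boolP (x \in Z)) => [|_]; last by rewrite mulr0.
    by rewrite inE mulr1.
  exists (X `|` Z); first exact: measurableU.
  split.
    have le : fine (m (X `|` Z)) <= fine (m X) + fine (m Z).
      rewrite -fineD ?fin_num_measure// fine_le ?fin_numD ?fin_num_measure//.
        exact: measurableU.
      exact: measureU2.
    have : (e / 3) * (fine (m X) + fine (m Z)) <= (e / 3) * eta.
      by move: HX HZ Hf; rewrite mulrDr /d; lra.
    by rewrite ler_pM2l// => /(le_trans le).
  move=> x ng; apply: contrapT => /not_orP[nX nZ]; apply: ng.
  have /cvgrPdist_le/(_ _ e30)/nbhs_ballP[d1 /= d10 H1] := @C1_cont R f (proj1 tf) x.
  exists d1 => // r r0 rd.
  have h1 : bI (fun y => `|g y - f y|) x r <= e / 3 * bm x r.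
    by rewrite leNgt; apply/negP => /(cX x r r0).
  have h2 : `|g x - f x| < e / 3 by rewrite ltNge; apply/negP.
  have bgx : bmf (fun y => `|g y - g x|) by apply/bmf_norm/bmfB => //; exact: bmf_cst.
  have -> : e * bm x r = e / 3 * bm x r + \int[m]_y (2 * (e / 3) * \1_(eball x r) y).
    by rewrite rI_Z; [rewrite /bm; field|exact: bmf_ball].
  apply: le_trans (lerD h1 (lexx _)).
  have bb := bmf_ball x r.
  rewrite /bI -rI_D; [|exact: bmf_ballM|exact: bmfZ].
  apply: rI_le; [exact: bmf_ballM|by apply: bmfD; [exact: bmf_ballM|exact: bmfZ]|].
  move=> y; rewrite indicE; case: (boolP (y \in eball x r)) => [|_]; last first.
    by rewrite !mul0r mulr0 addr0.
  rewrite inE /eball/= => yr; rewrite !mul1r mulr1.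
  have : `|f x - f y| <= e / 3.
    apply: H1; split; rewrite /ball/= distrC.
      by apply: le_lt_trans rd; apply: le_trans (ltW yr); exact: (le_enorm1 (y - x)).
    by apply: le_lt_trans rd; apply: le_trans (ltW yr); exact: (le_enorm2 (y - x)).
  move: h2; rewrite -[g x - f x]opprB normrN.
  have := ler_normD (g y - f y) (f y - f x + (f x - g x)).
  have := ler_normD (f y - f x) (f x - g x).
  rewrite -[f y - f x]opprB normrN opprB.
  rewrite (_ : g y - f y + (f y - f x + (f x - g x)) = g y - g x); last ring.
  lra.
have Hn n : exists W : set plane, [/\ measurable W, fine (m W) <= n.+1%:R^-1 & forall x, ~ good x -> W x].
  by have [|W mW [? ?]] := H n.+1%:R^-1; [rewrite invr_gt0|exists W].
have {Hn}[W HW] := choice Hn.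
exists (\bigcap_n W n); split.
- by apply: bigcapT_measurable => n; case: (HW n).
- have mI : measurable (\bigcap_n W n) by apply: bigcapT_measurable => n; case: (HW n).
  have fin := fin_num_measure m _ mI.
  rewrite -(fineK fin); congr EFin; apply/eqP; rewrite eq_le fine_ge0// andbT.
  apply/ler_addgt0Pr => eta eta0; rewrite add0r.
  have [n ne] : exists n : nat, n.+1%:R^-1 <= eta.
    exists (Num.truncn eta^-1); rewrite invf_ple ?posrE//; exact/ltW/truncnS_gt.
  have [mW le _] := HW n; apply: le_trans (le_trans le ne).
  apply: fine_le => //; first exact: fin_num_measure.
  by apply: le_measure; rewrite ?inE// => x; exact.
- by move=> x /= ng n _; have [_ _] := HW n; exact.
Qed.

End Differentiation.

(** * Mass near a Lebesgue point of the normal, by flux through cylinders *)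

Section Cylinder.
Context {R : realType}.
Local Notation plane := (plane R).
Local Notation lam := (@lebesgue_measure R).

Lemma le_integral_pos d (T : measurableType d) (mu : {measure set T -> \bar R})
    (D : set T) (f g : T -> \bar R) : measurable D -> measurable_fun D f ->
  measurable_fun D g -> (forall x, D x -> 0 <= g x)%E ->
  (forall x, D x -> f x <= g x)%E -> (\int[mu]_(x in D) f x <= \int[mu]_(x in D) g x)%E.
Proof.
move=> mD mf mg g0 fg; rewrite integralE.
apply: (@le_trans _ _ (\int[mu]_(x in D) (f^\+ x))%E).
  by rewrite -[leRHS]sube0; apply: leeB => //; apply: integral_ge0.
apply: ge0_le_integral => //.
- exact: measurable_funepos.
- by move=> x Dx; rewrite funeposE ge_max fg// g0.
Qed.

Lemma integral_dstep1 : (\int[lam]_z (dstep1 z)%:E = 1)%E.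
Proof.
have mS : measurable_fun setT (@dstep1 R).
  by apply: continuous_measurable_fun; exact: dstep1_continuous.
rewrite (_ : (\int[lam]_z (dstep1 z)%:E = \int[lam]_(z in `[0%R, 1%R]) (dstep1 z)%:E)%E); last first.
  rewrite [RHS]integral_mkcond; apply: eq_integral => z _; rewrite patchE.
  case: ifPn => //; rewrite notin_setE/= in_itv/= => H; rewrite dstep1_out//.
  have [z0|z0] := lerP z 0; [by left|right; rewrite leNgt; apply/negP => z1].
  by apply: H; rewrite !ltW.
rewrite (@continuous_FTC2 _ _ (@step1 R))//.
- by rewrite step1_ge1// step1_le0// sube0.
- by apply: continuous_subspaceT; exact: dstep1_continuous.
- split.
  + by move=> t _; have [] := is_derive_step1 t.
  + by apply: cvg_at_right_filter; exact: step1_continuous.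
  + by apply: cvg_at_left_filter; exact: step1_continuous.
- by move=> t _; rewrite derive1E; have [_ ->] := is_derive_step1 t.
Qed.

Definition perp (e : plane) : plane := (- e.2, e.1).

Context (F : set plane) (m : {finite_measure set plane -> \bar R}) (nu : plane -> plane).
Hypothesis U : unit_polar F m nu.
Hypothesis mF : lmeasurable F.
Hypothesis finF : (area F < +oo)%E.

(** A smoothed indicator of [cyl e x0 a b L], the rectangle with axis [e], with ramps of width [k]
    outside it. It is written through linear forms in [x] so that [C1_step1_lin] applies;
    [cylfun_args] gives the coordinates relative to [x0]. *)
Definition cylfun (e x0 : plane) (a b L k : R) (x : plane) : R :=
  (step1 (lin (k^-1 *: perp e) x + (1 - (a + lin (perp e) x0) / k)) *
   step1 (lin (- k^-1 *: perp e) x + (1 + (b + lin (perp e) x0) / k))) *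
  (step1 (lin (k^-1 *: e) x + (1 + (L - lin e x0) / k)) *
   step1 (lin (- k^-1 *: e) x + (1 + (L + lin e x0) / k))).

Lemma cylfun_args (e x0 : plane) (a b L k : R) (x : plane) : 0 < k ->
  [/\ lin (k^-1 *: perp e) x + (1 - (a + lin (perp e) x0) / k) = (lin (perp e) (x - x0) - a) / k + 1,
   lin (- k^-1 *: perp e) x + (1 + (b + lin (perp e) x0) / k) = (b - lin (perp e) (x - x0)) / k + 1,
   lin (k^-1 *: e) x + (1 + (L - lin e x0) / k) = (L + lin e (x - x0)) / k + 1 &
   lin (- k^-1 *: e) x + (1 + (L + lin e x0) / k) = (L - lin e (x - x0)) / k + 1].
Proof.
move=> k0; have k1 := lt0r_neq0 k0.
by split; rewrite /lin /= /GRing.scale/=; field.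
Qed.

Lemma cylfun_01 e x0 a b L k x : 0 <= cylfun e x0 a b L k x <= 1.
Proof.
have H (p q : R) : 0 <= p <= 1 -> 0 <= q <= 1 -> 0 <= p * q <= 1.
  by move=> /andP[? ?] /andP[? ?]; apply/andP; split; nra.
by apply: (H); apply: (H); exact: step1_01.
Qed.

Lemma cylfun_1 e x0 a b L k x : 0 < k -> a <= lin (perp e) (x - x0) <= b ->
  - L <= lin e (x - x0) <= L -> cylfun e x0 a b L k x = 1.
Proof.
move=> k0 /andP[h1 h2] /andP[h3 h4]; rewrite /cylfun.
have [-> -> -> ->] := cylfun_args e x0 a b L x k0.
have p (t : R) : 0 <= t -> 1 <= t / k + 1 by move=> t0; rewrite lerDr divr_ge0// ltW.
by rewrite !step1_ge1 ?mulr1//; apply: p; lra.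
Qed.

Lemma cylfun_0 e x0 a b L k x : 0 < k -> cylfun e x0 a b L k x != 0 ->
  (a - k < lin (perp e) (x - x0) < b + k) /\ (- (L + k) < lin e (x - x0) < L + k).
Proof.
move=> k0; rewrite /cylfun.
have [-> -> -> ->] := cylfun_args e x0 a b L x k0.
have p (t : R) : step1 (t / k + 1) != 0 -> - k < t.
  apply: contraNT; rewrite -leNgt => tk; apply/eqP/step1_le0.
  by rewrite -lerBrDr sub0r ler_pdivrMr// mulN1r.
rewrite !mulf_eq0 !negb_or => /andP[/andP[/p ? /p ?] /andP[/p ? /p ?]].
by split; apply/andP; split; lra.
Qed.

Lemma lin_perp_sqr (e x : plane) : enorm e = 1 ->
  lin (perp e) x ^+ 2 + lin e x ^+ 2 = enorm x ^+ 2.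
Proof.
move=> e1; have : e.1 ^+ 2 + e.2 ^+ 2 = 1 by rewrite -enorm_sqr e1 expr1n.
rewrite enorm_sqr /lin /perp/= => H.
rewrite (_ : _ + _ = (e.1 ^+ 2 + e.2 ^+ 2) * (x.1 ^+ 2 + x.2 ^+ 2)); last ring.
by rewrite H mul1r.
Qed.

Lemma cylfun_test e x0 a b L k : enorm e = 1 -> 0 < k -> test_function (cylfun e x0 a b L k).
Proof.
move=> e1 k0.
apply: (@test_functionP _ _ (`|a - k| + `|b + k| + `|L + k| + enorm x0)).
  by apply: C1M; apply: C1M; exact: C1_step1_lin.
move=> x /(cylfun_0 k0)[/andP[h1 h2] /andP[h3 h4]].
have H : enorm (x - x0) <= `|a - k| + `|b + k| + `|L + k|.
  rewrite -(@ler_sqr R) ?nnegrE ?enorm_ge0 ?addr_ge0// -(lin_perp_sqr _ e1).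
  have H1 : `|lin (perp e) (x - x0)| <= `|a - k| + `|b + k|.
    have := ler_norm (b + k); have := ler_norm (- (a - k)); rewrite normrN.
    by have := normr_ge0 (b + k); have := normr_ge0 (a - k) => *; rewrite ler_norml; apply/andP; split; lra.
  have H2 : `|lin e (x - x0)| <= `|L + k|.
    by have := ler_norm (L + k) => ?; rewrite ler_norml; apply/andP; split; lra.
  rewrite -[lin _ _ ^+ 2]real_normK ?num_real// -[lin e _ ^+ 2]real_normK ?num_real//.
  move: H1 H2 (normr_ge0 (lin (perp e) (x - x0))) (normr_ge0 (lin e (x - x0))).
  move: (`|lin _ _|) (`|lin e _|) (`|a - k| + `|b + k|) (`|L + k|) => p q P Q *; nra.
have Hx : enorm x <= `|a - k| + `|b + k| + `|L + k| + enorm x0.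
  by rewrite -{1}(subrK x0 x); apply: le_trans (enormD _ _) _; rewrite lerD2r.
by split; apply: le_trans Hx; [exact: le_enorm1|exact: le_enorm2].
Qed.

(** The lateral factors are constant along [e] and the exit ramp decreases, so only the entrance
    ramp contributes positively. *)
Lemma cylfun_derive e x0 a b L k x : enorm e = 1 -> 0 < k ->
  'D_e (cylfun e x0 a b L k) x <=
  \1_(`[a - k, b + k]%classic : set R) (lin (perp e) x - lin (perp e) x0) *
  (k^-1 * dstep1 ((lin e x - lin e x0 + L) / k + 1)).
Proof.
move=> e1 k0.
have ee : lin e e = 1 by rewrite /lin -!expr2 -enorm_sqr e1 expr1n.
have pe : lin (perp e) e = 0 by rewrite /lin /perp/=; ring.
have lc (c : R) p : lin (c *: p) e = c * lin p e by rewrite /lin /= /GRing.scale/=; ring.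
set f1 := fun x => step1 (lin (k^-1 *: perp e) x + (1 - (a + lin (perp e) x0) / k)).
set f2 := fun x => step1 (lin (- k^-1 *: perp e) x + (1 + (b + lin (perp e) x0) / k)).
set f3 := fun x => step1 (lin (k^-1 *: e) x + (1 + (L - lin e x0) / k)).
set f4 := fun x => step1 (lin (- k^-1 *: e) x + (1 + (L + lin e x0) / k)).
have D1 := is_derive_step1_lin (k^-1 *: perp e) (1 - (a + lin (perp e) x0) / k) x e.
have D2 := is_derive_step1_lin (- k^-1 *: perp e) (1 + (b + lin (perp e) x0) / k) x e.
have D3 := is_derive_step1_lin (k^-1 *: e) (1 + (L - lin e x0) / k) x e.
have D4 := is_derive_step1_lin (- k^-1 *: e) (1 + (L + lin e x0) / k) x e.
have D12 := is_deriveM D1 D2; have D34 := is_deriveM D3 D4.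
have [_ D] := is_deriveM D12 D34.
rewrite (_ : 'D_e (cylfun e x0 a b L k) x = 'D_e (f1 * f2 * (f3 * f4)) x)// D {D D1 D2 D3 D4 D12 D34}.
rewrite !lc pe ee !mulr0 !mulr1 !scaler0 addr0 scaler0 addr0.
rewrite -[X in X <= _]/(f1 x * f2 x * (f3 x * (dstep1 _ * - k^-1) + f4 x * (dstep1 _ * k^-1))).
have [E1 E2 E3 E4] := cylfun_args e x0 a b L x k0.
rewrite E3 E4 -linB.
have /andP[a1 b1] : 0 <= f1 x <= 1 := step1_01 _.
have /andP[a2 b2] : 0 <= f2 x <= 1 := step1_01 _.
have /andP[a3 b3] : 0 <= f3 x <= 1 := step1_01 _.
have /andP[a4 b4] : 0 <= f4 x <= 1 := step1_01 _.
have ki : 0 <= k^-1 by rewrite invr_ge0 ltW.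
rewrite (_ : lin e x - lin e x0 + L = L + lin e (x - x0)); last by rewrite linB; ring.
have d3 := dstep1_ge0 ((L + lin e (x - x0)) / k + 1).
have d4 := dstep1_ge0 ((L - lin e (x - x0)) / k + 1).
move: d3 d4; set d3 := dstep1 _; set d4 := dstep1 _ => d30 d40.
have kd3 : 0 <= k^-1 * d3 by rewrite mulr_ge0.
have kd4 : 0 <= k^-1 * d4 by rewrite mulr_ge0.
have le : f3 x * (d4 * - k^-1) + f4 x * (d3 * k^-1) <= k^-1 * d3.
  rewrite (_ : d4 * - k^-1 = - (k^-1 * d4)); last ring.
  by rewrite [d3 * _]mulrC; nra.
have f12 : f1 x * f2 x <= \1_(`[a - k, b + k]%classic : set R) (lin (perp e) (x - x0)).
  rewrite indicE; case: (boolP (_ \in _)) => [_|]; first by rewrite -[leRHS]mulr1; apply: ler_pM.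
  rewrite notin_setE/= in_itv/= => /negP; rewrite negb_and -!ltNge /f1 /f2 E1 E2.
  have p (t : R) : t <= - k -> step1 (t / k + 1) = 0.
    by move=> tk; apply/step1_le0; rewrite -lerBrDr sub0r ler_pdivrMr// mulN1r.
  by case/orP => h; [rewrite [X in X * _]p ?mul0r//; lra|rewrite [X in _ * X]p ?mulr0//; lra].
apply: le_trans (_ : f1 x * f2 x * (k^-1 * d3) <= _).
  by rewrite ler_wpM2l// mulr_ge0.
by rewrite ler_wpM2r.
Qed.

(** The flux is the integral over [F] of the derivative along [e]. Its nonnegative majorant does not
    see [F], and the entrance ramp integrates to 1 on every line parallel to [e], which leaves the
    enlarged width. *)
Lemma cylinder_flux e x0 a b L k : enorm e = 1 -> 0 < k -> a <= b ->
  \int[m]_x (cylfun e x0 a b L k x * lin e (nu x)) <= b - a + 2 * k.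
Proof.
move=> e1 k0 ab.
have k1 := lt0r_neq0 k0.
have tc := cylfun_test x0 a b L e1 k0.
rewrite -lee_fin -(unit_polar_test e U tc).
have [B mB FB] := lmeasurable_borel mF finF.
have mD : measurable_fun setT (fun x => ('D_e (cylfun e x0 a b L k) x)%:E).
  apply/measurable_EFinP; apply: continuous_plane_measurable.
  by apply: C1_dcont; case: tc.
rewrite (integral_area_borel mF mB FB mD).
pose I : set R := `[a - k, b + k]%classic.
pose G (z : plane) : \bar R := (\1_I z.1 * (k^-1 * dstep1 (z.2 / k + 1)))%:E.
have mS : measurable_fun setT (@dstep1 R).
  by apply: continuous_measurable_fun; exact: dstep1_continuous.
have mS' : measurable_fun setT (fun t : measurableTypeR R => k^-1 * dstep1 (t / k + 1)).
  apply: measurable_funM; first exact: measurable_cst.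
  apply: (measurableT_comp mS); apply: measurable_funD; last exact: measurable_cst.
  by apply: measurable_funM; [exact: measurable_id|exact: measurable_cst].
have mG : measurable_fun setT G.
  apply/measurable_EFinP; apply: measurable_funM.
    by apply: (measurableT_comp _ measurable_fst); apply: measurable_indic; exact: measurable_itv.
  exact: (measurableT_comp mS' measurable_snd).
have h0 t : 0 <= k^-1 * dstep1 (t / k + 1) by rewrite mulr_ge0 ?dstep1_ge0// invr_ge0 ltW.
have G0 z : (0 <= G z)%E by rewrite lee_fin mulr_ge0// indicE.
pose A (x : plane) : plane := ((- e.2) * x.1 + e.1 * x.2 + - lin (perp e) x0, e.1 * x.1 + e.2 * x.2 + (L - lin e x0)).
have mA : measurable_fun setT A by exact: measurable_affine2.
apply: (@le_trans _ _ (\int[borel_area]_x G (A x))%E).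
  apply: (@le_trans _ _ (\int[borel_area]_(x in B) G (A x))%E); last first.
    apply: ge0_subset_integral => //; exact: (measurableT_comp mG mA).
  apply: le_integral_pos => //; first exact: measurable_funTS.
    by apply: measurable_funTS; exact: (measurableT_comp mG mA).
  move=> x _; rewrite lee_fin; have H := cylfun_derive x0 a b L x e1 k0; apply: (le_trans H).
  rewrite le_eqVlt; apply/orP; left; apply/eqP; congr (\1_I _ * (_ * dstep1 (_ / k + 1))) => /=.
  by rewrite /lin; ring.
have dete : (- e.2) * e.2 - e.1 * e.1 = -1.
  have : e.1 ^+ 2 + e.2 ^+ 2 = 1 by rewrite -enorm_sqr e1 expr1n.
  by rewrite !expr2; lra.
rewrite ge0_integral_affine2//; last by rewrite dete oppr_eq0 oner_eq0.
rewrite dete normrN normr1 invr1 mul1e integral_plane_xy//.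
have I1 : (\int[lam]_y (k^-1 * dstep1 (y / k + 1))%:E = 1)%E.
  under eq_integral do rewrite EFinM.
  rewrite ge0_integralZlT ?invr_ge0 ?ltW//; first last.
  - by move=> y; rewrite lee_fin dstep1_ge0.
  - apply/measurable_EFinP; apply: (measurableT_comp mS); apply: measurable_funD; last exact: measurable_cst.
    by apply: measurable_funM; [exact: measurable_id|exact: measurable_cst].
  have ki : k^-1 != 0 by rewrite invr_eq0.
  have E : (\int[lam]_x (dstep1 (k^-1 * x + 1)%R)%:E = k%:E)%E.
    have -> := @ge0_integral_affine R (fun y => (dstep1 y)%:E) k^-1 1 ki.
    - by rewrite integral_dstep1 mule1 normfV gtr0_norm// invrK.
    - by apply/measurable_EFinP.
    - by move=> y; rewrite lee_fin dstep1_ge0.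
  rewrite (_ : (\int[lam]_x (dstep1 (x / k + 1)%R)%:E = \int[lam]_x (dstep1 (k^-1 * x + 1)%R)%:E)%E).
    by rewrite E -EFinM mulVf.
  by apply: eq_integral => x _; rewrite mulrC.
have -> : (\int[lam]_x \int[lam]_y G (x, y) = \int[lam]_x (\1_I x)%:E)%E.
  apply: eq_integral => x _.
  rewrite /G/=; under eq_integral do rewrite EFinM.
  rewrite ge0_integralZlT ?indicE//; first by rewrite I1 mule1.
    by apply/measurable_EFinP.
rewrite integral_indic ?setIT//; last exact: measurable_itv.
have := @lebesgue_measure_itv R `[a - k, b + k]; rewrite /= lte_fin ifT; last lra.
by move=> E; apply: (@le_trans _ _ (b + k - (a - k))%:E); [rewrite EFinB -E|rewrite lee_fin; lra].
Qed.

Lemma bmf_dist e : bmf (fun y => enorm (nu y - e)).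
Proof.
have [mnu _ _] := unit_polar_measurable U; have [_ n1] := U; split.
  apply: (measurableT_comp (f := fun x : plane => enorm (x - e)) _ mnu).
  apply: continuous_plane_measurable => x.
  have c : continuous (fun y : plane => y - e).
    by move=> z; apply: cvgB; [exact: cvg_id|exact: cvg_cst].
  exact (continuous_comp (c x) (@enorm_continuous R _)).
exists (1 + enorm e) => x; rewrite ger0_norm ?enorm_ge0//.
by apply: le_trans (enormD _ _) _; rewrite enormN n1.
Qed.

Definition cyl (e x0 : plane) (a b L : R) : set plane :=
  [set x | a <= lin (perp e) (x - x0) <= b /\ - L <= lin e (x - x0) <= L].

Lemma measurable_lin (p x0 : plane) : measurable_fun setT (fun x : plane => lin p (x - x0)).
Proof.
apply: continuous_plane_measurable => x.
have c : continuous (fun y : plane => y - x0).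
  by move=> z; apply: cvgB; [exact: cvg_id|exact: cvg_cst].
exact (continuous_comp (c x) (@lin_continuous R p _)).
Qed.

Lemma cyl_measurable e x0 a b L : measurable (cyl e x0 a b L).
Proof.
rewrite (_ : cyl _ _ _ _ _ = ([set x | a <= lin (perp e) (x - x0)] `&`
   [set x | - b <= - lin (perp e) (x - x0)]) `&` ([set x | - L <= lin e (x - x0)] `&`
   [set x | - L <= - lin e (x - x0)])).
  by do 2?apply: measurableI; apply: measurable_superlevel; try exact: measurable_lin;
    apply: measurable_funN; exact: measurable_lin.
apply/seteqP; split=> x /=; rewrite /cyl/= !lerN2.
  by move=> [/andP[-> ->] /andP[-> ->]].
by move=> [[-> ->] [-> ->]].
Qed.

(** Where [nu] equals [e] the flux counts the whole mass; in general the deficit [1 - lin e (nu x)]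
    is at most [enorm (nu x - e)], integrated over a ball containing the enlarged cylinder. *)
Lemma cyl_mass e x0 a b L k rho : enorm e = 1 -> 0 < k -> a <= b ->
  (forall x, a - k < lin (perp e) (x - x0) < b + k ->
     - (L + k) < lin e (x - x0) < L + k -> enorm (x - x0) < rho) ->
  fine (m (cyl e x0 a b L)) <= b - a + 2 * k + bI m (fun y => enorm (nu y - e)) x0 rho.
Proof.
move=> e1 k0 ab H.
have [_ n1] := U; have [_ b1 b2] := unit_polar_measurable U.
have tc := cylfun_test x0 a b L e1 k0.
have bc := test_bounded tc.
have bl : bmf (fun x => lin e (nu x)) by apply: bmfD; exact: bmfZ.
have bd := bmf_dist e.
have mc := cyl_measurable e x0 a b L.
rewrite -rI_indic//.
apply: le_trans (_ : \int[m]_x (cylfun e x0 a b L k x * lin e (nu x) +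
    \1_(eball x0 rho) x * enorm (nu x - e)) <= _); last first.
  rewrite rI_D; [|exact: bmfM|exact: bmf_ballM].
  by rewrite lerD2r cylinder_flux.
apply: rI_le; [exact: bmf_indic|by apply: bmfD; [exact: bmfM|exact: bmf_ballM]|].
move=> x.
have /andP[c0 c1] := cylfun_01 e x0 a b L k x.
have le : 1 - lin e (nu x) <= enorm (nu x - e).
  have ee : lin e e = 1 by rewrite /lin -!expr2 -enorm_sqr e1 expr1n.
  by rewrite -ee -linB; apply: le_trans (lin_le _ _) _; rewrite e1 mul1r enormB.
have d0 := enorm_ge0 (nu x - e).
apply: (@le_trans _ _ (cylfun e x0 a b L k x)).
  rewrite indicE; case: (boolP (x \in cyl e x0 a b L)) => // /[!inE] -[h1 h2].
  by rewrite cylfun_1.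
have [->|cn0] := eqVneq (cylfun e x0 a b L k x) 0.
  by rewrite mul0r add0r mulr_ge0// indicE.
have [h1 h2] := cylfun_0 k0 cn0.
rewrite indicE mem_set ?mul1r; last exact: H.
move: c0 c1 d0 le; set c := cylfun _ _ _ _ _ _ _; nra.
Qed.

Definition lebp (eps d : R) (e x : plane) := forall r, 0 < r -> r < d ->
  bI m (fun y => enorm (nu y - e)) x r <= eps * bm m x r.

(** The ball sits in a square cylinder of width [2 r], and ramps of width [r / 4] make the flux
    [5 / 2 * r]. The enlarged square has half-side [5 r / 4], hence lies in the ball of radius
    [2 r]. *)
Lemma ball_mass2 eps d e x r : enorm e = 1 -> lebp eps d e x -> 0 < r -> 2 * r < d ->
  bm m x r <= 5 / 2 * r + eps * bm m x (2 * r).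
Proof.
move=> e1 H r0 rd.
have k0 : 0 < r / 4 by rewrite divr_gt0.
have := @cyl_mass e x (- r) r r (r / 4) (2 * r) e1 k0.
have h1 : - r <= r by lra.
move=> /(_ h1) HH.
have : bm m x r <= fine (m (cyl e x (- r) r r)).
  rewrite bmE fine_le ?fin_num_measure//; [exact: eball_measurable|exact: cyl_measurable|].
  apply: le_measure; rewrite ?inE; [exact: eball_measurable|exact: cyl_measurable|].
  move=> y /ltW yr.
  have sq := lin_perp_sqr (y - x) e1.
  have en := enorm_ge0 (y - x).
  have s1 := sqr_ge0 (lin (perp e) (y - x)); have s2 := sqr_ge0 (lin e (y - x)).
  by rewrite /cyl/=; split; apply/andP; split; nra.
move=> /le_trans; apply; apply: le_trans (HH _) _.
  move=> y /andP[a1 a2] /andP[a3 a4].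
  rewrite -(@ltr_sqr R) ?nnegrE ?enorm_ge0//; last lra.
  rewrite -(lin_perp_sqr _ e1).
  have : lin (perp e) (y - x) ^+ 2 <= (5 / 4 * r) ^+ 2 by nra.
  have : lin e (y - x) ^+ 2 <= (5 / 4 * r) ^+ 2 by nra.
  have : 0 < r ^+ 2 by rewrite exprn_gt0.
  by rewrite !exprMn; nra.
have := H (2 * r); have : 0 < 2 * r by lra.
by move=> h2 /(_ h2 rd); lra.
Qed.

(** For [eps <= 1/4] the doubling estimate iterates: the bound [5 s] reproduces itself, as
    [5/2 + 10/4 = 5], and the total mass is damped by 4 at each doubling. Doubling stops at radius
    comparable to [d], where the condition on [r] makes the damped mass at most [r]. *)
Lemma ball_mass eps d e x r : enorm e = 1 -> lebp eps d e x -> eps <= 4^-1 ->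
  0 < d -> 0 < r -> r < d / 2 -> r * (4 * fine (m setT) + 4) <= d ^+ 2 ->
  bm m x r <= 6 * r.
Proof.
move=> e1 H eps4 d0 r0 rd rT.
set T := fine (m setT).
have bmT s : bm m x s <= T.
  rewrite bmE fine_le ?fin_num_measure//; first exact: eball_measurable.
  by apply: le_measure; rewrite ?inE//; exact: eball_measurable.
have bm0 s : 0 <= bm m x s by apply: Rintegral_ge0 => y _; rewrite indicE.
have P n : forall s, 0 < s -> 2 ^+ n * s < d -> bm m x s <= 5 * s + 4^-1 ^+ n * T.
  elim: n => [|n IH] s s0 sd; first by rewrite expr0 mul1r; apply: le_trans (bmT s) _; rewrite lerDr mulr_ge0// ltW.
  have s2 : 2 * s < d.
    apply: le_lt_trans sd; rewrite exprS -mulrA ler_wpM2l// ler_peMl ?(ltW s0)//.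
    by rewrite exprn_ege1// ler1n.
  apply: le_trans (ball_mass2 e1 H s0 s2) _.
  have IH2 := IH (2 * s); have p2 : 0 < 2 * s by lra.
  have {IH2} := IH2 p2; rewrite mulrA -exprSr => /(_ sd) IH2.
  have := bm0 (2 * s); rewrite exprS; nra.
have [n [n1 n2]] : exists n, 2 ^+ n * r < d /\ d / 2 <= 2 ^+ n * r.
  have ex : exists n, d <= 2 ^+ n * r.
    exists (Num.truncn (d / r)).+1; rewrite -ler_pdivrMr//.
    apply: ltW; apply: lt_le_trans (truncnS_gt _) _.
    by rewrite -natrX ler_nat ltnW// ltn_expl.
  case: (ex_minnP ex) => -[|n] dn minn.
    by move: dn; rewrite expr0 mul1r; lra.
  exists n; split; first by rewrite ltNge; apply/negP => /minn; rewrite ltnn.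
  by rewrite ler_pdivrMr// mulrAC -exprSr.
apply: le_trans (P n r r0 n1) _.
suff : 4^-1 ^+ n * T <= r by lra.
have p0 : 0 < 2 ^+ n :> R by rewrite exprn_gt0.
rewrite (_ : 4^-1 ^+ n = (2 ^+ n * 2 ^+ n)^-1); last by rewrite -exprMn exprVn; congr (_ ^+ _)^-1; ring.
rewrite mulrC ler_pdivrMr ?mulr_gt0//.
have : (d / 2) ^+ 2 <= (2 ^+ n * r) ^+ 2 by move: (2 ^+ n * r) n2 => q n2; nra.
rewrite -(ler_pM2l r0).
have T0 : 0 <= T by rewrite fine_ge0.
rewrite exprMn; move: rT; rewrite -/T !expr2; move: (2 ^+ n) p0 => p p0; nra.
Qed.

(** A set of diameter at most [t] projects to an interval of length at most [t], so it fits in a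
    cylinder of that width. Ramps of width [eps * t] cost [2 eps t], and the deficit on the ball of
    radius [2 t] costs [12 eps t] by [ball_mass], hence the 14. *)
Lemma set_mass eps d e x t (V : set plane) : enorm e = 1 -> lebp eps d e x ->
  0 < eps -> eps <= 4^-1 -> 0 < d -> 0 < t -> 2 * t < d / 2 ->
  2 * t * (4 * fine (m setT) + 4) <= d ^+ 2 ->
  V x -> (forall y y', V y -> V y' -> enorm (y - y') <= t) ->
  exists C : set plane, [/\ measurable C, V `<=` C & fine (m C) <= (1 + 14 * eps) * t].
Proof.
move=> e1 H eps0 eps4 d0 t0 td tT Vx Vt.
pose S := [set lin (perp e) (y - x) | y in V].
have le y : lin (perp e) y <= enorm y.
  have pe : enorm (perp e) = 1 by rewrite -e1 /enorm /perp/= sqrrN addrC.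
  by apply: le_trans (lin_le _ _) _; rewrite pe mul1r.
have S0 : S !=set0 by exists (lin (perp e) (x - x)), x.
have ubS : ubound S t by move=> _ [y Vy <-]; apply: le_trans (le _) (Vt _ _ Vy Vx).
have lbS : lbound S (- t).
  move=> _ [y Vy <-]; rewrite lerNl.
  have -> : - lin (perp e) (y - x) = lin (perp e) (x - y) by rewrite !linB opprB.
  by apply: le_trans (le _) (Vt _ _ Vx Vy).
pose a := inf S; pose b := sup S.
have hS : has_sup S by split=> //; exists t.
have hI : has_inf S by split=> //; exists (- t).
have bt : b <= t by apply: ge_sup.
have at_ : - t <= a by apply: lb_le_inf.
have ya y : V y -> a <= lin (perp e) (y - x) <= b.
  by move=> Vy; apply/andP; split; [apply: ge_inf => //; [exact: hI.2|exists y]|apply: ub_le_sup => //; [exact: hS.2|exists y]].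
have ab : a <= b by have /andP[h1 h2] := ya x Vx; exact: le_trans h1 h2.
have abt : b - a <= t.
  rewrite lerBlDr; apply: ge_sup => // _ [y Vy <-]; rewrite -lerBlDl.
  apply: lb_le_inf => // _ [z Vz <-].
  by have := le_trans (le _) (Vt _ _ Vy Vz); rewrite !linB; lra.
have k0 : 0 < eps * t by rewrite mulr_gt0.
have sqb (P Q : R) : - (5 / 4 * t) < P -> P < 5 / 4 * t -> - (5 / 4 * t) < Q -> Q < 5 / 4 * t ->
    P ^+ 2 + Q ^+ 2 < (2 * t) ^+ 2.
  move=> *; have : P ^+ 2 <= (5 / 4 * t) ^+ 2 by nra.
  have : Q ^+ 2 <= (5 / 4 * t) ^+ 2 by nra.
  have : 0 < t ^+ 2 by rewrite exprn_gt0.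
  by rewrite !exprMn; nra.
have et : eps * t <= t / 4 by rewrite mulrC ler_pM2l.
have HH := @cyl_mass e x a b t (eps * t) (2 * t) e1 k0 ab.
exists (cyl e x a b t); split; first exact: cyl_measurable.
  move=> y Vy; split; first exact: ya.
  have ley z : lin e z <= enorm z by apply: le_trans (lin_le _ _) _; rewrite e1 mul1r.
  apply/andP; split.
    rewrite lerNl (_ : - _ = lin e (x - y)); last by rewrite !linB opprB.
    exact: le_trans (ley _) (Vt _ _ Vx Vy).
  exact: le_trans (ley _) (Vt _ _ Vy Vx).
apply: le_trans (HH _) _.
  move=> y /andP[a1 a2] /andP[a3 a4].
  rewrite -(@ltr_sqr R) ?nnegrE ?enorm_ge0//; last lra.
  by rewrite -(lin_perp_sqr _ e1); apply: sqb; clear -a1 a2 a3 a4 et t0 at_ bt; lra.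
have t20 : 0 < 2 * t by lra.
have td2 : 2 * t < d by lra.
have b6 := ball_mass e1 H eps4 d0 t20 td tT.
have := H (2 * t) t20 td2.
nra.
Qed.

End Cylinder.

(** * Perimeter lower bound *)

Section Norms.
Context {R : realType} (phi : plane R -> R).
Local Notation plane := (plane R).
Hypothesis N : is_norm phi.

Lemma norm0 : phi 0 = 0.
Proof. by have [_ H _] := N; rewrite -(scale0r 0) H normr0 mul0r. Qed.

Lemma normNx x : phi (- x) = phi x.
Proof. by have [_ H _] := N; rewrite -scaleN1r H normrN normr1 mul1r. Qed.

Lemma norm_ge0 x : 0 <= phi x.
Proof.
have [_ _ H] := N; have := H x (- x); rewrite subrr norm0 normNx; lra.
Qed.

Lemma norm_le x : phi x <= (phi (1, 0) + phi (0, 1)) * enorm x.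
Proof.
have [_ Z H] := N.
have -> : x = x.1 *: ((1, 0) : plane) + x.2 *: ((0, 1) : plane).
  by case: x => a b; congr (_, _) => /=; rewrite /GRing.scale/=; ring.
set y := _ + _; apply: le_trans (H _ _) _; rewrite !Z -/y.
have -> : x.1 = y.1 by rewrite /y/= /GRing.scale/=; ring.
have -> : x.2 = y.2 by rewrite /y/= /GRing.scale/=; ring.
have := le_enorm1 y; have := le_enorm2 y; have := norm_ge0 (1, 0); have := norm_ge0 (0, 1).
nra.
Qed.

Lemma norm_dist x y : `|phi x - phi y| <= phi (x - y).
Proof.
have [_ _ H] := N; rewrite ler_norml; apply/andP; split.
  by have := H (y - x) x; rewrite subrK -(normNx (y - x)) opprB; lra.
by have := H (x - y) y; rewrite subrK; lra.
Qed.

Lemma is_norm_continuous : continuous phi.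
Proof.
move=> x; set C := phi (1, 0) + phi (0, 1).
have C0 : 0 <= C by rewrite addr_ge0// norm_ge0.
apply/cvgrPdist_le => e e0.
have d0 : 0 < e / (C + 1) / 2 by rewrite !divr_gt0// ltr_pwDr.
apply/(@nbhs_ballP R (plane : pseudoMetricType R)); exists (e / (C + 1) / 2) => //= y [/= y1 y2].
apply: le_trans (norm_dist _ _) _; apply: le_trans (norm_le _) _; rewrite -/C.
have : enorm (x - y) <= e / (C + 1).
  by apply: le_trans (enorm_le _) _; move: y1 y2; rewrite /ball/= => y1 y2; lra.
rewrite ler_pdivlMr; last by rewrite ltr_pwDr.
by have := enorm_ge0 (x - y); nra.
Qed.

End Norms.

(** * Integration against the Hausdorff outer measure *)

Section Hausdorff.
Context {R : realType}.
Local Notation plane := (plane R).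
Local Open Scope ereal_scope.

Lemma diam_ge0 (A : set plane) : 0 <= diam A.
Proof. by apply: ereal_sup_ubound; left. Qed.

Lemma diam_le (A : set plane) x y : A x -> A y -> (enorm (x - y))%:E <= diam A.
Proof. by move=> Ax Ay; apply: ereal_sup_ubound; right; exists x, y. Qed.

Lemma hausdorff1_delta_ge0 (delta : R) (A : set plane) : 0 <= hausdorff1_delta delta A.
Proof.
apply: le_ereal_inf_tmp => _ [U _ <-]; apply: nneseries_ge0 => n _ _; exact: diam_ge0.
Qed.

Lemma hausdorff1_ge (delta : R) (A : set plane) : (0 < delta)%R ->
  hausdorff1_delta delta A <= hausdorff1 A.
Proof. by move=> d0; apply: ereal_sup_ubound; exists delta. Qed.

Lemma hausdorff1_ge0 (A : set plane) : 0 <= hausdorff1 A.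
Proof.
by apply: le_trans (hausdorff1_delta_ge0 1 A) _; apply: hausdorff1_ge.
Qed.

Lemma diam_set0 : diam (set0 : set plane) = 0.
Proof.
apply/le_anti; rewrite diam_ge0 andbT; apply: ge_ereal_sup => _ [->//|[x [y []]]//].
Qed.

Lemma hausdorff1_set0 : hausdorff1 (set0 : set plane) = 0.
Proof.
apply/le_anti; rewrite hausdorff1_ge0 andbT; apply: ge_ereal_sup => _ [d /= d0 <-].
apply: ereal_inf_lbound; exists (fun=> set0); first by split=> // k; rewrite diam_set0 lee_fin ltW.
by rewrite eseries0// => *; exact: diam_set0.
Qed.

Lemma sintegral_range (mu : set plane -> \bar R) (h : {nnsfun plane >-> R}) : mu set0 = 0 ->
  sintegral mu h = \sum_(x \in range h) x%:E * mu (h @^-1` [set x]).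
Proof.
move=> mu0; rewrite (fsbig_widen (range h) setT)//= => x [_ Nfx] /=.
by rewrite preimage10// mu0 mule0.
Qed.

(** [hausdorff1] is an outer measure on all sets, so the integral is unfolded to its definition. The
    negative part vanishes and there remains a supremum over simple functions. *)
Lemma integral_hausdorff1 (D : set plane) (f : plane -> \bar R) : (forall x, 0 <= f x) ->
  \int[hausdorff1]_(x in D) f x = ereal_sup [set sintegral hausdorff1 h |
    h in [set h : {nnsfun plane >-> R} | forall x, (h x)%:E <= (f \_ D) x]].
Proof.
move=> f0; have g0 x : 0 <= (f \_ D) x by rewrite patchE; case: ifP.
rewrite /integral.
have -> : ((f \_ D)^\-) = cst 0.
  apply/funext => x; rewrite funenegE; apply/max_idPr.
  by rewrite leeNl oppe0.
have -> : ((f \_ D)^\+) = f \_ D.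
  by apply/funext => x; rewrite funeposE; apply/max_idPl.
rewrite [X in _ - X](_ : _ = 0) ?sube0//.
apply/le_anti/andP; split.
  apply: ge_ereal_sup => _ [h /= h0 <-].
  rewrite sintegral_range ?hausdorff1_set0// fsbig1// => x [y _ <-].
  have -> : h y = 0%R by apply/le_anti; have := h0 y; rewrite lee_fin => ->/=.
  by rewrite mul0e.
apply: ereal_sup_ubound; exists (cst_nnsfun _ (NngNum (lexx 0%R))) => //=.
rewrite /sintegral fsbig1// => x _; rewrite preimage_cst.
by case: ifPn => [/[!inE] <-|_]; rewrite ?mul0e// hausdorff1_set0 mule0.
Qed.

Lemma integral_hausdorff1_ge0 (D : set plane) (f : plane -> \bar R) :
  (forall x, 0 <= f x) -> 0 <= \int[hausdorff1]_(x in D) f x.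
Proof.
move=> f0; rewrite integral_hausdorff1//; apply: ereal_sup_ubound.
exists (cst_nnsfun _ (NngNum (lexx 0%R))); first by move=> x /=; rewrite patchE; case: ifP.
rewrite /sintegral fsbig1// => x _; rewrite preimage_cst.
by case: ifPn => [/[!inE] <-|_]; rewrite ?mul0e// hausdorff1_set0 mule0.
Qed.

End Hausdorff.

Section LowerBound.
Context {R : realType}.
Local Notation plane := (plane R).
Context (F : set plane) (m : {finite_measure set plane -> \bar R}) (nu : plane -> plane).
Hypothesis U : unit_polar F m nu.
Hypothesis mF : lmeasurable F.
Hypothesis finF : (area F < +oo)%E.

(** Each member of a fine cover that meets [A] contains a Lebesgue point, so [set_mass] bounds its
    mass by nearly its diameter. The radii for which the points are good must be uniform in [A],
    hence the fixed [d]. *)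
Lemma mass_hausdorff (eps d : R) (A : set plane) : 0 < eps -> eps <= 4^-1 -> 0 < d ->
  measurable A -> (forall x, A x -> exists2 e, enorm e = 1 & lebp m nu eps d e x) ->
  (m A <= (1 + 14 * eps)%:E * hausdorff1 A)%E.
Proof.
move=> e0 e4 d0 mA H.
set T := fine (m setT); have T0 : 0 <= T by rewrite fine_ge0.
have c0 : 0 < 1 + 14 * eps by lra.
pose delta := Num.min (d / 16) (d ^+ 2 / (4 * (4 * T + 4))).
have delta0 : 0 < delta by rewrite lt_min !divr_gt0 ?exprn_gt0//; lra.
apply: (@le_trans _ _ ((1 + 14 * eps)%:E * hausdorff1_delta delta A)%E); last first.
  by apply: lee_wpmul2l; [rewrite lee_fin ltW|exact: hausdorff1_ge].
rewrite muleC -lee_pdivrMr//; apply: le_ereal_inf_tmp => _ [V [Vd AV] <-].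
rewrite lee_pdivrMr// muleC.
apply/lee_addgt0Pr => eta eta0.
(* [set_mass] needs a positive size while diameters may vanish. The k-th diameter is enlarged by
   [eta' / 2 ^ k.+1], and these additions sum to [eta']. *)
pose eta' := Num.min delta (eta / (1 + 14 * eps)).
have eta'0 : 0 < eta' by rewrite lt_min delta0 divr_gt0.
have fd k : diam (V k) \is a fin_num.
  by rewrite ge0_fin_numE ?diam_ge0//; apply: le_lt_trans (Vd k) (ltry _).
have /choice[C HC] : forall k, exists X : set plane, [/\ measurable X, V k `&` A `<=` X &
    fine (m X) <= (1 + 14 * eps) * (fine (diam (V k)) + eta' / (2 ^ k.+1)%:R)].
  move=> k.
  have q0 : 0 < eta' / (2 ^ k.+1)%:R by rewrite divr_gt0// ltr0n expn_gt0.
  have dk0 : 0 <= fine (diam (V k)) by rewrite fine_ge0// diam_ge0.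
  have [E|/set0P[x [Vx Ax]]] := eqVneq (V k `&` A) set0.
    exists set0; split=> //; first by rewrite E.
    by rewrite measure0/= mulr_ge0// ?ltW// ltr_wpDl.
  have [e en He] := H x Ax.
  have q1 : eta' / (2 ^ k.+1)%:R <= delta.
    rewrite ler_pdivrMr ?ltr0n ?expn_gt0//; apply: (@le_trans _ _ delta); last first.
      by rewrite ler_peMr ?(ltW delta0)// ler1n expn_gt0.
    by rewrite /eta' ge_min lexx.
  have dk : fine (diam (V k)) <= delta by rewrite -lee_fin fineK.
  set t := fine (diam (V k)) + _.
  have t0 : 0 < t by rewrite ltr_wpDl.
  have td : t <= 2 * delta by rewrite /t; lra.
  have [d1 d2] : delta <= d / 16 /\ delta * (4 * (4 * T + 4)) <= d ^+ 2.
    split; first by rewrite /delta ge_min lexx.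
    rewrite -ler_pdivlMr; last lra.
    by rewrite /delta ge_min lexx orbT.
  have := set_mass U mF finF en He e0 e4 d0 t0.
  have h1 : 2 * t < d / 2 by lra.
  have h2 : 2 * t * (4 * T + 4) <= d ^+ 2 by nra.
  move=> /(_ _ h1 h2 Vx)[y y' Vy Vy'|X [mX VX Xm]].
    by rewrite /t; have := diam_le Vy Vy'; rewrite -{1}(fineK (fd k)) lee_fin; lra.
  by exists X; split=> // z [/VX].
apply: (@le_trans _ _ (\sum_(k <oo) m (C k))%E).
  apply: (@le_trans _ _ (m (\bigcup_k C k))).
    apply: le_measure; rewrite ?inE//; first by apply: bigcup_measurable => k _; case: (HC k).
    by move=> x Ax; have [k _ Vx] := AV x Ax; exists k => //; case: (HC k) => _ + _; apply.
  apply: measure_sigma_subadditive => //; last by apply: bigcup_measurable => k _; case: (HC k).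
  by move=> k; case: (HC k).
apply: (@le_trans _ _ (\sum_(k <oo) ((1 + 14 * eps)%:E * (diam (V k) + (eta' / (2 ^ k.+1)%:R)%:E)))%E).
  apply: lee_nneseries => // k _; have [_ _] := HC k.
  rewrite -lee_fin fineK ?fin_num_measure//; last by case: (HC k).
  by move=> h; apply: (le_trans h); rewrite -[X in (_ <= _ * (X + _))%E](fineK (fd k)).
have p0 k : (0 <= (eta' / (2 ^ k.+1)%:R)%:E)%E by rewrite lee_fin divr_ge0 ?ltW.
rewrite nneseriesZl; last by move=> k _; rewrite adde_ge0// diam_ge0.
apply: (@le_trans _ _ ((1 + 14 * eps)%:E * (\sum_(k <oo) diam (V k) + eta'%:E))%E).
  apply: lee_wpmul2l; first by rewrite lee_fin ltW.
  by apply: epsilon_trick; [move=> n; exact: diam_ge0|exact: ltW].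
rewrite ge0_muleDr ?lee_fin ?(ltW eta'0)//; last by apply: nneseries_ge0 => k _ _; exact: diam_ge0.
apply: leeD => //; rewrite -EFinM lee_fin mulrC -ler_pdivlMr//.
by rewrite /eta' ge_min lexx orbT.
Qed.

(** Simple functions below [f] on [A] also lie below [g] on [D], and each nonzero level is a
    measurable subset of [A] to which [mass_hausdorff] applies. *)
Lemma integral_mass_hausdorff (eps d : R) (A : set plane) (f g : plane -> \bar R) (D : set plane) :
  0 < eps -> eps <= 4^-1 -> 0 < d ->
  measurable A -> (forall x, A x -> exists2 e, enorm e = 1 & lebp m nu eps d e x) ->
  measurable_fun setT f -> (forall x, 0 <= f x)%E -> (forall x, 0 <= g x)%E ->
  (forall x, A x -> D x /\ f x = g x) ->
  (\int[m]_(x in A) f x <= (1 + 14 * eps)%:E * \int[hausdorff1]_(x in D) g x)%E.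
Proof.
move=> e0 e4 d0 mA H mf f0 g0 Dg.
have c0 : 0 < 1 + 14 * eps by lra.
rewrite integral_mkcond ge0_integralTE; last first.
- by move=> x; rewrite patchE; case: ifP.
apply: ge_ereal_sup => _ [h /= hf <-].
rewrite integral_hausdorff1//.
apply: (@le_trans _ _ ((1 + 14 * eps)%:E * sintegral hausdorff1 h)%E); last first.
  apply: lee_wpmul2l; first by rewrite lee_fin ltW.
  apply: ereal_sup_ubound; exists h => //= x.
  apply: le_trans (hf x) _; rewrite !patchE; case: ifPn => [/[!inE] Ax|_].
    by have [Dx ->] := Dg x Ax; rewrite ifT// inE.
  by case: ifP.
rewrite !sintegral_range ?hausdorff1_set0//.
have h0 x : range h x -> 0 <= x by move=> [y _ <-].
rewrite ge0_mule_fsumr; last first.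
  move=> x; have [x0|x0] := lerP 0 x.
    by rewrite mule_ge0// hausdorff1_ge0.
  rewrite preimage10 ?hausdorff1_set0 ?mule0// => -[y _ E].
  by move: x0; rewrite -E ltNge => /negP; apply; exact: fun_ge0.
apply: lee_fsum => // x /h0 x0.
have [->|xn] := eqVneq x 0; first by rewrite !mul0e mule0.
rewrite muleCA; apply: lee_wpmul2l => //; apply: (mass_hausdorff e0 e4 d0) => //.
move=> y /= hy; apply: H; apply: contrapT => nA.
have := hf y; rewrite patchE memNset// lee_fin hy => x1.
by move/eqP: xn; apply; apply/le_anti; rewrite x0 x1.
Qed.

End LowerBound.

(** * Reduced boundary and lower bound of the perimeter *)

Section PolarLowerBound.
Context {R : realType}.
Local Notation plane := (plane R).

Lemma unit_polar_lin (F : set plane) (m : {finite_measure set plane -> \bar R})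
  (nu : plane -> plane) e : unit_polar F m nu -> bmf (fun x => lin e (nu x)).
Proof.
by move=> U; have [_ b1 b2] := unit_polar_measurable U; exact (bmfD (bmfZ e.1 b1) (bmfZ e.2 b2)).
Qed.

(** The total variation is recovered by testing with the normal itself: [m A] is the integral of
    [1_A nu . nu] for [m], which by uniqueness equals that of [1_A nu . nu'] for [m'], and the
    scalar product is at most 1. *)
Lemma polar_measure_le (F : set plane) (m m' : {finite_measure set plane -> \bar R})
  (nu nu' : plane -> plane) A : unit_polar F m nu -> unit_polar F m' nu' ->
  measurable A -> (m A <= m' A)%E.
Proof.
move=> U U' mA; rewrite -[leLHS]fineK ?fin_num_measure// -[leRHS]fineK ?fin_num_measure//.
rewrite lee_fin -!rI_indic//.
have [mnu b1 b2] := unit_polar_measurable U; have [_ b1' b2'] := unit_polar_measurable U'.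
have bA : bmf (\1_A : plane -> R) by exact: bmf_indic.
have bl e := unit_polar_lin e U; have bl' e := unit_polar_lin e U'.
have b1A := bmfM bA b1; have b2A := bmfM bA b2.
have n2 x : (nu x).1 ^+ 2 + (nu x).2 ^+ 2 = 1 by rewrite -enorm_sqr (proj2 U) expr1n.
have n2' x : (nu' x).1 ^+ 2 + (nu' x).2 ^+ 2 = 1 by rewrite -enorm_sqr (proj2 U') expr1n.
have E : \int[m]_x \1_A x = \int[m]_x (\1_A x * (nu x).1 * lin e1 (nu x)) +
    \int[m]_x (\1_A x * (nu x).2 * lin e2 (nu x)).
  rewrite -rI_D.
  - apply: eq_Rintegral => x _; rewrite /lin /e1 /e2/=.
    by rewrite !(mul1r, mul0r, addr0, add0r) -!mulrA -mulrDr -!expr2 n2 mulr1.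
  - exact (bmfM b1A (bl e1)).
  - exact (bmfM b2A (bl e2)).
have le1 i x : `|\1_A x * (if i then (nu x).1 else (nu x).2)| <= 1 :> R.
  rewrite normrM; have [h1 h2] := unit_polar_le x U.
  rewrite -[leRHS]mulr1; apply: ler_pM => //; last by case: i.
  by rewrite indicE; case: (_ \in _); rewrite ?normr1 ?normr0.
have ms i : measurable_fun setT (fun x => \1_A x * (if i then (nu x).1 else (nu x).2) : R).
  by case: i; apply: measurable_funM; try exact: measurable_indic; [case: b1|case: b2].
rewrite E (unit_polar_unique e1 U U' (ms true) (le1 true)).
rewrite (unit_polar_unique e2 U U' (ms false) (le1 false)).
rewrite -rI_D; [|exact (bmfM b1A (bl' e1))|exact (bmfM b2A (bl' e2))].
apply: rI_le => //; first exact (bmfD (bmfM b1A (bl' e1)) (bmfM b2A (bl' e2))).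
move=> x; rewrite /lin /e1 /e2/= !(mul1r, mul0r, addr0, add0r) -!mulrA -mulrDr.
rewrite -[leRHS]mulr1; apply: ler_wpM2l; first by rewrite indicE.
have := n2 x; have := n2' x.
have := sqr_ge0 ((nu x).1 - (nu' x).1); have := sqr_ge0 ((nu x).2 - (nu' x).2).
rewrite !sqrrB; lra.
Qed.

Lemma polar_measure_eq (F : set plane) (m m' : {finite_measure set plane -> \bar R})
  (nu nu' : plane -> plane) A : unit_polar F m nu -> unit_polar F m' nu' ->
  measurable A -> m A = m' A.
Proof.
by move=> U U' mA; apply/le_anti; rewrite (polar_measure_le U U')// (polar_measure_le U' U).
Qed.

Lemma polar_average_eq (F : set plane) (m m' : {finite_measure set plane -> \bar R})
  (nu nu' : plane -> plane) A e : unit_polar F m nu -> unit_polar F m' nu' ->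
  measurable A -> \int[m]_(x in A) lin e (nu x) = \int[m']_(x in A) lin e (nu' x).
Proof.
move=> U U' mA.
rewrite -(rI_indicM m mA (unit_polar_lin e U)) -(rI_indicM m' mA (unit_polar_lin e U')).
apply: (unit_polar_unique e U U'); first exact: measurable_indic.
by move=> x; rewrite indicE; case: (_ \in _); rewrite ?normr1 ?normr0.
Qed.

(** [outer_normal_at] hides its own polar pair; uniqueness transfers its limits to any chosen
    pair. *)
Lemma outer_normal_averages (F : set plane) (m : {finite_measure set plane -> \bar R})
  (nu : plane -> plane) x w : unit_polar F m nu -> outer_normal_at F x w ->
  [/\ forall r : R, 0 < r -> (0 < m (eball x r))%E,
      (\int[m]_(y in eball x r) (nu y).1) / fine (m (eball x r)) @[r --> 0^'+] --> w.1 &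
      (\int[m]_(y in eball x r) (nu y).2) / fine (m (eball x r)) @[r --> 0^'+] --> w.2].
Proof.
move=> U [m' [nu' [P' pos l1 l2 _]]].
have [nu2 U2 ae2] := polar_normalize P'.
have [mn' _ _] := P'; have [mn2 b1 b2] := unit_polar_measurable U2.
have mb r : measurable (eball x r) by exact: eball_measurable.
have Em r : m (eball x r) = m' (eball x r) by exact: polar_measure_eq U U2 (mb r).
have EI i r : \int[m]_(y in eball x r) (if i then (nu y).1 else (nu y).2) =
    \int[m']_(y in eball x r) (if i then (nu' y).1 else (nu' y).2).
  have -> : \int[m]_(y in eball x r) (if i then (nu y).1 else (nu y).2) =
      \int[m]_(y in eball x r) lin (if i then e1 else e2) (nu y).
    by apply: eq_Rintegral => y _; rewrite /lin /e1 /e2; case: i => /=; ring.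
  rewrite (polar_average_eq _ U U2 (mb r)).
  rewrite /Rintegral; congr fine; apply: ae_eq_integral => //.
  - apply: measurable_funTS; apply/measurable_EFinP.
    by case: (unit_polar_lin (if i then e1 else e2) U2).
  - apply: measurable_funTS; apply/measurable_EFinP.
    by case: i; [exact: (measurableT_comp measurable_fst mn')|exact: (measurableT_comp measurable_snd mn')].
  - apply: filterS ae2 => y E _; rewrite -E /lin /e1 /e2; congr EFin.
    by case: i => /=; ring.
split.
- by move=> r r0; rewrite Em; exact: pos.
- by under eq_fun do rewrite Em (EI true); exact: l1.
- by under eq_fun do rewrite Em (EI false); exact: l2.
Qed.

Context (F : set plane) (m : {finite_measure set plane -> \bar R}) (nu : plane -> plane).
Hypothesis U : unit_polar F m nu.

Lemma outer_normalE x w : outer_normal_at F x w -> outer_normal F x = w.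
Proof.
move=> H; apply: xget_unique => // w' H'.
have [_ l1 l2] := outer_normal_averages U H; have [_ l1' l2'] := outer_normal_averages U H'.
case: w w' l1 l2 l1' l2' {H H'} => [a b] [a' b'] /= l1 l2 l1' l2'.
by congr (_, _); [exact: cvg_unique l1' l1|exact: cvg_unique l2' l2].
Qed.

Definition coord (i : bool) (z : plane) : R := if i then z.1 else z.2.

(** Points whose normal oscillates by at most [eps] in mean on all balls of radius below [1/(n+1)].
    Rational radii keep the set measurable; [gset_le] recovers the others. Fixing [n] provides the
    uniform radius that [mass_hausdorff] requires. *)
Definition gset (eps : R) (n : nat) : set plane := [set x | forall q : rat,
  0 < (ratr q : R) -> (ratr q : R) < n.+1%:R^-1 -> forall i,
  bI m (fun y => `|coord i (nu y) - coord i (nu x)|) x (ratr q) <= eps * bm m x (ratr q)].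

Lemma coord_bmf i : bmf (fun x => coord i (nu x)).
Proof. by have [_ b1 b2] := unit_polar_measurable U; case: i. Qed.

Lemma coord_diff_bmf i x : bmf (fun y => `|coord i (nu y) - coord i (nu x)|).
Proof. by apply/bmf_norm/bmfB; [exact: coord_bmf|exact: bmf_cst]. Qed.

Lemma gset_measurable eps n : measurable (gset eps n).
Proof.
pose G i (q : rat) : set plane := [set x |
  bI m (fun y => `|coord i (nu y) - coord i (nu x)|) x (ratr q) <= eps * bm m x (ratr q)].
have mG i q : measurable (G i q).
  rewrite (_ : G i q = [set x | 0 <= eps * bm m x (ratr q) -
      bI m (fun y => `|coord i (nu y) - coord i (nu x)|) x (ratr q)]); last first.
    by apply/seteqP; split=> x; rewrite /G/= subr_ge0.
  apply: measurable_superlevel; apply: measurable_funB.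
    by apply: measurable_funM; [exact: measurable_cst|exact: measurable_bm].
  apply: (measurable_bI2 m (h := fun z : plane * plane => `|coord i (nu z.2) - coord i (nu z.1)|)) => //.
  have [mc _] := coord_bmf i.
  apply: (measurableT_comp (@normr_measurable R setT)); apply: measurable_funB.
    exact: (measurableT_comp mc measurable_snd).
  exact: (measurableT_comp mc measurable_fst).
rewrite (_ : gset eps n = \bigcap_k (match unpickle k with
   | Some q => if (0 < (ratr (q : rat) : R)) && ((ratr q : R) < n.+1%:R^-1) then G true q `&` G false q else setT
   | None => setT end)).
  apply: bigcap_measurable => // k _; case: (unpickle k) => // q.
  by case: ifP => // _; exact: measurableI.
apply/seteqP; split=> x H.
  move=> k _; case: (unpickle k) => // q; case: ifP => // /andP[q0 q1].
  by split; exact: H.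
move=> q q0 q1 i; have := H (pickle q) I; rewrite pickleK q0 q1/= => -[? ?].
by case: i.
Qed.

Lemma gset_le eps n i x r : gset eps n x -> 0 < r -> r < n.+1%:R^-1 ->
  bI m (fun y => `|coord i (nu y) - coord i (nu x)|) x r <= eps * bm m x r.
Proof.
move=> G r0 rn; apply: bI_rat => //; first exact: coord_diff_bmf.
by move=> q q0 qr; apply: G => //; exact: le_lt_trans rn.
Qed.

Lemma gset_lebp eps n x : gset eps n x -> lebp m nu (2 * eps) n.+1%:R^-1 (nu x) x.
Proof.
move=> G r r0 rn; have h1 := gset_le true G r0 rn; have h2 := gset_le false G r0 rn.
apply: (@le_trans _ _ (bI m (fun y => `|coord true (nu y) - coord true (nu x)|) x r +
  bI m (fun y => `|coord false (nu y) - coord false (nu x)|) x r)); last by lra.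
rewrite /bI -rI_D; try by apply: bmf_ballM; exact: coord_diff_bmf.
apply: rI_le.
- by apply: bmf_ballM; exact: bmf_dist U _.
- by apply: bmfD; apply: bmf_ballM; exact: coord_diff_bmf.
move=> y; rewrite -mulrDr ler_wpM2l ?indicE//; exact: (enorm_le (nu y - nu x)).
Qed.

Lemma gset_ae eps : 0 < eps -> {ae m, forall x, exists n, gset eps n x}.
Proof.
move=> e0.
have L i : {ae m, forall x, exists2 d : R, 0 < d & forall r, 0 < r -> r < d ->
    bI m (fun y => `|coord i (nu y) - coord i (nu x)|) x r <= eps * bm m x r}.
  apply: lebesgue_point => //; first by case: (coord_bmf i).
  by move=> x; have [? ?] := unit_polar_le x U; case: i.
apply: filterS2 (L true) (L false) => x [d1 d10 H1] [d2 d20 H2].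
exists (Num.truncn (Num.min d1 d2)^-1) => q q0 qn i.
have : ratr q < Num.min d1 d2.
  apply: (lt_trans qn); rewrite invf_plt ?posrE ?ltr0n ?lt_min ?d10//.
  exact: truncnS_gt.
by rewrite lt_min => /andP[h1 h2]; case: i; [exact: H1|exact: H2].
Qed.

(** A point with a null ball lies in a null ball with rational centre and radius, and there are
    countably many of these. *)
Lemma support_ae : {ae m, forall x, forall r : R, 0 < r -> (0 < m (eball x r))%E}.
Proof.
pose B (p : rat * rat * rat) : set plane := eball (ratr p.1.1, ratr p.1.2) (ratr p.2).
pose N k : set plane := match unpickle k with
  | Some p => if m (B p) == 0%E then B p else set0 | None => set0 end.
have : m.-negligible (\bigcup_k N k).
  apply: negligible_bigcup => k; rewrite /N; case: (unpickle k) => [p|]; last exact: negligible_set0.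
  case: ifPn => [/eqP E|_]; last exact: negligible_set0.
  by apply/negligibleP => //; exact: eball_measurable.
apply: negligibleS => x /= /existsNP[r /not_implyP[r0 /negP]].
rewrite lt0e measure_ge0 andbT negbK => /eqP mr.
have [a /andP[a1 a2]] := @rat_in_itvoo R (x.1 - r / 8) (x.1 + r / 8) ltac:(lra).
have [b /andP[b1 b2]] := @rat_in_itvoo R (x.2 - r / 8) (x.2 + r / 8) ltac:(lra).
have [q /andP[q1 q2]] := @rat_in_itvoo R (r / 4) (r / 2) ltac:(lra).
move: a1 a2 b1 b2 q1 q2; rewrite !bnd_simp => a1 a2 b1 b2 q1 q2.
have d1 : enorm (x - (ratr a, ratr b)) < ratr q.
  apply: le_lt_trans (enorm_le _) _ => /=.
  have h1 : `|x.1 - ratr a| < r / 8 by rewrite ltr_norml; apply/andP; split; lra.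
  have h2 : `|x.2 - ratr b| < r / 8 by rewrite ltr_norml; apply/andP; split; lra.
  by apply: lt_trans q1; rewrite (_ : r / 4 = r / 8 + r / 8); [exact: ltrD|lra].
have E : m (B (a, b, q)) = 0%E.
  apply/eqP; rewrite -measure_le0 -mr; apply: le_measure; rewrite ?inE; try exact: eball_measurable.
  move=> y; rewrite /B /eball/= => yq.
  have -> : y - x = (y - (ratr a, ratr b)) + ((ratr a, ratr b) - x) by rewrite addrA subrK.
  apply: le_lt_trans (enormD _ _) _; rewrite (enormB (_, _) x); lra.
exists (pickle ((a, b), q)); first exact: I.
have -> : N (pickle ((a, b), q)) = B (a, b, q) by rewrite /N pickleK E eqxx.
exact: d1.
Qed.

Lemma gset_normal x : (forall eps, 0 < eps -> exists n, gset eps n x) ->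
  (forall r : R, 0 < r -> (0 < m (eball x r))%E) -> outer_normal_at F x (nu x).
Proof.
move=> G pos; exists m, nu.
have L i : (\int[m]_(y in eball x r) coord i (nu y)) / fine (m (eball x r)) @[r --> 0^'+] --> coord i (nu x).
  apply/cvgrPdist_le => e e0; have [n Gn] := G e e0.
  have n0 : 0 < n.+1%:R^-1 :> R by rewrite invr_gt0 ltr0n.
  near=> r.
  have r0 : 0 < r by near: r; exact: nbhs_right_gt.
  have rn : r < n.+1%:R^-1 by near: r; exact: nbhs_right_lt.
  have b0 : 0 < bm m x r by rewrite bmE fine_gt0// pos//= ltey_eq fin_num_measure//; exact: eball_measurable.
  have bc := coord_bmf i; have bb := bmf_ball x r.
  have mb : measurable (eball x r) by exact: eball_measurable.
  rewrite -rI_indicM// -bmE distrC.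
  rewrite (_ : _ - _ = (\int[m]_y (\1_(eball x r) y * (coord i (nu y) - coord i (nu x)))) / bm m x r).
    rewrite normrM normfV (gtr0_norm b0) ler_pdivrMr//.
    apply: le_trans (gset_le i Gn r0 rn).
    apply: le_trans (rI_abs _ _) _; first by apply: bmf_ballM; apply: bmfB => //; exact: bmf_cst.
    apply: rI_le.
    + by apply/bmf_norm/bmf_ballM/bmfB => //; exact: bmf_cst.
    + by apply: bmf_ballM; exact: coord_diff_bmf.
    + by move=> y; rewrite normrM ger0_norm// indicE.
  rewrite (_ : \int[m]_y (\1_(eball x r) y * (coord i (nu y) - coord i (nu x))) =
     \int[m]_y (\1_(eball x r) y * coord i (nu y)) - coord i (nu x) * bm m x r).
    by rewrite mulrBl mulfK// gt_eqF.
  rewrite /bm -rI_Z// -rI_B; [|exact: bmf_ballM|exact: bmfZ].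
  by apply: eq_Rintegral => y _; ring.
split; [exact: (proj1 U)|exact: pos|exact: (L true)|exact: (L false)|exact: (proj2 U)].
Unshelve. all: by end_near.
Qed.

Hypothesis mF : lmeasurable F.
Hypothesis finF : (area F < +oo)%E.

Lemma perimeter_lower phi : is_norm phi ->
  (\int[m]_x (phi (nu x))%:E <= aniso_perimeter phi F)%E.
Proof.
move=> Nphi.
rewrite /aniso_perimeter asboolT; last by exists m, nu; exact: (proj1 U).
have [mnu b1 b2] := unit_polar_measurable U.
have mphi : measurable_fun setT (fun x => (phi (nu x))%:E).
  apply/measurable_EFinP; apply: (measurableT_comp _ mnu).
  by apply: continuous_plane_measurable; exact (is_norm_continuous Nphi).
have p0 x : (0 <= (phi (nu x))%:E)%E by rewrite lee_fin norm_ge0.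
set Y := (\int[hausdorff1]_(x in _) _)%E.
have [N [mN N0 HN]] : {ae m, forall x, outer_normal_at F x (nu x)}.
  have : {ae m, forall x, forall k, exists n, gset k.+1%:R^-1 n x}.
    by apply: ae_foralln => k; apply: gset_ae; rewrite invr_gt0.
  apply: filterS2 support_ae => x S G; apply: gset_normal => // e e0.
  have [n Gn] := G (Num.truncn e^-1); exists n => q q0 qn i.
  apply: le_trans (Gn q q0 qn i) _; apply: ler_wpM2r.
    by rewrite bmE fine_ge0.
  by rewrite ltW// invf_plt ?posrE//; exact: truncnS_gt.
(* The sets [A n] increase to almost everything, so monotone convergence concludes. The parameter is
   [eps / 2] because the two coordinates of the normal add up in [gset_lebp]. *)
have main eps : 0 < eps -> eps <= 4^-1 -> (\int[m]_x (phi (nu x))%:E <= (1 + 14 * eps)%:E * Y)%E.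
  move=> e0 e4.
  have e20 : 0 < eps / 2 by rewrite divr_gt0.
  pose A n := gset (eps / 2) n `\` N.
  have mA n : measurable (A n) by apply: measurableD => //; exact: gset_measurable.
  have ndA : nondecreasing_seq A.
    move=> n k nk; rewrite subsetEset => x [Gx Nx]; split=> // q q0 qk; apply: Gx => //.
    by apply: (lt_le_trans qk); rewrite lef_pV2 ?posrE// ler_nat.
  have HA n : (\int[m]_(x in A n) (phi (nu x))%:E <= (1 + 14 * eps)%:E * Y)%E.
    apply: (@integral_mass_hausdorff _ F m nu U mF finF eps n.+1%:R^-1) => //.
    - move=> x [Gx _]; exists (nu x); first exact: (proj2 U).
      by have := gset_lebp Gx; rewrite mulrC divfK.
    - by move=> x; rewrite lee_fin norm_ge0.
    move=> x [_ Nx]; have H : outer_normal_at F x (nu x) by apply: contrapT => /HN.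
    by split; [exists (nu x)|rewrite (outer_normalE H)].
  have cv := @ge0_nondecreasing_set_cvg_integral _ _ R A (fun x => (phi (nu x))%:E) m ndA mA
    (fun i => measurable_funTS mphi) (fun i x _ => p0 x).
  have -> : (\int[m]_x (phi (nu x))%:E = \int[m]_(x in \bigcup_i A i) (phi (nu x))%:E)%E.
    have mU : measurable (\bigcup_i A i) by exact: bigcup_measurable.
    have [N' [mN' N'0 HN']] := gset_ae e20.
    rewrite (@ge0_negligible_integral _ _ _ m setT (N' `|` N) _ _ measurableT)//; [|exact: measurableU|]; last first.
      exact: null_set_setU.
    rewrite [RHS](@ge0_negligible_integral _ _ _ m (\bigcup_i A i) (N' `|` N))//; [|exact: measurableU|exact: measurable_funTS|]; last first.
      exact: null_set_setU.
    congr (\int[m]_(x in _) _)%E; apply/seteqP; split=> x [Hx /not_orP[h1 h2]]; split=> //; try by case.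
    have [n Gn] : exists n, gset (eps / 2) n x by apply: contrapT => /HN'.
    by exists n.
  rewrite -(cvg_lim _ cv)//; apply: lime_le; first by apply/cvg_ex; eexists; exact: cv.
  exact: nearW.
have [Yy|] := eqVneq Y +oo%E; first by rewrite Yy leey.
have Y0 : (0 <= Y)%E by   apply: integral_hausdorff1_ge0 => x; rewrite lee_fin norm_ge0.
move=> Yn; have Yf : Y \is a fin_num by rewrite ge0_fin_numE// lt_neqAle Yn leey.
apply/lee_addgt0Pr => eta eta0.
pose y := fine Y; have y0 : 0 <= y by rewrite fine_ge0.
pose eps := Num.min 4^-1 (eta / (14 * (y + 1))).
have yp : 0 < 14 * (y + 1) by lra.
have e0 : 0 < eps by rewrite lt_min invr_gt0 divr_gt0//= ltr0n.
have e4 : eps <= 4^-1 by rewrite /eps ge_min lexx.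
apply: le_trans (main eps e0 e4) _.
rewrite -(fineK Yf) -EFinM -EFinD lee_fin -/y.
have : eps * (14 * (y + 1)) <= eta by rewrite -ler_pdivlMr// /eps ge_min lexx orbT.
by nra.
Qed.

End PolarLowerBound.

(** * Mollification *)

Section FiniteFubini.
Context {R : realType}.

Definition restrm d (T : measurableType d) (mu : {measure set T -> \bar R}) (D : set T)
  (mD : measurable D) (moo : (mu D < +oo)%E) : {finite_measure set T -> \bar R} :=
  mfrestr mD moo.

Lemma integral_restrm d (T : measurableType d) (mu : {measure set T -> \bar R}) (D : set T)
    (mD : measurable D) (moo : (mu D < +oo)%E) (f : T -> \bar R) :
  measurable_fun setT f ->
  (\int[restrm mD moo]_x f x = \int[mu]_(x in D) f x)%E.
Proof.
move=> mf.
have -> : (\int[mu]_(x in D) f x = \int[restrm mD moo]_(x in D) f x)%E.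
  by apply: eq_measure_integral => A mA AD; rewrite /= /mfrestr /mrestr setIidl.
have E : D = setT `\` ~` D by rewrite setTD setCK.
have P (g : T -> \bar R) : measurable_fun setT g -> (forall x, 0 <= g x)%E ->
    (\int[restrm mD moo]_x g x = \int[restrm mD moo]_(x in D) g x)%E.
  move=> mg g0.
  rewrite (@ge0_negligible_integral _ _ _ (restrm mD moo) setT (~` D))//; [by rewrite -E|exact: measurableC|].
  by change (mu (~` D `&` D) = 0%E); rewrite setICl measure0.
rewrite integralE [RHS]integralE; congr (_ - _)%E; apply: P.
- exact: measurable_funepos.
- by move=> x; exact: funepos_ge0.
- exact: measurable_funeneg.
- by move=> x; exact: funeneg_ge0.
Qed.

Context d1 d2 (T1 : measurableType d1) (T2 : measurableType d2)
  (m1 : {finite_measure set T1 -> \bar R}) (m2 : {finite_measure set T2 -> \bar R}).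

Lemma bmf_comp d d' (T : measurableType d) (T' : measurableType d') (f : T -> T') (g : T' -> R) :
  measurable_fun setT f -> bmf g -> bmf (fun x => g (f x)).
Proof. by move=> mf [mg [C gC]]; split; [exact: measurableT_comp mg mf|exists C]. Qed.

Lemma bmf_section (h : T1 * T2 -> R) x : bmf h -> bmf (fun y => h (x, y)).
Proof. by move=> bh; apply: bmf_comp bh; exact: measurable_pair1. Qed.

Lemma bmf_section2 (h : T1 * T2 -> R) y : bmf h -> bmf (fun x => h (x, y)).
Proof. by move=> bh; apply: bmf_comp bh; exact: measurable_pair2. Qed.

Lemma bmf_param_ge0 (h : T1 * T2 -> R) : bmf h -> (forall z, 0 <= h z) ->
  bmf (fun x => \int[m2]_y h (x, y)).
Proof.
move=> bh h0; have [mh [C hC]] := bh; split.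
  rewrite /Rintegral; apply: (measurableT_comp (@fine_measurable R setT measurableT)).
  have mE : measurable_fun setT (EFin \o h) by apply/measurable_EFinP.
  exact (@measurable_fun_fubini_tonelli_F _ _ _ _ R m2 (EFin \o h) mE (fun z => h0 z)).
exists (C * fine (m2 setT)) => x.
apply: le_trans (rI_abs _ _) _; first exact: bmf_section.
rewrite -(@Rintegral_cst _ _ _ m2 setT measurableT C).
by apply: rI_le => //; [apply: bmf_norm; exact: bmf_section|exact: bmf_cst].
Qed.

(** Tonelli requires a sign: bounded functions are raised by a constant, whose integral over a
    finite measure is subtracted afterwards. *)
Lemma bmf_shift d (T : measurableType d) (f : T -> R) : bmf f ->
  exists2 C, bmf (fun x => f x + C) & forall x, 0 <= f x + C.
Proof.
move=> [mf [C fC]]; exists C; last by move=> x; have := fC x; rewrite ler_norml; lra.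
by apply: bmfD; [split=> //; exists C|exact: bmf_cst].
Qed.

Lemma bmf_param (h : T1 * T2 -> R) : bmf h -> bmf (fun x => \int[m2]_y h (x, y)).
Proof.
move=> bh; have [C bC hC] := bmf_shift bh.
have -> : (fun x => \int[m2]_y h (x, y)) =
    (fun x => \int[m2]_y (h (x, y) + C) - \int[m2]_y C).
  by apply/funext => x; rewrite rI_D ?addrK//; [exact: bmf_section|exact: bmf_cst].
by apply: bmfB; [exact: (bmf_param_ge0 bC)|exact: bmf_cst].
Qed.

Lemma bmf_swap (h : T1 * T2 -> R) : bmf h -> bmf (fun z : T2 * T1 => h (z.2, z.1)).
Proof.
by move=> bh; apply: bmf_comp bh; apply: measurable_fun_pair; [exact: measurable_snd|exact: measurable_fst].
Qed.

End FiniteFubini.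

Section FiniteFubini2.
Context {R : realType}.
Context d1 d2 (T1 : measurableType d1) (T2 : measurableType d2)
  (m1 : {finite_measure set T1 -> \bar R}) (m2 : {finite_measure set T2 -> \bar R}).

Lemma rI_fubini (h : T1 * T2 -> R) : bmf h ->
  \int[m1]_x \int[m2]_y h (x, y) = \int[m2]_y \int[m1]_x h (x, y).
Proof.
have P (g : T1 * T2 -> R) : bmf g -> (forall z, 0 <= g z) ->
    \int[m1]_x \int[m2]_y g (x, y) = \int[m2]_y \int[m1]_x g (x, y).
  move=> bg g0.
  have mE : measurable_fun setT (EFin \o g) by apply/measurable_EFinP; case: bg.
  have := @fubini_tonelli _ _ _ _ R m1 m2 (EFin \o g) mE (fun z => g0 z).
  rewrite (eq_integral _ _ (fun x _ => rI_E m2 (bmf_section x bg))).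
  rewrite [in X in _ = X](eq_integral _ _ (fun y _ => rI_E m1 (bmf_section2 y bg))).
  by rewrite /= [in X in X = _ -> _]/Rintegral => H; rewrite /Rintegral; congr fine.
move=> bh; have [C bC hC] := bmf_shift bh.
have := P _ bC hC.
have bs := bmf_swap bh.
have E1 x : \int[m2]_y (h (x, y) + C) = \int[m2]_y h (x, y) + C * fine (m2 setT).
  by rewrite rI_D ?Rintegral_cst//; [exact: bmf_section|exact: bmf_cst].
have E2 y : \int[m1]_x (h (x, y) + C) = \int[m1]_x h (x, y) + C * fine (m1 setT).
  by rewrite rI_D ?Rintegral_cst//; [exact: bmf_section2|exact: bmf_cst].
under eq_Rintegral do rewrite E1.
under [in X in _ = X -> _]eq_Rintegral do rewrite E2.
have b1 : bmf (fun x => \int[m2]_y h (x, y)) by exact: bmf_param.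
have b2 : bmf (fun y => \int[m1]_x h (x, y)) by exact: (bmf_param m1 bs).
have c1 : bmf (fun _ : T1 => C * fine (m2 setT)) := bmf_cst _ _.
have c2 : bmf (fun _ : T2 => C * fine (m1 setT)) := bmf_cst _ _.
by rewrite (rI_D m1 b1 c1) (rI_D m2 b2 c2) !Rintegral_cst//; lra.
Qed.

End FiniteFubini2.

Section Translate.
Context {R : realType}.
Local Notation plane := (plane R).
Implicit Types (f : plane -> R) (w y z : plane).

Lemma derive_translate f w y z : 'D_w (fun y => f (y - z)) y = 'D_w f (y - z).
Proof.
rewrite /derive (_ : (fun h : R => _) =
  (fun h : R => h^-1 *: ((f \o shift (y - z)) (h *: w) - f (y - z))))//.
by apply/funext => h /=; rewrite addrA.
Qed.

Lemma test_derive_bmf f w : test_function f -> bmf ('D_w f).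
Proof.
move=> tf; have [Cf [M M0 HM]] := test_functionE tf.
have HM' x : ~ (`|x.1| <= M /\ `|x.2| <= M) -> f x = 0.
  by move=> /not_andP[|] /negP; rewrite -ltNge => /ltW h; apply: HM; [left|right].
have cD : continuous ('D_w f) by exact: (@C1_dcont R f w Cf).
split; first exact: continuous_plane_measurable.
have /compact_bounded[N [_ HN]] : compact ('D_w f @` [set x : plane | `|x.1| <= M /\ `|x.2| <= M]).
  by apply: continuous_compact; [exact: continuous_subspaceT|exact: compact_box].
exists (Num.max (N + 1) 0) => x.
have [xM|xM] := pselect (`|x.1| <= M /\ `|x.2| <= M).
  rewrite le_max; apply/orP; left; apply: (HN (N + 1)); first by rewrite ltrDl.
  by exists x.
rewrite [X in `|X|](_ : _ = 0) ?normr0 ?le_max ?lexx ?orbT//.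
have Z : \forall t \near (0 : R), f (x + t *: w) = 0.
  have O : open (~` [set x : plane | `|x.1| <= M /\ `|x.2| <= M]).
    by apply: closed_openC; apply: compact_closed; [exact: norm_hausdorff|exact: compact_box].
  have := @line_continuous R x w 0; rewrite /continuous_at scale0r addr0 => /(_ _ (open_nbhs_nbhs (conj O xM))).
  move=> H; have H' : nbhs (0 : R) [set t | ~ (`|(x + t *: w).1| <= M /\ `|(x + t *: w).2| <= M)] := H.
  by apply: filterS H' => t; exact: HM'.
apply: cvg_lim => //; apply: cvg_near_cst.
have fx : f x = 0 by exact: HM'.
apply: nbhs_dnbhs; apply: filterS Z => t /= ft.
by rewrite [t *: w + x]addrC ft fx subr0 scaler0.
Qed.

End Translate.

Section Kernel.
Context {R : realType}.
Local Notation plane := (plane R).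
Local Notation lam := (@lebesgue_measure R).

Definition mollifier (h : R) (k : plane -> R) := [/\ forall z, test_function (fun y => k (y - z)),
  forall y, 0 <= k y, (\int[borel_area]_y (k y)%:E = 1)%E &
  forall y, k y != 0 -> `|y.1| < h /\ `|y.2| < h].

Lemma cylfun_e1_0 (h : R) y : 0 < h ->
  cylfun e1 0 (- h) h h h y != 0 -> `|y.1| < 2 * h /\ `|y.2| < 2 * h.
Proof.
move=> h0 /(cylfun_0 h0); rewrite subr0 /lin /perp /e1/=.
by move=> [/andP[? ?] /andP[? ?]]; rewrite !ltr_norml; split; apply/andP; split; lra.
Qed.

Lemma cylfun_translate e (z : plane) a b L (k : R) y : 0 < k ->
  cylfun e z a b L k y = cylfun e 0 a b L k (y - z).
Proof.
move=> k0; rewrite /cylfun.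
by have [-> -> -> ->] := cylfun_args e z a b L y k0; have [-> -> -> ->] := cylfun_args e 0 a b L (y - z) k0; rewrite subr0.
Qed.

Lemma box_area (a b c d : R) : a <= b -> c <= d ->
  borel_area (`[a, b] `*` `[c, d] : set plane) = ((b - a) * (d - c))%:E.
Proof.
move=> ab cd; have -> : borel_area (`[a, b] `*` `[c, d] : set plane) = (lam `[a, b]%classic * lam `[c, d]%classic)%E.
  exact: (@product_measure1E _ _ (measurableTypeR R) (measurableTypeR R) R lam lam).
have L (p q : R) : p <= q -> lam `[p, q]%classic = (q - p)%:E.
  move=> pq; have := lebesgue_measure_itv `[p, q]; rewrite /= lte_fin => ->.
  by case: ltP => // qp; congr EFin; lra.
by rewrite !L.
Qed.

Lemma mollifier_exists (h : R) : 0 < h -> exists k : plane -> R, mollifier h k.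
Proof.
move=> h0; pose g := cylfun (R := R) e1 0 (- (h / 2)) (h / 2) (h / 2) (h / 2).
have h20 : 0 < h / 2 by lra.
have e11 : enorm (e1 : plane) = 1 by rewrite /enorm /= expr1n expr0n /= addr0 sqrtr1.
have tg z : test_function (fun y => g (y - z)).
  have := cylfun_test z (- (h / 2)) (h / 2) (h / 2) e11 h20; congr (test_function _).
  by apply/funext => y; rewrite cylfun_translate.
have g01 y : 0 <= g y <= 1 := cylfun_01 _ _ _ _ _ _ _.
have gsupp y : g y != 0 -> `|y.1| < h /\ `|y.2| < h.
  by move=> /(cylfun_e1_0 h20)[]; rewrite (_ : 2 * (h / 2) = h)//; lra.
have mg : measurable_fun setT (fun y => (g y)%:E).
  have := tg 0; under eq_fun do rewrite subr0.
  by move=> [Cg _]; apply/measurable_EFinP; exact: C1_measurable.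
pose Z := (\int[borel_area]_y (g y)%:E)%E.
have mbox (r : R) : measurable (`[- r, r] `*` `[- r, r] : set plane) by apply: measurableX; exact: measurable_itv.
have Z1 : (Z <= ((h - - h) * (h - - h))%:E)%E.
  rewrite -box_area; [|lra|lra].
  rewrite -(setIT (_ `*` _)) -integral_indic//; apply: ge0_le_integral => //.
  - by move=> y _; rewrite lee_fin; case/andP: (g01 y).
  - by apply/measurable_EFinP; apply: measurable_indic.
  move=> y _; rewrite lee_fin; have [->|/gsupp[y1 y2]] := eqVneq (g y) 0; first by rewrite indicE.
  rewrite indicE mem_set; first by case/andP: (g01 y).
  by split; rewrite /= in_itv/= -ler_norml ltW.
have Z0 : (0 < Z)%E.
  apply: (@lt_le_trans _ _ (((h / 2 - - (h / 2)) * (h / 2 - - (h / 2)))%:E)).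
    by rewrite lte_fin mulr_gt0//; lra.
  rewrite -box_area; [|lra|lra].
  rewrite -(setIT (_ `*` _)) -integral_indic//; apply: ge0_le_integral => //.
  - by apply/measurable_EFinP; apply: measurable_indic.
  move=> y _; rewrite lee_fin indicE; case: (boolP (y \in _)) => [/[!inE] -[]|_]; last by case/andP: (g01 y).
  rewrite /= !in_itv/= => y1 y2; rewrite /g cylfun_1// subr0 /lin /perp /e1/=.
    by rewrite (_ : - 0 * _ + _ = y.2)//; ring.
  by rewrite (_ : _ + _ = y.1)//; ring.
have Zf : Z \is a fin_num by rewrite ge0_fin_numE ?(ltW Z0)// (le_lt_trans Z1)// ltry.
pose c := (fine Z)^-1; have z0 : 0 < fine Z by rewrite fine_gt0// Z0 ltey_eq Zf.
have c0 : 0 <= c by rewrite invr_ge0 ltW.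
exists (fun y => g y * c); split.
- by move=> z; exact (test_functionM (tg z) (C1_cst c)).
- by move=> y; rewrite mulr_ge0//; case/andP: (g01 y).
- under eq_integral do rewrite EFinM muleC.
  rewrite ge0_integralZl//; last by move=> y _; rewrite lee_fin; case/andP: (g01 y).
  by rewrite -/Z -(fineK Zf) -EFinM mulVf// gt_eqF.
- by move=> y; rewrite mulf_eq0 negb_or => /andP[/gsupp].
Qed.

End Kernel.

Section Mollify.
Context {R : realType}.
Local Notation plane := (plane R).
Local Notation lam := (@lebesgue_measure R).
Context (F : set plane) (m : {finite_measure set plane -> \bar R}) (nu : plane -> plane).
Hypothesis U : unit_polar F m nu.
Hypothesis mF : lmeasurable F.
Hypothesis finF : (area F < +oo)%E.
Context (B : set plane) (mB : measurable B) (finB : (borel_area B < +oo)%E).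
Hypothesis FB : area (F `+` B) = 0%E.
Context (h : R) (k : plane -> R).
Hypothesis K : mollifier h k.

Let muB : {finite_measure set plane -> \bar R} := restrm mB finB.

Definition moll (x : plane) : R := \int[muB]_y k (y - x).
(** The mollification of the measure [|lin e nu| m]: a majorant for the derivative of [moll] along
    [e], with total integral controlled by [om_total]. *)
Definition om (e x : plane) : R := \int[m]_y (k (y - x) * `|lin e (nu y)|).

Lemma itv_finite (a b : R) : (lam `[a, b]%classic < +oo)%E.
Proof.
by have := lebesgue_measure_itv `[a, b]; rewrite /= => ->; case: ifP => _; rewrite ?ltry// -EFinB ltry.
Qed.

Let mulam (a b : R) : {finite_measure set (measurableTypeR R) -> \bar R} :=
  @restrm R _ (measurableTypeR R) lam `[a, b]%classic (measurable_itv `[a, b]) (itv_finite a b).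

Lemma kernel_test : test_function k.
Proof. by have [H _ _ _] := K; have := H 0; under eq_fun do rewrite subr0. Qed.

Lemma kernel_bmf : bmf k. Proof. exact: test_bounded kernel_test. Qed.

Lemma measurable_translate (x : plane) : measurable_fun setT (fun y : plane => y - x).
Proof.
have := @measurable_affine2 R 1 0 0 1 (- x.1) (- x.2).
by apply: eq_measurable_fun => y _; rewrite !mul1r !mul0r addr0 add0r.
Qed.

Lemma measurable_sub2 : measurable_fun setT (fun z : plane * plane => z.2 - z.1).
Proof.
apply/measurable_fun_pairP; split => /=.
- apply: measurable_funB.
    exact: (measurableT_comp measurable_fst measurable_snd).
  exact: (measurableT_comp measurable_fst measurable_fst).
- apply: measurable_funB.
    exact: (measurableT_comp measurable_snd measurable_snd).
  exact: (measurableT_comp measurable_snd measurable_fst).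
Qed.

Lemma kernel_bmf1 x : bmf (fun y : plane => k (y - x)).
Proof. exact (bmf_comp (measurable_translate x) kernel_bmf). Qed.

Lemma kernel_bmf2 : bmf (fun z : plane * plane => k (z.2 - z.1)).
Proof. exact (bmf_comp measurable_sub2 kernel_bmf). Qed.

Lemma om_ker_bmf e : bmf (fun z : plane * plane => k (z.2 - z.1) * `|lin e (nu z.2)|).
Proof.
apply: (bmfM kernel_bmf2).
exact (bmf_comp measurable_snd (bmf_norm (unit_polar_lin e U))).
Qed.

Lemma om_bmf e : bmf (om e).
Proof. exact (bmf_param m (om_ker_bmf e)). Qed.

Lemma moll_bmf : bmf moll.
Proof. exact (bmf_param muB kernel_bmf2). Qed.

Lemma om_ge0 e x : 0 <= om e x.
Proof. by apply: Rintegral_ge0 => y _; rewrite mulr_ge0//; case: K. Qed.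

Lemma kernel_int (x : plane) : (\int[borel_area]_y (k (y - x))%:E = 1)%E.
Proof.
have [_ k0 <- _] := K.
have mk : measurable_fun setT (EFin \o k) by apply/measurable_EFinP; case: kernel_bmf.
have := @ge0_integral_affine2 R (EFin \o k) 1 0 0 1 (- x.1) (- x.2).
rewrite (_ : 1 * 1 - 0 * 0 = 1); last ring.
rewrite normr1 invr1 mul1e => /(_ (oner_neq0 _) mk (fun y => k0 y)) <-.
by apply: eq_integral => y _ /=; rewrite !mul1r !mul0r addr0 add0r.
Qed.

Lemma kernel_int2 (y : plane) : (\int[borel_area]_x (k (y - x))%:E = 1)%E.
Proof.
have [_ k0 <- _] := K.
have mk : measurable_fun setT (EFin \o k) by apply/measurable_EFinP; case: kernel_bmf.
have := @ge0_integral_affine2 R (EFin \o k) (-1) 0 0 (-1) y.1 y.2.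
rewrite (_ : -1 * -1 - 0 * 0 = 1); last ring.
rewrite normr1 invr1 mul1e => /(_ (oner_neq0 _) mk (fun y => k0 y)) <-.
by apply: eq_integral => x _ /=; rewrite !mulN1r !mul0r addr0 add0r ![- _ + _]addrC.
Qed.

Lemma rI_restr_le1 (C : set plane) (mC : measurable C) (finC : (borel_area C < +oo)%E)
   (f : plane -> R) (c : \bar R) :
  bmf f -> (forall x, 0 <= f x) -> (\int[borel_area]_x (f x)%:E <= c)%E ->
  ((\int[restrm mC finC]_x f x)%:E <= c)%E.
Proof.
move=> bf f0 fc; rewrite -(rI_E (restrm mC finC) bf) integral_restrm; last by apply/measurable_EFinP; case: bf.
apply: le_trans fc; apply: ge0_subset_integral => //.
  by apply/measurable_EFinP; case: bf.
by move=> x _; rewrite lee_fin.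
Qed.

Lemma moll_le1 x : moll x <= 1.
Proof.
rewrite -lee_fin; apply: rI_restr_le1; [exact: kernel_bmf1|by move=> y; case: K|].
by rewrite kernel_int.
Qed.

Lemma om_total e (C : set plane) (mC : measurable C) (finC : (borel_area C < +oo)%E) :
  \int[restrm mC finC]_x om e x <= \int[m]_y `|lin e (nu y)|.
Proof.
rewrite (rI_fubini _ m (om_ker_bmf e)) /=.
have bn := bmf_norm (unit_polar_lin e U).
apply: rI_le => //; first exact (bmf_param _ (bmf_swap (om_ker_bmf e))).
have b2 y : bmf (fun x : plane => k (y - x)) by exact (bmf_section2 y kernel_bmf2).
move=> y; under eq_Rintegral do rewrite mulrC.
rewrite rI_Z// -[leRHS]mulr1 ler_wpM2l// -lee_fin.
by apply: rI_restr_le1 => //; [move=> x; case: K|rewrite kernel_int2].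
Qed.

(** The fundamental theorem for [k] along the line and Fubini turn the increment into integrals of
    derivatives of [k] over [B]. As [B] differs from [F] by a null set, the polar identity of [F]
    rewrites them as integrals against [m]. *)
Lemma moll_variation (e x : plane) (a b : R) : a <= b ->
  (`|moll (x + b *: e) - moll (x + a *: e)|%:E <=
   \int[lam]_(t in `[a, b]) (om e (x + t *: e))%:E)%E.
Proof.
move=> ab.
have Ck : C1 k by case: kernel_test.
have bD : bmf ('D_(- e) k) by exact: test_derive_bmf kernel_test.
pose A (z : measurableTypeR R * plane) := z.2 - (x + z.1 *: e).
have mA : measurable_fun setT A.
  apply/measurable_fun_pairP; split; apply: measurable_funB.
  - exact: (measurableT_comp measurable_fst measurable_snd).
  - apply: measurable_funD; first exact: measurable_cst.
    by apply: measurable_funM; [exact: measurable_fst|exact: measurable_cst].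
  - exact: (measurableT_comp measurable_snd measurable_snd).
  - apply: measurable_funD; first exact: measurable_cst.
    by apply: measurable_funM; [exact: measurable_fst|exact: measurable_cst].
have bh : bmf (fun z : measurableTypeR R * plane => 'D_(- e) k (z.2 - (x + z.1 *: e))).
  exact (bmf_comp mA bD).
have tl (f : plane -> R) : bmf f -> bmf (fun t : measurableTypeR R => f (x + t *: e)).
  move=> bf; apply: bmf_comp bf; apply/measurable_fun_pairP; split;
  (apply: measurable_funD; first exact: measurable_cst);
  by apply: measurable_funM; [exact: measurable_id|exact: measurable_cst].
have E1 y : \int[mulam a b]_t 'D_(- e) k (y - (x + t *: e)) = k (y - (x + b *: e)) - k (y - (x + a *: e)).
  apply: EFin_inj; rewrite -rI_E; last exact (bmf_section2 y bh).
  have R1 t : y - (x + t *: e) = y - x + t *: (- e) by rewrite opprD addrA scalerN.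
  rewrite !R1 -C1_FTC// /mulam integral_restrm; last first.
    by apply/measurable_EFinP; case: (bmf_section2 y bh).
  by apply: eq_integral => t _; rewrite R1.
have E2 t : \int[muB]_y 'D_(- e) k (y - (x + t *: e)) = \int[m]_y (k (y - (x + t *: e)) * lin (- e) (nu y)).
  have [T _ _ _] := K.
  have bt := bmf_comp (measurable_translate (x + t *: e)) bD.
  have mt : measurable_fun setT (fun y : plane => ('D_(- e) k (y - (x + t *: e)))%:E).
    by apply/measurable_EFinP; case: bt.
  have := unit_polar_test (- e) U (T (x + t *: e)).
  under eq_integral do rewrite derive_translate.
  rewrite (integral_area_borel mF mB FB mt) -(integral_restrm mB finB mt) rI_E//.
  by move=> H; exact: EFin_inj H.
have E : moll (x + b *: e) - moll (x + a *: e) =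
    \int[mulam a b]_t \int[m]_y (k (y - (x + t *: e)) * lin (- e) (nu y)).
  rewrite /moll -rI_B; [|exact: kernel_bmf1|exact: kernel_bmf1].
  under [RHS]eq_Rintegral do rewrite -E2.
  rewrite (rI_fubini (mulam a b) muB bh) /=.
  by apply: eq_Rintegral => y _; rewrite E1.
have bk t : bmf (fun y : plane => k (y - (x + t *: e)) * lin (- e) (nu y)).
  exact (bmfM (kernel_bmf1 _) (unit_polar_lin _ U)).
have b3 : bmf (fun z : measurableTypeR R * plane => k (z.2 - (x + z.1 *: e)) * lin (- e) (nu z.2)).
  apply: bmfM; first exact (bmf_comp mA kernel_bmf).
  exact (bmf_comp measurable_snd (unit_polar_lin _ U)).
have bo := tl _ (om_bmf e).
apply: (@le_trans _ _ (\int[mulam a b]_t om e (x + t *: e))%:E).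
  rewrite lee_fin E; apply: le_trans (rI_abs _ _) _; first exact (bmf_param m b3).
  apply: rI_le => //; first by apply: bmf_norm; exact (bmf_param m b3).
  move=> t; apply: le_trans (rI_abs _ _) _ => //.
  rewrite /om le_eqVlt; apply/orP; left; apply/eqP; apply: eq_Rintegral => y _.
  have [_ k0 _ _] := K.
  by rewrite normrM (ger0_norm (k0 _)) (_ : lin (- e) _ = - lin e (nu y)) ?normrN// /lin/=; ring.
by rewrite -rI_E// /mulam integral_restrm//; apply/measurable_EFinP; case: bo.
Qed.

Lemma moll_line (e : plane) : exists2 C, 0 <= C & forall x t, `|moll (x + t *: e) - moll x| <= C * `|t|.
Proof.
have [mo [C oC]] := om_bmf e.
have C0 : 0 <= C by apply: le_trans (oC 0).
have H x (a b : R) : a <= b -> `|moll (x + b *: e) - moll (x + a *: e)| <= C * (b - a).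
  move=> ab; rewrite -lee_fin; apply: le_trans (moll_variation e x ab) _.
  apply: (@le_trans _ _ (\int[lam]_(t in `[a, b]) (cst C%:E) t)%E).
    apply: ge0_le_integral => //.
    - by move=> t _; rewrite lee_fin om_ge0.
    - apply: measurable_funTS; apply/measurable_EFinP; apply: (measurableT_comp mo).
      apply/measurable_fun_pairP; split;
      (apply: measurable_funD; first exact: measurable_cst);
      by apply: measurable_funM; [exact: measurable_id|exact: measurable_cst].
    - by move=> t _; rewrite lee_fin; apply: le_trans (oC _); exact: ler_norm.
  rewrite integral_cst//; have := lebesgue_measure_itv `[a, b]; rewrite /= => ->.
  rewrite lte_fin; case: ltP => // ba; rewrite ?mule0 lee_fin mulr_ge0// subr_ge0//.
exists C => // x t; have [t0|t0] := lerP 0 t.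
  by have := H x 0 t t0; rewrite scale0r addr0 subr0 (ger0_norm t0).
by have := H x t 0 (ltW t0); rewrite scale0r addr0 sub0r distrC (ltr0_norm t0).
Qed.

Lemma moll_continuous : continuous moll.
Proof.
have [C1 C10 H1] := moll_line e1; have [C2 C20 H2] := moll_line e2.
have L x y : `|moll x - moll y| <= C1 * `|x.1 - y.1| + C2 * `|x.2 - y.2|.
  have E : x = (y + (x.1 - y.1) *: e1) + (x.2 - y.2) *: e2.
    by case: x y => [a b] [c d]; congr (_, _) => /=; rewrite /GRing.scale/=; ring.
  rewrite {1}E; set z := y + _.
  have := H1 y (x.1 - y.1); have := H2 z (x.2 - y.2); rewrite -/z.
  by have := ler_normD (moll (z + (x.2 - y.2) *: e2) - moll z) (moll z - moll y); rewrite addrA subrK; lra.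
move=> x; apply/cvgrPdist_le => e e0.
have d0 : 0 < e / (C1 + C2 + 1) by rewrite divr_gt0//; lra.
apply/(@nbhs_ballP R (plane : pseudoMetricType R)); exists (e / (C1 + C2 + 1)) => //= y [/= y1 y2].
apply: le_trans (L _ _) _; move: y1 y2 d0; rewrite /ball/=.
set d := e / _ => y1 y2 d0.
have -> : e = d * (C1 + C2 + 1) by rewrite /d divfK//; lra.
by have := normr_ge0 (x.1 - y.1); have := normr_ge0 (x.2 - y.2); nra.
Qed.

(** [B] has finite area, so little of it lies outside a large box, and the kernel is bounded and
    concentrated within distance [h]. This makes superlevel sets bounded. *)
Lemma moll_small (eta : R) : 0 < eta -> exists2 M : R, 0 < M & forall x,
  M <= `|x.1| \/ M <= `|x.2| -> moll x <= eta.
Proof.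
move=> eta0; have [mk [C kC]] := kernel_bmf.
have C0 : 0 <= C by apply: le_trans (kC 0).
have eC : 0 < eta / (C + 1) by rewrite divr_gt0//; lra.
pose A (n : nat) : set plane := `[- n%:R, n%:R] `*` `[- n%:R, n%:R].
have mA n : measurable (A n) by apply: measurableX; exact: measurable_itv.
have [||||n Hn] := @rI_dc _ _ _ muB (fun n => \1_(A n)) (cst 1) 1 _ _ _ _ _ eC.
- by move=> n; exact: measurable_indic.
- by move=> n x; rewrite indicE; case: (_ \in _); rewrite ?normr1 ?normr0.
- exact: bmf_cst.
- move=> x; apply: cvg_near_cst.
  exists (Num.truncn (Num.max `|x.1| `|x.2|)).+1 => // n /= xn.
  have : Num.max `|x.1| `|x.2| <= n%:R.
    by apply: ltW; apply: lt_le_trans (truncnS_gt _) _; rewrite ler_nat.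
  rewrite ge_max => /andP[h1 h2]; rewrite indicE mem_set//.
  by split; rewrite /= in_itv/= -ler_norml.
exists (n%:R + `|h| + 1); first by have := normr_ge0 h; have := ler0n R n; lra.
move=> x Hx; rewrite /moll.
apply: le_trans (_ : \int[muB]_y (C * `|cst 1 y - \1_(A n) y|) <= _); last first.
  rewrite rI_Z; last by apply/bmf_norm/bmfB; [exact: bmf_cst|exact: bmf_indic].
  move: Hn; rewrite ler_pdivlMr; last lra.
  set I := \int[muB]_x _ => Hn.
  have I0 : 0 <= I by apply: Rintegral_ge0.
  nra.
apply: rI_le; [exact: kernel_bmf1|by apply/bmfZ/bmf_norm/bmfB; [exact: bmf_cst|exact: bmf_indic]|].
move=> y; have [->|] := eqVneq (k (y - x)) 0; first by rewrite mulr_ge0.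
have [_ _ _ ks] := K => /ks/= [y1 y2].
rewrite indicE memNset; last first.
  move=> [/=]; rewrite !in_itv/= -!ler_norml => n1 n2.
  have hh := ler_norm h.
  case: Hx => Hx.
    have := ler_normD (x.1 - y.1) y.1; rewrite subrK distrC; lra.
  have := ler_normD (x.2 - y.2) y.2; rewrite subrK distrC; lra.
by rewrite subr0 normr1 mulr1; apply: le_trans (kC _); exact: ler_norm.
Qed.

End Mollify.

Section MollApprox.
Context {R : realType}.
Local Notation plane := (plane R).

Lemma test_lipschitz (f : plane -> R) : test_function f -> exists2 C, 0 <= C &
  forall x y, `|f x - f y| <= C * (`|x.1 - y.1| + `|x.2 - y.2|).
Proof.
move=> tf; have [Cf _] := tf.
have [_ [A1 H1]] := test_derive_bmf e1 tf; have [_ [A2 H2]] := test_derive_bmf e2 tf.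
have A10 : 0 <= A1 by apply: le_trans (H1 0).
have A20 : 0 <= A2 by apply: le_trans (H2 0).
exists (A1 + A2); first by lra.
move=> x y.
have E : x = (y + (x.1 - y.1) *: e1) + (x.2 - y.2) *: e2.
  by case: x y => [a b] [c d]; congr (_, _) => /=; rewrite /GRing.scale/=; ring.
have [t1 _ E1] := C1_MVT y e1 (x.1 - y.1) Cf.
have [t2 _ E2] := C1_MVT (y + (x.1 - y.1) *: e1) e2 (x.2 - y.2) Cf.
rewrite {1}E; move: E1 E2; set z := y + _ => E1 E2.
have := ler_normD (f (z + (x.2 - y.2) *: e2) - f z) (f z - f y); rewrite addrA subrK.
rewrite E1 E2 !normrM => /le_trans; apply.
have := H1 (y + t1 *: e1); have := H2 (z + t2 *: e2).
have := normr_ge0 (x.1 - y.1); have := normr_ge0 (x.2 - y.2).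
move: (`|'D_e1 f _|) (`|'D_e2 f _|) (`|x.1 - y.1|) (`|x.2 - y.2|) => *; nra.
Qed.

Definition box (M : R) : set plane := `[- M, M] `*` `[- M, M].

Lemma boxP M x : box M x <-> `|x.1| <= M /\ `|x.2| <= M.
Proof. by rewrite /box/= /setX/= !in_itv/= -!ler_norml. Qed.

Lemma box_measurable M : measurable (box M).
Proof. by apply: measurableX; exact: measurable_itv. Qed.

Lemma box_finite M : (borel_area (box M) < +oo)%E.
Proof.
have [M0|M0] := lerP 0 M; first by rewrite /box box_area ?ltry//; lra.
rewrite (_ : box M = set0) ?measure0//; apply/seteqP; split=> // x /boxP[h _].
by have := normr_ge0 x.1; lra.
Qed.

Definition boxm (M : R) : {finite_measure set plane -> \bar R} :=
  restrm (box_measurable M) (box_finite M).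

(** For [h <= 1] and [x] in [box M] the kernel has full mass inside [box (M + 1)]. Replacing [1_B]
    by a Lipschitz test function leaves three errors: its error at [x], its oscillation at scale
    [h], and its mollified error, which Fubini bounds by the error in mean. *)
Lemma moll_approx (B : set plane) (mB : measurable B) (finB : (borel_area B < +oo)%E) (M eps : R) :
  0 < M -> 0 < eps -> exists2 h0 : R, 0 < h0 & forall h k, 0 < h -> h <= h0 -> mollifier h k ->
  \int[boxm (M + 1)]_x (\1_(B `&` box M) x * (1 - moll mB finB k x)) <= eps.
Proof.
move=> M0 eps0; pose mu := boxm (M + 1).
have e3 : 0 < eps / 3 by lra.
pose T := fine (mu setT); have T0 : 0 <= T by rewrite fine_ge0.
have mB1 : measurable_fun setT (\1_B : plane -> R) by exact: measurable_indic.
have B1 x : `|\1_B x| <= 1 :> R by rewrite indicE; case: (_ \in _); rewrite ?normr1 ?normr0.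
have [f [tf f1 Hf]] := density mu mB1 B1 e3.
have [C C0 HC] := test_lipschitz tf.
pose h0 := Num.min 1 (eps / 3 / (2 * C + 1) / (T + 1)).
have h00 : 0 < h0 by rewrite lt_min ltr01/= !divr_gt0//; lra.
exists h0 => // h k hp hh K.
have [_ k0 _ ks] := K.
have h1 : h <= 1 by apply: le_trans hh _; rewrite /h0 ge_min lexx.
have bf := test_bounded tf.
have bB : bmf (\1_B : plane -> R) by exact: bmf_indic.
have bg : bmf (fun x => `|\1_B x - f x|) by apply/bmf_norm/bmfB.
have mBb : measurable (B `&` box M) by apply: measurableI => //; exact: box_measurable.
have bk x : bmf (fun y : plane => k (y - x)) by exact: kernel_bmf1 K x.
have mkE x : measurable_fun setT (fun y : plane => (k (y - x))%:E) by apply/measurable_EFinP; case: (bk x).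
have near x y : box M x -> k (y - x) != 0 -> box (M + 1) y.
  move=> /boxP[x1 x2] /ks/=[y1 y2]; apply/boxP; split.
    by have := ler_normD (y.1 - x.1) x.1; rewrite subrK; clear -x1 y1 h1; lra.
  by have := ler_normD (y.2 - x.2) x.2; rewrite subrK; clear -x2 y2 h1; lra.
have I1 x : box M x -> \int[mu]_y k (y - x) = 1.
  move=> bx; apply: EFin_inj; rewrite -rI_E// integral_restrm//.
  rewrite -(kernel_int K x) [LHS]integral_mkcond; apply: eq_integral => y _.
  rewrite patchE; case: ifPn => // /negP yb; congr EFin; apply/esym/eqP; apply: contrapT => /negP n0.
  by apply: yb; rewrite inE; exact: near n0.
have I2 x : box M x -> moll mB finB k x = \int[mu]_y (k (y - x) * \1_B y).
  move=> bx; apply: EFin_inj; rewrite /moll -[LHS]rI_E// -[RHS]rI_E; last exact: bmfM.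
  rewrite !integral_restrm//; last by apply/measurable_EFinP; case: (bmfM (bk x) bB).
  rewrite [LHS]integral_mkcond [RHS]integral_mkcond; apply: eq_integral => y _.
  rewrite !patchE indicE; case: (y \in B); last by rewrite mulr0 if_same.
  rewrite mulr1; case: ifPn => // /negP yb; congr EFin; apply/eqP; apply: contrapT => /negP n0.
  by apply: yb; rewrite inE; exact: near n0.
pose d := eps / 3 / (T + 1).
have dT : d * T <= eps / 3.
  have d0 : 0 <= d by clear -e3 T0; rewrite divr_ge0//; lra.
  have : d * (T + 1) = eps / 3 by clear -T0; rewrite /d divfK// gt_eqF//; lra.
  by clear -d0; lra.
have Cd : C * (2 * h) <= d.
  have : h <= eps / 3 / (2 * C + 1) / (T + 1) by apply: le_trans hh _; rewrite /h0 ge_min lexx orbT.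
  rewrite [eps / 3 / _ / _]mulrAC -/d; clear -C0 hp; rewrite ler_pdivlMr; last lra.
  by lra.
have bh : bmf (fun z : plane * plane => k (z.2 - z.1) * `|\1_B z.2 - f z.2|).
  by apply: (bmfM (kernel_bmf2 K)); exact (bmf_comp measurable_snd bg).
have bI2 : bmf (fun x : plane => \int[mu]_y (k (y - x) * `|\1_B y - f y|)) by exact (bmf_param mu bh).
apply: (@le_trans _ _ (\int[mu]_x (`|\1_B x - f x| + d + \int[mu]_y (k (y - x) * `|\1_B y - f y|)))).
  apply: rI_le.
  - by apply: bmfM; [exact: bmf_indic|apply: bmfB; [exact: bmf_cst|exact: moll_bmf K]].
  - by apply: bmfD => //; apply: bmfD => //; exact: bmf_cst.
  move=> x; have d0 : 0 <= d by clear -e3 T0; rewrite divr_ge0//; lra.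
  have i0 : 0 <= \int[mu]_y (k (y - x) * `|\1_B y - f y|) by apply: Rintegral_ge0 => y _; rewrite mulr_ge0.
  rewrite indicE; case: (boolP (x \in _)) => [/[!inE] -[Bx bx]|_]; last first.
    by rewrite mul0r !addr_ge0.
  rewrite mul1r -(I1 x bx) (I2 x bx) -rI_B; [|exact: bk|exact: bmfM].
  have -> : `|\1_B x - f x| + d + \int[mu]_y (k (y - x) * `|\1_B y - f y|) =
     \int[mu]_y ((`|\1_B x - f x| + d) * k (y - x) + k (y - x) * `|\1_B y - f y|).
    by rewrite rI_D; [rewrite rI_Z// I1// mulr1|exact: bmfZ|exact: bmfM].
  apply: rI_le; first by apply: bmfB => //; exact: bmfM.
    by apply: bmfD; [exact: bmfZ|exact: bmfM].
  have B1x : \1_B x = 1 :> R by rewrite indicE mem_set.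
  move=> y; rewrite B1x.
  have [->|n0] := eqVneq (k (y - x)) 0; first by rewrite !mul0r mulr0 subr0 addr0.
  have [y1 y2] := ks _ n0.
  have L : `|f x - f y| <= d.
    rewrite distrC; apply: le_trans (HC _ _) _; apply: le_trans Cd; apply: ler_wpM2l => //.
    by move: y1 y2; rewrite /=; clear; lra.
  rewrite -{1}[k (y - x)]mulr1 -mulrBr [_ * k _]mulrC -mulrDr; apply: ler_wpM2l => //.
  have := ler_norm (1 - \1_B y : R).
  have := ler_normD (1 - f x + (f x - f y)) (f y - \1_B y).
  have := ler_normD (1 - f x) (f x - f y).
  rewrite (_ : 1 - f x + (f x - f y) + (f y - \1_B y) = 1 - \1_B y); last ring.
  by rewrite [`|f y - _|]distrC; clear -L; lra.
rewrite !rI_D//; [|exact: bmf_cst|by apply: bmfD => //; exact: bmf_cst].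
rewrite Rintegral_cst// -/T.
have : \int[mu]_x \int[mu]_y (k (y - x) * `|\1_B y - f y|) <= \int[mu]_y `|\1_B y - f y|.
  rewrite (rI_fubini mu mu bh) /=; apply: rI_le => //; first exact (bmf_param mu (bmf_swap bh)).
  have b2 y : bmf (fun x : plane => k (y - x)) by exact (bmf_section2 y (kernel_bmf2 K)).
  move=> y; under eq_Rintegral do rewrite mulrC.
  rewrite rI_Z// -[leRHS]mulr1 ler_wpM2l// -lee_fin.
  by apply: rI_restr_le1 => //; rewrite (kernel_int2 K).
by clear -dT Hf; lra.
Qed.

End MollApprox.

(** * Coarea formula and connected pieces *)

Section Level.
Context {R : realType}.
Local Notation plane := (plane R).
Local Notation lam := (@lebesgue_measure R).

(** Take the last point [s] of [[a, b]] where the growth from [a] still reaches slope [c];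
    monotonicity shows that this supremum is attained. It lies before [b], and every increment
    starting at [s] has slope at most [c]. *)
Lemma small_quotient (G : R -> R) (a b c : R) : a < b -> 0 < c ->
  (forall s t, a <= s -> s <= t -> t <= b -> G s <= G t) -> G b - G a < c * (b - a) ->
  exists t, [/\ a <= t, t < b & forall d0, 0 < d0 -> exists d, [/\ 0 < d, d < d0, t + d <= b &
    G (t + d) - G t <= c * d]].
Proof.
move=> ab c0 Gm Gab; apply: contrapT => /forallNP H.
pose S := [set t | a <= t <= b /\ c * (t - a) <= G t - G a].
have Sa : S a by split; [rewrite lexx ltW|rewrite !subrr mulr0].
have hS : has_sup S by split; [exists a|exists b => t [/andP[]]].
pose s := sup S.
have sa : a <= s by apply: ub_le_sup => //; case: hS.
have sb : s <= b by apply: ge_sup; [exists a|move=> t [/andP[]]].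
have Ss : S s.
  split; first by rewrite sa.
  suff : s <= (G s - G a) / c + a by rewrite -lerBlDr ler_pdivlMr// mulrC.
  apply: ge_sup; first by exists a.
  move=> t St; have ts : t <= s by apply: ub_le_sup => //; case: hS.
  have [/andP[ta tb] ct] := St.
  rewrite -lerBlDr ler_pdivlMr// mulrC; apply: le_trans ct _.
  by rewrite lerD2r; apply: Gm.
have [sb'|sb'] := ltP s b; last first.
  by move: Ss => [_]; rewrite (_ : s = b); [lra|apply/le_anti; rewrite sb sb'].
apply: (H s); split=> // d0 d00.
pose d := Num.min (d0 / 2) (b - s).
have dp : 0 < d by rewrite lt_min; apply/andP; split; lra.
have dd0 : d < d0 by apply: (@le_lt_trans _ _ (d0 / 2)); [rewrite /d ge_min lexx|lra].
have db : d <= b - s by rewrite /d ge_min lexx orbT.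
exists d; split=> //; first lra.
rewrite leNgt; apply/negP => cd.
have : S (s + d).
  split; first by apply/andP; split; lra.
  by case: Ss => _; lra.
move=> Sd; have : s + d <= s by apply: ub_le_sup => //; case: hS.
by lra.
Qed.

Lemma compact_min (T : topologicalType) (A : set T) (f : T -> R) : A !=set0 -> compact A ->
  continuous f -> exists2 x, A x & forall y, A y -> f x <= f y.
Proof.
move=> A0 cA cf; have [|x /[!inE] Ax H] := compact_EVT_min A0 cA (f := f).
  exact: continuous_subspaceT.
by exists x => // y Ay; apply: H; rewrite inE.
Qed.

Lemma compact_max (T : topologicalType) (A : set T) (f : T -> R) : A !=set0 -> compact A ->
  continuous f -> exists2 x, A x & forall y, A y -> f y <= f x.
Proof.
move=> A0 cA cf; have [|x /[!inE] Ax H] := compact_EVT_max A0 cA (f := f).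
  exact: continuous_subspaceT.
by exists x => // y Ay; apply: H; rewrite inE.
Qed.

Lemma compact_itv_preimage (f : R -> R) (a b : R) (C : set R) : continuous f -> closed C ->
  compact (`[a, b]%classic `&` f @^-1` C).
Proof.
move=> cf cC; apply: compact_closedI; first exact: segment_compact.
by apply: preimage_closed => // x; exact: cf.
Qed.

(** [z2] is the first time the value drops to [t], and [z1] the last earlier time at which it is at
    least [t + d]. Staying above [t] up to [z2] later keeps the crossing inside one component. *)
Lemma crossing (f : R -> R) (t d Z : R) : continuous f -> 0 < d -> 0 < Z ->
  t + d < f 0 -> f Z <= t -> exists z1 z2, [/\ 0 <= z1, z1 < z2, t + d <= f z1 /\ f z2 <= t,
   forall z, z1 < z -> z < z2 -> t < f z < t + d & forall z, 0 <= z -> z < z2 -> t < f z].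
Proof.
move=> cf d0 Z0 f0 fZ.
have [|z2 [/=]] := @compact_min _ (`[0, Z]%classic `&` f @^-1` [set y | y <= t]) id _
   (@compact_itv_preimage f 0 Z _ cf (@closed_le R t)) (fun x => cvg_id).
  by exists Z; split=> //=; rewrite in_itv/= lexx ltW.
rewrite !in_itv/= => /andP[z20 z2Z] fz2 H2.
have z2p : 0 < z2 by rewrite lt_neqAle z20 andbT; apply/eqP => E; move: fz2; rewrite -E; lra.
have P2 z : 0 <= z -> z < z2 -> t < f z.
  move=> h0 h1; rewrite ltNge; apply/negP => fz.
  have : z2 <= z by apply: H2; split=> //; rewrite in_itv/= h0/=; lra.
  by lra.
have [|z1 [/=]] := @compact_max _ (`[0, z2]%classic `&` f @^-1` [set y | t + d <= y]) id _
   (@compact_itv_preimage f 0 z2 _ cf (@closed_ge R _)) (fun x => cvg_id).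
  by exists 0; split=> /=; [rewrite in_itv/= lexx ltW|rewrite ltW].
rewrite !in_itv/= => /andP[z10 z1z] fz1 H1.
have z12 : z1 < z2 by rewrite lt_neqAle z1z andbT; apply/eqP => E; move: fz1; rewrite E; lra.
have P1 z : z1 < z -> z < z2 -> f z < t + d.
  move=> h0 h1; rewrite ltNge; apply/negP => fz.
  have : z <= z1 by apply: H1; split=> //; rewrite in_itv/=; apply/andP; split; lra.
  by lra.
exists z1, z2; split=> // z h1 h2; rewrite P1// P2//; lra.
Qed.

(** Starting from a point above [t + d], the line leaves through the band once forwards and once
    backwards. The two crossings are disjoint and each has variation at least [d]. *)
Lemma integral_moll_crossing (u om : R -> R) (t d Z : R) (A : set R) : continuous u ->
  measurable A -> measurable_fun setT om -> (forall z, 0 <= om z) ->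
  (forall a b, a <= b -> (`|u b - u a|%:E <= \int[lam]_(z in `[a, b]) (om z)%:E)%E) ->
  0 < d -> 0 < Z -> t + d < u 0 -> u Z <= t -> u (- Z) <= t ->
  (forall z, (forall y, `|y| <= `|z| -> 0 <= y * z -> t < u y) -> u z < t + d -> A z) ->
  ((2 * d)%:E <= \int[lam]_(z in A) (om z)%:E)%E.
Proof.
move=> cu mA mo o0 V d0 Z0 u0 uZ uNZ HA.
have cuN : continuous (fun z => u (- z)).
  by move=> z; apply: continuous_comp; [exact: opp_continuous|exact: cu].
have [p1 [p2 [p10 p12 [up1 up2] Hp Hp']]] := crossing cu d0 Z0 u0 uZ.
have [|q1 [q2 [q10 q12 [uq1 uq2] Hq Hq']]] := crossing cuN d0 Z0 _ uNZ; first by rewrite oppr0.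
have moE (D : set R) : measurable_fun D (fun z => (om z)%:E) by apply: measurable_funTS; apply/measurable_EFinP.
have oo (a b : R) : (\int[lam]_(z in `]a, b[) (om z)%:E = \int[lam]_(z in `[a, b]) (om z)%:E)%E.
  by rewrite [RHS]integral_itv_bndoo//; exact: moE.
pose D : set R := `]p1, p2[%classic `|` `]- q2, - q1[%classic.
have H : ((2 * d)%:E <= \int[lam]_(z in D) (om z)%:E)%E.
  have h1 := V p1 p2 (ltW p12); have h2 : - q2 <= - q1 by rewrite lerN2 ltW.
  have := V _ _ h2; move=> {}h2; rewrite -!oo in h1 h2.
  rewrite /D ge0_integral_setU//; first last.
  - apply/disj_setPLR => z /=; rewrite !in_itv/= => /andP[z1 z2] /andP[z3 z4]; clear -z1 z4 p10 q10; lra.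
  - by move=> z _; rewrite lee_fin.
  - exact: moE.
  apply: le_trans (leeD h1 h2); rewrite -EFinD lee_fin.
  have := ler_norm (- (u p2 - u p1)); have := ler_norm (u (- q1) - u (- q2)).
  by rewrite normrN; lra.
apply: le_trans H _; apply: ge0_subset_integral => //.
- by apply: measurableU; exact: measurable_itv.
- exact: moE.
- by move=> z _; rewrite lee_fin.
move=> z [] /=; rewrite in_itv/= => /andP[z1 z2]; apply: HA.
- move=> y; rewrite (ger0_norm (ltW (le_lt_trans p10 z1))) => yz yz0.
  have zp := le_lt_trans p10 z1.
  have y0 : 0 <= y by rewrite -(pmulr_lge0 _ zp).
  by move: yz; rewrite (ger0_norm y0) => yz; apply: Hp' => //; lra.
- by have /andP[] := Hp z z1 z2.
- have zp : z < 0 by lra.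
  move=> y; rewrite (ltr0_norm zp) => yz yz0.
  have y0 : y <= 0 by rewrite -(nmulr_lge0 _ zp).
  by move: yz; rewrite (ler0_norm y0) => yz; have := Hq' (- y); rewrite opprK; apply; lra.
- by have := Hq (- z); rewrite opprK ltrNr ltrNl => /(_ z2 z1)/andP[].
Qed.

Lemma sqr_sum_gt0 (e : plane) : e != 0 -> 0 < e.1 ^+ 2 + e.2 ^+ 2.
Proof.
move=> e0; rewrite lt_neqAle addr_ge0 ?sqr_ge0// andbT eq_sym; apply: contra e0.
rewrite paddr_eq0 ?sqr_ge0// !sqrf_eq0 => /andP[/eqP h1 /eqP h2].
by apply/eqP; case: e h1 h2 => /= ? ? -> ->.
Qed.

Lemma perp_neq0 (e : plane) : e != 0 -> perp e != 0.
Proof.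
move=> e0; apply: contraNneq e0 => /(congr1 (fun x : plane => (x.2, - x.1))).
by case: e => a b [/= -> hb]; apply/eqP; congr (_, _); rewrite -[b]opprK hb oppr0.
Qed.

Lemma lin_open_image (p : plane) (W : set plane) : p != 0 -> open W -> open (lin p @` W).
Proof.
move=> p0 oW; have q0 := sqr_sum_gt0 p0.
set q := p.1 ^+ 2 + p.2 ^+ 2 in q0.
pose eta : plane := q^-1 *: p.
rewrite openE => _ [x Wx <-].
have : nbhs x W by apply: open_nbhs_nbhs.
have := @line_continuous R x eta 0; rewrite /continuous_at scale0r addr0 => cl /cl.
move=> /(@nbhs_ballP R R) [r /= r0 H].
apply/(@nbhs_ballP R R); exists r => //= y xy.
exists (x + (y - lin p x) *: eta).
  by apply: H; move: xy; rewrite /ball/= sub0r normrN distrC.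
rewrite linD linZ (_ : lin p eta = 1); first by rewrite mulr1 addrC subrK.
by rewrite /eta linZ /lin -!expr2 -/q mulVf// gt_eqF.
Qed.

(** The area is sliced by lines parallel to [e], parametrised by [lin (perp e)]; [eta] is dual to
    this form, so the change of variables has determinant of modulus 1. Each line meeting [C] above
    [t + d] contributes [2 d] from inside [C], since [C] absorbs segments on which [u > t]. *)
Lemma coarea_line (u : plane -> R) (om : plane -> R) (e : plane) (t d M : R) (C : set plane) :
  continuous u -> open C -> e != 0 -> measurable_fun setT om -> (forall x, 0 <= om x) ->
  (forall x a b, a <= b -> (`|u (x + b *: e) - u (x + a *: e)|%:E <=
     \int[lam]_(z in `[a, b]) (om (x + z *: e))%:E)%E) ->
  (forall x, M <= `|x.1| \/ M <= `|x.2| -> u x <= t) ->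
  (forall x y, C x -> (forall s, 0 <= s <= 1 -> t < u (x + s *: (y - x))) -> C y) ->
  0 < d ->
  ((2 * d)%:E * lam [set lin (perp e) x | x in C `&` [set x | (t + d < u x)%R]] <=
    \int[borel_area]_(x in C `&` [set x | (t < u x < t + d)%R]) (om x)%:E)%E.
Proof.
move=> cu oC e0 mo o0 V uM HC d0.
set W := C `&` _; set A := C `&` _.
have e20 := sqr_sum_gt0 e0.
set q := e.1 ^+ 2 + e.2 ^+ 2.
have q0 : q != 0 by rewrite gt_eqF.
pose eta : plane := (- e.2 / q, e.1 / q).
have dec w : w = lin (perp e) w *: eta + (lin e w / q) *: e.
  case: w => a b; rewrite /lin /perp /eta /GRing.scale/=; congr (_, _) => /=; rewrite /GRing.scale/=; move: q0; rewrite /q; set p := _ + _ => p0.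
    have -> : a = a * p / p by rewrite mulfK.
    by rewrite /p; field.
  have -> : b = b * p / p by rewrite mulfK.
  by rewrite /p; field.
have oU (c : R) : open [set x | c < u x].
  by have := @open_comp _ _ u [set y | c < y] (fun x _ => cu x) (@open_gt R c).
have oU' (c : R) : open [set x | u x < c].
  by have := @open_comp _ _ u [set y | y < c] (fun x _ => cu x) (@open_lt R c).
have oW : open W by apply: openI => //; exact: oU.
have mA : measurable A.
  apply: open_plane_measurable; apply: openI => //.
  rewrite (_ : [set x | _] = [set x | t < u x] `&` [set x | u x < t + d]); first exact: openI.
  by apply/seteqP; split=> x /=; [move=> /andP[]|move=> [-> ->]].
have mP : measurable [set lin (perp e) x | x in W].
  by apply: open_measurable; apply: lin_open_image => //; exact: perp_neq0.
pose f (x : plane) : \bar R := (\1_A x * om x)%:E.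
have f0 x : (0 <= f x)%E by rewrite lee_fin mulr_ge0// indicE.
have mf : measurable_fun setT f.
  by apply/measurable_EFinP; apply: measurable_funM => //; exact: measurable_indic.
have -> : (\int[borel_area]_(x in A) (om x)%:E = \int[borel_area]_x f x)%E.
  rewrite integral_mkcond; apply: eq_integral => x _; rewrite patchE /f indicE.
  by case: ifP => _; rewrite ?mul1r ?mul0r.
have det : eta.1 * e.2 - e.1 * eta.2 = -1.
  by rewrite /eta/= mulrC !mulrA -mulrBl mulrN -!expr2 -opprD addrC mulNr divff.
have := @ge0_integral_affine2 R f eta.1 e.1 eta.2 e.2 0 0.
rewrite det oppr_eq0 oner_eq0 normrN normr1 invr1 mul1e => /(_ isT mf f0) <-.
have mA2 := @measurable_affine2 R eta.1 e.1 eta.2 e.2 0 0.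
rewrite (@integral_plane_xy R (fun x => f (eta.1 * x.1 + e.1 * x.2 + 0, eta.2 * x.1 + e.2 * x.2 + 0)))//; last first.
  exact: measurableT_comp mf mA2.
rewrite -integral_cst//.
rewrite integral_mkcond; apply: ge0_le_integral => //.
- by move=> s _; rewrite patchE; case: ifP => // _; rewrite lee_fin; lra.
- by apply/measurable_restrict => //; exact: measurable_cst.
- exact: (@measurable_int_y R _ (measurableT_comp mf mA2) (fun z => f0 _)).
move=> s _; rewrite patchE; case: ifPn => [/[!inE] -[w Ww ws]|_]; last exact: integral_ge0.
pose G (z : R) := f (w + z *: e).
have mline : measurable_fun setT (fun z : measurableTypeR R => w + z *: e).
  apply/measurable_fun_pairP; split;
  (apply: measurable_funD; first exact: measurable_cst);
  by apply: measurable_funM; [exact: measurable_id|exact: measurable_cst].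
have mG : measurable_fun setT G by exact: measurableT_comp mf mline.
have -> : (\int[lam]_y f (eta.1 * (s, y).1 + e.1 * (s, y).2 + 0, eta.2 * (s, y).1 + e.2 * (s, y).2 + 0)%R =
    \int[lam]_z G z)%E.
  have := @ge0_integral_affine R G 1 (- (lin e w / q)) (oner_neq0 _) mG (fun z => f0 _).
  rewrite normr1 invr1 mul1e => <-; apply: eq_integral => y _; rewrite /G; congr f.
  transitivity (s *: eta + (lin e w / q) *: e + (1 * y - lin e w / q) *: e); last by rewrite -ws -dec.
  by congr (_, _) => /=; rewrite /GRing.scale/=; ring.
pose A' := [set z : R | A (w + z *: e)].
have mA' : measurable A'.
  by have := mline measurableT _ mA; rewrite setTI.
have -> : (\int[lam]_z G z = \int[lam]_(z in A') (om (w + z *: e))%:E)%E.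
  rewrite [RHS]integral_mkcond; apply: eq_integral => z _; rewrite patchE /G /f indicE.
  have -> : (w + z *: e \in A) = (z \in A') by apply/idP/idP; rewrite !inE.
  by case: ifP => _; rewrite ?mul1r ?mul0r.
pose c := Num.max `|e.1| `|e.2|.
have c0 : 0 < c.
  rewrite lt_max !normr_gt0 -negb_and; apply: contra e0 => /andP[/eqP h1 /eqP h2].
  by apply/eqP; case: e h1 h2 {V q q0 e20 eta dec mP det mA2 mline G mG A' mA' c W oW Ww ws A mA f f0 mf} => /= ? ? -> ->.
pose Z := (`|M| + `|w.1| + `|w.2| + 1) / c.
have Zc : Z * c = `|M| + `|w.1| + `|w.2| + 1 by rewrite /Z divfK// gt_eqF.
have Z0 : 0 < Z by rewrite divr_gt0// ltr_pwDr// !addr_ge0.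
have far (b : R) : `|b| = Z -> u (w + b *: e) <= t.
  move=> bZ; apply: uM.
  have T (p r : R) : `|p| - `|r| <= `|r + p|.
    by have := ler_normB (r + p) r; rewrite addrAC subrr add0r; lra.
  have E1 : Z * `|e.1| - `|w.1| <= `|(w + b *: e).1| by rewrite -bZ -normrM; exact: T.
  have E2 : Z * `|e.2| - `|w.2| <= `|(w + b *: e).2| by rewrite -bZ -normrM; exact: T.
  have M1 := ler_norm M; have w1 := normr_ge0 w.1; have w2 := normr_ge0 w.2.
  move: Zc; rewrite /c; clearbody Z; case: (leP `|e.1| `|e.2|) => _ Zc; [right; apply: le_trans E2|left; apply: le_trans E1]; rewrite Zc; clear -M1 w1 w2; lra.
apply: (@integral_moll_crossing (fun z => u (w + z *: e)) (fun z => om (w + z *: e)) t d Z) => //.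
- exact: continuous_line.
- exact: measurableT_comp mo mline.
- by move=> a b ab; apply: V.
- by rewrite scale0r addr0; case: Ww.
- by apply: far; rewrite gtr0_norm.
- by apply: far; rewrite normrN gtr0_norm.
move=> z Hz uz; have Hzz : t < u (w + z *: e) by apply: Hz => //; rewrite -expr2 sqr_ge0.
split; last by rewrite /= Hzz.
apply: (HC w); first by case: Ww.
move=> r /andP[r0 r1]; rewrite [w + z *: e]addrC addrK scalerA; apply: Hz.
  by rewrite normrM (ger0_norm r0) ler_piMl.
by rewrite -mulrA mulr_ge0// -expr2 sqr_ge0.
Qed.

End Level.

(** * Connected components of a good superlevel set *)

Section Pieces.
Context {R : realType}.
Local Notation plane := (plane R).
Local Notation lam := (@lebesgue_measure R).

(** Not normalised: it scales with [e]. The convention for [sup] makes it 0 on the empty set and on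
    sets unbounded in the direction [e]. *)
Definition width (e : plane) (A : set plane) : R :=
  sup [set r | exists x y, [/\ A x, A y & r = lin e (x - y)]].

Definition psi (l : seq (R * plane)) (x : plane) : R := \sum_(p <- l) p.1 * `|lin p.2 x|.

(* The anisotropic perimeter, for the norm [psi l], of a bounded convex set. *)
Definition wperimeter (l : seq (R * plane)) (A : set plane) : R :=
  \sum_(p <- l) 2 * p.1 * width (perp p.2) A.

Lemma near0_seq (I : eqType) (s : seq I) (P : I -> R -> Prop) :
  (forall i, i \in s -> exists2 d0, 0 < d0 & forall d, 0 < d -> d < d0 -> P i d) ->
  exists2 d0, 0 < d0 & forall i d, i \in s -> 0 < d -> d < d0 -> P i d.
Proof.
elim: s => [|a s IH] H; first by exists 1.
have [|d1 d10 H1] := IH; first by move=> i ik; apply: H; rewrite inE ik orbT.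
have [d2 d20 H2] := H a (mem_head _ _).
exists (Num.min d1 d2); first by rewrite lt_min d10.
move=> i d; rewrite inE lt_min => /orP[/eqP->|si] d0 /andP[dd1 dd2]; first exact: H2.
exact: H1.
Qed.

Lemma connected_component_segment (U : set plane) (x0 x y : plane) :
  connected_component U x0 x -> (forall s : R, 0 <= s <= 1 -> U (x + s *: (y - x))) ->
  connected_component U x0 y.
Proof.
move=> Cx H; apply: (connected_component_trans Cx).
apply: (@connected_component_max _ _ ((fun s : R => x + s *: (y - x)) @` `[0, 1]%classic)).
- by exists 0; rewrite /= ?in_itv/= ?lexx ?ler01// scale0r addr0.
- by move=> _ [s + <-]; rewrite /= in_itv/= => /H.
- apply: connected_continuous_connected; first exact: segment_connected.
  by apply: continuous_subspaceT; exact: line_continuous.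
- by exists 1; rewrite /= ?in_itv/= ?lexx ?ler01// scale1r addrC subrK.
Qed.

Lemma connected_component_open (U : set plane) x : open U -> open (connected_component U x).
Proof.
move=> oU; rewrite openE => y Cy.
have Uy := connected_component_sub Cy.
have /(@nbhs_ballP R (plane : pseudoMetricType R))[r /= r0 H] : nbhs y U by apply: open_nbhs_nbhs.
apply/(@nbhs_ballP R (plane : pseudoMetricType R)); exists r => // z yz.
apply: (connected_component_segment Cy) => t /andP[t0 t1]; apply: H.
have T (p : R) : `|p| < r -> `|t * p| < r.
  by move=> pr; rewrite normrM (ger0_norm t0); apply: le_lt_trans pr; rewrite ler_piMl.
by case: yz => /= y1 y2; split; rewrite /ball/= opprD addNKr normrN; apply: T; rewrite distrC.
Qed.

Lemma sum_indic_le (s : seq (set plane)) (f : set plane -> set plane) (X : set plane) x :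
  pairwise (fun C D : set plane => `[< C `&` D = set0 >]) s ->
  (forall C, f C `<=` C `&` X) -> \sum_(C <- s) \1_(f C) x <= \1_X x :> R.
Proof.
move=> + fC; elim: s => [|C s IH]; first by rewrite big_nil indicE.
rewrite big_cons/= => /andP[Cs /IH{}IH].
rewrite [X in X + _]indicE; case: (boolP (x \in f C)) => [/[!inE] xC|_]; last by rewrite add0r.
have [Cx Xx] := fC _ _ xC.
rewrite indicE mem_set// big_seq big1 ?addr0// => D Ds; rewrite indicE memNset// => /fC[Dx _].
by have /asboolP CD := allP Cs _ Ds; have : (C `&` D) x by []; rewrite CD.
Qed.

(** A connected set projects onto an interval, so its width is a length. The parts of [C] where
    [u > t + 1/(n+1)] exhaust [C], and continuity of the measure gives an admissible [d]. *)
Lemma width_le_proj (C : set plane) (u : plane -> R) (e : plane) (t eps : R) :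
  C !=set0 -> open C -> connected C -> continuous u -> (forall x, C x -> t < u x) -> e != 0 ->
  0 < eps -> exists2 d0, 0 < d0 & forall d, 0 < d -> d < d0 ->
  ((width (perp e) C - eps)%:E <= lam [set lin (perp e) x | x in C `&` [set x | (t + d < u x)%R]])%E.
Proof.
move=> C0 oC cC cu Cu e0 eps0.
pose S (d : R) := [set lin (perp e) x | x in C `&` [set x | (t + d < u x)%R]].
have mS d : measurable (S d).
  apply: open_measurable; apply: lin_open_image; first exact: perp_neq0.
  apply: openI => //; exact: (@open_comp _ _ u [set y | t + d < y] (fun x _ => cu x) (@open_gt R _)).
have Sm d d' : d <= d' -> S d' `<=` S d.
  by move=> dd _ [x [Cx ux] <-]; exists x => //; split=> //=; apply: le_lt_trans ux; rewrite lerD2l.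
(* Without a finite supremum the width is 0 and the bound is trivial. *)
have [hs|nhs] := pselect (has_sup [set r | exists x y, [/\ C x, C y & r = lin (perp e) (x - y)]]); last first.
  exists 1 => // d d0 _; rewrite /width sup_out// sub0r.
  by apply: (@le_trans _ _ 0%E); rewrite ?lee_fin ?measure_ge0//; lra.
have e20 : 0 < eps / 2 by lra.
have [_ [x [y [Cx Cy ->]]] Hxy] := sup_adherent e20 hs.
set a := lin (perp e) y; set b := lin (perp e) x.
have ab : width (perp e) C - eps / 2 < b - a by move: Hxy; rewrite linB.
have [ba|ba] := leP b a.
  exists 1 => // d d0 _; apply: (@le_trans _ _ 0%E); rewrite ?lee_fin ?measure_ge0//; lra.
have I : is_interval (lin (perp e) @` C).
  apply/connected_intervalP; apply: connected_continuous_connected => //.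
  by apply: continuous_subspaceT; exact: lin_continuous.
pose Sn n := S n.+1%:R^-1.
have L : ((b - a)%:E <= lam (\bigcup_n Sn n))%E.
  have := lebesgue_measure_itv `[a, b]; rewrite /= lte_fin ba -EFinB => <-.
  apply: le_measure; rewrite ?inE//; first by apply: bigcup_measurable => n _; exact: mS.
  move=> r /=; rewrite in_itv/= => /andP[ar rb].
  have [z Cz zr] : (lin (perp e) @` C) r by apply: (I a b); [exists y|exists x|rewrite ar].
  have uz : 0 < u z - t by rewrite subr_gt0; exact: Cu.
  exists (Num.truncn (u z - t)^-1) => //; exists z => //; split=> //=.
  by rewrite -ltrBrDl invf_plt ?posrE//; exact: truncnS_gt.
have [n Hn] : exists n, ((b - a - eps / 2)%:E < lam (Sn n))%E.
  apply: contrapT => /forallNP H.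
  have nd : nondecreasing_seq Sn.
    by move=> n k nk; rewrite subsetEset; apply: Sm; rewrite lef_pV2 ?posrE// ler_nat.
  have cv := nondecreasing_cvg_mu (fun n => mS _) (bigcup_measurable (fun n _ => mS n.+1%:R^-1) : measurable (\bigcup_n Sn n)) nd (mu := lam).
  have : (lam (\bigcup_n Sn n) <= (b - a - eps / 2)%:E)%E.
    rewrite -(cvg_lim _ cv)//; apply: lime_le; first by apply/cvg_ex; eexists; exact: cv.
    by apply: nearW => n; rewrite leNgt; apply/negP; exact: H.
  by move=> /(le_trans L); rewrite lee_fin; lra.
exists n.+1%:R^-1; first by rewrite invr_gt0.
move=> d d0 dn; apply: (@le_trans _ _ (lam (S n.+1%:R^-1))).
  by apply: le_trans (ltW Hn); rewrite lee_fin; lra.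
by apply: le_measure; rewrite ?inE; [exact: mS|exact: mS|apply: Sm; exact: ltW].
Qed.

Context (F : set plane) (m : {finite_measure set plane -> \bar R}) (nu : plane -> plane).
Hypothesis U : unit_polar F m nu.
Hypothesis mF : lmeasurable F.
Hypothesis finF : (area F < +oo)%E.

Lemma psi_int (l : seq (R * plane)) :
  \int[m]_x psi l (nu x) = \sum_(p <- l) p.1 * \int[m]_x `|lin p.2 (nu x)|.
Proof.
have b (p : R * plane) : bmf (fun x => p.1 * `|lin p.2 (nu x)|) by apply/bmfZ/bmf_norm/(unit_polar_lin _ U).
have [_ ->] := rI_sum m l b; apply: eq_bigr => p _.
by rewrite rI_Z//; apply/bmf_norm/(unit_polar_lin _ U).
Qed.

(** Coarea in averaged form. The weighted variation carried by levels between [eta] and [t] grows by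
    at most [V] over [[eta, 1 - eta]], so [small_quotient] finds a level above which arbitrarily
    thin bands carry little more than [V] per unit height, and [coarea_line] converts this into
    projections. *)
Lemma level_exists (l : seq (R * plane)) (M eps : R) :
  (forall p, p \in l -> 0 <= p.1 /\ p.2 != 0) -> 0 < M -> 0 < eps ->
  exists (u : plane -> R) (t M' : R), [/\ continuous u, forall x, M' <= `|x.1| \/ M' <= `|x.2| -> u x <= t,
    (area ((F `&` box M) `\` [set x | (t < u x)%R]) <= eps%:E)%E &
    forall d0, 0 < d0 -> exists d, [/\ 0 < d, d < d0 & forall s : seq (set plane),
      pairwise (fun C D : set plane => `[< C `&` D = set0 >]) s ->
      (forall C, C \in s -> open C /\ forall x y, C x ->
         (forall s, 0 <= s <= 1 -> t < u (x + s *: (y - x))) -> C y) ->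
      \sum_(C <- s) \sum_(p <- l) 2 * p.1 *
        fine (lam [set lin (perp p.2) x | x in C `&` [set x | (t + d < u x)%R]]) <=
      \int[m]_x psi l (nu x) + eps]].
Proof.
move=> hl M0 eps0.
set V := \int[m]_x psi l (nu x).
have V0 : 0 <= V.
  apply: Rintegral_ge0 => x _; rewrite /psi big_seq; apply: sumr_ge0 => p /hl[p0 _].
  by rewrite mulr_ge0.
(* Small enough for [V < (V + eps / 2) (1 - 2 eta)], the slope hypothesis of [small_quotient]. The
   mollification error is later taken as [eps * eta], so that Markov's inequality on [1 - u >= eta]
   gives area [eps]. *)
pose eta := eps / (4 * (V + eps) + 4).
have D0 : 0 < 4 * (V + eps) + 4 by lra.
have etaD : eta * (4 * (V + eps) + 4) = eps by rewrite /eta divfK// gt_eqF.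
have eta0 : 0 < eta by rewrite divr_gt0.
have eta4 : 4 * eta < 1 by nra.
have [B mB FB] := lmeasurable_borel mF finF.
have finB : (borel_area B < +oo)%E.
  by rewrite -area_borel// -(eqA_area FB).
have ee0 : 0 < eps * eta by rewrite mulr_gt0.
have [h0 h00 Happ] := moll_approx mB finB M0 ee0.
have [k K] := mollifier_exists h00.
have {}Happ := Happ h0 k h00 (lexx _) K.
pose u := moll mB finB k.
have [M' M'0 HM'] := moll_small mB finB K eta0.
have mu_ := moll_bmf mB finB K.
have cu : continuous u by exact (moll_continuous U mF FB K).
pose mu := boxm M'.
have bom e : bmf (om m nu k e) by exact (om_bmf U K e).
have om0 e x : 0 <= om m nu k e x by exact (om_ge0 m nu K e x).
pose X (s t : R) : set plane := [set x | s < u x] `&` ~` [set x | t < u x].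
have mU s : measurable [set x | s < u x].
  apply: open_plane_measurable; exact: (@open_comp _ _ u [set y | s < y] (fun x _ => cu x) (@open_gt R _)).
have mX s t : measurable (X s t) by apply: measurableI => //; exact: measurableC.
have bX s t : bmf (\1_(X s t) : plane -> R) by exact: bmf_indic.
pose g (e : plane) s t := \int[mu]_x (\1_(X s t) x * om m nu k e x).
(* The directions are summed before the level is chosen, so one level serves all of them. *)
pose G t := \sum_(p <- l) p.1 * g p.2 eta t.
have gB e s t : eta <= s -> s <= t -> g e eta t - g e eta s = g e s t.
  move=> es st; rewrite /g -rI_B; [|exact: bmfM|exact: bmfM].
  apply: eq_Rintegral => x _; rewrite -mulrBl; congr (_ * _).
  have E a b : \1_(X a b) x = ((a < u x) && (u x <= b))%:R :> R.
    rewrite indicE; congr (nat_of_bool _)%:R; apply/idP/idP => [/[!inE] -[/= ax /negP]|/andP[ax bx]].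
      by rewrite -leNgt ax => ->.
    by rewrite inE; split=> //=; apply/negP; rewrite -leNgt.
  rewrite !E; case: (ltP eta (u x)); case: (ltP s (u x)); case: (leP (u x) t); case: (leP (u x) s) => /=;
    rewrite ?subr0 ?subrr ?sub0r//; clear -es st; move=> *; lra.
have g0 e s t : 0 <= g e s t.
  by apply: Rintegral_ge0 => x _; rewrite mulr_ge0// indicE.
have GB s t : eta <= s -> s <= t -> G t - G s = \sum_(p <- l) p.1 * g p.2 s t.
  move=> es st; rewrite /G -sumrB; apply: eq_bigr => p _.
  by rewrite -mulrBr gB.
have S0 s t : 0 <= \sum_(p <- l) p.1 * g p.2 s t.
  by rewrite big_seq; apply: sumr_ge0 => p /hl[p0 _]; rewrite mulr_ge0.
have GV : G (1 - eta) - G eta <= V.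
  rewrite GB//; last by clear -eta0 eta4; lra.
  rewrite /V psi_int big_seq [leRHS]big_seq; apply: ler_sum => p /hl[p0 _].
  apply: ler_wpM2l => //; apply: le_trans (om_total U K p.2 (box_measurable M') (box_finite M')).
  apply: rI_le => //; first exact: bmfM.
  by move=> x; rewrite -[leRHS]mul1r ler_wpM2r// indicE; case: (_ \in _).
have [||||t [te t1 Ht]] := @small_quotient R G eta (1 - eta) (V + eps / 2).
- by clear -eta0 eta4; lra.
- by clear -V0 eps0; lra.
- by move=> s t es st _; rewrite -subr_ge0 GB.
- by apply: le_lt_trans GV _; clear -V0 eps0 etaD eta0; nra.
exists u, t, M'; split=> //.
- by move=> x /HM'/le_trans; apply.
- pose Y := (B `&` box M) `\` [set x | t < u x].
  have mY : measurable Y by apply: measurableD => //; apply: measurableI => //; exact: box_measurable.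
  apply: (@le_trans _ _ (area (Y `|` (F `+` B)))).
    apply: le_area => x [[Fx bx] ux]; have [Bx|nB] := pselect (B x); first by left.
    by right; left.
  apply: le_trans (areaU _ _) _; rewrite FB adde0 area_borel//.
  have -> : borel_area Y = boxm (M + 1) Y.
    change (borel_area Y = borel_area (Y `&` box (M + 1))); rewrite setIidl//.
    by move=> x [[_ /boxP[x1 x2]] _]; apply/boxP; rewrite (le_trans x1) ?(le_trans x2) ?lerDl.
  rewrite -[leLHS]fineK ?fin_num_measure// lee_fin -(ler_pM2r eta0); apply: le_trans Happ.
  rewrite -rI_indic// mulrC -rI_Z; last exact: bmf_indic.
  have mBb : measurable (B `&` box M) by apply: measurableI => //; exact: box_measurable.
  apply: rI_le; first by apply: bmfZ; exact: bmf_indic.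
    by apply: bmfM; [exact: bmf_indic|apply: bmfB => //; exact: bmf_cst].
  move=> x; rewrite !indicE; case: (boolP (x \in Y)) => [/[!inE] -[Bx /= tx]|_].
    rewrite mem_set// mul1r mulr1; move/negP: tx; rewrite -leNgt /u => tx; lra.
  by rewrite mulr0 mulr_ge0// subr_ge0 (moll_le1 mB finB K).
move=> d0 d00; have [d [dp dd td Hd]] := Ht d0 d00.
exists d; split=> // s ds Hs.
have oU' (c : R) : open [set x | u x < c].
  exact: (@open_comp _ _ u [set y | y < c] (fun x _ => cu x) (@open_lt R c)).
have mCd C : open C -> measurable (C `&` [set x | t < u x < t + d]).
  move=> oC; rewrite (_ : [set x | _] = [set x | t < u x] `&` [set x | u x < t + d]).
    by apply: measurableI; [exact: open_plane_measurable|apply: measurableI; [exact: mU|exact: open_plane_measurable]].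
  by apply/seteqP; split=> x /=; [move=> /andP[]|move=> [-> ->]].
have key C p : C \in s -> p \in l ->
    2 * d * fine (lam [set lin (perp p.2) x | x in C `&` [set x | (t + d < u x)%R]]) <=
    \int[mu]_x (\1_(C `&` [set x | t < u x < t + d]) x * om m nu k p.2 x).
  move=> Cs pl; have [oC HC] := Hs C Cs; have [p0 p20] := hl p pl.
  have mC := mCd C oC.
  have := @coarea_line R u (om m nu k p.2) p.2 t d M' C cu oC p20 (proj1 (bom _)) (om0 _).
  have V1 := @moll_variation R F m nu U mF B mB finB FB h0 k K p.2.
  have far x : M' <= `|x.1| \/ M' <= `|x.2| -> u x <= t by move=> /HM'/le_trans; apply.
  move=> /(_ V1 far HC dp) H.
  have E : (\int[borel_area]_(x in C `&` [set x | (t < u x < t + d)%R]) (om m nu k p.2 x)%:E =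
     (\int[mu]_x (\1_(C `&` [set x | t < u x < t + d]) x * om m nu k p.2 x))%:E)%E.
    have bA : bmf (fun x => \1_(C `&` [set x | t < u x < t + d]) x * om m nu k p.2 x).
      by apply: bmfM => //; exact: bmf_indic.
    rewrite -(rI_E mu bA) integral_restrm; last by apply/measurable_EFinP; case: bA.
    rewrite [LHS]integral_mkcond [RHS]integral_mkcond; apply: eq_integral => x _.
    rewrite !patchE indicE; case: (boolP (x \in _)) => [/[!inE] -[Cx /andP[tx _]]|_]; last first.
      by rewrite mul0r if_same.
    rewrite mul1r mem_set//; apply/boxP; split; rewrite leNgt; apply/negP => /ltW x1.
      by have := far x (or_introl x1); rewrite leNgt tx.
    by have := far x (or_intror x1); rewrite leNgt tx.
  move: H; rewrite E; set L := lebesgue_measure _.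
  have : (0 <= L)%E by exact: measure_ge0.
  case: L => [v _|_|//]; first by rewrite -EFinM lee_fin.
  by rewrite gt0_muley ?lte_fin ?mulr_gt0.
rewrite -(ler_pM2l dp).
apply: (@le_trans _ _ (\sum_(p <- l) p.1 * \sum_(C <- s) \int[mu]_x (\1_(C `&` [set x | t < u x < t + d]) x * om m nu k p.2 x))).
  rewrite exchange_big/= mulr_sumr big_seq [leRHS]big_seq; apply: ler_sum => p pl.
  rewrite !mulr_sumr big_seq [leRHS]big_seq; apply: ler_sum => C Cs.
  have [p0 _] := hl p pl.
  have := ler_wpM2l p0 (key C p Cs pl); congr (_ <= _); ring.
apply: (@le_trans _ _ (\sum_(p <- l) p.1 * g p.2 t (t + d))); last first.
  rewrite -GB//; last by rewrite lerDl ltW.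
  by apply: le_trans Hd _; clear -dp eps0; nra.
rewrite big_seq [leRHS]big_seq; apply: ler_sum => p /hl[p0 _]; apply: ler_wpM2l => //.
pose f C := if C \in s then C `&` [set x | t < u x < t + d] else set0.
have bf C : bmf (fun x => \1_(f C) x * om m nu k p.2 x).
  apply: bmfM => //; rewrite /f; case: ifP => [/Hs[oC _]|_]; apply: bmf_indic => //.
  exact: mCd.
rewrite (_ : \sum_(C <- s) _ = \sum_(C <- s) \int[mu]_x (\1_(f C) x * om m nu k p.2 x)); last first.
  by apply: eq_big_seq => C Cs; rewrite /f Cs.
have [bs <-] := rI_sum mu s bf.
apply: rI_le => //; first exact: bmfM.
move=> x; rewrite -mulr_suml; apply: ler_wpM2r => //.
apply: sum_indic_le => // C; rewrite /f; case: ifP => _ //.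
move=> y [Cy /andP[y1 y2]]; split=> //; split=> //=; apply/negP; rewrite -leNgt; exact: ltW.
Qed.

(** The components of the open set [u > t] are countably many, each containing a rational point.
    Finitely many exhaust it up to area [eps / 2], and the band height [d] is chosen after this
    finite list. *)
Lemma pieces (l : seq (R * plane)) (M eps : R) :
  (forall p, p \in l -> 0 <= p.1 /\ p.2 != 0) -> 0 < M -> 0 < eps ->
  exists s : seq (set plane), [/\
    forall C, C \in s -> [/\ C !=set0, connected C & exists M', C `<=` box M'],
    \sum_(C <- s) wperimeter l C <= \int[m]_x psi l (nu x) + eps &
    (area ((F `&` box M) `\` [set x | exists2 C, C \in s & C x]) <= eps%:E)%E].
Proof.
move=> hl M0 eps0.
have e20 : 0 < eps / 2 by lra.
have [u [t [M' [cu far aF Ht]]]] := level_exists hl M0 e20.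
pose W := [set x | t < u x].
have oW : open W by exact: (@open_comp _ _ u [set y | t < y] (fun x _ => cu x) (@open_gt R _)).
have WM : W `<=` box M'.
  move=> x; rewrite /W/= => tx; apply/boxP; split; rewrite leNgt; apply/negP => /ltW x1.
    by have := far x (or_introl x1); rewrite leNgt tx.
  by have := far x (or_intror x1); rewrite leNgt tx.
pose q (n : nat) : plane := if unpickle n is Some p then (ratr (p : rat * rat).1, ratr p.2) else 0.
pose V n := connected_component W (q n).
have oV n : open (V n) by exact: connected_component_open.
have WV : W `<=` \bigcup_n V n.
  move=> x Wx; have oC : open (connected_component W x) by exact: connected_component_open.
  have : nbhs x (connected_component W x) by apply: open_nbhs_nbhs; split=> //; exact: connected_component_refl.
  move=> /(@nbhs_ballP R (plane : pseudoMetricType R))[r /= r0 H].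
  have [a /andP[a1 a2]] := @rat_in_itvoo R (x.1 - r) (x.1 + r) ltac:(lra).
  have [b /andP[b1 b2]] := @rat_in_itvoo R (x.2 - r) (x.2 + r) ltac:(lra).
  move: a1 a2 b1 b2; rewrite !bnd_simp => a1 a2 b1 b2.
  exists (pickle (a, b)) => //; rewrite /V /q pickleK /=; apply: connected_component_sym; apply: H.
  by clear -a1 a2 b1 b2; split; rewrite /ball/= ltr_norml; apply/andP; split; lra.
have [N HN] : exists N : nat, (borel_area (W `\` \bigcup_(n < N) V n) <= (eps / 2)%:E)%E.
  pose D (N : nat) := W `\` \bigcup_(n < N) V n.
  have mD N : measurable (D N).
    apply: measurableD; first exact: open_plane_measurable.
    by apply: bigcup_measurable => n _; exact: open_plane_measurable.
  have cv := @nonincreasing_cvg_mu _ _ _ (boxm M') D _ mD.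
  have : boxm M' (D N) @[N --> \oo] --> 0%E.
    rewrite (_ : 0%E = boxm M' (\bigcap_N D N)).
      apply: cv; first by rewrite ltey_eq fin_num_measure.
        by apply: bigcap_measurable => // n _.
      move=> n k nk; rewrite subsetEset => x [Wx Vx]; split=> // -[i /= ik Vi]; apply: Vx.
      by exists i => //=; exact: leq_trans nk.
    rewrite (_ : \bigcap_N D N = set0) ?measure0//; apply/seteqP; split=> // x H.
    have [Wx _] := H 0%N I; have [n _ Vn] := WV x Wx.
    by have [_] := H n.+1 I; apply; exists n => //=.
  move=> /fine_cvgP[_] /cvgrPdist_le /(_ _ e20) [N _ /(_ N (leqnn _))]; rewrite sub0r normrN => HN.
  exists N; rewrite (_ : borel_area _ = boxm M' (D N)).
    by rewrite -[leLHS]fineK ?fin_num_measure// lee_fin; apply: le_trans HN; exact: ler_norm.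
  by change (borel_area (D N) = borel_area (D N `&` box M')); rewrite setIidl// => x [/WM].
have [s [Hs ds Vs]] : exists s : seq (set plane), [/\
    forall C, C \in s -> exists2 x, W x & C = connected_component W x,
    pairwise (fun C D : set plane => `[< C `&` D = set0 >]) s &
    forall n x, (n < N)%N -> V n x -> exists2 C, C \in s & C x].
  elim: N {HN} => [|N [s [Hs ds Vs]]]; first by exists [::]; split.
  have [[C Cs Cq]|nq] := pselect (exists2 C, C \in s & C (q N)).
    exists s; split=> // n x; rewrite ltnS leq_eqVlt => /orP[/eqP->|]; last exact: Vs.
    move=> Vx; exists C => //; have [y Wy E] := Hs C Cs.
    by rewrite E; apply: connected_component_trans Vx; rewrite -E.
  have [Wq|nW] := pselect (W (q N)); last first.
    exists s; split=> // n x; rewrite ltnS leq_eqVlt => /orP[/eqP->|]; last exact: Vs.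
    by rewrite /V connected_component_out.
  exists (V N :: s); split.
  - by move=> C; rewrite inE => /orP[/eqP->|/Hs//]; exists (q N).
  - rewrite /= ds andbT; apply/allP => C Cs; apply/asboolP/seteqP; split=> // x [Vx Cx].
    apply: nq; exists C => //; have [y Wy E] := Hs C Cs.
    rewrite E; apply: (@connected_component_trans _ _ x); first by rewrite -E.
    exact: connected_component_sym.
  - move=> n x; rewrite ltnS leq_eqVlt => /orP[/eqP->|nN Vx]; first by exists (V N); rewrite ?mem_head.
    by have [C Cs Cx] := Vs n x nN Vx; exists C; rewrite ?inE ?Cs ?orbT.
have HC C : C \in s -> [/\ open C, connected C, C `<=` W & C !=set0].
  move=> /Hs[x Wx ->]; split; [exact: connected_component_open|exact: component_connected|
    exact: connected_component_sub|by exists x; exact: connected_component_refl].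
exists s; split.
- move=> C /HC[_ cC CW C0]; split=> //; exists M'; exact: subset_trans WM.
- pose A := \sum_(p <- l) 2 * p.1.
  have A0 : 0 <= A by rewrite /A big_seq; apply: sumr_ge0 => p /hl[p0 _]; rewrite mulr_ge0.
  (* Replacing each width by a projection costs [e'] per piece and direction; the weighted total
     [A * size s * e'] stays below [eps / 2]. *)
  pose e' := eps / 2 / (A * (size s)%:R + 1).
  have D0 : 0 < A * (size s)%:R + 1 by rewrite ltr_wpDl// mulr_ge0.
  have e'0 : 0 < e' by rewrite divr_gt0.
  have [d0 d00 Hd] : exists2 d0, 0 < d0 & forall i d, i \in s -> 0 < d -> d < d0 -> forall p, p \in l ->
     ((width (perp p.2) i - e')%:E <= lam [set lin (perp p.2) x | x in i `&` [set x | (t + d < u x)%R]])%E.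
    apply: (near0_seq (P := fun i d => forall p, p \in l -> ((width (perp p.2) i - e')%:E <= lam [set lin (perp p.2) x | x in i `&` [set x | (t + d < u x)%R]])%E)).
    move=> C /HC[oC cC CW C0].
    have [|d0 d00 H0] := @near0_seq _ l (fun p d => ((width (perp p.2) C - e')%:E <= lam [set lin (perp p.2) x | x in C `&` [set x | (t + d < u x)%R]])%E).
      by move=> p /hl[_ p0]; apply: width_le_proj.
    by exists d0 => // d dp dd p pl; exact: H0.
  have [d [dp dd HH]] := Ht d0 d00.
  have := HH s ds; have HHH : forall C, C \in s -> open C /\ forall x y, C x ->
         (forall s, 0 <= s <= 1 -> t < u (x + s *: (y - x))) -> C y.
    move=> C Cs; split; first by case: (HC C Cs).
    by move=> x y; have [z Wz ->] := Hs C Cs; exact: connected_component_segment.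
  move=> /(_ HHH) {HHH} H.
  have : \sum_(C <- s) wperimeter l C <= \sum_(C <- s) (\sum_(p <- l) 2 * p.1 *
        fine (lam [set lin (perp p.2) x | x in C `&` [set x | (t + d < u x)%R]]) + A * e').
    rewrite big_seq [leRHS]big_seq; apply: ler_sum => C Cs.
    rewrite /A mulr_suml -big_split /wperimeter big_seq [leRHS]big_seq /=; apply: ler_sum => p pl.
    have [p0 _] := hl p pl; rewrite -mulrDr; apply: ler_wpM2l; first by rewrite mulr_ge0.
    have := Hd C d Cs dp dd p pl.
    set L := lam _; set K := enorm (perp p.2) * (2 * M').
    pose IK : set R := `[- K, K]%classic.
    have : (L <= lam IK)%E.
      have := oW => _; apply: le_measure; rewrite ?inE; [|exact: measurable_itv|].
        apply: open_measurable; apply: lin_open_image; first by apply: perp_neq0; have [] := hl p pl.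
        apply: openI; first by case: (HC C Cs).
        exact: (@open_comp _ _ u [set y | t + d < y] (fun x _ => cu x) (@open_gt R _)).
      move=> _ [x [Cx _] <-]; change (is_true (lin (perp p.2) x \in `[- K, K])); rewrite in_itv/= -ler_norml.
      have /boxP[x1 x2] : box M' x by apply: WM; case: (HC C Cs) => _ _ + _; apply.
      apply: (@le_trans _ _ (enorm (perp p.2) * enorm x)).
        rewrite ler_norml lin_le andbT lerNl; have := lin_le (perp p.2) (- x).
        by rewrite enormN; apply: le_trans; rewrite linN.
      apply: ler_wpM2l; first exact: enorm_ge0.
      exact: enorm_le_box.
    have := itv_finite (- K) K; move=> /[swap] /le_lt_trans/[apply].
    have : (0 <= L)%E by exact: measure_ge0.
    by case: L => [v _ _| |]//; rewrite lee_fin lerBlDr.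
  move=> /le_trans; apply; rewrite big_split/=.
  rewrite (_ : \sum_(C <- s) A * e' = A * e' * (size s)%:R); last first.
    by rewrite -sum1_size natr_sum mulr_sumr; apply: eq_bigr => C _; rewrite mulr1.
  have : e' * (A * (size s)%:R + 1) = eps / 2 by rewrite /e' divfK// gt_eqF.
  by move: H; move: (\sum_(C <- s) _) => Q; lra.
- apply: (@le_trans _ _ (area (((F `&` box M) `\` W) `|` (W `\` \bigcup_(n < N) V n)))).
    apply: le_area => x [Fx nx]; have [Wx|nW] := pselect (W x); [right|left] => //.
    by split=> // -[n /= nN Vx]; apply: nx; exact: Vs Vx.
  apply: le_trans (areaU _ _) _.
  rewrite [eps in leRHS](_ : eps = eps / 2 + eps / 2); last by lra.
  rewrite EFinD; apply: leeD => //.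
  rewrite area_borel//; apply: measurableD; first exact: open_plane_measurable.
  by apply: bigcup_measurable => n _; exact: open_plane_measurable.
Qed.

End Pieces.

(** * Convex bodies and widths *)

Section Convex.
Context {R : realType}.
Local Notation plane := (plane R).
Implicit Types (A B K : set plane) (x y z v e : plane).

Definition cvx A := forall x y (t : R), A x -> A y -> 0 <= t <= 1 -> A (x + t *: (y - x)).

Lemma cvxP A : convex_set (A : set (convex_lmodType plane)) <-> cvx A.
Proof.
have E x y (k : {i01 R}) : conv k (x : convex_lmodType plane) y = y + k%:num *: (x - y).
  have -> : conv k (x : convex_lmodType plane) y = k%:num *: x + (1 - k%:num) *: y by [].
  by congr (_, _) => /=; rewrite /GRing.scale/=; ring.
split=> [cA x y t Ax Ay /andP[t0 t1]|cA x y k].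
  have := cA y x (Itv01 t0 t1); rewrite !inE E /=; exact.
rewrite !inE E => Ax Ay; apply: cA => //.
by rewrite ge0 le1.
Qed.

Lemma cvxI A B : cvx A -> cvx B -> cvx (A `&` B).
Proof. by move=> cA cB x y t [? ?] [? ?] t01; split; [exact: cA|exact: cB]. Qed.

Lemma cvx_lin_le e (c : R) : cvx [set x | lin e x <= c].
Proof. by move=> x y t /= h1 h2 /andP[t0 t1]; rewrite linD linZ linB; nra. Qed.

Lemma closed_lin_le e (c : R) : closed [set x | lin e x <= c].
Proof.
rewrite (_ : [set x | _] = lin e @^-1` [set y : R | y <= c])//.
by apply: preimage_closed => [x _|]; [exact: lin_continuous|exact: closed_le].
Qed.

Lemma box_closed (M : R) : closed (box M).
Proof.
apply: compact_closed; first exact: norm_hausdorff.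
have := @compact_box R M; congr compact; apply/seteqP; split=> x; by move=> /boxP.
Qed.

Lemma box_compact (M : R) : compact (box M).
Proof. by have := @compact_box R M; congr compact; apply/seteqP; split=> x; move=> /boxP. Qed.

Lemma box_cvx (M : R) : cvx (box M).
Proof.
move=> x y t /boxP[x1 x2] /boxP[y1 y2] /andP[t0 t1]; apply/boxP.
have H (a b : R) : `|a| <= M -> `|b| <= M -> `|a + t * (b - a)| <= M.
  by rewrite !ler_norml => /andP[? ?] /andP[? ?]; apply/andP; split; nra.
by split; exact: H.
Qed.

Definition chull A : set plane := [set x | forall K, closed K -> cvx K -> A `<=` K -> K x].

Lemma chull_sub A : A `<=` chull A.
Proof. by move=> x Ax K _ _; apply. Qed.

Lemma chull_min A K : closed K -> cvx K -> A `<=` K -> chull A `<=` K.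
Proof. by move=> cK vK AK x; apply. Qed.

Lemma chull_cvx A : cvx (chull A).
Proof. by move=> x y t Ax Ay t01 K cK vK AK; exact (vK _ _ _ (Ax _ cK vK AK) (Ay _ cK vK AK) t01). Qed.

Lemma chull_closed A : closed (chull A).
Proof.
rewrite (_ : chull A = \bigcap_(K in [set K | [/\ closed K, cvx K & A `<=` K]]) K); last first.
  by apply/seteqP; split=> x H K; [move=> [cK vK AK]; exact: H|move=> cK vK AK; exact: H].
by apply: closed_bigI => K [].
Qed.

Definition ccs K := compact K /\ cvx K.

Lemma ccs_closed K : ccs K -> closed K.
Proof. by move=> [cK _]; apply: compact_closed => //; exact: norm_hausdorff. Qed.

Lemma ccs_box K : ccs K -> exists M, K `<=` box M.
Proof.
move=> [/compact_bounded[M [_ HM]] _]; exists (M + 1) => x Kx.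
have := HM (M + 1) ltac:(by rewrite ltrDl) x Kx.
rewrite /= /Num.norm/= ge_max => /andP[h1 h2]; apply/boxP; split; [exact: h1|exact: h2].
Qed.

Lemma ccs_sub_box K M : closed K -> cvx K -> K `<=` box M -> ccs K.
Proof.
move=> cK vK KM; split=> //; apply: (subclosed_compact cK _ KM); exact: box_compact.
Qed.

Lemma ccs_measurable K : ccs K -> measurable K.
Proof. by move=> /ccs_closed; exact: closed_plane_measurable. Qed.

Lemma chull_ccs A M : A `<=` box M -> ccs (chull A).
Proof.
move=> AM; apply: (@ccs_sub_box _ M); [exact: chull_closed|exact: chull_cvx|].
by apply: chull_min => //; [exact: box_closed|exact: box_cvx].
Qed.

Lemma box_lin e M x y : box M x -> box M y -> lin e (x - y) <= enorm e * (4 * M).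
Proof.
move=> /boxP[x1 x2] /boxP[y1 y2]; apply: le_trans (lin_le _ _) _.
apply: ler_wpM2l; first exact: enorm_ge0.
apply: le_trans (enorm_le _) _ => /=.
by have := ler_normB x.1 y.1; have := ler_normB x.2 y.2; lra.
Qed.

Lemma width_ge e A M x y : A `<=` box M -> A x -> A y -> lin e (x - y) <= width e A.
Proof.
move=> AM Ax Ay; apply: ub_le_sup; last by exists x, y.
by exists (enorm e * (4 * M)) => _ [u [v [Au Av ->]]]; apply: box_lin; exact: AM.
Qed.

Lemma width_le e A (c : R) : 0 <= c -> (forall x y, A x -> A y -> lin e (x - y) <= c) -> width e A <= c.
Proof.
move=> c0 H; rewrite /width; have [->|/set0P ne] := eqVneq [set r | exists x y, [/\ A x, A y & r = lin e (x - y)]] set0.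
  by rewrite sup0.
by apply: ge_sup => // _ [x [y [Ax Ay ->]]]; exact: H.
Qed.

Lemma width_ge0 e A M : A `<=` box M -> 0 <= width e A.
Proof.
move=> AM; have [->|/set0P[x Ax]] := eqVneq A set0.
  rewrite /width (_ : [set r | _] = set0) ?sup0//.
  by apply/seteqP; split=> // r [x [y []]].
by apply: le_trans (width_ge e AM Ax Ax); rewrite subrr /lin/= !mulr0 addr0.
Qed.

Lemma width_sub e A B M : B `<=` box M -> A `<=` B -> width e A <= width e B.
Proof.
move=> BM AB; apply: width_le; first exact: width_ge0 BM.
by move=> x y Ax Ay; apply: (width_ge e BM); exact: AB.
Qed.

Lemma width_chull e A M : A `<=` box M -> width e (chull A) <= width e A.
Proof.
move=> AM; apply: width_le; first exact: width_ge0 AM.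
move=> x y Hx Hy.
have H1 : A `<=` [set x | lin e x <= lin e y + width e A].
  move=> u Au; have : chull A `<=` [set y | lin (- e) y <= - (lin e u - width e A)].
    apply: chull_min; [exact: closed_lin_le|exact: cvx_lin_le|].
    move=> v Av /=; have := width_ge e AM Au Av.
    by rewrite linB /lin/=; lra.
  by move=> /(_ y Hy) /=; rewrite /lin/=; lra.
have := Hx _ (@closed_lin_le e _) (@cvx_lin_le e _) H1.
by rewrite /= linB; lra.
Qed.

Lemma width_translate e A v : width e [set x | A (x - v)] = width e A.
Proof.
rewrite /width; congr sup; apply/seteqP; split=> r [x [y [Ax Ay ->]]].
  by exists (x - v), (y - v); split=> //; congr lin; rewrite opprB addrA subrK.
by exists (x + v), (y + v); split=> /=; rewrite ?addrK//; congr lin; rewrite opprD addrACA subrr addr0.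
Qed.

(* Widths of two sets that nearly share the two points [x1 ~ y1], [x2 ~ y2]
   overlap along the segment joining these points. *)
Lemma width_union e A B M x1 x2 y1 y2 : A `<=` box M -> B `<=` box M ->
  A x1 -> A x2 -> B y1 -> B y2 ->
  width e (A `|` B) <= width e A + width e B -
    (`|lin e (x2 - x1)| - `|lin e (x1 - y1)| - `|lin e (x2 - y2)|).
Proof.
move=> AM BM Ax1 Ax2 By1 By2.
have gA := width_ge e AM; have gB := width_ge e BM.
have wA := width_ge0 e AM; have wB := width_ge0 e BM.
have n1 := ler_norm (lin e (x1 - y1)); have n2 := ler_norm (lin e (x2 - y2)).
have n1' := ler_norm (- lin e (x1 - y1)); have n2' := ler_norm (- lin e (x2 - y2)).
rewrite !normrN !linB in n1 n2 n1' n2' gA gB *.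
have hA1 := gA _ _ Ax1 Ax2; have hA2 := gA _ _ Ax2 Ax1.
have hB1 := gB _ _ By1 By2; have hB2 := gB _ _ By2 By1.
rewrite !linB in hA1 hA2 hB1 hB2.
have o : `|lin e x2 - lin e x1| <= width e A by rewrite ler_norml; apply/andP; split; lra.
have o' : `|lin e x2 - lin e x1| - `|lin e x1 - lin e y1| - `|lin e x2 - lin e y2| <= width e B.
  have : `|lin e x2 - lin e x1| <= `|lin e x1 - lin e y1| + `|lin e x2 - lin e y2| + width e B.
    by rewrite ler_norml; apply/andP; split; lra.
  by lra.
apply: width_le.
  by have := normr_ge0 (lin e x1 - lin e y1); have := normr_ge0 (lin e x2 - lin e y2); lra.
move=> u v; have p1 := normr_ge0 (lin e x1 - lin e y1); have p2 := normr_ge0 (lin e x2 - lin e y2).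
move=> [Au|Bu] [Av|Bv]; rewrite linB.
- by have := gA _ _ Au Av; rewrite linB; lra.
- have := gA _ _ Au Ax1; have := gA _ _ Au Ax2; have := gB _ _ By1 Bv; have := gB _ _ By2 Bv; rewrite !linB.
  by case: (ger0P (lin e x2 - lin e x1)) => *; lra.
- have := gA _ _ Ax1 Av; have := gA _ _ Ax2 Av; have := gB _ _ Bu By1; have := gB _ _ Bu By2; rewrite !linB.
  by case: (ger0P (lin e x2 - lin e x1)) => *; lra.
- by have := gB _ _ Bu Bv; rewrite linB; lra.
Qed.

(** The homothety of centre [z] and ratio [t] maps [A] into itself and the given ball onto the new
    one. *)
Lemma cvx_ball A (c z : plane) (r t : R) : cvx A -> eball c r `<=` A -> A z -> 0 < t -> t <= 1 ->
  eball (z + t *: (c - z)) (t * r) `<=` A.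
Proof.
move=> cA cr Az t0 t1 x; rewrite /eball/= => xr.
pose y := c + t^-1 *: (x - (z + t *: (c - z))).
have Ay : A y.
  by apply: cr; rewrite /eball/= /y addrAC subrr add0r enormZ gtr0_norm ?invr_gt0// ltr_pdivrMl.
have -> : x = z + t *: (y - z).
  have tn : t != 0 by rewrite gt_eqF.
  by rewrite /y addrAC scalerDr scalerA divff// scale1r addrA addrC subrK.
by apply: cA => //; rewrite ltW.
Qed.

(** Let [w] be a chord longer than half the diameter. In the coordinates [lin (perp w)] and [lin w]
    the set lies in a rectangle of half-sides [eta] and [2 |w|^2], of area [8 eta |w|^2]; the
    determinant of the coordinates is [|w|^2] in modulus. *)
Lemma area_det_bound A (eta : R) M : A `<=` box M -> 0 <= eta ->
  (forall x1 x2 x3, A x1 -> A x2 -> A x3 -> `|lin (perp (x2 - x1)) (x3 - x1)| <= eta) ->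
  (area A <= (8 * eta)%:E)%E.
Proof.
move=> AM eta0 H.
have [A0|/set0P[x0 Ax0]] := eqVneq A set0; first by rewrite A0 area0 lee_fin mulr_ge0.
pose S := [set r | exists x y, [/\ A x, A y & r = enorm (x - y)]].
have hS : has_sup S.
  split; first by exists (enorm (x0 - x0)), x0, x0.
  exists (4 * M) => _ [x [y [/AM/boxP[a1 a2] /AM/boxP[b1 b2] ->]]].
  apply: le_trans (enorm_le _) _ => /=.
  by have := ler_normB x.1 y.1; have := ler_normB x.2 y.2; lra.
have Sle x y : A x -> A y -> enorm (x - y) <= sup S.
  by move=> Ax Ay; apply: ub_le_sup; [case: hS|exists x, y].
have [S0|S0] := leP (sup S) 0.
  apply: (@le_trans _ _ 0%E); last by rewrite lee_fin mulr_ge0.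
  have -> : A = [set x0].
    apply/seteqP; split=> [x Ax|x ->//]; have e0 : enorm (x - x0) = 0.
      by apply/le_anti; rewrite enorm_ge0 andbT; apply: le_trans S0; exact: Sle.
    apply/eqP; rewrite -subr_eq0; apply: contraT => /sqr_sum_gt0.
    by rewrite -enorm_sqr e0 expr0n ltxx.
  have -> : [set x0] = `[x0.1, x0.1] `*` `[x0.2, x0.2] :> set plane.
    by apply/seteqP; split=> [_ ->|[a b]] /=; rewrite !in_itv/= ?lexx// => -[/le_anti <- /le_anti <-]; case: (x0).
  rewrite area_borel; last by apply: measurableX; exact: measurable_itv.
  by rewrite box_area// subrr mul0r.
have S2 : 0 < sup S / 2 by lra.
have [_ [x1 [x2 [Ax1 Ax2 ->]]] Hx] := sup_adherent S2 hS.
pose w := x2 - x1.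
have wl : sup S < 2 * enorm w by rewrite /w enormB; lra.
have {}H x : A x -> `|lin (perp w) (x - x1)| <= eta by move=> Ax; exact: H.
clearbody w.
have w0 : 0 < enorm w by lra.
have ww : w.1 ^+ 2 + w.2 ^+ 2 = enorm w ^+ 2 by rewrite enorm_sqr.
pose Q : set plane := `[- eta, eta] `*` `[- (2 * enorm w ^+ 2), 2 * enorm w ^+ 2].
have mQ : measurable Q by apply: measurableX; exact: measurable_itv.
pose T (x : plane) : plane := (- w.2 * x.1 + w.1 * x.2 + - lin (perp w) x1, w.1 * x.1 + w.2 * x.2 + - lin w x1).
have mT : measurable_fun setT T by exact: measurable_affine2.
have sub : A `<=` T @^-1` Q.
  move=> x Ax; rewrite /T /Q/=; split; rewrite /= in_itv/= -ler_norml.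
    rewrite (_ : - w.2 * x.1 + w.1 * x.2 - lin (perp w) x1 = lin (perp w) (x - x1)); first exact: H.
    by rewrite linB /lin/=; ring.
  rewrite (_ : _ + _ = lin w (x - x1)); last by rewrite linB /lin/=; ring.
  have L : `|lin w (x - x1)| <= enorm w * enorm (x - x1).
    rewrite ler_norml lin_le andbT lerNl; have := lin_le w (- (x - x1)).
    by rewrite enormN; apply: le_trans; rewrite linN.
  apply: le_trans L _; rewrite expr2 mulrCA; apply: ler_wpM2l; first exact: ltW.
  by apply: le_trans (Sle _ _ Ax Ax1) _; exact: ltW.
apply: le_trans (le_area sub) _.
have mTQ : measurable (T @^-1` Q) by have := mT measurableT Q mQ; rewrite setTI.
rewrite area_borel// -(setIT (T @^-1` Q)) -integral_indic//.
have := @ge0_integral_affine2 R (fun x => (\1_Q x)%:E) (- w.2) w.1 w.1 w.2 (- lin (perp w) x1) (- lin w x1).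
have -> : - w.2 * w.2 - w.1 * w.1 = - enorm w ^+ 2 by rewrite -ww; ring.
have e2 : 0 < enorm w ^+ 2 by rewrite exprn_gt0.
move=> ->//; first last.
- by apply/measurable_EFinP; apply: measurable_indic.
- by rewrite oppr_eq0 gt_eqF.
rewrite integral_indic// setIT /Q box_area; [|lra|lra].
rewrite normrN gtr0_norm// -EFinM lee_fin.
rewrite ler_pdivrMl// le_eqVlt; apply/orP; left; apply/eqP; ring.
Qed.

End Convex.

(** * Near contacts and gaps between convex sets *)

Section Touch.
Context {R : realType}.
Local Notation plane := (plane R).
Implicit Types (A B K : set plane) (x y z v e : plane).

Lemma cvx3 A x1 x2 x3 (a b : R) : cvx A -> A x1 -> A x2 -> A x3 -> 0 <= a -> 0 <= b ->
  a + b <= 1 -> A (x1 + a *: (x2 - x1) + b *: (x3 - x1)).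
Proof.
move=> cA A1 A2 A3 a0 b0 ab; have [s0|s0] := leP (a + b) 0.
  have -> : a = 0 by lra.
  have -> : b = 0 by lra.
  by rewrite !scale0r !addr0.
have sn : a + b != 0 by rewrite gt_eqF.
have t01 : 0 <= b / (a + b) <= 1.
  by rewrite divr_ge0 ?(ltW s0)//= ler_pdivrMr// mul1r lerDr.
have Ay := cA x2 x3 _ A2 A3 t01.
have s01 : 0 <= a + b <= 1 by rewrite (ltW s0).
have := cA x1 _ _ A1 Ay s01; congr (A _); congr (_, _) => /=; rewrite /GRing.scale/=; field; exact: sn.
Qed.

Lemma cross_le v w : `|lin (perp v) w| <= enorm v * enorm w.
Proof.
have pv : enorm (perp v) = enorm v by rewrite /enorm /perp/= sqrrN addrC.
rewrite -pv ler_norml lin_le andbT lerNl; have := lin_le (perp v) (- w).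
by rewrite enormN; apply: le_trans; rewrite linN.
Qed.

Lemma box_dist M x y : box M x -> box M y -> enorm (x - y) <= 4 * M.
Proof.
move=> /boxP[a1 a2] /boxP[b1 b2]; apply: le_trans (enorm_le _) _ => /=.
by have := ler_normB x.1 y.1; have := ler_normB x.2 y.2; lra.
Qed.

(** By [area_det_bound] some inscribed triangle has determinant above [c / 9]. Moving its centroid
    by [c / (216 M)] changes two barycentric coordinates by at most [(c / 54) / (c / 9) = 1/6], so
    the point stays in the triangle. *)
Lemma cvx_has_ball A (M c : R) : cvx A -> A `<=` box M -> 0 < M -> 0 < c -> (c%:E <= area A)%E ->
  exists a, eball a (c / (216 * M)) `<=` A.
Proof.
move=> cA AM M0 c0 cAr.
have [x1 [x2 [x3 [A1 A2 A3 D]]]] : exists x1 x2 x3, [/\ A x1, A x2, A x3 &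
    c / 9 < `|lin (perp (x2 - x1)) (x3 - x1)|].
  apply: contrapT => H; have : (area A <= (8 * (c / 9))%:E)%E.
    apply: (area_det_bound AM); first lra.
    move=> x1 x2 x3 A1 A2 A3; rewrite leNgt; apply/negP => D; apply: H.
    by exists x1, x2, x3; split.
  by move=> /(le_trans cAr); rewrite lee_fin; lra.
pose p := x2 - x1; pose q := x3 - x1.
have qM : enorm q <= 4 * M by apply: box_dist; exact: AM.
have pM : enorm p <= 4 * M by apply: box_dist; exact: AM.
rewrite -/p -/q in D.
have D0 : 0 < `|lin (perp p) q| by lra.
have Dn : lin (perp p) q != 0 by rewrite -normr_gt0.
exists (x1 + 3^-1 *: p + 3^-1 *: q) => z; rewrite /eball/=.
set v := z - _ => vr.
have small w : enorm w <= 4 * M -> `|lin (perp v) w / lin (perp p) q| <= 6^-1.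
  move=> wM; rewrite normrM normfV ler_pdivrMr//.
  apply: le_trans (cross_le _ _) _.
  have : enorm v * enorm w <= c / (216 * M) * (4 * M).
    by apply: ler_pM; rewrite ?enorm_ge0// ltW.
  have -> : c / (216 * M) * (4 * M) = c / 54 by field; rewrite gt_eqF.
  lra.
have /[!ler_norml]/andP[s1 s2] := small q qM.
have /[!ler_norml]/andP[s3 s4] := small p pM.
have -> : z = x1 + (3^-1 + lin (perp v) q / lin (perp p) q) *: (x2 - x1) +
    (3^-1 - lin (perp v) p / lin (perp p) q) *: (x3 - x1).
  rewrite -/p -/q; have -> : z = v + (x1 + 3^-1 *: p + 3^-1 *: q) by rewrite subrK.
  clear -Dn; rewrite /lin/perp/= in Dn *; congr (_, _) => /=; rewrite /GRing.scale/=; field; move: Dn;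
   rewrite /lin/perp/=; apply: contra_neq => <-; ring.
by apply: cvx3 => //; clear -s1 s2 s3 s4; lra.
Qed.

Lemma area_eball x (r : R) : 0 < r -> ((r ^+ 2 / 3)%:E <= area (eball x r))%E.
Proof.
move=> r0; pose Q : set plane := `[x.1 - r / 3, x.1 + r / 3] `*` `[x.2 - r / 3, x.2 + r / 3].
have mQ : measurable Q by apply: measurableX; exact: measurable_itv.
apply: (@le_trans _ _ (area Q)).
  rewrite area_borel// /Q box_area; [|lra|lra].
  by rewrite lee_fin; have := sqr_ge0 r; rewrite expr2; lra.
apply: le_area => y [/=]; rewrite !in_itv/= => /andP[a1 a2] /andP[b1 b2].
apply: le_lt_trans (enorm_le _) _ => /=.
have h1 : `|y.1 - x.1| <= r / 3 by rewrite ler_norml; apply/andP; split; lra.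
have h2 : `|y.2 - x.2| <= r / 3 by rewrite ler_norml; apply/andP; split; lra.
lra.
Qed.

Lemma area_ball_sub A x (r : R) : 0 < r -> eball x r `<=` A -> area A != 0%E.
Proof.
move=> r0 BA; apply/eqP => A0; have := le_trans (area_eball x r0) (le_area BA).
by rewrite A0 lee_fin; have := exprn_gt0 2 r0; lra.
Qed.

Lemma area_translate A v : measurable A -> measurable [set x | A (x - v)] /\ area [set x | A (x - v)] = area A.
Proof.
move=> mA; have mT := @measurable_affine2 R 1 0 0 1 (- v.1) (- v.2).
have E : [set x | A (x - v)] = (fun x : plane => (1 * x.1 + 0 * x.2 + - v.1, 0 * x.1 + 1 * x.2 + - v.2) : plane) @^-1` A.
  by apply/seteqP; split=> x /=; rewrite !mul1r !mul0r addr0 add0r.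
have mA' : measurable [set x | A (x - v)] by rewrite E; have := mT measurableT A mA; rewrite setTI.
have L X : measurable X -> borel_area X = (\int[borel_area]_x (\1_X x)%:E)%E.
  by move=> mX; rewrite (integral_indic borel_area measurableT mX) setIT.
split=> //; rewrite (area_borel mA) (area_borel mA') !L//.
have := @ge0_integral_affine2 R (fun x => (\1_A x)%:E) 1 0 0 1 (- v.1) (- v.2).
rewrite (_ : 1 * 1 - 0 * 0 = 1); last ring.
rewrite normr1 invr1 mul1e => <-//; last by apply/measurable_EFinP; apply: measurable_indic.
by rewrite [in LHS]E; apply: eq_integral => x _; rewrite !indicE.
Qed.

(* The gap left between two convex sets that nearly touch along the segment from [a] to [b]. *)
Lemma gap_ball A a q (rho r lambda : R) : cvx A -> eball a rho `<=` A ->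
  0 < lambda -> lambda <= 1 -> r <= lambda * rho ->
  ~ A (q + lambda *: (a - q)) -> forall z, enorm (z - q) < r -> ~ A z.
Proof.
move=> cA aA l0 l1 rl nA z zr Az; apply: nA.
apply: (cvx_ball cA aA Az l0 l1); rewrite /eball/=.
rewrite (_ : _ - _ = (1 - lambda) *: (q - z)); last first.
  by congr (_, _) => /=; rewrite /GRing.scale/=; ring.
rewrite enormZ ger0_norm ?subr_ge0// enormB.
apply: (@le_lt_trans _ _ (enorm (z - q))); last by lra.
by rewrite ler_piMl ?enorm_ge0// lerBlDr lerDl ltW.
Qed.

(** On the line parallel to [b - a] at signed distance [c], [A] ends at parameter [tA] and [B]
    begins at [tB]. A short interval between them gives nearly touching points; around the midpoint
    of a long one there is a ball inside the hull of the two sets that misses both. *)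
Lemma touch_side A B a b (rho delta M c : R) : ccs A -> ccs B -> A `<=` box M -> B `<=` box M ->
  eball a rho `<=` A -> eball b rho `<=` B -> a != b -> 0 < rho -> 0 < delta -> delta <= M ->
  area (A `&` B) = 0%E -> `|c| <= rho / 2 ->
  let s := (enorm (b - a))^-1 *: perp (b - a) in
  (exists x y, [/\ A x, B y, enorm (x - y) <= delta & lin s x = lin s a + c]) \/
  (exists q, forall z, enorm (z - q) < delta * rho / (32 * M) -> [/\ chull (A `|` B) z, ~ A z & ~ B z]).
Proof.
move=> [kA cA] [kB cB] AM BM aA bB ab rho0 d0 dM AB0 crho s.
have M0 : 0 < M by lra.
set e := b - a; set L := enorm e.
have e0 : e != 0 by rewrite subr_eq0 eq_sym.
have L2 : e.1 ^+ 2 + e.2 ^+ 2 = L ^+ 2 by rewrite enorm_sqr.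
have L0 : 0 < L.
  rewrite lt_neqAle enorm_ge0 andbT eq_sym; apply: contraTneq (sqr_sum_gt0 e0) => E.
  by rewrite L2 E expr0n ltxx.
have Ln : L != 0 by rewrite gt_eqF.
have self r x : 0 < r -> eball x r x by move=> r0; rewrite /eball/= subrr enorm0.
have LM : L <= 4 * M by apply: box_dist; [exact/BM/bB/self|exact/AM/aA/self].
have ss : lin s s = 1.
  rewrite /s -/e -/L /lin /perp/= /GRing.scale/=.
  rewrite (_ : _ + _ = (e.1 ^+ 2 + e.2 ^+ 2) / L ^+ 2); first by rewrite L2 divff// expf_neq0.
  by rewrite /e/=; field.
have se : lin s e = 0 by rewrite /s -/e -/L /lin /perp/= /GRing.scale/= /e/=; ring.
have ns : enorm s = 1.
  have := enorm_sqr s; rewrite -(_ : lin s s = s.1 ^+ 2 + s.2 ^+ 2) ?ss; last by rewrite /lin !expr2.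
  move/eqP; rewrite sqrf_eq1 => /orP[/eqP//|/eqP h]; have := enorm_ge0 s; rewrite h; lra.
clearbody s; pose p (t : R) := a + c *: s + t *: e.
have pE t : lin s (p t) = lin s a + c by rewrite /p !linD !linZ ss se; ring.
have pp t u : p t - p u = (t - u) *: e.
  by rewrite /p opprD addrACA subrr add0r scalerBl.
have cp : continuous p by exact: line_continuous.
have nc : enorm (c *: s) <= rho / 2 by rewrite enormZ ns mulr1.
have bA0 : eball (p 0) (rho / 2) `<=` A.
  move=> z; rewrite /eball/= => zp; apply: aA; rewrite /eball/=.
  have -> : z - a = (z - p 0) + c *: s by rewrite /p scale0r addr0 opprD addrA subrK.
  by apply: le_lt_trans (enormD _ _) _; lra.
have bB1 : eball (p 1) (rho / 2) `<=` B.
  move=> z; rewrite /eball/= => zp; apply: bB; rewrite /eball/=.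
  have -> : z - b = (z - p 1) + c *: s.
    by congr (_, _) => /=; rewrite /GRing.scale/=; ring.
  by apply: le_lt_trans (enormD _ _) _; lra.
have r20 : 0 < rho / 2 by lra.
have kI (C : set plane) : closed C -> compact (`[0, 1]%classic `&` p @^-1` C).
  move=> cC; apply: compact_closedI; first exact: segment_compact.
  by apply: preimage_closed => // x _; exact: cp.
have clA : closed A by apply: compact_closed => //; exact: norm_hausdorff.
have clB : closed B by apply: compact_closed => //; exact: norm_hausdorff.
have [|tA [/= tA01 ptA] HA] := @compact_max _ _ (`[0, 1]%classic `&` p @^-1` A) id _ (kI _ clA) (fun u : R => cvg_id).
  by exists 0; split; [rewrite /= in_itv/= lexx ler01|exact/bA0/self].
have [|tB [/= tB01 ptB] HB] := @compact_min _ _ (`[0, 1]%classic `&` p @^-1` B) id _ (kI _ clB) (fun u : R => cvg_id).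
  by exists 1; split; [rewrite /= in_itv/= lexx ler01|exact/bB1/self].
move: tA01 tB01; rewrite !in_itv/= => /andP[tA0 tA1] /andP[tB0 tB1].
(* In the opposite order an intermediate point would be interior to both sets, by [cvx_ball], and
   the intersection would have positive area. *)
have tAB : tA <= tB.
  rewrite leNgt; apply/negP => tBA.
  pose t := (tA + tB) / 2.
  have h1 : 0 < 1 - t / tA by clear -tA0 tA1 tB0 tB1 tBA t; rewrite subr_gt0 ltr_pdivrMr; rewrite /t; lra.
  have h1' : 1 - t / tA <= 1 by clear -tA0 tA1 tB0 tB1 tBA t; rewrite lerBlDr lerDl divr_ge0// /t; lra.
  have h2 : 0 < 1 - (1 - t) / (1 - tB) by clear -tA0 tA1 tB0 tB1 tBA t; rewrite subr_gt0 ltr_pdivrMr; rewrite /t; lra.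
  have h2' : 1 - (1 - t) / (1 - tB) <= 1 by clear -tA0 tA1 tB0 tB1 tBA t; rewrite lerBlDr lerDl divr_ge0// /t; lra.
  have B1 := cvx_ball cA bA0 ptA h1 h1'.
  have B2 := cvx_ball cB bB1 ptB h2 h2'.
  have E1 : p tA + (1 - t / tA) *: (p 0 - p tA) = p t.
    rewrite pp sub0r scalerA -[p tA](subrK (p t)) pp [_ + p t]addrC -addrA -scalerDl.
    by rewrite (_ : tA - t + (1 - t / tA) * - tA = 0) ?scale0r ?addr0//; clear -tA0 tA1 tB0 tB1 tBA t; field; rewrite gt_eqF//; lra.
  have E2 : p tB + (1 - (1 - t) / (1 - tB)) *: (p 1 - p tB) = p t.
    rewrite pp scalerA -[p tB](subrK (p t)) pp [_ + p t]addrC -addrA -scalerDl.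
    by rewrite (_ : tB - t + (1 - (1 - t) / (1 - tB)) * (1 - tB) = 0) ?scale0r ?addr0//; clear -tA0 tA1 tB0 tB1 tBA t; field; rewrite gt_eqF//; lra.
  rewrite E1 in B1; rewrite E2 in B2.
  pose r := Num.min ((1 - t / tA) * (rho / 2)) ((1 - (1 - t) / (1 - tB)) * (rho / 2)).
  have r0 : 0 < r by rewrite lt_min !mulr_gt0.
  have := @area_ball_sub (A `&` B) (p t) r r0; rewrite AB0 eqxx => H; suff : false by [].
  apply: H => z; rewrite /eball/= lt_min => /andP[z1 z2]; split; [exact: B1|exact: B2].
have [gap|gap] := leP ((tB - tA) * L) delta.
  left; exists (p tA), (p tB); split=> //.
  by rewrite pp enormZ ler0_norm ?opprB// subr_le0.
right; pose tq := (tA + tB) / 2; exists (p tq).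
set r := delta * rho / (32 * M).
(* A gap longer than [delta] on a line with [L <= 4 M] means [tB - tA > 4 lam]. A shift of the
   midpoint by a fraction [lam] towards either end therefore stays in the gap, and [gap_ball] yields
   the radius [lam * (rho / 2) = r]. *)
pose lam := delta / (16 * M).
have l0 : 0 < lam by rewrite divr_gt0// mulr_gt0.
have l1 : lam <= 1 by clear -M0 dM; rewrite ler_pdivrMr; lra.
have rl : r = lam * (rho / 2) by rewrite /r /lam; clear -M0; field; rewrite gt_eqF.
have lt : lam < (tB - tA) / 2.
  have : delta < (tB - tA) * (4 * M) by apply: lt_le_trans gap _; rewrite ler_wpM2l// subr_ge0.
  by rewrite /lam; clear -M0 d0; rewrite ltr_pdivrMr; lra.
have rle : r <= lam * (rho / 2) by rewrite rl.
have rr : r <= rho / 2 by rewrite rl ler_piMl// ltW.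
have nA := gap_ball cA bA0 l0 l1 rle.
have nB := gap_ball cB bB1 l0 l1 rle.
move=> z zr; split.
- have zE : z = ((a + (c *: s + (z - p tq)))) + tq *: ((b + (c *: s + (z - p tq))) - (a + (c *: s + (z - p tq)))).
    rewrite -[LHS](subrK (p tq)) [LHS]addrC; move: (z - p tq) => v.
    by rewrite /p; congr (_, _) => /=; rewrite /GRing.scale/=; ring.
  have nv : enorm (c *: s + (z - p tq)) < rho.
    by apply: le_lt_trans (enormD _ _) _; clear -nc zr rr; lra.
  rewrite zE; apply: chull_cvx.
  + by apply: chull_sub; left; apply: aA; rewrite /eball/= addrAC subrr add0r.
  + by apply: chull_sub; right; apply: bB; rewrite /eball/= addrAC subrr add0r.
  + by rewrite /tq; clear -tA0 tA1 tB0 tB1; apply/andP; split; lra.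
- refine (nA (p tq) _ z zr); rewrite pp sub0r.
  have -> : p tq + lam *: (- tq *: e) = p (tq - lam * tq).
    by rewrite /p scalerA -addrA -scalerDl; congr (_ + _ *: _); ring.
  move=> Ap; have : tq - lam * tq <= tA.
    apply: HA; split=> //=; rewrite in_itv/= /tq; clear -tA0 tA1 tB0 tB1 l0 l1; apply/andP; split; nra.
  have : lam * tq <= lam by rewrite ler_piMr ?(ltW l0)// /tq; clear -tA1 tB1; lra.
  by rewrite /tq in lt *; clear -lt; lra.
- refine (nB (p tq) _ z zr); rewrite pp.
  have -> : p tq + lam *: ((1 - tq) *: e) = p (tq + lam * (1 - tq)).
    by rewrite /p scalerA -addrA -scalerDl.
  move=> Bp; have : tB <= tq + lam * (1 - tq).
    apply: HB; split=> //=; rewrite in_itv/= /tq; clear -tA0 tA1 tB0 tB1 l0 l1; apply/andP; split; nra.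
  have : lam * (1 - tq) <= lam by rewrite ler_piMr ?(ltW l0)// /tq; clear -tA0 tB0; lra.
  by rewrite /tq in lt *; clear -lt; lra.
Qed.

(** [touch_side] is used on the two parallels at distances [rho / 2] and [- rho / 2]. Two near
    contacts on them are [rho] apart across the contact direction. *)
Lemma touch_gap A B a b (rho delta M : R) : ccs A -> ccs B -> A `<=` box M -> B `<=` box M ->
  eball a rho `<=` A -> eball b rho `<=` B -> 0 < rho -> 0 < delta -> delta <= M ->
  area (A `&` B) = 0%E ->
  (exists x1 x2 y1 y2, [/\ A x1, A x2, B y1 & B y2] /\ [/\ rho <= enorm (x2 - x1),
      enorm (x1 - y1) <= delta & enorm (x2 - y2) <= delta]) \/
  (exists q, forall z, enorm (z - q) < delta * rho / (32 * M) -> [/\ chull (A `|` B) z, ~ A z & ~ B z]).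
Proof.
move=> hA hB AM BM aA bB rho0 d0 dM AB0.
have ab : a != b.
  apply/eqP => E; have := @area_ball_sub (A `&` B) a rho rho0; rewrite AB0 eqxx => H.
  by suff : false by []; apply: H => z za; split; [exact: aA|apply: bB; rewrite -E].
set s := (enorm (b - a))^-1 *: perp (b - a).
have h1 : `|rho / 2| <= rho / 2 by rewrite ger0_norm//; lra.
have h2 : `|- (rho / 2)| <= rho / 2 by rewrite normrN ger0_norm//; lra.
have [[x2 [y2 [Ax2 By2 d2 l2]]]|] := touch_side hA hB AM BM aA bB ab rho0 d0 dM AB0 h1; last by right.
have [[x1 [y1 [Ax1 By1 d1 l1]]]|] := touch_side hA hB AM BM aA bB ab rho0 d0 dM AB0 h2; last by right.
left; exists x1, x2, y1, y2; split=> //; split=> //.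
have ns : enorm s <= 1.
  have ps : enorm (perp (b - a)) = enorm (b - a) by rewrite /enorm /perp/= sqrrN addrC.
  rewrite /s enormZ ps ger0_norm ?invr_ge0 ?enorm_ge0//.
  by have [->|n0] := eqVneq (enorm (b - a)) 0; [rewrite mulr0|rewrite mulVf].
have : lin s (x2 - x1) = rho by rewrite linB l1 l2; lra.
move=> <-; apply: le_trans (lin_le _ _) _; by rewrite -[leRHS]mul1r ler_wpM2r ?enorm_ge0.
Qed.

End Touch.

(** * Separation and common supporting lines *)

Section Shadow.
Context {R : realType}.
Local Notation plane := (plane R).
Implicit Types (A B K : set plane) (x y z v e : plane).

(** The normal joins a pair of closest points. If a point of either set violated the inequality,
    moving slightly towards it would shorten the distance. *)
Lemma separation A B : ccs A -> ccs B -> A !=set0 -> B !=set0 -> A `&` B = set0 ->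
  exists n (g : R), [/\ n != 0, 0 < g & forall a b, A a -> B b -> lin n a + g <= lin n b].
Proof.
move=> [kA cA] [kB cB] [a0 Aa0] [b0 Bb0] AB.
have kAB : compact (A `*` B) by exact: compact_setX.
have cf : continuous (fun p : plane * plane => enorm (p.1 - p.2)).
  move=> p; have c : continuous (fun p : plane * plane => p.1 - p.2).
    by move=> q; apply: cvgB; [exact: cvg_fst|exact: cvg_snd].
  exact (continuous_comp (c p) (@enorm_continuous R _)).
have [|[a b] [/= Aa Bb] H] := @compact_min R _ (A `*` B) _ _ kAB cf.
  by exists (a0, b0).
pose n := b - a; have n0 : n != 0.
  rewrite /n subr_eq0; apply/eqP => E; have : (A `&` B) a by split=> //; rewrite -E.
  by rewrite AB.
have n2 := sqr_sum_gt0 n0; set N := n.1 ^+ 2 + n.2 ^+ 2 in n2.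
have nn : lin n n = N by rewrite /lin -!expr2.
have key u v : (forall t : R, 0 < t -> t <= 1 -> enorm n <= enorm (n + t *: (v - u))) -> 0 <= lin n (v - u).
  move=> K; rewrite leNgt; apply/negP => neg.
  set w := v - u in K neg; pose W := w.1 ^+ 2 + w.2 ^+ 2.
  have W0 : 0 <= W by rewrite addr_ge0 ?sqr_ge0.
  pose t := Num.min 1 (- lin n w / (W + 1)).
  have t0 : 0 < t by rewrite lt_min ltr01 divr_gt0//; lra.
  have t1 : t <= 1 by rewrite /t ge_min lexx.
  have tW : t * (W + 1) <= - lin n w by rewrite -ler_pdivlMr; [rewrite /t ge_min lexx orbT|lra].
  have := K t t0 t1; rewrite -(@ler_sqr R) ?nnegrE ?enorm_ge0// !enorm_sqr.
  have -> : (n + t *: w).1 ^+ 2 + (n + t *: w).2 ^+ 2 = N + t * (2 * lin n w + t * W).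
    by rewrite /N /W /lin /= /GRing.scale/=; ring.
  rewrite -/N -subr_ge0 addrAC subrr add0r pmulr_rge0//; nra.
exists n, N; split=> // a' b' Aa' Bb'.
have h1 : 0 <= lin n (a - a').
  apply: key => t t0 t1; have t01 : 0 <= t <= 1 by rewrite (ltW t0).
  have := H (a + t *: (a' - a), b) (conj (cA a a' t Aa Aa' t01) Bb) => /=.
  rewrite enormB -/n; congr (_ <= _); rewrite -[RHS]enormN; congr enorm.
  by congr (_, _) => /=; rewrite /GRing.scale/=; ring.
have h2 : 0 <= lin n (b' - b).
  apply: key => t t0 t1; have t01 : 0 <= t <= 1 by rewrite (ltW t0).
  have := H (a, b + t *: (b' - b)) (conj Aa (cB b b' t Bb Bb' t01)) => /=.
  rewrite enormB -/n; congr (_ <= _); rewrite -[RHS]enormN; congr enorm.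
  by congr (_, _) => /=; rewrite /GRing.scale/=; ring.
have : lin n (b - a) = N by [].
by move: h1 h2; rewrite !linB; lra.
Qed.

(* Two disjoint convex bodies have a common supporting line with both bodies on
   the same side; along that direction one of them lies in the shadow of the other. *)
Lemma shadow A B : ccs A -> ccs B -> A !=set0 -> B !=set0 -> A `&` B = set0 ->
  exists d, (forall z, A z -> exists2 t : R, 0 <= t & B (z + t *: d)) \/
            (forall z, B z -> exists2 t : R, 0 <= t & A (z + t *: d)).
Proof.
move=> hA hB A0 B0 AB.
have [n [g [n0 g0 sep]]] := separation hA hB A0 B0 AB.
have n2 := sqr_sum_gt0 n0; set N := n.1 ^+ 2 + n.2 ^+ 2 in n2.
have Nn : N != 0 by rewrite gt_eqF.
have [a0 Aa0] := A0; have [b0 Bb0] := B0.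
(* The level lines of [f k] tilt with [k], always transversally to the separating line; [h C k] is
   the value of the supporting line of [C] on one side. *)
pose f (k : R) x := lin (perp n) x + k * lin n x.
have cf k : continuous (f k).
  move=> x; apply: cvgD; first exact: lin_continuous.
  by apply: cvgM; [exact: cvg_cst|exact: lin_continuous].
have [kA cA] := hA; have [kB cB] := hB.
pose h (C : set plane) k := sup (f k @` C).
have hmax C k : compact C -> C !=set0 -> exists2 x, C x & f k x = h C k /\ forall y, C y -> f k y <= f k x.
  move=> kC C0; have [x Cx Hx] := compact_max C0 kC (cf k).
  exists x => //; split=> //; apply/le_anti/andP; split.
    apply: ub_le_sup; last by exists x.
    by exists (f k x) => _ [y Cy <-]; exact: Hx.
  by apply: ge_sup; [exists (f k x), x|move=> _ [y Cy <-]; exact: Hx].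
have [M AM] := ccs_box hA; have [M' BM'] := ccs_box hB.
have bound C : compact C -> exists2 S, 0 <= S & forall x, C x -> `|lin n x| <= S /\ `|lin (perp n) x| <= S.
  move=> kC.
  have b (p : plane) : exists2 S : R, 0 <= S & forall x, C x -> `|lin p x| <= S.
    have kI : compact (lin p @` C).
      by apply: continuous_compact => //; apply: continuous_subspaceT; exact: lin_continuous.
    have /compact_bounded[S [_ HS]] := kI.
    exists (`|S| + 1); first by rewrite addr_ge0.
    move=> x Cx; apply: (HS (`|S| + 1)); last by exists x.
    by rewrite ltr_pwDr// ler_norm.
  have [S1 S10 H1] := b n; have [S2 S20 H2] := b (perp n).
  exists (S1 + S2); first by rewrite addr_ge0.
  by move=> x Cx; have := H1 x Cx; have := H2 x Cx; clear -S10 S20; split; lra.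
have [SA SA0 HA] := bound A kA; have [SB SB0 HB] := bound B kB.
have lip C S : compact C -> C !=set0 -> (forall x, C x -> `|lin n x| <= S) ->
    forall k k', h C k' <= h C k + S * `|k' - k|.
  move=> kC C0 HS k k'; have [x Cx [<- _]] := hmax C k' kC C0.
  have [y Cy [<- Hy]] := hmax C k kC C0.
  have -> : f k' x = f k x + (k' - k) * lin n x by rewrite /f; ring.
  apply: lerD; first exact: Hy.
  apply: le_trans (ler_norm _) _; rewrite normrM mulrC ler_wpM2r//; exact: HS.
have clip C S : compact C -> C !=set0 -> 0 <= S -> (forall x, C x -> `|lin n x| <= S) -> continuous (h C).
  move=> kC C0 S0 HS k; apply/cvgrPdist_le => e e0.
  have d0 : 0 < e / (S + 1) by rewrite divr_gt0//; lra.
  apply/(@nbhs_ballP R R); exists (e / (S + 1)) => //= k' kk'.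
  have l1 := lip C S kC C0 HS k k'; have l2 := lip C S kC C0 HS k' k.
  rewrite [`|k - k'|]distrC in l2.
  have : `|k' - k| * (S + 1) <= e.
    by rewrite -ler_pdivlMr; [move: kk'; rewrite /ball/= distrC => /ltW|lra].
  have := normr_ge0 (k' - k); move: (`|k' - k|) l1 l2 => q l1 l2 q0 qe.
  by rewrite ler_norml; clear -l1 l2 q0 qe; apply/andP; split; nra.
have cD : continuous (fun k => h B k - h A k).
  move=> k; apply: cvgB; first by apply: (clip B SB) => // x /HB[].
  by apply: (clip A SA) => // x /HA[].
(* At slope [K] the separation gap, multiplied by [K], outweighs the tangential extents of both
   sets, so [B] reaches higher; at [- K] it is [A]. The intermediate value theorem gives a common
   supporting line. *)
pose K := (SA + SB) / g.
have K0 : 0 <= K by rewrite divr_ge0 ?addr_ge0// ltW.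
have Kg : K * g = SA + SB by rewrite /K divfK// gt_eqF.
have pos : 0 <= h B K - h A K.
  have [x Ax [<- _]] := hmax A K kA A0; have [y By [<- _]] := hmax B K kB B0.
  have := sep x y Ax By; have [_ /ler_normlP[h1 h2]] := HA x Ax; have [_ /ler_normlP[h3 h4]] := HB y By.
  by rewrite /f; clear -h1 h2 h3 h4 Kg K0 g0; nra.
have neg : h B (- K) - h A (- K) <= 0.
  have [x Ax [<- _]] := hmax A (- K) kA A0; have [y By [<- _]] := hmax B (- K) kB B0.
  have := sep x y Ax By; have [_ /ler_normlP[h1 h2]] := HA x Ax; have [_ /ler_normlP[h3 h4]] := HB y By.
  by rewrite /f; clear -h1 h2 h3 h4 Kg K0 g0; nra.
have [|||k _ hk] := @IVT R (fun k => h B k - h A k) (- K) K 0.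
- by lra.
- exact: continuous_subspaceT.
- by rewrite ge_min neg le_max pos orbT.
have [a1 Aa1 [fa1 Ha1]] := hmax A k kA A0; have [b1 Bb1 [fb1 Hb1]] := hmax B k kB B0.
have [a2 Aa2 Ha2] := compact_min A0 kA (cf k); have [b2 Bb2 Hb2] := compact_min B0 kB (cf k).
have fab : f k a1 = f k b1 by rewrite fa1 fb1; lra.
pose d := N^-1 *: (n - k *: perp n).
have fd w z : f k w = f k z -> w = z + (lin n w - lin n z) *: d.
  rewrite /f /d => E.
  have P : lin (perp n) w - lin (perp n) z = - k * (lin n w - lin n z) by clear -E; lra.
  transitivity (z + N^-1 *: ((lin n w - lin n z) *: n + (lin (perp n) w - lin (perp n) z) *: perp n)).
    rewrite -!linB -[LHS](subrK z) [LHS]addrC; congr (_ + _).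
    move: (w - z) => v; rewrite /lin /perp /N in Nn *.
    by case: v => v1 v2; congr (_, _) => /=; rewrite /GRing.scale/=; field.
  by rewrite P; congr (_, _) => /=; rewrite /GRing.scale/=; ring.
have hit C c1 c2 (y : R) : cvx C -> C c1 -> C c2 -> f k c2 <= y -> y <= f k c1 -> exists2 w, C w & f k w = y.
  move=> cC C1 C2 y1 y2; have [E|E] := eqVneq (f k c1) (f k c2).
    by exists c1 => //; apply/le_anti; rewrite y2 E y1.
  have p : 0 < f k c1 - f k c2 by rewrite subr_gt0 lt_neqAle eq_sym E; exact: le_trans y2.
  exists (c2 + ((y - f k c2) / (f k c1 - f k c2)) *: (c1 - c2)).
    apply: cC => //; rewrite divr_ge0 ?(ltW p) ?subr_ge0//= ler_pdivrMr// mul1r; clear -y1 y2; lra.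
  have fl (t : R) : f k (c2 + t *: (c1 - c2)) = f k c2 + t * (f k c1 - f k c2).
    by rewrite /f !linD !linZ !linB; ring.
  by rewrite fl divfK ?gt_eqF//; ring.
(* With equal maxima, the set with the lower minimum of [f k] covers the whole range of the other,
   so every level line meeting the latter meets the former. *)
have [ba|ab] := leP (f k b2) (f k a2).
  exists d; left => z Az.
  have [w Bw fw] : exists2 w, B w & f k w = f k z.
    by apply: (hit B b1 b2) => //; [exact: le_trans (Ha2 z Az)|rewrite -fab; exact: Ha1].
  exists (lin n w - lin n z); last by rewrite -fd.
  by have := sep z w Az Bw; clear -g0; lra.
exists (- d); right => z Bz.
have [w Aw fw] : exists2 w, A w & f k w = f k z.
  by apply: (hit A a1 a2) => //; [exact: le_trans (ltW ab) (Hb2 z Bz)|rewrite fab; exact: Hb1].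
exists (lin n z - lin n w); last by rewrite scalerN -scaleNr opprB -fd.
by have := sep w z Aw Bz; clear -g0; lra.
Qed.

End Shadow.

(** * Merging disjoint convex pieces *)

Section Merge.
Context {R : realType}.
Local Notation plane := (plane R).
Implicit Types (A B E K X Y Z : set plane) (x y z v e d : plane) (s o r : seq (set plane)).

Definition ar A : R := fine (area A).
Definition uni s : set plane := [set x | exists2 C, C \in s & C x].

Lemma area_box_fin A (M : R) : A `<=` box M -> area A \is a fin_num.
Proof.
move=> AM; rewrite ge0_fin_numE ?area_ge0//; apply: le_lt_trans (le_area AM) _.
by rewrite area_borel ?box_finite//; exact: box_measurable.
Qed.

Lemma arE A (M : R) : A `<=` box M -> area A = (ar A)%:E.
Proof. by move=> AM; rewrite /ar fineK//; exact: area_box_fin AM. Qed.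

Lemma ar_ge0 A : 0 <= ar A.
Proof. exact/fine_ge0/area_ge0. Qed.

Lemma ar_le A B (M : R) : B `<=` box M -> A `<=` B -> ar A <= ar B.
Proof.
move=> BM AB; apply: fine_le; [exact: area_box_fin (subset_trans AB BM)|exact: area_box_fin BM|exact: le_area].
Qed.

Lemma arU_le A B (M : R) : A `<=` box M -> B `<=` box M -> ar (A `|` B) <= ar A + ar B.
Proof.
move=> AM BM; rewrite -lee_fin EFinD -(arE AM) -(arE BM) -(@arE _ M) ?areaU//.
by move=> x [/AM|/BM].
Qed.

Lemma arU_ge A B (M : R) : A `<=` box M -> B `<=` box M -> measurable A -> area (A `&` B) = 0%E ->
  ar A + ar B <= ar (A `|` B).
Proof.
move=> AM BM mA AB; rewrite -lee_fin EFinD -(arE AM) -(arE BM) -(@arE _ M); last by move=> x [/AM|/BM].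
have lA := borel_lmeasurable mA.
rewrite (areaD_split (A `|` B) lA) (areaD_split B lA) setIC AB add0e.
by apply: leeD; apply: le_area => x /=; [move=> Ax; split=> //; left|move=> [Bx nA]; split=> //; right].
Qed.

Lemma uni_cons Z s : uni (Z :: s) = Z `|` uni s.
Proof.
apply/seteqP; split=> x.
  by move=> [C]; rewrite inE => /orP[/eqP->|Cs] Cx; [left|right; exists C].
by move=> [Zx|[C Cs Cx]]; [exists Z; rewrite ?mem_head|exists C; rewrite // inE Cs orbT].
Qed.

Lemma uni_nil : uni [::] = set0.
Proof. by apply/seteqP; split=> x // []. Qed.

Lemma uni_sub s E : (forall Z, Z \in s -> Z `<=` E) -> uni s `<=` E.
Proof. by move=> H x [C Cs Cx]; exact: (H C). Qed.

Lemma uni_perm s s' : perm_eq s s' -> uni s = uni s'.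
Proof. by move=> p; apply/seteqP; split=> x [C Cs Cx]; exists C; rewrite // ?(perm_mem p)// -(perm_mem p). Qed.

Lemma uni_compact s : (forall Z, Z \in s -> compact Z) -> compact (uni s).
Proof.
elim: s => [|Z s IH] H; first by rewrite uni_nil; exact: compact0.
rewrite uni_cons; apply: compactU; first by apply: H; rewrite mem_head.
by apply: IH => C Cs; apply: H; rewrite inE Cs orbT.
Qed.

Lemma uni_null s A : (forall Z, Z \in s -> area (A `&` Z) = 0%E) -> area (A `&` uni s) = 0%E.
Proof.
elim: s => [|Z s IH] H.
  by rewrite uni_nil setI0 area0.
rewrite uni_cons setIUr; apply/eqP; rewrite eq_le area_ge0 andbT.
apply: le_trans (areaU _ _) _; rewrite H ?mem_head// IH ?adde0// => C Cs.
by apply: H; rewrite inE Cs orbT.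
Qed.

Lemma ccs_translate A v : ccs A -> ccs [set x | A (x - v)].
Proof.
move=> [kA cA]; split.
  rewrite (_ : [set x | A (x - v)] = (fun x => x + v) @` A); last first.
    apply/seteqP; split=> x /=; first by move=> Ax; exists (x - v); rewrite ?subrK.
    by move=> [y Ay <-]; rewrite addrK.
  apply: continuous_compact => //; apply: continuous_subspaceT => x.
  by apply: cvgD; [exact: cvg_id|exact: cvg_cst].
move=> x y t /= Ax Ay t01; rewrite (_ : _ - v = (x - v) + t *: ((y - v) - (x - v))); first exact: cA.
by rewrite opprB addrA subrK addrAC.
Qed.

Lemma ccs_separated A B p (r : R) : 0 < r -> eball p r `<=` A `&` B -> forall d, exists2 h : R, 0 < h &
  forall t : R, 0 <= t <= h -> A (p + t *: d) /\ B p.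
Proof.
move=> r0 pr d; exists (r / (enorm d + 1) / 2).
  by rewrite !divr_gt0// ltr_wpDl ?enorm_ge0.
have d1 : 0 < enorm d + 1 by rewrite ltr_wpDl ?enorm_ge0.
move=> t /andP[t0 th]; split; last by have [] := pr p; rewrite /eball/= ?subrr ?enorm0.
have [] // := pr (p + t *: d); rewrite /eball/= addrAC subrr add0r enormZ ger0_norm//.
apply: (@le_lt_trans _ _ (t * (enorm d + 1))); first by rewrite ler_wpM2l// lerDl.
by rewrite -ltr_pdivlMr//; apply: le_lt_trans th _; have := divr_gt0 r0 d1; lra.
Qed.

(** [T] is the least time at which a point of [X] moving along [d] hits another piece. No point has
    passed its shadow in [Y] by then, so convexity keeps the translate in [E]. An overlap of
    positive area would contain a ball, and moving back a little would give an earlier contact. *)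
Lemma translate_to_touch E X Y d o : cvx E -> ccs X -> X !=set0 -> X `<=` E ->
  (forall Z, Z \in o -> ccs Z /\ Z `<=` E) -> Y \in o ->
  (forall Z, Z \in o -> X `&` Z = set0) ->
  (forall z, X z -> exists2 t : R, 0 <= t & Y (z + t *: d)) ->
  exists v, [/\ [set x | X (x - v)] `<=` E,
    exists Z p, [/\ Z \in o, X (p - v) & Z p] &
    forall Z, Z \in o -> area ([set x | X (x - v)] `&` Z) = 0%E].
Proof.
move=> cE [kX cX] [z0 Xz0] XE ho Yo dis sh.
have ko : compact (uni o) by apply: uni_compact => Z /ho[[]].
have clo : closed (uni o) by apply: compact_closed => //; exact: norm_hausdorff.
have [t0 t00 Yz0] := sh z0 Xz0.
pose G : set (plane * R) := (X `*` `[0, t0]%classic) `&` (fun p : plane * R => p.1 + p.2 *: d) @^-1` uni o.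
have cG : continuous (fun p : plane * R => p.1 + p.2 *: d).
  move=> p; apply: cvgD; first exact: cvg_fst.
  by apply: cvgZl; exact: cvg_snd.
have kG : compact G.
  apply: compact_closedI; first by apply: compact_setX => //; exact: segment_compact.
  by apply: preimage_closed => // x _; exact: cG.
have uY z : Y z -> uni o z by move=> Yz; exists Y.
have [|[z1 T] [[/= Xz1 T0]] uT HT] := @compact_min R _ G (fun p => p.2) _ kG (fun p => @cvg_snd _ _ _ _ _).
  by exists (z0, t0); split=> /=; [split=> //=; rewrite in_itv/= t00 lexx|exact: uY].
move: T0; rewrite in_itv/= => /andP[T0 Tt0].
have Tpos : 0 < T.
  rewrite lt_neqAle T0 andbT; apply/eqP => E0; rewrite -E0 scale0r addr0 in uT.
  by have [Z Zo Zz] := uT; have : (X `&` Z) z1 by []; rewrite dis.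
have Tmin z (t : R) : X z -> 0 <= t -> uni o (z + t *: d) -> T <= t.
  move=> Xz ht uz; have [tt|/ltW] := leP t t0; last exact: le_trans.
  by apply: (HT (z, t)); split=> //=; split=> //=; rewrite in_itv/= ht tt.
exists (T *: d); split.
- move=> x /= Xx; have [t ht Yt] := sh _ Xx.
  have Tt := Tmin _ _ Xx ht (uY _ Yt).
  have t_gt0 : 0 < t by exact: lt_le_trans Tt.
  rewrite (_ : x = (x - T *: d) + (T / t) *: ((x - T *: d + t *: d) - (x - T *: d))).
    apply: cE; [exact: XE|exact: (proj2 (ho _ Yo))|].
    by rewrite divr_ge0//= ler_pdivrMr// mul1r.
  by rewrite [_ + t *: d]addrC addrK scalerA divfK ?gt_eqF// subrK.
- by have [Z Zo Zp] := uT; exists Z, (z1 + T *: d); rewrite addrK.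
- move=> Z Zo; have [hZ ZE] := ho Z Zo; have hX := ccs_translate (T *: d) (conj kX cX).
  apply: contrapT => /eqP pos.
  have [M ZM] := ccs_box hZ.
  have IM : [set x | X (x - T *: d)] `&` Z `<=` box (`|M| + 1).
    by move=> x [_ /ZM] /boxP[h1 h2]; apply/boxP; have := ler_norm M; split; lra.
  have cI := cvxI hX.2 hZ.2.
  have M0 : 0 < `|M| + 1 by rewrite ltr_wpDl.
  have a0 : 0 < ar ([set x | X (x - T *: d)] `&` Z).
    by rewrite -lte_fin -(arE IM) lt_neqAle eq_sym pos area_ge0.
  have [|p bp] := cvx_has_ball cI IM M0 a0; first by rewrite (arE IM).
  have r0 : 0 < ar ([set x | X (x - T *: d)] `&` Z) / (216 * (`|M| + 1)).
    by apply: (divr_gt0 a0); apply: mulr_gt0; [rewrite ltr0n|exact: M0].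
  have [h h0 H] := ccs_separated r0 bp d.
  pose k := Num.min h T.
  have k0 : 0 < k by rewrite lt_min h0.
  have [|Xk Zp] := H k; first by rewrite (ltW k0) /k ge_min lexx.
  have kT : k <= T by rewrite /k ge_min lexx orbT.
  have : T <= T - k.
    apply: (Tmin _ _ Xk); first by rewrite subr_ge0.
    exists Z => //; rewrite (_ : _ + _ = p)//.
    by rewrite scalerBl addrA subrK addrK.
  lra.
Qed.

Context (l : seq (R * plane)) (kappa C : R).
Hypothesis hl : forall p, p \in l -> 0 <= p.1.
(** The rotated norm: [wperimeter] uses the directions [perp p.2], so a segment of vector [x] has
    perimeter [2 psip x], both sides counted. *)
Definition psip x : R := \sum_(p <- l) p.1 * `|lin (perp p.2) x|.
Hypothesis psip_lo : forall x, kappa * enorm x <= psip x.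
Hypothesis psip_hi : forall x, psip x <= C * enorm x.
Hypotheses (kappa0 : 0 < kappa) (C0 : 0 < C).

Lemma wperimeter_union A B M x1 x2 y1 y2 : A `<=` box M -> B `<=` box M ->
  A x1 -> A x2 -> B y1 -> B y2 ->
  wperimeter l (A `|` B) <= wperimeter l A + wperimeter l B -
    2 * (psip (x2 - x1) - psip (x1 - y1) - psip (x2 - y2)).
Proof.
move=> AM BM Ax1 Ax2 By1 By2; rewrite /wperimeter /psip -big_split/= -!sumrB mulr_sumr -sumrB.
rewrite big_seq [leRHS]big_seq; apply: ler_sum => p pl.
have := @width_union _ (perp p.2) _ _ _ _ _ _ _ AM BM Ax1 Ax2 By1 By2; have := hl pl.
set a := p.1; move: (width _ _) (width _ _) (width _ _) (`|_|) (`|_|) (`|_|) => wU wA wB u v w a0 H.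
have : 0 <= a * (wA + wU - (w - v - u) - wB) by rewrite mulr_ge0// subr_ge0.
by lra.
Qed.

Lemma wperimeter_mono A B M : B `<=` box M -> (forall e, width e A <= width e B) ->
  wperimeter l A <= wperimeter l B.
Proof.
move=> BM H; rewrite /wperimeter big_seq [leRHS]big_seq; apply: ler_sum => p pl.
by rewrite ler_wpM2l// mulr_ge0 ?hl.
Qed.

Lemma wperimeter_sub A B M : B `<=` box M -> A `<=` B -> wperimeter l A <= wperimeter l B.
Proof. by move=> BM AB; apply: (wperimeter_mono BM) => e; exact: width_sub BM AB. Qed.

Lemma wperimeter_chull A M : A `<=` box M -> wperimeter l (chull A) <= wperimeter l A.
Proof. by move=> AM; apply: (wperimeter_mono AM) => e; exact: width_chull AM. Qed.

Lemma wperimeter_ge0 A M : A `<=` box M -> 0 <= wperimeter l A.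
Proof.
move=> AM; rewrite /wperimeter big_seq; apply: sumr_ge0 => p pl.
by rewrite mulr_ge0 ?(width_ge0 _ AM)// mulr_ge0 ?hl.
Qed.

Lemma wperimeter_translate A v : wperimeter l [set x | A (x - v)] = wperimeter l A.
Proof. by apply: eq_bigr => p _; rewrite width_translate. Qed.

Lemma wperimeter_ge A M x y : A `<=` box M -> A x -> A y -> 2 * psip (x - y) <= wperimeter l A.
Proof.
move=> AM Ax Ay; rewrite /wperimeter /psip mulr_sumr big_seq [leRHS]big_seq; apply: ler_sum => p pl.
rewrite -mulrA ler_wpM2l// ler_wpM2l ?hl// ler_norml; apply/andP; split.
  by rewrite lerNl (_ : - lin _ _ = lin (perp p.2) (y - x)); [exact: width_ge AM _ _|rewrite !linB opprB].
exact: width_ge AM _ _.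
Qed.

(** A perimeter [W] forces diameter at most [W / (2 kappa)], hence area at most [(W / kappa)^2]. For
    small area this quadratic bound beats any linear rate [c], which makes small pieces
    expensive. *)
Lemma wperimeter_area A M (c : R) : measurable A -> A `<=` box M -> A !=set0 -> 0 < c -> ar A < kappa ^+ 2 / c ^+ 2 ->
  c * ar A <= wperimeter l A.
Proof.
move=> mA AM [x Ax] c0 small.
set W := wperimeter l A; have W0 : 0 <= W by exact: wperimeter_ge0 AM.
pose d := W / (2 * kappa).
have d0 : 0 <= d by rewrite divr_ge0// mulr_ge0// ltW.
have sub : [set y | A (y - (- x))] `<=` box d.
  move=> y /= Ay; have h : enorm y <= d.
    rewrite ler_pdivlMr ?mulr_gt0//; have := wperimeter_ge AM Ay Ax.
    rewrite opprK addrK => H; apply: le_trans H; have := psip_lo y; lra.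
  by apply/boxP; split; apply: le_trans h; [exact: le_enorm1|exact: le_enorm2].
have ad : ar A <= (2 * d) ^+ 2.
  have : (area A <= ((2 * d) ^+ 2)%:E)%E.
    rewrite -(area_translate (- x) mA).2; apply: le_trans (le_area sub) _; rewrite area_borel; last exact: box_measurable.
    by rewrite /box box_area ?lee_fin; lra.
  by rewrite (arE AM) lee_fin.
have {}ad : ar A <= (W / kappa) ^+ 2.
  by apply: le_trans ad _; rewrite /d le_eqVlt; apply/orP; left; apply/eqP; field; rewrite gt_eqF.
rewrite leNgt; apply/negP => lt.
have a0 := ar_ge0 A.
have Wc : W ^+ 2 <= (c * ar A) ^+ 2 by rewrite ler_sqr ?nnegrE ?mulr_ge0// ltW.
have k2 : 0 < kappa ^+ 2 by rewrite exprn_gt0.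
have c2 : 0 < c ^+ 2 by rewrite exprn_gt0.
have ap : 0 < ar A.
  by rewrite lt_neqAle a0 andbT; apply/eqP => E0; rewrite -E0 mulr0 ltNge W0 in lt.
have h1 : ar A * kappa ^+ 2 <= W ^+ 2 by rewrite expr_div_n ler_pdivlMr in ad.
have h2 : ar A * c ^+ 2 < kappa ^+ 2 by rewrite ltr_pdivlMr in small.
have : ar A * kappa ^+ 2 <= ar A * (ar A * c ^+ 2) by apply: le_trans h1 _; apply: le_trans Wc _; lra.
by rewrite ler_pM2l// leNgt h2.
Qed.

End Merge.

Section Reduce.
Context {R : realType}.
Local Notation plane := (plane R).
Implicit Types (A B K V X Y Z : set plane) (x y z v d : plane) (s o r : seq (set plane)).

Context (l : seq (R * plane)) (kappa C : R).
Hypothesis hl : forall p, p \in l -> 0 <= p.1.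
Hypothesis psip_lo : forall x, kappa * enorm x <= psip l x.
Hypothesis psip_hi : forall x, psip l x <= C * enorm x.
Hypotheses (kappa0 : 0 < kappa) (C0 : 0 < C).
Context (E : set plane) (M c : R).
Hypotheses (hE : ccs E) (EM : E `<=` box M) (M0 : 0 < M) (c0 : 0 < c).

Definition lperimeter s : R := \sum_(Z <- s) wperimeter l Z.
(** The lower bound on areas gives every piece a ball of a common radius, so all gains below are
    uniform in the number and shape of the pieces. *)
Definition good s := forall Z, Z \in s -> [/\ ccs Z, Z `<=` E & c <= ar Z].

Let psip0 : psip l 0 = 0.
Proof.
by apply/le_anti; have := psip_hi 0; have := psip_lo 0; rewrite enorm0 !mulr0 => -> ->.
Qed.

Let subM A : A `<=` E -> A `<=` box M.
Proof. by move=> AE; exact: subset_trans EM. Qed.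

Let good_sub s : good s -> uni s `<=` E.
Proof. by move=> g; apply: uni_sub => Z /g[]. Qed.

Let good_ball A : ccs A -> A `<=` E -> c <= ar A -> exists a, eball a (c / (216 * M)) `<=` A.
Proof.
move=> hA AE cA; apply: cvx_has_ball => //; [exact: hA.2|exact: subM|].
by rewrite (arE (subM AE)) lee_fin.
Qed.

Lemma good_perm s s' : perm_eq s s' -> good s -> good s'.
Proof. by move=> p g Z; rewrite -(perm_mem p); exact: g. Qed.

Lemma lperimeter_perm s s' : perm_eq s s' -> lperimeter s = lperimeter s'.
Proof. by move=> p; rewrite /lperimeter (perm_big _ p). Qed.

Lemma merge_two A B r x1 x2 y1 y2 : good (A :: B :: r) -> A x1 -> A x2 -> B y1 -> B y2 ->
  [/\ good (chull (A `|` B) :: r), uni (A :: B :: r) `<=` uni (chull (A `|` B) :: r) &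
    lperimeter (chull (A `|` B) :: r) <= lperimeter (A :: B :: r) -
      2 * (psip l (x2 - x1) - psip l (x1 - y1) - psip l (x2 - y2))].
Proof.
move=> g Ax1 Ax2 By1 By2.
have [hA AE cA] : [/\ ccs A, A `<=` E & c <= ar A] by apply: g; rewrite mem_head.
have [hB BE cB] : [/\ ccs B, B `<=` E & c <= ar B] by apply: g; rewrite !inE eqxx orbT.
have UE : A `|` B `<=` E by move=> x [/AE|/BE].
have HE : chull (A `|` B) `<=` E by apply: chull_min => //; [exact: ccs_closed|exact: hE.2].
split.
- move=> Z; rewrite inE => /orP[/eqP->|Zr]; last by apply: g; rewrite !inE Zr !orbT.
  split=> //; first exact: chull_ccs (subM UE).
  by apply: le_trans cA _; apply: ar_le (subM HE) _ => x Ax; apply: chull_sub; left.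
- rewrite !uni_cons => x [Ax|[Bx|rx]]; [left|left|by right]; apply: chull_sub; [by left|by right].
- rewrite /lperimeter !big_cons.
  have := wperimeter_union hl (subM AE) (subM BE) Ax1 Ax2 By1 By2.
  have := wperimeter_chull hl (subM UE).
  by move: (wperimeter l (chull _)) (wperimeter l (_ `|` _)) => a b; lra.
Qed.

Lemma merge_meeting X o Z : good (X :: o) -> Z \in o -> X `&` Z !=set0 ->
  exists s, [/\ (size s <= size o)%N, good s, lperimeter s <= lperimeter (X :: o) & uni (X :: o) `<=` uni s].
Proof.
move=> g Zo [x [Xx Zx]].
have p : perm_eq (X :: o) (X :: Z :: rem Z o) by rewrite perm_cons perm_to_rem.
have [g1 u1 t1] := merge_two (good_perm p g) Xx Xx Zx Zx.
exists (chull (X `|` Z) :: rem Z o); split=> //.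
- by rewrite /= size_rem// prednK//; case: (o) Zo.
- by rewrite (lperimeter_perm p); apply: le_trans t1 _; rewrite !subrr psip0; lra.
- by rewrite (uni_perm p).
Qed.

(** [rho] is the radius from [cvx_has_ball]. [delta] makes each end defect [C * delta] at most a
    quarter of [kappa * rho]. [r0] is the radius of the hole from [touch_gap]. [h] is a length that
    every piece contains from any of its points, short enough to remain in the hole when starting in
    its inner half. *)
Let rho := c / (216 * M).
Let delta := Num.min M (kappa * rho / (4 * C)).
Let r0 := delta * rho / (32 * M).
Let h := Num.min (rho / 4) (r0 / 4).
(** One term for each outcome of a merge. A contact of length [rho] saves
    [2 (1 - 1/4 - 1/4) kappa rho] of perimeter. Filling the inner half of the hole adds area at
    least [(r0 / 2)^2 / 3]. A third piece entering the hole shares a segment of length [h] with the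
    hull, which saves [2 kappa h]. *)
Definition gain := Num.min (kappa * rho) (Num.min (r0 ^+ 2 / 12) (2 * (kappa * h))).

Let rho0 : 0 < rho.
Proof. by apply: divr_gt0; [exact: c0|apply: mulr_gt0; [rewrite ltr0n|exact: M0]]. Qed.
Let delta0 : 0 < delta. Proof. by rewrite /delta lt_min M0/=; apply: divr_gt0; apply: mulr_gt0. Qed.
Let r00 : 0 < r0. Proof. by apply: divr_gt0; apply: mulr_gt0. Qed.
Let h0 : 0 < h. Proof. by rewrite /h lt_min; apply/andP; split; apply: divr_gt0. Qed.

Lemma gain_gt0 : 0 < gain.
Proof.
rewrite /gain !lt_min; apply/and3P; split; first exact: mulr_gt0.
  by apply: divr_gt0 => //; exact: exprn_gt0.
by apply: mulr_gt0 => //; exact: mulr_gt0.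
Qed.

Lemma far_point V z : ccs V -> V `<=` E -> c <= ar V -> V z -> exists2 w, V w & enorm (w - z) = h.
Proof.
move=> hV VE cV Vz; have [a aV] := good_ball hV VE cV.
have [w Vw wz] : exists2 w, V w & rho / 4 <= enorm (w - z).
  have n1 : enorm ((rho / 2, 0) : plane) = rho / 2.
    by rewrite /enorm/= expr0n addr0 sqrtr_sqr ger0_norm// divr_ge0// ltW.
  have [le|lt] := leP (rho / 4) (enorm (a - z)).
    by exists a => //; apply: aV; rewrite /eball/= subrr enorm0.
  exists (a + (rho / 2, 0)).
    by apply: aV; rewrite /eball/= addrAC subrr add0r n1; have := rho0; rewrite -/rho; lra.
  have := enormD (a + (rho / 2, 0) - z) (z - a).
  by rewrite addrA subrK addrAC subrr add0r n1 (enormB z a); lra.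
have w0 : 0 < enorm (w - z) by apply: lt_le_trans wz; rewrite divr_gt0.
exists (z + (h / enorm (w - z)) *: (w - z)).
  apply: hV.2 => //; apply/andP; split; first by rewrite divr_ge0 ?(ltW h0)// ltW.
  rewrite ler_pdivrMr// mul1r.
  by apply: le_trans wz; rewrite /h ge_min lexx.
by rewrite addrAC subrr add0r enormZ ger0_norm ?divfK ?gt_eqF// divr_ge0 ?(ltW h0)// ltW.
Qed.

(** Moving loses no area because the overlaps after translation are null. Once in contact, [X] and
    the piece it touches either run side by side along length [rho], or their hull fills a hole. *)
Lemma move_merge X Y d o : good (X :: o) -> Y \in o -> (forall Z, Z \in o -> X `&` Z = set0) ->
  (forall z, X z -> exists2 t : R, 0 <= t & Y (z + t *: d)) ->
  exists s, [/\ (size s <= size o)%N, good s, lperimeter s <= lperimeter (X :: o), ar (uni (X :: o)) <= ar (uni s) &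
    lperimeter s + gain <= lperimeter (X :: o) \/ ar (uni (X :: o)) + gain <= ar (uni s)].
Proof.
move=> g Yo dis sh.
have go Z : Z \in o -> [/\ ccs Z, Z `<=` E & c <= ar Z] by move=> Zo; apply: g; rewrite inE Zo orbT.
have [hX XE cX] : [/\ ccs X, X `<=` E & c <= ar X] by apply: g; rewrite mem_head.
have X0 : X !=set0.
  have [a aX] := good_ball hX XE cX; exists a; apply: aX.
  by rewrite /eball/= subrr enorm0; exact: rho0.
have ho Z : Z \in o -> ccs Z /\ Z `<=` E by move=> /go[].
have [v [vE [Z [p [Zo Xp Zp]]] null]] := translate_to_touch hE.2 hX X0 XE ho Yo dis sh.
set X' := [set x | X (x - v)] in vE null.
have hX' : ccs X' by exact: ccs_translate.
have mX := ccs_measurable hX; have mX' := ccs_measurable hX'.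
have arX : ar X' = ar X by rewrite /ar /X' (area_translate v mX).2.
have uoE : uni o `<=` E by apply: uni_sub => V /ho[].
have area1 : ar (uni (X :: o)) <= ar (uni (X' :: o)).
  rewrite !uni_cons; apply: le_trans (arU_le (subM XE) (subM uoE)) _.
  by rewrite -arX; apply: arU_ge (subM vE) (subM uoE) mX' _; exact: uni_null.
have tot1 : lperimeter (X' :: o) = lperimeter (X :: o) by rewrite /lperimeter !big_cons wperimeter_translate.
have pe : perm_eq (X' :: o) (X' :: Z :: rem Z o) by rewrite perm_cons perm_to_rem.
have sz : (size (rem Z o)).+1 = size o by rewrite size_rem// prednK//; case: (o) Zo.
have g1 : good (X' :: Z :: rem Z o).
  apply: (good_perm pe) => V; rewrite inE => /orP[/eqP->|/go//]; by split; rewrite ?arX.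
have {}tot1 : lperimeter (X' :: Z :: rem Z o) = lperimeter (X :: o) by rewrite -(lperimeter_perm pe).
have {}area1 : ar (uni (X :: o)) <= ar (uni (X' :: Z :: rem Z o)) by rewrite -(uni_perm pe).
have sub1 : uni (X' :: Z :: rem Z o) `<=` E by exact: good_sub.
have [hZ ZE cZ] := go Z Zo.
have HE : chull (X' `|` Z) `<=` E.
  by apply: chull_min; [exact: ccs_closed|exact: hE.2|move=> x [/vE|/ZE]].
have [a aX] : exists a, eball a rho `<=` X' by apply: good_ball => //; rewrite arX.
have [b bZ] := good_ball hZ ZE cZ.
have dM : delta <= M by rewrite /delta ge_min lexx.
have dC : C * delta <= kappa * rho / 4.
  have : delta <= kappa * rho / (4 * C) by rewrite /delta ge_min lexx orbT.
  by rewrite ler_pdivlMr ?mulr_gt0//; lra.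
have gle : [/\ gain <= kappa * rho, gain <= r0 ^+ 2 / 12 & gain <= 2 * (kappa * h)].
  by rewrite /gain; split; rewrite !ge_min lexx ?orbT.
have [g_1 g_2 g_3] := gle.
have [[x1 [x2 [y1 [y2 [[Xx1 Xx2 Zy1 Zy2] [d12 d1 d2]]]]]]|[q gap]] :=
    touch_gap hX' hZ (subM vE) (subM ZE) aX bZ rho0 delta0 dM (null Z Zo).
  have [g2 u2 t2] := merge_two g1 Xx1 Xx2 Zy1 Zy2.
  have P1 : kappa * rho <= psip l (x2 - x1) by apply: le_trans (psip_lo _); rewrite ler_pM2l.
  have P2 : psip l (x1 - y1) <= kappa * rho / 4.
    by apply: le_trans dC; apply: le_trans (psip_hi _) _; rewrite ler_pM2l.
  have P3 : psip l (x2 - y2) <= kappa * rho / 4.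
    by apply: le_trans dC; apply: le_trans (psip_hi _) _; rewrite ler_pM2l.
  have T : lperimeter (chull (X' `|` Z) :: rem Z o) + gain <= lperimeter (X :: o).
    by rewrite -tot1; lra.
  exists (chull (X' `|` Z) :: rem Z o); split=> //.
  - by rewrite /= sz.
  - by apply: le_trans T; rewrite lerDl; exact/ltW/gain_gt0.
  - by apply: le_trans area1 _; apply: ar_le u2; exact: subM (good_sub g2).
  - by left.
have r00' := r00.
have [g2 u2] := merge_two g1 Xp Xp Zp Zp; rewrite !subrr psip0 !subr0 mulr0 subr0 tot1 => t2.
set H := chull (X' `|` Z) in g2 u2 t2 gap HE.
have a2 : ar (uni (X :: o)) <= ar (uni (H :: rem Z o)).
  by apply: le_trans area1 _; apply: ar_le u2; exact: subM (good_sub g2).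
(* Filling the hole adds area only if no other piece occupies it. A piece [V] that enters its inner
   half shares a segment with [H] and is merged as well. *)
have [[V Vr [z Vz zq]]|none] := pselect (exists2 V, V \in rem Z o & exists2 z, V z & enorm (z - q) < r0 / 2).
  have [hV VE cV] : [/\ ccs V, V `<=` E & c <= ar V] by apply: g2; rewrite inE Vr orbT.
  have [w Vw wz] := far_point hV VE cV Vz.
  have hr : h <= r0 / 4 by rewrite /h ge_min lexx orbT.
  have Hz : H z.
    have [] // := gap z; rewrite -/r0; apply: lt_trans zq _.
    by rewrite ltr_pdivrMr// ltr_pMr// ltr1n.
  have Hw : H w.
    have [] // := gap w; rewrite -/r0 -[w](subrK z) -addrA; apply: le_lt_trans (enormD _ _) _.
    by rewrite wz; lra.
  have pe2 : perm_eq (H :: rem Z o) (H :: V :: rem V (rem Z o)) by rewrite perm_cons perm_to_rem.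
  have [g3 u3] := merge_two (good_perm pe2 g2) Hz Hw Vz Vw.
  rewrite -(lperimeter_perm pe2) !subrr psip0 !subr0 => t3.
  have P1 : kappa * h <= psip l (w - z) by apply: le_trans (psip_lo _); rewrite wz.
  have T : lperimeter (chull (H `|` V) :: rem V (rem Z o)) + gain <= lperimeter (X :: o).
    by lra.
  exists (chull (H `|` V) :: rem V (rem Z o)); split=> //.
  - by rewrite /= [size (rem V _)]size_rem// -sz prednK ?leqnSn//; case: (rem Z o) Vr.
  - by apply: le_trans T; rewrite lerDl; exact/ltW/gain_gt0.
  - apply: le_trans a2 _; rewrite (uni_perm pe2).
    by apply: ar_le u3; exact: subM (good_sub g3).
  - by left.
have BH : eball q (r0 / 2) `<=` H.
  by move=> z zq; have [] := gap z; rewrite // -/r0; move: zq; rewrite /eball/=; lra.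
exists (H :: rem Z o); split=> //; first by rewrite /= sz.
right; apply: (@le_trans _ _ (ar (eball q (r0 / 2) `|` uni (X' :: Z :: rem Z o)))); last first.
  apply: ar_le; first exact: subM (good_sub g2).
  by move=> x [/BH Hx|/u2//]; rewrite uni_cons; left.
have BE : eball q (r0 / 2) `<=` E by exact: subset_trans BH HE.
apply: le_trans (arU_ge (subM BE) (subM sub1) _ _); last 2 first.
- exact: eball_measurable.
- rewrite (_ : _ `&` _ = set0) ?area0//; apply/seteqP; split=> z // [zq].
  have zr : enorm (z - q) < r0 by move: zq; rewrite /eball/=; lra.
  have [_ nX nZ] := gap z zr.
  rewrite !uni_cons => -[//|[//|[V Vr Vz]]]; apply: none; exists V => //; exists z => //.
have B1 : (r0 / 2) ^+ 2 / 3 <= ar (eball q (r0 / 2)).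
  by rewrite -lee_fin -(arE (subM BE)); apply: area_eball; rewrite divr_gt0.
have e1 : (r0 / 2) ^+ 2 / 3 = r0 ^+ 2 / 12 by field.
by rewrite addrC; apply: lerD => //; rewrite -e1 in g_2; exact: le_trans B1.
Qed.

(** Induction on the number of pieces. Meeting pieces merge at no cost and cover what they covered;
    otherwise [shadow] tells which of two disjoint pieces can be moved. A single move already
    produces the definite gain, so the inclusion in [K] is claimed only when none was made. *)
Lemma reduce s : good s -> exists K, [/\ ccs K, K `<=` E, wperimeter l K <= lperimeter s,
  ar (uni s) <= ar K &
  [\/ uni s `<=` K, wperimeter l K + gain <= lperimeter s | ar (uni s) + gain <= ar K]].
Proof.
have [n] := ubnP (size s); elim: n s => // n IH s /ltnSE sn g.
have meet X o : perm_eq s (X :: o) -> (exists2 Z, Z \in o & X `&` Z !=set0) ->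
    exists K, [/\ ccs K, K `<=` E, wperimeter l K <= lperimeter s, ar (uni s) <= ar K &
    [\/ uni s `<=` K, wperimeter l K + gain <= lperimeter s | ar (uni s) + gain <= ar K]].
  move=> p [Z Zo XZ].
  have [s' [z' g' t' u']] := merge_meeting (good_perm p g) Zo XZ.
  have sn' : (size s' < n)%N by move: sn; rewrite (perm_size p); exact: leq_ltn_trans.
  have [K [hK KE wK aK alt]] := IH s' sn' g'.
  rewrite (uni_perm p) (lperimeter_perm p).
  have au : ar (uni (X :: o)) <= ar (uni s') by apply: ar_le u'; exact: subM (good_sub g').
  exists K; split=> //; [exact: le_trans t'|exact: le_trans aK|].
  case: alt => [uK|wg|ag].
  - by apply: Or31; exact: subset_trans uK.
  - by apply: Or32; exact: le_trans t'.
  - by apply: Or33; apply: le_trans ag; rewrite lerD2r.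
have mov X Y d o : perm_eq s (X :: o) -> Y \in o -> (forall Z, Z \in o -> X `&` Z = set0) ->
  (forall z, X z -> exists2 t : R, 0 <= t & Y (z + t *: d)) ->
    exists K, [/\ ccs K, K `<=` E, wperimeter l K <= lperimeter s, ar (uni s) <= ar K &
    [\/ uni s `<=` K, wperimeter l K + gain <= lperimeter s | ar (uni s) + gain <= ar K]].
  move=> p Yo dis sh.
  have [s' [z' g' t' a' alt']] := move_merge (good_perm p g) Yo dis sh.
  have sn' : (size s' < n)%N by move: sn; rewrite (perm_size p); exact: leq_ltn_trans.
  have [K [hK KE wK aK alt]] := IH s' sn' g'.
  rewrite (uni_perm p) (lperimeter_perm p).
  exists K; split=> //; [exact: le_trans t'|exact: le_trans aK|].
  case: alt' => [wg|ag].
  - by apply: Or32; apply: le_trans wg; rewrite lerD2r.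
  - by apply: Or33; exact: le_trans aK.
have dis X o : ~ (exists2 Z, Z \in o & X `&` Z !=set0) -> forall Z, Z \in o -> X `&` Z = set0.
  by move=> N Z Zo; apply/eqP/negPn/negP => /set0P XZ; apply: N; exists Z.
case: s sn g meet mov => [|A [|B r]] sn g meet mov.
- exists set0; split=> //.
  + by split; [exact: compact0|move=> ? ?].
  + rewrite /lperimeter big_nil; apply: sumr_le0 => p _.
    rewrite (_ : width _ _ = 0) ?mulr0// /width (_ : [set r | _] = set0) ?sup0//.
    by apply/seteqP; split=> // r [x [y []]].
  + by rewrite uni_nil.
  + by apply: Or31; rewrite uni_nil.
- have [hA AE _] := g A (mem_head _ _).
  by exists A; rewrite /lperimeter big_seq1 uni_cons uni_nil setU0; split=> //; apply: Or31.
- have [m|n1] := pselect (exists2 Z, Z \in B :: r & A `&` Z !=set0); first exact: (meet A (B :: r)).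
  have p : perm_eq (A :: B :: r) (B :: A :: r) by rewrite (perm_catCA [:: A] [:: B] r).
  have [m|n2] := pselect (exists2 Z, Z \in A :: r & B `&` Z !=set0); first exact: (meet B (A :: r)).
  have gA := g A (mem_head _ _).
  have gB : [/\ ccs B, B `<=` E & c <= ar B] by apply: g; rewrite !inE eqxx orbT.
  have ne Z : [/\ ccs Z, Z `<=` E & c <= ar Z] -> Z !=set0.
    move=> [hZ ZE cZ]; have [a aX] := good_ball hZ ZE cZ; exists a; apply: aX.
    by rewrite /eball/= subrr enorm0; exact: rho0.
  have [hA _ _] := gA; have [hB _ _] := gB.
  have [d [sh|sh]] := shadow hA hB (ne _ gA) (ne _ gB) (dis _ _ n1 B (mem_head _ _)).
    by apply: (mov A B d (B :: r)) => //; [rewrite mem_head|exact: dis].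
  by apply: (mov B A d (A :: r)) => //; [rewrite mem_head|exact: dis].
Qed.

End Reduce.

Section Convexify.
Context {R : realType}.
Local Notation plane := (plane R).
Implicit Types (A B E K : set plane) (x y z : plane) (s : seq (set plane)).
Context (F : set plane) (m : {finite_measure set plane -> \bar R}) (nu : plane -> plane).
Hypotheses (U : unit_polar F m nu) (mF : lmeasurable F) (finF : (area F < +oo)%E).

Lemma ar_uni s E (M : R) : E `<=` box M -> (forall Z, Z \in s -> Z `<=` E) ->
  ar (uni s) <= \sum_(Z <- s) ar Z.
Proof.
move=> EM; elim: s => [|Z s IH] H; first by rewrite uni_nil big_nil /ar area0.
rewrite uni_cons big_cons; have ZE : Z `<=` E by apply: H; rewrite mem_head.
have sE Y : Y \in s -> Y `<=` E by move=> Ys; apply: H; rewrite inE Ys orbT.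
apply: (@le_trans _ _ (ar Z + ar (uni s))); last by rewrite lerD2l; exact: IH.
by apply: (@arU_le _ _ _ M); apply: subset_trans EM => //; exact: uni_sub.
Qed.

(** The variable [w] is the total area of the discarded small pieces. It enters the perimeter bound
    with factor [L] and the area bounds with factor 1, the trade-off that [energy_arith]
    exploits. *)
Lemma convexify (l : seq (R * plane)) (kappa C M L eps : R) E :
  (forall p, p \in l -> 0 <= p.1 /\ p.2 != 0) ->
  (forall x, kappa * enorm x <= psip l x) -> (forall x, psip l x <= C * enorm x) ->
  0 < kappa -> 0 < C -> 0 < M -> 0 < L -> 0 < eps -> ccs E -> E `<=` box M ->
  let g := gain kappa C M (kappa ^+ 2 / L ^+ 2) in
  exists K (w : R), [/\ ccs K, K `<=` E, 0 <= w,
    wperimeter l K + L * w <= \int[m]_x psi l (nu x) + eps /\ ar (F `&` E) <= ar K + eps + w &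
    [\/ ar ((F `&` E) `\` K) <= eps + w,
        wperimeter l K + L * w + g <= \int[m]_x psi l (nu x) + eps |
        ar (F `&` E) + g <= ar K + eps + w]].
Proof.
move=> hl plo phi_ k0 C0 M0 L0 eps0 hE EM; set c := kappa ^+ 2 / L ^+ 2 => g.
have c0 : 0 < c by rewrite divr_gt0 ?exprn_gt0.
have hl1 p : p \in l -> 0 <= p.1 by move=> /hl[].
have [s [hs Ps As]] := pieces U mF finF hl M0 eps0.
(* Taking hulls and intersecting with the convex set [E] increases no width and keeps [V] inside [E]
   covered. *)
pose f (V : set plane) := chull V `&` E.
pose s1 := [seq f V | V <- s].
have h1 Z : Z \in s1 -> [/\ ccs Z & Z `<=` E].
  move=> /mapP[V Vs ->]; have [_ _ [M' VM']] := hs V Vs.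
  have hV := chull_ccs VM'; split; last by move=> x [].
  apply: (@ccs_sub_box _ _ M); [by apply: closedI; exact: ccs_closed|exact: cvxI hV.2 hE.2|].
  by move=> x [_ /EM].
have EA A : A `<=` E -> A `<=` box M by move=> AE; exact: subset_trans EM.
have t1 : lperimeter l s1 <= \int[m]_x psi l (nu x) + eps.
  apply: le_trans Ps; rewrite /lperimeter big_map big_seq [leRHS]big_seq; apply: ler_sum => V Vs.
  have [_ _ [M' VM']] := hs V Vs; apply: le_trans (wperimeter_chull hl1 VM').
  apply: (@wperimeter_sub _ _ hl1 _ _ M'); last by move=> x [].
  by apply: chull_min => //; [exact: box_closed|exact: box_cvx].
(* Below this threshold [wperimeter_area] applies with rate [L]; above it the pieces are [good]. *)
pose big (Z : set plane) := c <= ar Z.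
pose s2 := [seq Z <- s1 | big Z]; pose D := [seq Z <- s1 | ~~ big Z].
pose w := \sum_(Z <- D) ar Z.
have w0 : 0 <= w by apply: sumr_ge0 => Z _; exact: ar_ge0.
have tD : lperimeter l s2 + L * w <= lperimeter l s1.
  rewrite /lperimeter /w [leRHS](bigID big)/= !big_filter lerD2l mulr_sumr big_seq_cond [leRHS]big_seq_cond.
  apply: ler_sum => Z /andP[Zs1 nb]; have [hZ ZE] := h1 Z Zs1.
  have [->|/set0P Z0] := eqVneq Z set0.
    by rewrite /ar area0 mulr0; apply: (@wperimeter_ge0 _ _ hl1 _ 0) => x.
  apply: (wperimeter_area hl1 plo k0 (ccs_measurable hZ) (EA _ ZE) Z0 L0).
  by rewrite ltNge.
have g2 : good E c s2.
  by move=> Z; rewrite mem_filter => /andP[bZ Zs1]; have [] := h1 Z Zs1.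
have D1 Z : Z \in D -> Z `<=` E by rewrite mem_filter => /andP[_ /h1[]].
have cover : F `&` E `<=` ((F `&` box M) `\` [set x | exists2 V, V \in s & V x]) `|` (uni s2 `|` uni D).
  move=> x [Fx Ex]; have [[V Vs Vx]|n] := pselect (exists2 V, V \in s & V x); last first.
    by left; split=> //; split=> //; exact: EM.
  right; have fs : f V \in s1 by exact: map_f.
  have fx : f V x by split=> //; exact: chull_sub.
  have [b|nb] := boolP (big (f V)); [left|right]; exists (f V) => //; by rewrite mem_filter fs ?b ?nb.
pose G := (F `&` box M) `\` [set x | exists2 V, V \in s & V x].
have GM : G `<=` box M by move=> x [[]].
have arG : ar G <= eps by rewrite -lee_fin -(arE GM).
have arD : ar (uni D) <= w by exact: ar_uni EM D1.
have s2E : uni s2 `<=` E by apply: uni_sub => Z /g2[].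
have DE : uni D `<=` E by exact: uni_sub.
have UM : uni s2 `|` uni D `<=` box M by move=> x [/s2E|/DE]; exact: EM.
have arF : ar (F `&` E) <= ar (uni s2) + eps + w.
  have GU : G `|` (uni s2 `|` uni D) `<=` box M by move=> x [/GM|/UM].
  have := ar_le GU cover; have := arU_le GM UM; have := arU_le (EA _ s2E) (EA _ DE); clear -arG arD; lra.
have [K [hK KE wK aK alt]] := reduce hl1 plo phi_ k0 C0 hE EM M0 c0 g2.
exists K, w; split=> //; first by split; [clear -wK tD t1; lra|clear -arF aK; lra].
case: alt => [sK|wg|ag].
- apply: Or31; have sub : (F `&` E) `\` K `<=` G `|` uni D.
    by move=> x [/cover[Gx|[/sK//|Dx]] nK]; [left|right].
  have GD : G `|` uni D `<=` box M by move=> x [/GM|/DE/EM].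
  by have := ar_le GD sub; have := arU_le GM (EA _ DE); clear -arG arD; lra.
- by apply: Or32; rewrite /g; clear -wg tD t1; lra.
- by apply: Or33; rewrite /g; clear -ag arF; lra.
Qed.

End Convexify.

(** * Perimeter of polygons *)

Section HausdorffSegment.
Context {R : realType}.
Local Notation plane := (plane R).
Local Notation lam := (@lebesgue_measure R).
Implicit Types (A B : set plane).
Local Open Scope ereal_scope.

(** The two covers are interleaved, even indices for [A] and odd ones for [B]; partial sums up to
    [n.*2] split accordingly. *)
Lemma hausdorff1_deltaU (delta : R) A B :
  hausdorff1_delta delta (A `|` B) <= hausdorff1_delta delta A + hausdorff1_delta delta B.
Proof.
have [->|Af] := eqVneq (hausdorff1_delta delta A) +oo.
  by rewrite addye ?leey// gt_eqF// (lt_le_trans _ (hausdorff1_delta_ge0 _ _))// ltNyr.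
have [->|Bf] := eqVneq (hausdorff1_delta delta B) +oo.
  by rewrite addey ?leey// gt_eqF// (lt_le_trans _ (hausdorff1_delta_ge0 _ _))// ltNyr.
have fA : hausdorff1_delta delta A \is a fin_num.
  by rewrite ge0_fin_numE ?hausdorff1_delta_ge0// ltey.
have fB : hausdorff1_delta delta B \is a fin_num.
  by rewrite ge0_fin_numE ?hausdorff1_delta_ge0// ltey.
apply/lee_addgt0Pr => eps eps0.
have e20 : (0 < eps / 2)%R by rewrite divr_gt0.
have [_ [/= U [Ud AU] <-] hU] := lb_ereal_inf_adherent e20 fA.
have [_ [/= V [Vd BV] <-] hV] := lb_ereal_inf_adherent e20 fB.
pose W n := if odd n then V n./2 else U n./2.
apply: (@le_trans _ _ (\sum_(k <oo) diam (W k))).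
  apply: ereal_inf_lbound; exists W => //; split.
    by move=> k; rewrite /W; case: ifP.
  move=> x [/AU|/BV] [k _ h].
    by exists k.*2 => //; rewrite /W odd_double doubleK.
  by exists k.*2.+1 => //; rewrite /W /= odd_double /= uphalf_double.
have dW k : 0 <= diam (W k) by exact: diam_ge0.
apply: (@le_trans _ _ (\sum_(k <oo) diam (U k) + \sum_(k <oo) diam (V k))); last first.
  rewrite [eps]splitr EFinD addeACA; apply: leeD; exact: ltW.
apply: lime_le; first by apply: is_cvg_nneseries => n _ _; exact: diam_ge0.
apply: nearW => n; rewrite /= big_mkord.
have sub P : \sum_(k < P.*2) diam (W k) = \sum_(k < P) diam (U k) + \sum_(k < P) diam (V k).
  elim: P => [|P IH]; first by rewrite !big_ord0 adde0.
  rewrite doubleS !big_ord_recr /= IH /W /= odd_double /= doubleK uphalf_double.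
  by rewrite -!addeA; congr (_ + _); rewrite addeCA.
apply: (@le_trans _ _ (\sum_(k < n.*2) diam (W k))).
  rewrite -!(big_mkord xpredT (fun k => diam (W k))).
  apply: lee_sum_nneg_natr => //; rewrite -addnn; exact: leq_addr.
rewrite sub; apply: leeD.
  by rewrite -(big_mkord xpredT (fun k => diam (U k))); apply: nneseries_lim_ge => k *; exact: diam_ge0.
by rewrite -(big_mkord xpredT (fun k => diam (V k))); apply: nneseries_lim_ge => k *; exact: diam_ge0.
Qed.

Lemma hausdorff1U A B : hausdorff1 (A `|` B) <= hausdorff1 A + hausdorff1 B.
Proof.
apply: ge_ereal_sup => _ [d /= d0 <-]; apply: le_trans (hausdorff1_deltaU d A B) _.
by apply: leeD; exact: hausdorff1_ge.
Qed.

Lemma le_hausdorff1 A B : A `<=` B -> hausdorff1 A <= hausdorff1 B.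
Proof.
move=> AB; apply: ge_ereal_sup => _ [d /= d0 <-]; apply: le_trans (hausdorff1_ge B d0).
apply: ereal_inf_le_tmp => _ [U [Ud BU] <-]; exists U => //; split=> //.
exact: subset_trans BU.
Qed.

(** An edge is a starting point with a vector, not a pair of endpoints. *)
Definition segpt (e : plane * plane) (t : R) : plane := (e.1 + t *: e.2)%R.

(** Lebesgue outer measure is an infimum over covers by open intervals, and the edge map multiplies
    lengths by [enorm e.2]. The whole parameter interval is short, so every piece respects
    [delta]. *)
Lemma hausdorff1_delta_short (e : plane * plane) (delta a b : R) (T : set R) :
  (0 < delta)%R -> (enorm e.2 * (b - a) <= delta)%R -> T `<=` `[a, b]%classic ->
  hausdorff1_delta delta (segpt e @` T) <= (enorm e.2)%:E * lam T.
Proof.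
move=> d0 small Tab.
have v0 := enorm_ge0 e.2.
have lenE s t : (enorm (segpt e s - segpt e t) = enorm e.2 * `|s - t|)%R.
  rewrite /segpt (_ : _ - _ = (s - t) *: e.2)%R ?enormZ 1?mulrC//.
  by rewrite opprD addrACA subrr add0r scalerBl.
have lT : lam T < +oo.
  by apply: le_lt_trans (itv_finite a b); exact: (le_outer_measure (mu_ext (wlength idfun))).
have fT : lam T \is a fin_num by rewrite ge0_fin_numE// outer_measure_ge0.
apply/lee_addgt0Pr => eps eps0.
have e1 : (0 < eps / (enorm e.2 + 1))%R by rewrite divr_gt0// ltr_wpDl.
have [_ [/= O [Oi TO] <-] hO] := lb_ereal_inf_adherent e1 (eq_ind _ (fun u => u \is a fin_num) fT _ (outer_measure_open_itv_cover T)).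
apply: (@le_trans _ _ (\sum_(k <oo) (enorm e.2)%:E * wlength idfun (O k))).
  apply: le_trans (_ : \sum_(k <oo) diam (segpt e @` (T `&` O k)) <= _).
    apply: ereal_inf_lbound; exists (fun k => segpt e @` (T `&` O k)) => //; split.
      move=> k; apply: ge_ereal_sup => _ [->|[_ [_ [[s [Ts _] <-] [t [Tt _] <-] ->]]]].
        by rewrite lee_fin ltW.
      rewrite lee_fin lenE; apply: le_trans small; rewrite ler_wpM2l//.
      have := Tab _ Ts; have := Tab _ Tt; rewrite /= !in_itv/= => /andP[? ?] /andP[? ?].
      by rewrite ler_norml; apply/andP; split; lra.
    by move=> _ [t Tt <-]; have [k _ Ok] := TO t Tt; exists k => //; exists t.
  apply: lee_nneseries; [by move=> k *; exact: diam_ge0|move=> k _].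
  have [[c d] /= Ok] := Oi k.
  apply: ge_ereal_sup => _ [->|[_ [_ [[s [_ Os] <-] [t [_ Ot] <-] ->]]]].
    by rewrite mule_ge0 ?lee_fin// wlength_ge0.
  move: Os Ot; rewrite Ok /= !in_itv/= => /andP[? ?] /andP[? ?].
  have cd : (c < d)%R by lra.
  rewrite wlength_itv/= lte_fin cd lenE -EFinB -EFinM lee_fin ler_wpM2l//.
  by rewrite ler_norml; apply/andP; split; lra.
rewrite nneseriesZl; last by move=> k _; exact: wlength_ge0.
apply: (@le_trans _ _ ((enorm e.2)%:E * (lam T + (eps / (enorm e.2 + 1))%:E))).
  by apply: lee_wpmul2l => //; apply: ltW; apply: lt_le_trans hO _; rewrite -outer_measure_open_itv_cover.
rewrite ge0_muleDr ?outer_measure_ge0//; last by rewrite lee_fin ltW.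
apply: leeD => //; rewrite -EFinM lee_fin mulrA ler_pdivrMr ?ltr_wpDl//.
by rewrite mulrC ler_wpM2l ?(ltW eps0)// lerDl.
Qed.

Lemma hausdorff1_segment (e : plane * plane) (T : set (measurableTypeR R)) : measurable T ->
  (forall t, T t -> (0 <= t <= 1)%R) ->
  hausdorff1 (segpt e @` T) <= (enorm e.2)%:E * lam T.
Proof.
move=> mT T01; apply: ge_ereal_sup => _ [d /= d0 <-].
pose eta := (d / (enorm e.2 + 1))%R.
have v0 := enorm_ge0 e.2.
have eta0 : (0 < eta)%R by rewrite divr_gt0// ltr_wpDl.
have small : (enorm e.2 * eta <= d)%R.
  by rewrite /eta mulrA ler_pdivrMr ?ltr_wpDl// mulrC ler_wpM2l ?(ltW d0)// lerDl.
suff H n a (S : set (measurableTypeR R)) : measurable S -> (forall t, S t -> (a <= t <= a + n%:R * eta)%R) ->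
    hausdorff1_delta d (segpt e @` S) <= (enorm e.2)%:E * lam S.
  have := archimedean.Num.Theory.truncnS_gt (eta^-1)%R; set n := (archimedean.Num.truncn _).+1 => hn.
  apply: (H n 0%R) => // t /T01 /andP[-> t1] /=.
  rewrite add0r; apply: le_trans t1 _; rewrite -ler_pdivrMr// div1r; exact: ltW.
elim: n a S => [|n IH] a S mS Sa.
  apply: (@hausdorff1_delta_short _ _ a a) => //; first by rewrite subrr mulr0 ltW.
  by move=> t /Sa; rewrite mul0r addr0 /= in_itv.
pose c := (a + eta)%R.
pose S1 := S `&` `[a, c]%classic; pose S2 := S `&` `]c, +oo[%classic.
have mS1 : measurable S1 by apply: measurableI => //; exact: measurable_itv.
have mS2 : measurable S2 by apply: measurableI => //; exact: measurable_itv.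
have SE : S = S1 `|` S2.
  apply/seteqP; split=> [t St|t [[]|[]]//].
  have /andP[at_ _] := Sa t St.
  by have [tc|ct] := leP t c; [left|right]; split=> //=; rewrite in_itv/= ?at_ ?tc ?ct.
have dS : S1 `&` S2 = set0.
  apply/seteqP; split=> // t [[_ /=]]; rewrite in_itv/= => /andP[_ tc] [_ /=].
  by rewrite in_itv/= andbT ltNge tc.
rewrite SE image_setU measureU// ge0_muleDr//; apply: le_trans (hausdorff1_deltaU _ _ _) _.
apply: leeD.
  apply: (@hausdorff1_delta_short _ _ a c) => //; last by move=> t [].
  by rewrite /c addrAC subrr add0r.
apply: (IH c) => // t [St] /=; rewrite in_itv/= andbT => ct; rewrite (ltW ct)/=.
have /andP[_ h] := Sa t St; apply: le_trans h _.
by rewrite /c -natr1; lra.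
Qed.

Lemma hausdorff1_point (x : plane) : hausdorff1 [set x] = 0.
Proof.
apply/le_anti; rewrite hausdorff1_ge0 andbT.
have -> : [set x] = segpt (x, 0%R) @` [set 0%R].
  by rewrite image_set1 /segpt /= scaler0 addr0.
apply: le_trans (hausdorff1_segment _ _ _) _ => /=.
- by [].
- by move=> _ ->; rewrite lexx ler01.
- by rewrite enorm0 mul0e.
Qed.

End HausdorffSegment.

(** * Length measure and normal of finitely many edges *)

Section Edges.
Context {R : realType}.
Local Notation plane := (plane R).
Local Notation lam := (@lebesgue_measure R).
Implicit Types (e : plane * plane) (es : seq (plane * plane)) (x y : plane).

Lemma oitv_finite (a b : R) : (lam `]a, b[%classic < +oo)%E.
Proof. by rewrite lebesgue_measure_itv/=; case: ifP => _; rewrite -?EFinB ?ltry. Qed.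

Definition unit_mass : {finite_measure set (measurableTypeR R) -> \bar R} :=
  @restrm R _ (measurableTypeR R) lam _ (measurable_itv `]0, 1[) (oitv_finite 0 1).

Lemma segpt_continuous e : continuous (segpt e).
Proof. by move=> t; exact: line_continuous. Qed.

Lemma segpt_measurable e : measurable_fun setT (segpt e : measurableTypeR R -> plane).
Proof.
apply: measurable_fun_pair;
  (apply: measurable_funD; first exact: measurable_cst);
  by apply: measurable_funM; [exact: measurable_id|exact: measurable_cst].
Qed.

Definition edge_push e : {measure set plane -> \bar R} :=
  measure_function_pushforward__canonical__measure_function_Measure unit_mass (segpt_measurable e).

Fixpoint edges_mass es : {measure set plane -> \bar R} :=
  if es is e :: r then
    measure_add (mscale (NngNum (enorm_ge0 e.2)) (edge_push e)) (edges_mass r)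
  else mzero.

Lemma edges_mass_int es (f : plane -> \bar R) : measurable_fun setT f -> (forall x, 0 <= f x)%E ->
  (\int[edges_mass es]_x f x =
   \sum_(e <- es) (enorm e.2)%:E * \int[unit_mass]_t f (segpt e t))%E.
Proof.
move=> mf f0; elim: es => [|e r IH]; first by rewrite big_nil integral_measure_zero.
rewrite big_cons /= ge0_integral_measure_add// IH; congr (_ + _)%E.
by rewrite ge0_integral_mscale// ge0_integral_pushforward//; exact: segpt_measurable.
Qed.

Lemma edges_mass_finite es : (edges_mass es setT < +oo)%E.
Proof.
rewrite -[edges_mass es setT]mul1e -integral_cst// edges_mass_int//.
elim: es => [|e r IH]; rewrite ?big_nil ?ltry// big_cons lte_add_pinfty//.
have -> : (\int[unit_mass]_t cst 1 (segpt e t) = unit_mass setT)%E by rewrite -[RHS]mul1e -integral_cst.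
by rewrite -(fineK (fin_num_measure unit_mass _ measurableT)) -EFinM ltry.
Qed.

Definition edges_meas es : {finite_measure set plane -> \bar R} :=
  restrm measurableT (edges_mass_finite es).

Lemma segpt_bmf e (f : plane -> R) : bmf f -> bmf (fun t : measurableTypeR R => f (segpt e t)).
Proof. by move=> bf; exact (bmf_comp (segpt_measurable e) bf). Qed.

Lemma edges_rI es (f : plane -> R) : bmf f ->
  \int[edges_meas es]_x f x = \sum_(e <- es) enorm e.2 * \int[unit_mass]_t f (segpt e t).
Proof.
have P (g : plane -> R) : bmf g -> (forall x, 0 <= g x) ->
    \int[edges_meas es]_x g x = \sum_(e <- es) enorm e.2 * \int[unit_mass]_t g (segpt e t).
  move=> bg g0; have mg : measurable_fun setT (EFin \o g) by apply/measurable_EFinP; case: bg.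
  apply: EFin_inj; rewrite -(rI_E (edges_meas es) bg) integral_restrm// edges_mass_int//.
  rewrite -sumEFin; apply: eq_bigr => e _.
  by rewrite EFinM -(rI_E unit_mass (segpt_bmf e bg)).
move=> bf; have [C _ hC] := bmf_shift bf.
have bc : bmf (fun _ : plane => `|C|) := bmf_cst _ _.
have bC : bmf (fun x => f x + `|C|) by exact: bmfD.
have hC' x : 0 <= f x + `|C| by apply: le_trans (hC x) _; rewrite lerD2l ler_norm.
have := P _ bC hC'; rewrite (rI_D (edges_meas es) bf bc) (P _ bc) => [|x]; last exact: normr_ge0.
move/(canRL (addrK _)) => ->; rewrite -sumrB; apply: eq_bigr => e _.
have be := segpt_bmf e bf; have bce : bmf (fun _ : measurableTypeR R => `|C|) := bmf_cst _ _.
by rewrite (rI_D unit_mass be bce) mulrDr addrK.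
Qed.

Definition oseg e : set plane := segpt e @` [set t | 0 < t < 1].
Definition cseg e : set plane := segpt e @` `[0, 1]%classic.

Lemma cseg_compact e : compact (cseg e).
Proof.
apply: continuous_compact; last exact: segment_compact.
by apply: continuous_subspaceT; exact: segpt_continuous.
Qed.

Lemma cseg_closed e : closed (cseg e).
Proof. by apply: compact_closed; [exact: norm_hausdorff|exact: cseg_compact]. Qed.

Lemma oseg_cseg e : oseg e `<=` cseg e.
Proof. by move=> _ [t /= /andP[/ltW t0 /ltW t1] <-]; exists t => //=; rewrite in_itv/= t0. Qed.

Lemma cseg_split e : cseg e `<=` oseg e `|` [set segpt e 0; segpt e 1].
Proof.
move=> x [t /= t01 <-]; move: t01; rewrite in_itv/= => /andP[t0 t1].
have [->|tn0] := eqVneq t 0; first by right; left.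
have [->|tn1] := eqVneq t 1; first by right; right.
by left; exists t => //=; rewrite !lt_neqAle t0 t1 tn1 eq_sym tn0.
Qed.

Lemma segpt_inj e s t : e.2 != 0 -> segpt e s = segpt e t -> s = t.
Proof.
move=> v0 /addrI/eqP; rewrite -subr_eq0 -scalerBl scaler_eq0 (negbTE v0) orbF subr_eq0.
by move/eqP.
Qed.

Lemma oseg_measurable e : e.2 != 0 -> measurable (oseg e).
Proof.
move=> v0.
have -> : oseg e = (cseg e `\` [set segpt e 0]) `\` [set segpt e 1].
  apply/seteqP; split=> x.
    move=> ox; split; first split; first exact: oseg_cseg.
      by case: ox => t /= /andP[t0 _] <- /(segpt_inj v0) E; rewrite E ltxx in t0.
    by case: ox => t /= /andP[_ t1] <- /(segpt_inj v0) E; rewrite E ltxx in t1.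
  by move=> [[/cseg_split[//|[]//]]].
have m1 x : measurable [set x] by apply: closed_plane_measurable; apply: compact_closed; [exact: norm_hausdorff|exact: compact_set1].
exact (measurableD (measurableD (closed_plane_measurable (@cseg_closed e)) (m1 _)) (m1 _)).
Qed.

Definition edge_normal e : plane := (enorm e.2)^-1 *: (e.2.2, - e.2.1).

Lemma enorm_edge_normal e : e.2 != 0 -> enorm (edge_normal e) = 1.
Proof.
move=> v0; have n0 : 0 < enorm e.2 by rewrite sqrtr_gt0; exact: sqr_sum_gt0.
rewrite enormZ ger0_norm ?invr_ge0 ?(ltW n0)// (_ : enorm (_, _) = enorm e.2) ?mulVf ?gt_eqF//.
by rewrite /enorm /= sqrrN addrC.
Qed.

(** The first edge containing [x] decides, which is immaterial on open edges of a simple family. The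
    value off the edges only keeps the length equal to 1 everywhere, as [unit_polar] demands. *)
Fixpoint edges_normal es x : plane :=
  if es is e :: r then \1_(oseg e) x *: edge_normal e + (1 - \1_(oseg e) x) *: edges_normal r x
  else (1, 0).

Definition simple_edges es := (forall e, e \in es -> e.2 != 0) /\
  forall e e', e \in es -> e' \in es -> e != e' -> forall s t, 0 < s < 1 -> 0 <= t <= 1 ->
    segpt e s != segpt e' t.

Lemma edges_normal_norm es x : (forall e, e \in es -> e.2 != 0) -> enorm (edges_normal es x) = 1.
Proof.
elim: es => [|e r IH] H /=; first by rewrite /enorm/= expr1n expr0n addr0 sqrtr1.
have Hr : enorm (edges_normal r x) = 1 by apply: IH => e' er; apply: H; rewrite inE er orbT.
rewrite indicE; case: (x \in oseg e); rewrite ?scale1r ?subrr ?scale0r ?addr0 ?subr0 ?add0r ?scale1r//.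
by rewrite enorm_edge_normal// H// mem_head.
Qed.

Lemma edges_normal_measurable es : (forall e, e \in es -> e.2 != 0) -> measurable_fun setT (edges_normal es).
Proof.
elim: es => [|e r IH] H; first exact: measurable_cst.
have mr : measurable_fun setT (edges_normal r) by apply: IH => e' er; apply: H; rewrite inE er orbT.
have mi : measurable_fun setT (\1_(oseg e) : plane -> R).
  by apply: measurable_indic; apply: oseg_measurable; apply: H; rewrite mem_head.
have m1 : measurable_fun setT (fun x => 1 - \1_(oseg e) x : R).
  by apply: measurable_funB => //; exact: measurable_cst.
apply: measurable_fun_pair; (apply: measurable_funD; apply: measurable_funM => //).
- exact: (measurableT_comp measurable_fst mr).
- exact: (measurableT_comp measurable_snd mr).
Qed.

Lemma edges_normal_oseg es e x : simple_edges es -> e \in es -> oseg e x -> edges_normal es x = edge_normal e.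
Proof.
move=> [_]; elim: es => // e' r IH H ein ox /=.
have [->|ne] := eqVneq e' e; first by rewrite indicE mem_set// scale1r subrr scale0r addr0.
have er : e \in r by move: ein; rewrite inE eq_sym (negbTE ne).
rewrite indicE memNset; last first.
  case: ox => s s01 <- [t t01] E.
  have t01' : 0 <= t <= 1 by move: t01 => /= /andP[/ltW -> /ltW ->].
  have ne' : e != e' by rewrite eq_sym.
  by have := H e e' ein (mem_head _ _) ne' s t s01 t01'; rewrite E eqxx.
rewrite scale0r add0r subr0 scale1r; apply: IH => // a b ar_ br; apply: H; by rewrite inE ?ar_ ?br orbT.
Qed.

Lemma unit_mass_eq (f g : R -> R) : measurable_fun setT (f : measurableTypeR R -> R) ->
  measurable_fun setT (g : measurableTypeR R -> R) ->
  (forall t, 0 < t < 1 -> f t = g t) -> \int[unit_mass]_t f t = \int[unit_mass]_t g t.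
Proof.
move=> mf mg fg; rewrite /Rintegral !integral_restrm; [|exact/measurable_EFinP..].
by congr fine; apply: eq_integral => t; rewrite inE/= in_itv/= => /fg ->.
Qed.

End Edges.

Section EdgePerimeter.
Context {R : realType}.
Local Notation plane := (plane R).
Local Notation lam := (@lebesgue_measure R).
Implicit Types (e : plane * plane) (x y w : plane).
Context (K : set plane) (mK : measurable K) (finK : (borel_area K < +oo)%E).
Context (es : seq (plane * plane)).
Hypothesis simple : simple_edges es.

Definition boundary_flux := forall f, test_function f ->
  \int[restrm mK finK]_x 'D_(1, 0) f x =
    \sum_(e <- es) e.2.2 * \int[unit_mass]_t f (segpt e t) /\
  \int[restrm mK finK]_x 'D_(0, 1) f x =
    \sum_(e <- es) - e.2.1 * \int[unit_mass]_t f (segpt e t).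
Hypothesis flux : boundary_flux.

Let m := edges_meas es.
Let nu := edges_normal es.

Let test_bmf (f : plane -> R) : test_function f -> bmf f.
Proof. exact: test_bounded. Qed.

Let nu_bmf : bmf (fun x => (nu x).1) /\ bmf (fun x => (nu x).2).
Proof.
have mn := edges_normal_measurable simple.1.
have n1 x := edges_normal_norm x simple.1.
split; split.
- exact: (measurableT_comp measurable_fst mn).
- by exists 1 => x; rewrite -(n1 x); exact: le_enorm1.
- exact: (measurableT_comp measurable_snd mn).
- by exists 1 => x; rewrite -(n1 x); exact: le_enorm2.
Qed.

Lemma edges_unit_polar : unit_polar K m nu.
Proof.
have [b1 b2] := nu_bmf.
split; last by move=> x; exact: edges_normal_norm simple.1.
split; first exact: edges_normal_measurable simple.1.
  by apply: nearW => x; exact: edges_normal_norm simple.1.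
move=> u v tu tv.
have bu := test_bmf tu; have bv := test_bmf tv.
have du := test_derive_bmf (1, 0) tu; have dv := test_derive_bmf (0, 1) tv.
have bd : bmf (fun x => 'D_(1, 0) u x + 'D_(0, 1) v x) by exact: bmfD.
have bn : bmf (fun x => u x * (nu x).1 + v x * (nu x).2) by apply: bmfD; apply: bmfM.
rewrite (@integral_area_borel _ K K) ?setYK ?area0//; last 2 first.
- exact: borel_lmeasurable.
- by apply/measurable_EFinP; case: bd.
rewrite -(integral_restrm mK finK); last by apply/measurable_EFinP; case: bd.
rewrite (rI_E (restrm mK finK) bd) (rI_E m bn) (rI_D (restrm mK finK) du dv); congr (_%:E).
rewrite (flux tu).1 (flux tv).2 edges_rI// -big_split/= big_seq [RHS]big_seq.
apply: eq_bigr => e ein.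
have v0 := simple.1 e ein; have n0 : 0 < enorm e.2 by rewrite sqrtr_gt0; exact: sqr_sum_gt0.
have sbu := segpt_bmf e bu; have sbv := segpt_bmf e bv.
rewrite -(rI_Z unit_mass _ sbu) -(rI_Z unit_mass _ sbv).
have z1 : bmf (fun t : measurableTypeR R => e.2.2 * u (segpt e t)) by exact: bmfZ.
have z2 : bmf (fun t : measurableTypeR R => - e.2.1 * v (segpt e t)) by exact: bmfZ.
have sbn := segpt_bmf e bn.
rewrite -(rI_D unit_mass z1 z2) -(rI_Z unit_mass _ sbn); apply: unit_mass_eq.
- by case: (bmfD z1 z2).
- by case: (bmfZ (enorm e.2) sbn).
- move=> t t01; have ot : oseg e (segpt e t) by exists t.
  rewrite /nu (edges_normal_oseg simple ein ot) /edge_normal /= /GRing.scale/=.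
  by field; rewrite gt_eqF.
Qed.

Let edges_mass_set A : measurable A -> m A = (\sum_(e <- es) enorm e.2 * \int[unit_mass]_t \1_A (segpt e t))%:E.
Proof.
move=> mA; have bA := @bmf_indic _ _ _ A mA.
by rewrite -edges_rI// rI_indic// fineK// fin_num_measure.
Qed.

Lemma closed_avoid (S : set plane) x : closed S -> ~ S x -> exists2 r : R, 0 < r & forall y, eball x r y -> ~ S y.
Proof.
move=> cS nS; have /= : nbhs x (~` S) by apply: open_nbhs_nbhs; split=> //; exact: closed_openC.
move=> /(@nbhs_ballP R (plane : pseudoMetricType R))[r /= r0 rS]; exists r => // y xy.
apply: rS; move: xy; rewrite /eball/= => xy.
by split; rewrite /ball/= distrC; apply: le_lt_trans xy; [exact: le_enorm1 (y - x)|exact: le_enorm2 (y - x)].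
Qed.

Let others (P : pred (plane * plane)) x : (forall e, e \in es -> P e -> ~ cseg e x) ->
  exists2 r : R, 0 < r & forall y, eball x r y -> forall e, e \in es -> P e -> ~ cseg e y.
Proof.
move=> H; have kS : compact (uni [seq cseg e | e <- es & P e]).
  by apply: uni_compact => Z /mapP[e _ ->]; exact: cseg_compact.
have cS : closed (uni [seq cseg e | e <- es & P e]) by apply: compact_closed => //; exact: norm_hausdorff.
have [|r r0 Hr] := closed_avoid cS (x := x).
  by move=> [Z /mapP[e + ->]]; rewrite mem_filter => /andP[Pe ein]; exact: H.
exists r => // y xy e ein Pe ey; apply: (Hr y xy); exists (cseg e) => //.
by apply: map_f; rewrite mem_filter Pe.
Qed.

(** Off the edges small balls have no mass, against the positivity in [outer_normal_at]. At a point
    of an open edge small balls avoid all other edges, so the averages are constant and their limit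
    is the edge normal. *)
Lemma edges_outer_normal x w : outer_normal_at K x w ->
  (exists2 e, e \in es & cseg e x) /\ forall e, e \in es -> oseg e x -> w = edge_normal e.
Proof.
move=> ow; have [pos l1 l2] := outer_normal_averages edges_unit_polar ow.
split.
  apply: contrapT => no.
  have [|r r0 Hr] := @others xpredT x; first by move=> e ein _ ex; apply: no; exists e.
  have := pos r r0; rewrite edges_mass_set; last exact: eball_measurable.
  rewrite big_seq big1 ?ltxx// => e ein.
  rewrite (unit_mass_eq (g := fun=> 0)) ?Rintegral_cst ?mul0r ?mulr0//.
  - exact: (segpt_bmf e (bmf_ball x r)).1.
  - by move=> t /andP[/ltW t0 /ltW t1]; rewrite indicE memNset// => /Hr/(_ e ein isT); apply; exists t => //=; rewrite in_itv/= t0.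
move=> e ein ox.
have [|r0 r00 Hr0] := @others (fun e' => e' != e) x.
  move=> e' ein' ne [t /= t01 E]; case: ox => s s01 Es.
  rewrite in_itv/= in t01; rewrite eq_sym in ne.
  by have := simple.2 e e' ein ein' ne s t s01 t01; rewrite E Es eqxx.
have avg (c : plane -> R) : bmf (fun y => c (nu y)) -> forall r : R, 0 < r < r0 ->
    (\int[m]_(y in eball x r) c (nu y)) / fine (m (eball x r)) = c (edge_normal e).
  move=> bc r /andP[rp rr].
  have mb : measurable (eball x r) by exact: eball_measurable.
  have mpos : 0 < fine (m (eball x r)).
    by rewrite fine_gt0// pos//= ltey_eq fin_num_measure.
  have bb : bmf (\1_(eball x r) : plane -> R) := bmf_ball x r.
  have bbc : bmf (fun y => \1_(eball x r) y * c (nu y)) by exact: bmf_ballM.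
  apply: (mulIf (lt0r_neq0 mpos)); rewrite divfK ?lt0r_neq0//.
  rewrite -(rI_indicM m mb bc) -(rI_indic m mb) !edges_rI// mulr_sumr big_seq [RHS]big_seq.
  apply: eq_bigr => e' ein'; rewrite mulrCA; congr (_ * _).
  have sb := segpt_bmf e' bb; rewrite -(rI_Z unit_mass _ sb); apply: unit_mass_eq.
  - exact: (segpt_bmf e' bbc).1.
  - exact: (bmfZ (c (edge_normal e)) sb).1.
  move=> t t01; rewrite mulrC; have [yB|nB] := boolP (segpt e' t \in eball x r); last first.
    by rewrite indicE (negbTE nB) !mulr0.
  have yr : eball x r0 (segpt e' t) by move: yB; rewrite inE /eball/= => h; exact: lt_trans rr.
  have os : oseg e' (segpt e' t) by exists t.
  have [E|ne] := eqVneq e' e; last by have := Hr0 _ yr e' ein' ne; have := oseg_cseg os.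
  by rewrite /nu (edges_normal_oseg simple ein' os) E.
have lim (c : plane -> R) z : bmf (fun y => c (nu y)) ->
    (\int[m]_(y in eball x r) c (nu y)) / fine (m (eball x r)) @[r --> 0^'+] --> z -> z = c (edge_normal e).
  move=> bc lz; apply/esym; apply: (cvg_unique _ _ lz); first exact: Rhausdorff.
  apply: cvg_near_cst; near=> r; apply: avg => //; apply/andP; split.
    by near: r; exact: nbhs_right_gt.
  by near: r; exact: nbhs_right_lt.
rewrite [w]surjective_pairing [RHS]surjective_pairing; congr (_, _).
- exact: (lim (fun y => y.1)) nu_bmf.1 l1.
- exact: (lim (fun y => y.2)) nu_bmf.2 l2.
Unshelve. all: by end_near.
Qed.

Lemma hausdorff1_le_edges es' A : measurable A -> (forall x, A x -> exists2 e, e \in es' & cseg e x) ->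
  (hausdorff1 A <= edges_mass es' A)%E.
Proof.
elim: es' A => [|e r IH] A mA H.
  rewrite (_ : A = set0) ?hausdorff1_set0 ?measure_ge0//.
  by apply/seteqP; split=> // x /H[].
have mc : measurable (cseg e) by exact: closed_plane_measurable (@cseg_closed _ e).
pose T : set (measurableTypeR R) := segpt e @^-1` A `&` `]0, 1[%classic.
have mT : measurable T.
  apply: measurableI; last exact: measurable_itv.
  by rewrite -[X in measurable X]setTI; exact: segpt_measurable.
have cover : A `<=` ((segpt e @` T `|` [set segpt e 0]) `|` [set segpt e 1]) `|` (A `\` cseg e).
  move=> x Ax; have [cx|nx] := pselect (cseg e x); last by right.
  left; have [[t t01 E]|[|]] := cseg_split cx; [left; left|by left; right|by right].
  by exists t => //; split; rewrite /= ?E// in_itv.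
apply: le_trans (le_hausdorff1 cover) _; apply: le_trans (hausdorff1U _ _) _.
rewrite [leRHS](measure_addE _ _ A); apply: leeD; last first.
  apply: le_trans (IH _ _ _) _; first exact: measurableD.
    by move=> x [/H[e' +] ex nx]; rewrite inE => /orP[/eqP E|er]; [rewrite E in ex|exists e'].
  by apply: le_measure; rewrite ?inE//; exact: measurableD.
apply: le_trans (hausdorff1U _ _) _; rewrite hausdorff1_point adde0.
apply: le_trans (hausdorff1U _ _) _; rewrite hausdorff1_point adde0.
suff : (hausdorff1 (segpt e @` T) <= (enorm e.2)%:E * lam T)%E by [].
apply: hausdorff1_segment => //.
by move=> t [_ /=]; rewrite in_itv/= => /andP[/ltW -> /ltW ->].
Qed.

(** A simple function below the integrand vanishes off the reduced boundary, hence off the edges;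
    there [hausdorff1_le_edges] replaces the outer measure by the length measure, for which the
    integral splits over the edges. *)
Lemma edges_perimeter phi : is_norm phi ->
  (aniso_perimeter phi K <= (\sum_(e <- es) phi (e.2.2, - e.2.1))%:E)%E.
Proof.
move=> N; rewrite /aniso_perimeter asboolT; last by exists m, nu; have [] := edges_unit_polar.
rewrite integral_hausdorff1; last by move=> x; rewrite lee_fin norm_ge0.
apply: ge_ereal_sup => _ [h /= hle <-].
have mem x : 0 < h x -> reduced_boundary K x.
  move=> hx; apply: contrapT => nx; have := hle x; rewrite patchE memNset// lee_fin.
  by rewrite leNgt hx.
have mh : measurable_fun setT (EFin \o h) by exact/measurable_EFinP.
have h0 x : (0 <= (EFin \o h) x)%E by rewrite lee_fin.
apply: (@le_trans _ _ (\int[edges_mass es]_x (h x)%:E)%E).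
  rewrite integralT_nnsfun !sintegral_range ?hausdorff1_set0//.
  apply: lee_fsum; first exact: fimfunP.
  move=> r [x _ hx]; have [->|rn0] := eqVneq r 0; first by rewrite !mul0e.
  have rp : 0 < r by rewrite lt_neqAle eq_sym rn0 -hx; exact: (h0 x).
  apply: lee_wpmul2l; first by rewrite lee_fin ltW.
  apply: hausdorff1_le_edges => [|y /= hy]; first exact: measurable_sfunP.
  by have [w /edges_outer_normal[]] : reduced_boundary K y by apply: mem; rewrite hy.
rewrite (edges_mass_int _ mh h0) -sumEFin big_seq [leRHS]big_seq; apply: lee_sum => e ein.
have v0 := simple.1 e ein; have n0 : 0 < enorm e.2 by rewrite sqrtr_gt0; exact: sqr_sum_gt0.
have -> : phi (e.2.2, - e.2.1) = enorm e.2 * phi (edge_normal e).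
  by have [_ Z _] := N; rewrite /edge_normal Z gtr0_norm ?invr_gt0// mulVKf ?gt_eqF.
rewrite EFinM; apply: lee_wpmul2l; first by rewrite lee_fin ltW.
have ms : measurable_fun setT (fun t : measurableTypeR R => (h (segpt e t))%:E).
  by apply: (measurableT_comp mh); exact: segpt_measurable.
rewrite integral_restrm//.
have hc t : (`]0, 1[%classic : set (measurableTypeR R)) t -> ((h (segpt e t))%:E <= (phi (edge_normal e))%:E)%E.
  rewrite /= in_itv/= => t01; rewrite lee_fin.
  have os : oseg e (segpt e t) by exists t.
  have [hp|hp] := ltP 0 (h (segpt e t)); last by apply: le_trans hp _; exact: norm_ge0.
  have := hle (segpt e t); have D := mem _ hp; rewrite patchE mem_set// lee_fin.
  have [w ow] := D; rewrite (outer_normalE edges_unit_polar ow).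
  by have [_ /(_ e ein os) ->] := edges_outer_normal ow.
pose D : set (measurableTypeR R) := `]0, 1[%classic.
have mD : measurable D by exact: measurable_itv.
have H : (\int[lam]_(t in D) (h (segpt e t))%:E <= \int[lam]_(t in D) (cst (phi (edge_normal e))%:E) t)%E.
  by apply: ge0_le_integral => //; [move=> t _; rewrite lee_fin|exact: measurable_funTS].
apply: (le_trans H); rewrite integral_cst//.
have l1 : lam D = 1%E by rewrite /D lebesgue_measure_itv/= lte_fin ltr01 -EFinB subr0.
by change ((phi (edge_normal e))%:E * lam D <= (phi (edge_normal e))%:E)%E; rewrite l1 mule1.
Qed.

End EdgePerimeter.

(** * Gauss-Green on triangles *)

Section Triangle.
Context {R : realType}.
Local Notation plane := (plane R).
Local Notation lam := (@lebesgue_measure R).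
Implicit Types (e : plane * plane) (es : seq (plane * plane)) (x y p a b : plane) (f : plane -> R).

Definition cross a b : R := lin (perp a) b.

Lemma crossE a b : cross a b = a.1 * b.2 - a.2 * b.1.
Proof. by rewrite /cross /lin /perp /=; ring. Qed.

Lemma crossC a b : cross a b = - cross b a.
Proof. by rewrite !crossE; ring. Qed.

(** The open triangle in barycentric coordinates. Dividing by [cross a b] makes it independent of
    the order of [a] and [b]. *)
Definition tri p a b : set plane := [set x | [/\ 0 < cross (x - p) b / cross a b,
  0 < cross a (x - p) / cross a b & cross (x - p) b / cross a b + cross a (x - p) / cross a b < 1]].

Lemma tri_point p a b (s t : R) : cross a b != 0 ->
  tri p a b (p + s *: a + t *: b) <-> [/\ 0 < s, 0 < t & s + t < 1].
Proof.
move=> D; rewrite /tri /=.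
have -> : cross (p + s *: a + t *: b - p) b / cross a b = s.
  by move: D; rewrite !crossE /= /GRing.scale/= => D; field.
have -> // : cross a (p + s *: a + t *: b - p) / cross a b = t.
by move: D; rewrite !crossE /= /GRing.scale/= => D; field.
Qed.

Lemma tri_coord p a b x : cross a b != 0 -> tri p a b x ->
  exists s t, x = p + s *: a + t *: b /\ [/\ 0 < s, 0 < t & s + t < 1].
Proof.
move=> D T; exists (cross (x - p) b / cross a b), (cross a (x - p) / cross a b); split=> //.
move: D; rewrite !crossE => D; rewrite -[LHS](subrK p) [LHS]addrC -addrA; congr (_ + _).
move: (x - p) => v; clear T; case: v => v1 v2.
by congr (_, _) => /=; rewrite /GRing.scale/=; field.
Qed.

Lemma tri_swap p a b : tri p a b = tri p b a.
Proof.
have sw u v w z : cross u v / cross w z = cross v u / cross z w.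
  by rewrite (crossC u v) (crossC w z) invrN mulrNN.
have one q u v x : tri q u v x -> tri q v u x.
  move=> [h1 h2 h3]; split; [by rewrite (sw (x - q))|by rewrite (sw v)|].
  by rewrite (sw (x - q)) (sw v) addrC.
by apply/seteqP; split=> x; exact: one.
Qed.

Lemma tri_measurable p a b : measurable (tri p a b).
Proof.
have c1 : continuous (fun x : plane => cross (x - p) b / cross a b).
  have -> : (fun x : plane => cross (x - p) b / cross a b) = (fun x => (lin (b.2, - b.1) x - lin (b.2, - b.1) p) / cross a b).
    by apply/funext => x; rewrite -linB crossE /lin /=; congr (_ / _); ring.
  move=> x; apply: cvgMl; apply: cvgB; [exact: lin_continuous|exact: cvg_cst].
have c2 : continuous (fun x : plane => cross a (x - p) / cross a b).
  have -> : (fun x : plane => cross a (x - p) / cross a b) = (fun x => (lin (perp a) x - lin (perp a) p) / cross a b).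
    by apply/funext => x; rewrite -linB.
  move=> x; apply: cvgMl; apply: cvgB; [exact: lin_continuous|exact: cvg_cst].
have c3 : continuous (fun x : plane => cross (x - p) b / cross a b + cross a (x - p) / cross a b).
  by move=> x; apply: cvgD; [exact: c1|exact: c2].
have -> : tri p a b = (((fun x : plane => cross (x - p) b / cross a b) @^-1` [set r | 0 < r]) `&`
    ((fun x : plane => cross a (x - p) / cross a b) @^-1` [set r | 0 < r])) `&`
    ((fun x : plane => cross (x - p) b / cross a b + cross a (x - p) / cross a b) @^-1` [set r | r < 1]).
  by apply/seteqP; split=> x; [move=> [? ? ?]|move=> [[? ?] ?]].
apply: open_plane_measurable; apply: openI; first apply: openI.
- by apply: open_comp (@open_gt R 0) => x _; exact: c1.
- by apply: open_comp (@open_gt R 0) => x _; exact: c2.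
- by apply: open_comp (@open_lt R 1) => x _; exact: c3.
Qed.

Lemma tri_box p a b : cross a b != 0 -> exists M : R, tri p a b `<=` box M.
Proof.
move=> D; exists (`|p.1| + `|p.2| + (`|a.1| + `|a.2|) + (`|b.1| + `|b.2|)) => x /(tri_coord D)[s [t [-> [s0 t0 st]]]].
have bd (u v w : R) : `|u + s * v + t * w| <= `|u| + `|v| + `|w|.
  apply: le_trans (ler_normD _ _) _; apply: lerD; first apply: le_trans (ler_normD _ _) _; first apply: lerD => //.
    by rewrite normrM gtr0_norm// ler_piMl//; lra.
  by rewrite normrM gtr0_norm// ler_piMl//; lra.
have := normr_ge0 p.1; have := normr_ge0 p.2; have := normr_ge0 a.1; have := normr_ge0 a.2.
have := normr_ge0 b.1; have := normr_ge0 b.2; have := bd p.1 a.1 b.1; have := bd p.2 a.2 b.2.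
by move=> *; apply/boxP; split=> /=; rewrite /GRing.scale/=; lra.
Qed.

(** The parametrisation [p + s a + t b] has Jacobian [cross a b] and pulls the triangle back to a
    standard one; [J t] is the integral over its slice parallel to [a]. *)
Lemma tri_int p a b (G : plane -> R) (J : R -> R) : cross a b != 0 -> measurable_fun setT G ->
  (forall x, 0 <= G x) ->
  measurable_fun setT (fun t : measurableTypeR R => (J t)%:E) ->
  (forall t, 0 < t < 1 ->
    (\int[lam]_(s in `[0%R, (1 - t)%R]) (G (p + t *: b + s *: a))%:E = (J t)%:E)%E) ->
  (\int[borel_area]_(x in tri p a b) (G x)%:E = `|cross a b|%:E * \int[unit_mass]_t (J t)%:E)%E.
Proof.
move=> D mG G0 mJ HJ.
have mT := tri_measurable p a b.
pose F x := (G x * \1_(tri p a b) x)%:E.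
have mF : measurable_fun setT F.
  by apply/measurable_EFinP; apply: measurable_funM => //; exact: measurable_indic.
have F0 x : (0 <= F x)%E by rewrite lee_fin mulr_ge0.
have -> : (\int[borel_area]_(x in tri p a b) (G x)%:E = \int[borel_area]_x F x)%E.
  rewrite integral_mkcond; apply: eq_integral => x _; rewrite patchE /F indicE.
  by case: ifP => _; rewrite ?mulr1 ?mulr0.
have D' : a.1 * b.2 - b.1 * a.2 != 0 by move: D; rewrite crossE [a.2 * _]mulrC.
have := @ge0_integral_affine2 _ F a.1 b.1 a.2 b.2 p.1 p.2 D' mF F0.
have -> : a.1 * b.2 - b.1 * a.2 = cross a b by rewrite crossE; ring.
move=> E.
have n0 : (`|cross a b|%:E * `|cross a b|^-1%:E = 1)%E by rewrite -EFinM mulfV// normr_eq0.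
rewrite -[LHS]mul1e -n0 -muleA -E; congr (_ * _)%E.
have mFA : measurable_fun setT (fun x : plane => F (a.1 * x.1 + b.1 * x.2 + p.1, a.2 * x.1 + b.2 * x.2 + p.2)).
  by apply: (measurableT_comp mF); exact: measurable_affine2.
rewrite (integral_plane_yx mFA)// integral_restrm//.
rewrite [RHS]integral_mkcond; apply: eq_integral => t _; rewrite patchE.
have pt s : ((a.1 * s + b.1 * t + p.1, a.2 * s + b.2 * t + p.2) : plane) = p + s *: a + t *: b.
  by congr (_, _) => /=; rewrite /GRing.scale/=; ring.
have pt' s : ((a.1 * s + b.1 * t + p.1, a.2 * s + b.2 * t + p.2) : plane) = p + t *: b + s *: a.
  by rewrite pt addrAC.
have [|nt] := boolP (t \in _).
  rewrite inE/= in_itv/= => t01; rewrite -HJ//.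
  rewrite [RHS]integral_itv_bndoo; last first.
    apply/measurable_EFinP; apply: measurable_funTS; apply: (measurableT_comp mG).
    by apply: measurable_fun_pair; (apply: measurable_funD; first exact: measurable_cst);
      apply: measurable_funM; [exact: measurable_id|exact: measurable_cst|exact: measurable_id|exact: measurable_cst].
  rewrite [RHS]integral_mkcond; apply: eq_integral => s _; rewrite patchE /F.
  have [|ns] := boolP (s \in _).
    rewrite inE/= in_itv/= => /andP[s0 s1]; rewrite -pt' indicE mem_set ?mulr1//.
    by rewrite pt; apply/(tri_point _ _ _ D); clear -s0 s1 t01; split; lra.
  rewrite indicE memNset ?mulr0//; rewrite pt => /(tri_point _ _ _ D)[s0 t0 st].
  by move: ns; rewrite notin_setE /= in_itv/=; apply; clear -s0 t0 st; apply/andP; split; lra.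
rewrite integral0_eq// => s _; rewrite /F indicE memNset ?mulr0//.
rewrite pt => /(tri_point _ _ _ D)[s0 t0 st].
by move: nt; rewrite notin_setE /= in_itv/=; apply; clear -s0 t0 st; apply/andP; split; lra.
Qed.

Lemma integral_borel_rI (K : set plane) (mK : measurable K) (finK : (borel_area K < +oo)%E) (g : plane -> R) :
  bmf g -> (\int[borel_area]_(x in K) (g x)%:E = (\int[restrm mK finK]_x g x)%:E)%E.
Proof.
move=> bg; rewrite -(rI_E (restrm mK finK) bg) integral_restrm//.
by apply/measurable_EFinP; case: bg.
Qed.

Lemma tri_derive p a b f : cross a b != 0 -> test_function f ->
  (\int[borel_area]_(x in tri p a b) ('D_a f x)%:E =
    (`|cross a b| * (\int[unit_mass]_t f (segpt (p + a, b - a) t) - \int[unit_mass]_t f (segpt (p, b) t)))%:E)%E.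
Proof.
move=> D tf; have [Cf _] := tf.
(* [tri_int] wants a nonnegative integrand, so a constant is added to the derivative. Its own
   integral is computed in [H2] and cancelled; [l1] is [1 - t] truncated so as to be bounded on the
   whole line. *)
have bD := test_derive_bmf a tf; have [C bC hC] := bmf_shift bD.
have bf := test_bounded tf.
have [M TM] := tri_box p D; have mT := tri_measurable p a b.
have finT : (borel_area (tri p a b) < +oo)%E.
  by rewrite -area_borel//; apply: le_lt_trans (le_area TM) _; rewrite area_borel ?box_finite//; exact: box_measurable.
have b1 := segpt_bmf (p + a, b - a) bf; have b0 := segpt_bmf (p, b) bf.
have bl : bmf (fun t : measurableTypeR R => (1 - t) * \1_(`[0, 1]%classic : set (measurableTypeR R)) t).
  split.
    apply: measurable_funM; last exact: measurable_indic (measurable_itv _).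
    by apply: measurable_funB; [exact: measurable_cst|exact: measurable_id].
  exists 1 => t; rewrite indicE; case: (boolP (t \in _)); rewrite ?mulr0 ?normr0// inE/= in_itv/= mulr1 => /andP[? ?].
  by rewrite ler_norml; apply/andP; split; lra.
pose l1 (t : R) : R := (1 - t) * \1_(`[0, 1]%classic : set (measurableTypeR R)) t.
have l1E t : 0 < t < 1 -> l1 t = 1 - t.
  by move=> /andP[t0 t1]; rewrite /l1 indicE mem_set ?mulr1//= in_itv/= !ltW.
have mea (J : R -> R) : bmf (J : measurableTypeR R -> R) -> measurable_fun setT (fun t : measurableTypeR R => (J t)%:E).
  by move=> [mJ _]; exact/measurable_EFinP.
have bCl : bmf (fun t : measurableTypeR R => C * l1 t) by exact: bmfZ.
have bd : bmf (fun t : measurableTypeR R => f (segpt (p + a, b - a) t) - f (segpt (p, b) t)) by exact: bmfB.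
have bJ : bmf (fun t : measurableTypeR R => f (segpt (p + a, b - a) t) - f (segpt (p, b) t) + `|C| * l1 t).
  by apply: bmfD => //; exact: bmfZ.
have bcst : bmf (fun _ : plane => `|C|) := bmf_cst _ _.
have bDC : bmf (fun x => 'D_a f x + `|C|) by exact: bmfD.
have H1 : (\int[borel_area]_(x in tri p a b) ('D_a f x + `|C|)%:E =
    `|cross a b|%:E * \int[unit_mass]_t (f (segpt (p + a, b - a) t) - f (segpt (p, b) t) + `|C| * l1 t)%:E)%E.
  apply: (tri_int D).
  - by case: bDC.
  - by move=> x; apply: le_trans (hC x) _; rewrite lerD2l ler_norm.
  - exact (mea (fun t => f (segpt (p + a, b - a) t) - f (segpt (p, b) t) + `|C| * l1 t) bJ).
  move=> t t01; have t1 : 0 <= 1 - t by lra.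
  pose mu := @restrm R _ (measurableTypeR R) lam _ (measurable_itv `[0, 1 - t]) (itv_finite 0 (1 - t)).
  have bs : bmf (fun s : measurableTypeR R => 'D_a f (p + t *: b + s *: a)) := segpt_bmf (p + t *: b, a) bD.
  have bs2 : bmf (fun s : measurableTypeR R => 'D_a f (p + t *: b + s *: a) + `|C|).
    by apply: bmfD => //; exact: bmf_cst.
  rewrite -(@integral_restrm R _ (measurableTypeR R) lam _ (measurable_itv `[0, 1 - t]) (itv_finite 0 (1 - t)) (fun s => ('D_a f (p + t *: b + s *: a) + `|C|)%:E)); last first.
    by apply/measurable_EFinP; case: bs2.
  rewrite (rI_E mu bs2) (rI_D mu bs (bmf_cst _ _)) Rintegral_cst//; congr (_%:E).
  have E1 : \int[mu]_s 'D_a f (p + t *: b + s *: a) = f (p + t *: b + (1 - t) *: a) - f (p + t *: b).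
    apply: EFin_inj; rewrite -(rI_E mu bs) integral_restrm; last by apply/measurable_EFinP; case: bs.
    by rewrite (C1_FTC (p + t *: b) a Cf t1) scale0r addr0.
  have E2 : fine (mu setT) = 1 - t.
    rewrite /mu /restrm /= /mfrestr /mrestr setTI.
    have := lebesgue_measure_itv `[0, 1 - t]; rewrite /= lte_fin; case: ifP => h -> /=; lra.
  by rewrite E1 E2 l1E// /segpt; congr (f _ - _ + _); congr (_, _) => /=; rewrite /GRing.scale/=; ring.
have H2 : (\int[borel_area]_(x in tri p a b) (`|C|)%:E =
    `|cross a b|%:E * \int[unit_mass]_t (`|C| * l1 t)%:E)%E.
  apply: (@tri_int p a b (fun=> `|C|) (fun t => `|C| * l1 t) D) => //.
  - exact (mea (fun t => `|C| * l1 t) (bmfZ _ bl)).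
  move=> t t01; rewrite integral_cst//; have t1 : 0 < 1 - t by lra.
  have := lebesgue_measure_itv `[0, 1 - t]; rewrite /= lte_fin t1 => ->.
  by rewrite -EFinB -EFinM subr0 l1E.
have bDe : bmf (fun x => 'D_a f x) by [].
have := H1; have := H2; rewrite (integral_borel_rI mT finT bDC) (integral_borel_rI mT finT bcst) (integral_borel_rI mT finT bDe).
rewrite (rI_E _ bJ) (rI_E _ (bmfZ _ bl)) => {}H2 {}H1; move: H1 H2.
rewrite (rI_D _ bDe bcst) (rI_D _ bd (bmfZ _ bl)) (rI_B _ b1 b0) -!EFinM => -[H1] [H2].
by congr (_%:E); rewrite H2 in H1; move: H1; rewrite mulrDr => /addIr.
Qed.

Definition edge_int e f : R := \int[unit_mass]_t f (segpt e t).

(* The two components of the boundary flux of [f] through the oriented edges: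
   [edge.2.2, - edge.2.1] is the outer normal times the length when the region
   lies on the left. *)
Definition flux1 es f : R := \sum_(e <- es) e.2.2 * edge_int e f.
Definition flux2 es f : R := \sum_(e <- es) - e.2.1 * edge_int e f.

Definition has_flux (K : set plane) es := forall f, test_function f ->
  (\int[borel_area]_(x in K) ('D_(1, 0) f x)%:E = (flux1 es f)%:E)%E /\
  (\int[borel_area]_(x in K) ('D_(0, 1) f x)%:E = (flux2 es f)%:E)%E.

Lemma edge_int_rev p a f : bmf f -> edge_int (p + a, - a) f = edge_int (p, a) f.
Proof.
have P (g : plane -> R) : bmf g -> (forall x, 0 <= g x) -> edge_int (p + a, - a) g = edge_int (p, a) g.
  move=> bg g0; apply: EFin_inj.
  have b1 := segpt_bmf (p + a, - a) bg; have b2 := segpt_bmf (p, a) bg.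
  rewrite /edge_int -(rI_E unit_mass b1) -(rI_E unit_mass b2) !integral_restrm;
    [|by apply/measurable_EFinP; case: b2|by apply/measurable_EFinP; case: b1].
  rewrite integral_mkcond [RHS]integral_mkcond.
  pose D : set (measurableTypeR R) := `]0, 1[%classic.
  pose h (t : R) : \bar R := ((fun t : measurableTypeR R => (g (segpt (p, a) t))%:E) \_ D) t.
  have mh : measurable_fun setT (h : measurableTypeR R -> \bar R).
    have mD : measurable D by exact: measurable_itv.
    apply/(measurable_restrictT _ mD).
    by apply: measurable_funTS; apply/measurable_EFinP; case: b2.
  have h0 t : (0 <= h t)%E by rewrite /h patchE; case: ifP => // _; rewrite lee_fin.
  have N1 : (-1 : R) != 0 by rewrite oppr_eq0 oner_neq0.
  have := ge0_integral_affine 1 N1 mh h0; rewrite normrN1 invr1 mul1e => <-.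
  apply: eq_integral => t _; rewrite /h !patchE.
  have -> : (-1 * t + 1 \in D) = (t \in D).
    by apply/idP/idP; rewrite !inE /D /= !in_itv/= => /andP[? ?]; apply/andP; split; lra.
  case: ifP => // _; congr (g _)%:E; congr (_, _) => /=; rewrite /segpt /= /GRing.scale/=; ring.
move=> bf; have [C _ hC] := bmf_shift bf.
have bc : bmf (fun _ : plane => `|C|) := bmf_cst _ _.
have hC' x : 0 <= f x + `|C| by apply: le_trans (hC x) _; rewrite lerD2l ler_norm.
have := P _ (bmfD bf bc) hC'; rewrite /edge_int.
have bce : bmf (fun _ : measurableTypeR R => `|C|) := bmf_cst _ _.
rewrite (rI_D unit_mass (segpt_bmf (p + a, - a) bf) bce) (rI_D unit_mass (segpt_bmf (p, a) bf) bce).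
exact: addIr.
Qed.

(** [tri_derive] integrates the derivatives along the two sides [a] and [b] on slices. By Cramer's
    rule the coordinate derivatives are combinations of these, and the edge terms regroup into the
    flux. *)
Lemma tri_flux p a b : 0 < cross a b -> has_flux (tri p a b) [:: (p, a); (p + a, b - a); (p + b, - b)].
Proof.
move=> D0 f tf; have D : cross a b != 0 by rewrite gt_eqF.
have D' : cross b a != 0 by rewrite crossC oppr_eq0.
have [Cf _] := tf; have bf := test_bounded tf.
have Da := tri_derive p D tf; have Db := tri_derive p D' tf.
rewrite -tri_swap [cross b a]crossC normrN in Db.
have rev1 : edge_int (p + b, a - b) f = edge_int (p + a, b - a) f.
  have E : p + a + (b - a) = p + b by rewrite [b - a]addrC addrA addrK.
  by have := edge_int_rev (p + a) (b - a) bf; rewrite opprB E.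
have rev2 := edge_int_rev p b bf.
rewrite -/(edge_int _ _) -/(edge_int _ _) (gtr0_norm D0) in Da.
rewrite -/(edge_int _ _) -/(edge_int _ _) (gtr0_norm D0) rev1 in Db.
have [M TM] := tri_box p D; have mT := tri_measurable p a b.
have finT : (borel_area (tri p a b) < +oo)%E.
  by rewrite -area_borel//; apply: le_lt_trans (le_area TM) _; rewrite area_borel ?box_finite//; exact: box_measurable.
have ba : bmf (fun x => 'D_a f x) := test_derive_bmf a tf.
have bb : bmf (fun x => 'D_b f x) := test_derive_bmf b tf.
have lin_comb (c d : R) v : (forall x, 'D_v f x = c * 'D_a f x + d * 'D_b f x) ->
    (\int[borel_area]_(x in tri p a b) ('D_v f x)%:E =
     (c * (cross a b * (edge_int (p + a, b - a) f - edge_int (p, b) f)) +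
      d * (cross a b * (edge_int (p + a, b - a) f - edge_int (p, a) f)))%:E)%E.
  move=> E; have bv : bmf (fun x => 'D_v f x) := test_derive_bmf v tf.
  have [Ea] := etrans (esym (integral_borel_rI mT finT ba)) Da.
  have [Eb] := etrans (esym (integral_borel_rI mT finT bb)) Db.
  rewrite (integral_borel_rI mT finT bv).
  under eq_Rintegral do rewrite E.
  by rewrite (rI_D _ (bmfZ c ba) (bmfZ d bb)) (rI_Z _ _ ba) (rI_Z _ _ bb) Ea Eb.
have dl v x := C1_derive_lin x v Cf.
have crE := crossE a b.
split.
- rewrite (lin_comb (b.2 / cross a b) (- a.2 / cross a b)); last first.
    move=> x; rewrite (dl a) (dl b); change ('D_(1, 0) f x) with ('D_e1 f x).
    by move: ('D_e1 f x) ('D_e2 f x) => X Y; move: D; rewrite crE => D; field.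
  by congr (_%:E); rewrite /flux1 !big_cons big_nil /= rev2; field.
- rewrite (lin_comb (- b.1 / cross a b) (a.1 / cross a b)); last first.
    move=> x; rewrite (dl a) (dl b); change ('D_(0, 1) f x) with ('D_e2 f x).
    by move: ('D_e1 f x) ('D_e2 f x) => X Y; move: D; rewrite crE => D; field.
  by congr (_%:E); rewrite /flux2 !big_cons big_nil /= rev2; field.
Qed.

Lemma has_flux_union A B es es' : measurable A -> measurable B -> A `&` B = set0 ->
  has_flux A es -> has_flux B es' -> has_flux (A `|` B) (es ++ es').
Proof.
move=> mA mB AB fA fB f tf; have [a1 a2] := fA f tf; have [b1 b2] := fB f tf.
have dAB : [disjoint A & B] by apply/disj_setPS; rewrite AB.
have me v : measurable_fun (A `|` B) (fun x => ('D_v f x)%:E).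
  by apply: measurable_funTS; apply/measurable_EFinP; case: (test_derive_bmf v tf).
rewrite !integral_setU// a1 a2 b1 b2 /flux1 /flux2 !big_cat/=; split; exact: EFinD.
Qed.

End Triangle.

(** * Polygons between a lower and an upper chain *)

Section Slab.
Context {R : realType}.
Local Notation plane := (plane R).
Implicit Types (e : plane * plane) (es : seq (plane * plane)) (P Q S x z : plane) (f : plane -> R).

Definition ed P Q : plane * plane := (P, Q - P).

(** A common form for [flux1] and [flux2]: the cancellation of inner edges only uses that the weight
    is odd. *)
Definition wflux (w : plane -> R) es f : R := \sum_(e <- es) w e.2 * edge_int e f.

Lemma wflux_cat w es es' f : wflux w (es ++ es') f = wflux w es f + wflux w es' f.
Proof. by rewrite /wflux big_cat. Qed.

Lemma tri_has_flux P Q S : 0 < cross (Q - P) (S - P) ->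
  has_flux (tri P (Q - P) (S - P)) [:: ed P Q; ed Q S; ed S P].
Proof.
move=> /tri_flux-/(_ P); rewrite /ed.
by rewrite [P + (Q - P)]addrC subrK [P + (S - P)]addrC subrK !opprB addrA subrK.
Qed.

Lemma wflux_rev w P Q f : bmf f -> w (P - Q) = - w (Q - P) ->
  w (P - Q) * edge_int (ed Q P) f = - (w (Q - P) * edge_int (ed P Q) f).
Proof.
move=> bf ->; rewrite mulNr; congr (- (_ * _)).
by have := edge_int_rev P (Q - P) bf; rewrite [P + _]addrC subrK opprB.
Qed.

Context (x0 dl : R) (lo up : nat -> R).
Hypothesis dl0 : 0 < dl.

Definition node (h : nat -> R) (i : nat) : plane := (x0 + i%:R * dl, h i).
Local Notation pl := (node lo).
Local Notation pu := (node up).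

Definition lower_tri i := tri (pl i) (pl i.+1 - pl i) (pu i.+1 - pl i).
Definition upper_tri i := tri (pl i) (pu i.+1 - pl i) (pu i - pl i).

(** Each column is cut by a diagonal into two open triangles. Leaving out the null diagonals and
    verticals keeps the pieces disjoint. *)
Fixpoint slab n : set plane :=
  if n is n'.+1 then slab n' `|` (lower_tri n' `|` upper_tri n') else set0.

(** Counterclockwise, with the region on the left of every edge: lower nodes rightwards, upper nodes
    leftwards, the right side upwards, the left side downwards. *)
Definition chain n := [seq ed (pl i) (pl i.+1) | i <- iota 0 n] ++
  ([seq ed (pu i.+1) (pu i) | i <- iota 0 n] ++ [:: ed (pl n) (pu n); ed (pu 0) (pl 0)]).

Let step (h h' : nat -> R) i : (node h i.+1 - node h' i).1 = dl.
Proof. by rewrite /node /= -natr1; ring. Qed.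

Let vert (h h' : nat -> R) i : (node h i - node h' i).1 = 0.
Proof. by rewrite /node /= subrr. Qed.

Lemma lower_cross i : cross (pl i.+1 - pl i) (pu i.+1 - pl i) = dl * (up i.+1 - lo i.+1).
Proof. by rewrite crossE !step /=; ring. Qed.

Lemma upper_cross i : cross (pu i.+1 - pl i) (pu i - pl i) = dl * (up i - lo i).
Proof. by rewrite crossE step vert /=; ring. Qed.

Section Nondegenerate.
Context (n : nat).
Hypothesis lu : forall i, (i <= n)%N -> lo i < up i.

Let lower_gt0 i : (i < n)%N -> 0 < cross (pl i.+1 - pl i) (pu i.+1 - pl i).
Proof. by move=> h; rewrite lower_cross mulr_gt0// subr_gt0 lu. Qed.

Let upper_gt0 i : (i < n)%N -> 0 < cross (pu i.+1 - pl i) (pu i - pl i).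
Proof. by move=> h; rewrite upper_cross mulr_gt0// subr_gt0 lu// ltnW. Qed.

Let tri_strip i x : (i < n)%N -> (lower_tri i `|` upper_tri i) x -> (pl i).1 < x.1 < (pl i.+1).1.
Proof.
move=> h; have E : (pl i.+1).1 = (pl i).1 + dl by rewrite /node /= -natr1; ring.
move=> [|] /tri_coord.
  move=> /(_ (lt0r_neq0 (lower_gt0 h)))[s [t [-> [s0 t0 st]]]].
  have -> : (pl i + s *: (pl i.+1 - pl i) + t *: (pu i.+1 - pl i)).1 = (pl i).1 + (s + t) * dl.
    by rewrite /node /= /GRing.scale/= -!natr1; ring.
  by rewrite E ltrDl ltrD2l; apply/andP; split; [apply: mulr_gt0 => //; exact: addr_gt0|rewrite gtr_pMl//; lra].
move=> /(_ (lt0r_neq0 (upper_gt0 h)))[s [t [-> [s0 t0 st]]]].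
have -> : (pl i + s *: (pu i.+1 - pl i) + t *: (pu i - pl i)).1 = (pl i).1 + s * dl.
  by rewrite /node /= /GRing.scale/= -!natr1; ring.
by rewrite E ltrDl ltrD2l; apply/andP; split; [exact: mulr_gt0|rewrite gtr_pMl//; lra].
Qed.

Lemma slab_measurable k : measurable (slab k).
Proof. by elim: k => //= k IH; apply: measurableU => //; apply: measurableU; exact: tri_measurable. Qed.

Let slab_lt k x : (k <= n)%N -> slab k x -> x.1 < (pl k).1.
Proof.
elim: k => //= k IH kn [/(IH (ltnW kn)) h|/(tri_strip kn)/andP[//]].
by apply: lt_trans h _; rewrite /node /= ltrD2l ltr_pM2r// ltr_nat.
Qed.

Let tri_disjoint i : (i < n)%N -> lower_tri i `&` upper_tri i = set0.
Proof.
move=> h; apply/seteqP; split=> // x [].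
move=> /(tri_coord (lt0r_neq0 (lower_gt0 h)))[s [t [-> [s0 t0 st]]]].
move=> /(tri_coord (lt0r_neq0 (upper_gt0 h)))[s' [t' [E [s0' t0' st']]]].
have l0 := lower_gt0 h; have u0 := upper_gt0 h.
have : cross (pu i.+1 - pl i) (pl i + s *: (pl i.+1 - pl i) + t *: (pu i.+1 - pl i) - pl i) =
    - s * cross (pl i.+1 - pl i) (pu i.+1 - pl i).
  by rewrite !crossE /= /GRing.scale/=; ring.
rewrite E (_ : cross _ _ = t' * cross (pu i.+1 - pl i) (pu i - pl i)); last first.
  by rewrite !crossE /= /GRing.scale/=; ring.
by move: l0 u0; move: (cross _ _) (cross _ _) => A B *; nra.
Qed.

Lemma slab_flux k : (k <= n)%N -> has_flux (slab k) (chain k).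
Proof.
have wchain w j f : wflux w (chain j) f = \sum_(i < j) w (pl i.+1 - pl i) * edge_int (ed (pl i) (pl i.+1)) f +
    \sum_(i < j) w (pu i - pu i.+1) * edge_int (ed (pu i.+1) (pu i)) f +
    (w (pu j - pl j) * edge_int (ed (pl j) (pu j)) f + w (pl 0%N - pu 0%N) * edge_int (ed (pu 0%N) (pl 0%N)) f).
  rewrite /wflux /chain !big_cat/= !big_map !big_cons big_nil addr0 addrA.
  by rewrite -{1 2}[j]subn0 -!/(index_iota 0 j) !big_mkord.
elim: k => [|k IH] kn f tf.
  have bf := test_bounded tf; rewrite !integral_set0.
  have z w : (forall v, w (- v) = - w v) -> wflux w (chain 0) f = 0.
    move=> odd; rewrite wchain !big_ord0 !add0r (@wflux_rev w (pl 0%N) (pu 0%N) f bf); first by rewrite subrr.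
    by rewrite -odd opprB.
  by split; congr (_%:E); symmetry; [apply: (z (fun v => v.2))|apply: (z (fun v => - v.1))].
have lt := tri_has_flux (lower_gt0 kn); have ut := tri_has_flux (upper_gt0 kn).
have mt i : measurable (lower_tri i) /\ measurable (upper_tri i) by split; exact: tri_measurable.
have tt := has_flux_union (mt k).1 (mt k).2 (tri_disjoint kn) lt ut.
have dis : slab k `&` (lower_tri k `|` upper_tri k) = set0.
  apply/seteqP; split=> // x [/(slab_lt (ltnW kn)) h /(tri_strip kn)/andP[h' _]].
  by have := lt_trans h h'; rewrite ltxx.
have all := has_flux_union (slab_measurable k) (measurableU _ _ (mt k).1 (mt k).2) dis (IH (ltnW kn)) tt.
have [a1 a2] := all f tf; have bf := test_bounded tf.
have key w : (forall v, w (- v) = - w v) -> wflux w (chain k ++ ([:: ed (pl k) (pl k.+1); ed (pl k.+1) (pu k.+1); ed (pu k.+1) (pl k)] ++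
    [:: ed (pl k) (pu k.+1); ed (pu k.+1) (pu k); ed (pu k) (pl k)])) f = wflux w (chain k.+1) f.
  move=> odd; rewrite wflux_cat !wchain !big_ord_recr/= /wflux.
  rewrite !big_cons big_nil /=.
  rewrite (@wflux_rev w (pl k) (pu k.+1))//; last by rewrite -odd opprB.
  rewrite (@wflux_rev w (pl k) (pu k))//; last by rewrite -odd opprB.
  by ring.
split; rewrite ?[slab _]/=; [rewrite a1|rewrite a2]; congr (_%:E).
  exact: (key (fun v => v.2)).
by apply: (key (fun v => - v.1)) => v /=.
Qed.

Lemma slab_sub K : cvx K -> (forall i, (i <= n)%N -> K (pl i) /\ K (pu i)) ->
  forall k, (k <= n)%N -> slab k `<=` K.
Proof.
move=> cK H; elim=> [|k IH] kn x //= [/(IH (ltnW kn))//|].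
have [l1 u1] := H _ (ltnW kn); have [l2 u2] := H _ kn.
move=> [/(tri_coord (lt0r_neq0 (lower_gt0 kn)))|/(tri_coord (lt0r_neq0 (upper_gt0 kn)))] [s [t [-> [s0 t0 st]]]];
  by apply: cvx3 => //; lra.
Qed.

Lemma slab_cover i x : (i < n)%N -> (pl i).1 < x.1 < (pl i.+1).1 ->
  let s := (x.1 - (pl i).1) / dl in
  lo i + s * (lo i.+1 - lo i) < x.2 < up i + s * (up i.+1 - up i) ->
  x.2 != lo i + s * (up i.+1 - lo i) -> (lower_tri i `|` upper_tri i) x.
Proof.
move=> h /andP[x1 x2] s /andP[y1 y2] nd.
have E : (pl i.+1).1 = (pl i).1 + dl by rewrite /node /= -natr1; ring.
have dn : dl != 0 by rewrite gt_eqF.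
have sd : s * dl = x.1 - (pl i).1 by rewrite /s divfK.
have s0 : 0 < s by rewrite divr_gt0// subr_gt0.
have s1 : s < 1 by rewrite ltr_pdivrMr// mul1r; lra.
have q1 : 0 < up i.+1 - lo i.+1 by rewrite subr_gt0 lu.
have q0 : 0 < up i - lo i by rewrite subr_gt0 lu// ltnW.
move: nd; rewrite neq_lt => /orP[lt|gt].
  left; pose t := (x.2 - (lo i + s * (lo i.+1 - lo i))) / (up i.+1 - lo i.+1).
  have td : t * (up i.+1 - lo i.+1) = x.2 - (lo i + s * (lo i.+1 - lo i)) by rewrite /t divfK ?gt_eqF.
  have t0 : 0 < t by rewrite divr_gt0// subr_gt0.
  have ts : t < s by rewrite /t ltr_pdivrMr//; lra.
  have -> : x = pl i + (s - t) *: (pl i.+1 - pl i) + t *: (pu i.+1 - pl i).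
    rewrite [LHS]surjective_pairing; congr (_, _) => /=; rewrite /GRing.scale/=.
      by rewrite -!natr1; rewrite /node /= in sd; lra.
    by lra.
  by apply/(tri_point _ _ _ (lt0r_neq0 (lower_gt0 h))); split; lra.
right; pose t := (x.2 - (lo i + s * (up i.+1 - lo i))) / (up i - lo i).
have td : t * (up i - lo i) = x.2 - (lo i + s * (up i.+1 - lo i)) by rewrite /t divfK ?gt_eqF.
have t0 : 0 < t by rewrite divr_gt0// subr_gt0.
have ts : s + t < 1 by rewrite -ltrBrDl /t ltr_pdivrMr//; lra.
have -> : x = pl i + s *: (pu i.+1 - pl i) + t *: (pu i - pl i).
  rewrite [LHS]surjective_pairing; congr (_, _) => /=; rewrite /GRing.scale/=.
    by rewrite -!natr1; rewrite /node /= in sd; lra.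
  by lra.
by apply/(tri_point _ _ _ (lt0r_neq0 (upper_gt0 h))).
Qed.

Lemma chain_simple : (0 < n)%N -> simple_edges (chain n).
Proof.
move=> n0.
have mem e : e \in chain n -> [\/ exists2 i, (i < n)%N & e = ed (pl i) (pl i.+1),
    exists2 i, (i < n)%N & e = ed (pu i.+1) (pu i), e = ed (pl n) (pu n) | e = ed (pu 0) (pl 0)].
  rewrite !mem_cat => /or3P[/mapP[i]|/mapP[i]|].
  - by rewrite mem_iota => /andP[_ ?] ->; apply: Or41; exists i.
  - by rewrite mem_iota => /andP[_ ?] ->; apply: Or42; exists i.
  - by rewrite !inE => /orP[/eqP->|/eqP->]; [apply: Or43|apply: Or44].
have ptl i s : segpt (ed (pl i) (pl i.+1)) s = (x0 + (i%:R + s) * dl, lo i + s * (lo i.+1 - lo i)).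
  by rewrite /segpt /=; congr (_, _) => /=; rewrite /GRing.scale/= -?natr1; ring.
have ptu i s : segpt (ed (pu i.+1) (pu i)) s = (x0 + (i%:R + (1 - s)) * dl, up i + (1 - s) * (up i.+1 - up i)).
  by rewrite /segpt /=; congr (_, _) => /=; rewrite /GRing.scale/= -?natr1; ring.
have ptr s : segpt (ed (pl n) (pu n)) s = (x0 + n%:R * dl, lo n + s * (up n - lo n)).
  by rewrite /segpt /=; congr (_, _) => /=; rewrite /GRing.scale/=; ring.
have pt0 s : segpt (ed (pu 0) (pl 0)) s = (x0 + 0%:R * dl, up 0%N - s * (up 0%N - lo 0%N)).
  by rewrite /segpt /=; congr (_, _) => /=; rewrite /GRing.scale/=; ring.
have xinj (u v : R) : x0 + u * dl = x0 + v * dl -> u = v.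
  by move/addrI; apply: mulIf; rewrite gt_eqF.
have np : 0 < (n%:R : R) by rewrite ltr0n.
have idx i j (s t : R) : 0 < s < 1 -> 0 <= t <= 1 -> i%:R + s = j%:R + t -> i = j.
  move=> /andP[s0 s1] /andP[t0 t1] E; have [lt|gt|//] := ltngtP i j.
    exfalso; have : i.+1%:R <= j%:R :> R by rewrite ler_nat.
    by rewrite -natr1; lra.
  exfalso; have : j.+1%:R <= i%:R :> R by rewrite ler_nat.
  by rewrite -natr1; lra.
have top i (s : R) : (i < n)%N -> 0 < s < 1 -> i%:R + s = n%:R -> False.
  move=> h /andP[_ s1] E; have : i.+1%:R <= n%:R :> R by rewrite ler_nat.
  by rewrite -natr1; lra.
have bot i (s : R) : 0 < s < 1 -> i%:R + s = 0%:R -> False.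
  by move=> /andP[s0 _] E; have : 0 <= i%:R :> R by []; lra.
have flip (t : R) : 0 <= t <= 1 -> 0 <= 1 - t <= 1 by move=> /andP[? ?]; apply/andP; split; lra.
have oflip (t : R) : 0 < t < 1 -> 0 < 1 - t < 1 by move=> /andP[? ?]; apply/andP; split; lra.
have mid i (s : R) : (i < n)%N -> 0 < s < 1 ->
    lo i + s * (lo i.+1 - lo i) = up i + s * (up i.+1 - up i) -> False.
  move=> h /andP[s0 s1] E; have := lu (ltnW h); have := lu h.
  by move: (lo i) (lo i.+1) (up i) (up i.+1) E => A B A' B' *; nra.
have last i (t : R) : (i < n)%N -> 0 <= t <= 1 -> n%:R = i%:R + t -> i.+1 = n /\ t = 1.
  move=> h /andP[t0 t1] E; have : i.+1%:R <= n%:R :> R by rewrite ler_nat.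
  rewrite -natr1 => h'; have t1' : t = 1 by lra.
  by split=> //; apply/eqP; rewrite -(eqr_nat R) -natr1 E t1'.
have first i (t : R) : 0 <= t <= 1 -> 0%:R = i%:R + t -> i = 0%N /\ t = 0.
  move=> /andP[t0 t1] E; have h' : 0 <= i%:R :> R by [].
  have i0 : i%:R = 0 :> R by lra.
  by split; [apply/eqP; rewrite -(eqr_nat R) i0|lra].
split.
  have nz (e : plane * plane) s t : segpt e s <> segpt e t -> e.2 != 0.
    by move=> H; apply/eqP => E; apply: H; rewrite /segpt E !scaler0.
  move=> e /mem[[i h ->]|[i h ->]|->|->]; apply: (nz _ 0 1).
  - by rewrite !ptl => -[/xinj E _]; lra.
  - by rewrite !ptu => -[/xinj E _]; lra.
  - by rewrite !ptr => -[E]; have := lu (leqnn n); lra.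
  - by rewrite !pt0 => -[E]; have := lu (leq0n n); lra.
move=> e e' /mem[[i h ->]|[i h ->]|->|->] /mem[[j h' ->]|[j h' ->]|->|->] ne s t s01 t01; apply/eqP;
  rewrite ?ptl ?ptu ?ptr ?pt0 => -[].
- by move=> /xinj/(idx _ _ _ _ s01 t01) E _; rewrite E eqxx in ne.
- move=> /xinj E; have ij := idx _ _ _ _ s01 (flip _ t01) E; subst j.
  by move: E => /addrI <-; apply: mid.
- by move=> /xinj/(top _ _ h s01).
- by move=> /xinj/(bot _ _ s01).
- move=> /xinj E; have ij := idx _ _ _ _ (oflip _ s01) t01 E; subst j.
  move: E => /addrI E; rewrite -E => /esym; apply: mid => //; exact: oflip.
- by move=> /xinj/(idx _ _ _ _ (oflip _ s01) (flip _ t01)) E _; rewrite E eqxx in ne.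
- by move=> /xinj/(top _ _ h (oflip _ s01)).
- by move=> /xinj/(bot _ _ (oflip _ s01)).
- move=> /xinj/(last _ _ h' t01)[<- ->] E; move: s01 => /andP[s0 s1].
  have := lu h'; move: (lo _) (up _) E => A B E *; nra.
- move=> /xinj/(last _ _ h' (flip _ t01))[<- ->] E; move: s01 => /andP[s0 s1].
  have := lu h'; move: (lo _) (up _) E => A B E *; nra.
- by rewrite eqxx in ne.
- by move=> /xinj E; rewrite E ltxx in np.
- move=> /xinj/(first _ _ t01)[-> ->] E; move: s01 => /andP[s0 s1].
  have := lu (leq0n n); move: (lo _) (up _) E => A B E *; nra.
- move=> /xinj/(first _ _ (flip _ t01))[-> ->] E; move: s01 => /andP[s0 s1].
  have := lu (leq0n n); move: (lo 0%N) (up 0%N) E => A B E *; nra.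
- by move=> /xinj E; rewrite -E ltxx in np.
- by rewrite eqxx in ne.
Qed.

End Nondegenerate.

Lemma concave_variation (a : nat -> R) n :
  (forall i, (i.+2 <= n)%N -> a i.+2 - a i.+1 <= a i.+1 - a i) ->
  exists2 k, (k <= n)%N & \sum_(i < n) `|a i.+1 - a i| = 2 * a k - a 0%N - a n.
Proof.
move=> H; suff [k kn [E _]] : exists2 k, (k <= n)%N & \sum_(i < n) `|a i.+1 - a i| = 2 * a k - a 0%N - a n /\
    (k = n \/ exists2 m, n = m.+1 & a n <= a m) by exists k.
elim: n H => [|n IH] H; first by exists 0%N => //; rewrite big_ord0; split; [ring|left].
have [|k kn [E alt]] := IH; first by move=> i h; apply: H; exact: leqW.
rewrite big_ord_recr/=; have [d0|d0] := leP 0 (a n.+1 - a n); last first.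
  exists k; first exact: leqW.
  split; first by rewrite E ltr0_norm//; ring.
  by right; exists n => //; lra.
case: alt => [kE|[m' nE le]].
  by exists n.+1 => //; split; [rewrite E kE ger0_norm//; ring|left].
have := H m'; rewrite -nE => /(_ (leqnn _)) h.
exists k; first exact: leqW.
have -> : a n.+1 = a n by lra.
by rewrite subrr normr0 addr0 E; split=> //; right; exists n.
Qed.

(** For [theta.2 >= 0] the form is concave along the upper chain, and so is its opposite along the
    lower one. Their variations are twice the maxima minus end values, which the two vertical sides
    cancel; what is left is twice one difference between points of [K]. *)
Lemma chain_width n (theta : plane) (K : set plane) M : K `<=` box M ->
  (forall i, (i <= n)%N -> lo i < up i /\ K (pl i) /\ K (pu i)) ->
  (forall i, (i.+2 <= n)%N -> up i + up i.+2 <= 2 * up i.+1 /\ 2 * lo i.+1 <= lo i + lo i.+2) ->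
  \sum_(e <- chain n) `|lin theta e.2| <= 2 * width theta K.
Proof.
move=> KM HK conv.
have main th : 0 <= th.2 -> \sum_(e <- chain n) `|lin th e.2| <=
    2 * sup [set r | exists x y, [/\ K x, K y & r = lin th (x - y)]].
  move=> th0; pose a i := lin th (pu i); pose b i := - lin th (pl i).
  have [|k kn Ea] := @concave_variation a n.
    move=> i /conv[h _]; rewrite /a /lin /node /= -!natr1.
    by move: th0 h; move: th.1 th.2 (up i) (up i.+1) (up i.+2) => A B u v w B0 h; nra.
  have [|j jn Eb] := @concave_variation b n.
    move=> i /conv[_ h]; rewrite /b /lin /node /= -!natr1.
    by move: th0 h; move: th.1 th.2 (lo i) (lo i.+1) (lo i.+2) => A B u v w B0 h; nra.
  rewrite /chain !big_cat/= !big_map !big_cons big_nil addr0.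
  rewrite -{1 2}[n]subn0 -!/(index_iota 0 n) !big_mkord /=.
  have -> : \sum_(i < n) `|lin th (pl i.+1 - pl i)| = \sum_(i < n) `|b i.+1 - b i|.
    by apply: eq_bigr => i _; rewrite /b linB -normrN; congr `|_|; ring.
  have -> : \sum_(i < n) `|lin th (pu i - pu i.+1)| = \sum_(i < n) `|a i.+1 - a i|.
    by apply: eq_bigr => i _; rewrite /a linB distrC.
  rewrite Ea Eb.
  have vt i : (i <= n)%N -> `|lin th (pu i - pl i)| = a i + b i.
    move=> /HK[lt _]; rewrite /a /b linB ger0_norm//.
    by rewrite /lin /node /= ; move: lt th0; move: (lo i) (up i) th.2 => A B C *; nra.
  have -> : `|lin th (pu n - pl n)| = a n + b n by exact: vt.
  have -> : `|lin th (pl 0%N - pu 0%N)| = a 0%N + b 0%N.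
    by rewrite -vt// !linB distrC.
  have : lin th (pu k - pl j) <= sup [set r | exists x y, [/\ K x, K y & r = lin th (x - y)]].
    exact: (width_ge th KM (HK k kn).2.2 (HK j jn).2.1).
  by rewrite linB -/(a k) -[- lin th (pl j)]/(b j) => h; lra.
have [t0|t0] := leP 0 theta.2; first exact: main.
have := main (- theta); rewrite /= oppr_ge0 ltW// => /(_ isT).
have nl v : lin (- theta) v = - lin theta v by rewrite /lin /=; ring.
under eq_bigr do rewrite nl normrN.
congr (_ <= 2 * sup _); apply/seteqP; split=> r /= [x [y [Kx Ky ->]]];
  by exists y, x; split=> //; rewrite ?nl !linB; ring.
Qed.

End Slab.

(** * Inscribed polygons as competitors *)

Section Competitor.
Context {R : realType}.
Local Notation plane := (plane R).
Implicit Types (A K G : set plane) (x y z w c : plane).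

Lemma line_null A e (b M : R) : e != 0 -> A `<=` box M -> (forall x, A x -> lin e x = b) -> area A = 0%E.
Proof.
move=> e0 AM Ae; apply/eqP; rewrite eq_le area_ge0 andbT.
suff : (area A <= (8 * 0)%:E)%E by rewrite mulr0.
apply: (area_det_bound AM) => // x1 x2 x3 /Ae h1 /Ae h2 /Ae h3.
have u0 : lin e (x2 - x1) = 0 by rewrite linB h1 h2 subrr.
have v0 : lin e (x3 - x1) = 0 by rewrite linB h1 h3 subrr.
move: (x2 - x1) (x3 - x1) u0 v0 => u v u0 v0; rewrite /lin in u0 v0.
suff -> : lin (perp u) v = 0 by rewrite normr0.
have z1 : e.1 * lin (perp u) v = 0.
  rewrite /lin /perp /= (_ : _ * _ = - u.2 * (e.1 * v.1 + e.2 * v.2) + v.2 * (e.1 * u.1 + e.2 * u.2)); last by ring.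
  by rewrite u0 v0 !mulr0 addr0.
have z2 : e.2 * lin (perp u) v = 0.
  rewrite /lin /perp /= (_ : _ * _ = u.1 * (e.1 * v.1 + e.2 * v.2) - v.1 * (e.1 * u.1 + e.2 * u.2)); last by ring.
  by rewrite u0 v0 !mulr0 subr0.
apply/eqP; apply: contraNT e0 => n0.
move/eqP: z1; rewrite mulf_eq0 (negbTE n0) orbF => /eqP E1.
move/eqP: z2; rewrite mulf_eq0 (negbTE n0) orbF => /eqP E2.
by apply/eqP; rewrite [e]surjective_pairing E1 E2.
Qed.

Lemma area_homothety A (k : R) v : 0 < k -> measurable A ->
  measurable [set x | A (k *: x + v)] /\ area [set x | A (k *: x + v)] = ((k ^+ 2)^-1%:E * area A)%E.
Proof.
move=> k0 mA; have mT := @measurable_affine2 R k 0 0 k v.1 v.2.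
have E : [set x | A (k *: x + v)] =
    (fun x : plane => (k * x.1 + 0 * x.2 + v.1, 0 * x.1 + k * x.2 + v.2) : plane) @^-1` A.
  by apply/seteqP; split=> x /=; rewrite !mul0r addr0 add0r.
have mX : measurable [set x | A (k *: x + v)].
  by rewrite E -[X in measurable X]setTI; exact: mT.
split=> //.
have L X : measurable X -> (borel_area X = \int[borel_area]_x (\1_X x)%:E)%E.
  by move=> mX'; rewrite (integral_indic borel_area measurableT mX') setIT.
rewrite (area_borel mA) (area_borel mX) !L//.
have D0 : k * k - 0 * 0 != 0 by rewrite mul0r subr0 mulf_neq0// gt_eqF.
have mi : measurable_fun setT (fun x : plane => (\1_A x : R)%:E).
  by apply/measurable_EFinP; exact: measurable_indic.
have := @ge0_integral_affine2 _ (fun x : plane => (\1_A x : R)%:E) k 0 0 k v.1 v.2 D0 mi.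
rewrite mul0r subr0 -expr2 ger0_norm ?sqr_ge0// => <-; last by move=> x; rewrite lee_fin.
by apply: eq_integral => x _; rewrite E.
Qed.

Lemma aniso_perimeter_set0 (phi : plane -> R) : is_norm phi -> (aniso_perimeter phi set0 <= 0)%E.
Proof.
move=> N; have m0 : measurable (set0 : set plane) by [].
have f0 : (borel_area (set0 : set plane) < +oo)%E by rewrite measure0.
have s0 : simple_edges ([::] : seq (plane * plane)) by split.
have fl : boundary_flux m0 f0 [::].
  move=> f tf; rewrite !big_nil; split; apply: EFin_inj;
    by rewrite -(integral_borel_rI m0 f0 (test_derive_bmf _ tf)) integral_set0.
by have := edges_perimeter s0 fl N; rewrite big_nil.
Qed.

Lemma convex_sections K : ccs K -> forall x : R, exists p : R * R,
  (exists y : R, K (x, y)) -> [/\ K (x, p.1), K (x, p.2) & forall y : R, K (x, y) -> p.1 <= y <= p.2].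
Proof.
move=> hK x; have [[y0 Ky0]|no] := pselect (exists y : R, K (x, y)); last by exists (0, 0).
have [M KM] := ccs_box hK.
have cl : closed K by exact: ccs_closed.
have kS : compact (`[- M, M]%classic `&` (fun y : R => (x, y) : plane) @^-1` K).
  apply: compact_closedI; first exact: segment_compact.
  rewrite (_ : (fun y : R => (x, y) : plane) = segpt ((x, 0), (0, 1))).
    by apply: preimage_closed => // y _; exact: segpt_continuous.
  by apply/funext => y; congr (_, _) => /=; rewrite /GRing.scale/=; ring.
have inS (y : R) : K (x, y) -> (`[- M, M]%classic `&` (fun y : R => (x, y) : plane) @^-1` K) y.
  by move=> Ky; split=> //; have /boxP[_] := KM _ Ky; rewrite /= in_itv/= ler_norml.
have ne : `[- M, M]%classic `&` (fun y : R => (x, y) : plane) @^-1` K !=set0 by exists y0; exact: inS.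
have [l [_ Kl] Hl] := compact_min ne kS (fun u : R => cvg_id).
have [u [_ Ku] Hu] := compact_max ne kS (fun u : R => cvg_id).
by exists (l, u) => _; split=> // y Ky; rewrite Hl ?Hu//; exact: inS.
Qed.

Lemma interp_between (a b a' b' s z e : R) : 0 < s -> s < 1 -> 0 < e -> a <= z - e -> b <= z - e ->
  z + e <= a' -> z + e <= b' -> a + s * (b - a) < z < a' + s * (b' - a').
Proof. by move=> s0 s1 e0 h1 h2 h3 h4; apply/andP; split; nra. Qed.

(** Vertical sections of [K] at equidistant abscissas give an inscribed polygon. Up to null lines it
    contains the copy of [K] shrunk towards an interior point [c], since about each point of that
    copy [K] contains a ball wider than the mesh. *)
Lemma competitor (phi : plane -> R) l K (eps : R) : is_norm phi ->
  (forall p, p \in l -> 0 <= p.1) -> (forall x, phi x <= psi l x) -> ccs K -> 0 < eps ->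
  exists G, [/\ measurable G, G `<=` K, (aniso_perimeter phi G <= (wperimeter l K)%:E)%E &
    ar K - eps <= ar G].
Proof.
move=> N hl le hK eps0; have [M0 KM0] := ccs_box hK.
pose M := `|M0| + 1; have Mp : 0 < M by rewrite ltr_wpDl.
have KM : K `<=` box M.
  by move=> x /KM0/boxP[h1 h2]; apply/boxP; have := ler_norm M0; rewrite /M; split; lra.
have mK := ccs_measurable hK.
have [a0|a0] := leP (ar K) 0.
  exists set0; split=> //; last by rewrite {2}/ar area0/=; lra.
  apply: le_trans (aniso_perimeter_set0 N) _; rewrite lee_fin.
  exact: (wperimeter_ge0 hl KM).
have [|c cK] := cvx_has_ball hK.2 KM Mp a0; first by rewrite (arE KM).
set rho := ar K / (216 * M) in cK.
have rho0 : 0 < rho by apply: divr_gt0; [exact: a0|apply: mulr_gt0; [rewrite ltr0n|exact: Mp]].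
clearbody rho.
(* Shrinking with ratio [1 - t] loses at most [2 t ar K <= eps] of area, and [t <= 1/2] keeps the
   ratio away from 0. *)
pose t := Num.min 2^-1 (eps / (2 * ar K)).
have t0 : 0 < t by rewrite lt_min invr_gt0 ltr0n/=; apply: divr_gt0 => //; apply: mulr_gt0.
have t1 : t <= 2^-1 by rewrite /t ge_min lexx.
have te : t * (2 * ar K) <= eps by rewrite -ler_pdivlMr ?mulr_gt0// /t ge_min lexx orbT.
clearbody t.
pose r := t * rho; have r0 : 0 < r by exact: mulr_gt0.
have ballK w : K w -> eball (w + t *: (c - w)) r `<=` K by move=> Kw; apply: cvx_ball => //; [exact: hK.2|lra].
have Kc : K c by apply: cK; rewrite /eball/= subrr enorm0.
have Kne : K !=set0 by exists c.
have cfst : continuous (fun x : plane => x.1 : R) by move=> x; exact: cvg_fst.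
have [wa Kwa Ha] := compact_min Kne hK.1 cfst.
have [wb Kwb Hb] := compact_max Kne hK.1 cfst.
have off (s : R) : `|s| < rho -> K (c + (s, 0)).
  move=> hs; apply: cK; rewrite /eball/= addrAC subrr add0r /enorm/= expr0n addr0 sqrtr_sqr//.
have ac : wa.1 < c.1.
  have : `|- (rho / 2)| < rho by rewrite normrN gtr0_norm ?divr_gt0//; lra.
  by move=> /off/Ha /=; lra.
have cb : c.1 < wb.1.
  have : `|rho / 2| < rho by rewrite gtr0_norm ?divr_gt0//; lra.
  by move=> /off/Hb /=; lra.
pose xa := wa.1 + t * (c.1 - wa.1); pose xb := wb.1 + t * (c.1 - wb.1).
have ab : xa < xb by rewrite /xa /xb; nra.
(* Enough columns for the mesh [dl] to be smaller than [r], the radius of the ball that [K] contains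
   about each point of the shrunk copy. *)
pose n := (archimedean.Num.truncn ((xb - xa) / r)).+1.
have n0 : 0 < n%:R :> R by rewrite ltr0n.
pose dl := (xb - xa) / n%:R.
have dl0 : 0 < dl by rewrite divr_gt0// subr_gt0.
have dlr : dl < r.
  by rewrite ltr_pdivrMr// mulrC -ltr_pdivrMr//; exact: archimedean.Num.Theory.truncnS_gt.
have ndl : n%:R * dl = xb - xa by rewrite /dl mulrC divfK// gt_eqF.
have [hh Hh] := choice (convex_sections hK).
pose xi (i : nat) : R := xa + i%:R * dl.
pose lo i := (hh (xi i)).1; pose up i := (hh (xi i)).2.
have center i : (i <= n)%N -> exists y : R, forall v : plane, enorm (v - (xi i, y)) < r -> K v.
  move=> ni; pose s := i%:R / n%:R : R.
  have s01 : 0 <= s <= 1 by rewrite divr_ge0//= ler_pdivrMr// mul1r ler_nat.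
  have := ballK _ (hK.2 wa wb s Kwa Kwb s01); set w := wa + s *: (wb - wa) => bw.
  exists (w + t *: (c - w)).2 => v hv; apply: bw; rewrite /eball/=; move: hv; congr (enorm (_ - _) < _).
  rewrite [RHS]surjective_pairing; congr (_, _).
  have sdl : i%:R * dl = s * (xb - xa) by rewrite /dl /s; ring.
  by rewrite /xi sdl /w /xa /xb /= /GRing.scale/=; ring.
have sec i : (i <= n)%N -> [/\ K (xi i, lo i), K (xi i, up i) &
    forall y : R, K (xi i, y) -> lo i <= y <= up i].
  by move=> /center[y Hy]; apply: Hh; exists y; apply: Hy; rewrite subrr enorm0.
have vert (x1 y1 y2 : R) : enorm ((x1, y1) - (x1, y2) : plane) = `|y1 - y2|.
  by rewrite /enorm/= subrr expr0n add0r sqrtr_sqr.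
have lu i : (i <= n)%N -> lo i < up i.
  move=> ni; have [y Hy] := center i ni; have [_ _ H] := sec i ni.
  have h1 : K (xi i, y - r / 2) by apply: Hy; rewrite vert addrAC subrr add0r normrN gtr0_norm ?divr_gt0//; lra.
  have h2 : K (xi i, y + r / 2) by apply: Hy; rewrite vert addrAC subrr add0r gtr0_norm ?divr_gt0//; lra.
  by have /andP[a1 a2] := H _ h1; have /andP[a3 a4] := H _ h2; clear -a1 a4 r0; lra.
have nodes i : (i <= n)%N -> K (node xa dl lo i) /\ K (node xa dl up i) by move=> /sec[].
pose G := slab xa dl lo up n.
have mG : measurable G by exact: slab_measurable.
have GK : G `<=` K by apply: (slab_sub dl0 lu hK.2 nodes).
have finG : (borel_area G < +oo)%E.
  by rewrite -area_borel//; apply: le_lt_trans (le_area (subset_trans GK KM)) _; rewrite area_borel ?box_finite//; exact: box_measurable.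
have simp := chain_simple xa dl0 lu (ltn0Sn _).
have flux : boundary_flux mG finG (chain xa dl lo up n).
  move=> f tf; have [f1 f2] := slab_flux xa dl0 lu (leqnn n) tf.
  by split; apply: EFin_inj; rewrite -(integral_borel_rI mG finG (test_derive_bmf _ tf)) ?f1 ?f2.
exists G; split=> //.
  apply: le_trans (edges_perimeter simp flux N) _; rewrite lee_fin.
  apply: (@le_trans _ _ (\sum_(e <- chain xa dl lo up n) psi l (e.2.2, - e.2.1))).
    by apply: ler_sum => e _; exact: le.
  rewrite /psi exchange_big/= /wperimeter big_seq [leRHS]big_seq; apply: ler_sum => p pl.
  rewrite -mulr_sumr [2 * _]mulrC -mulrA ler_wpM2l ?hl//.
  have -> : \sum_(e <- chain xa dl lo up n) `|lin p.2 (e.2.2, - e.2.1)| =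
      \sum_(e <- chain xa dl lo up n) `|lin (perp p.2) e.2|.
    by apply: eq_bigr => e _; congr `|_|; rewrite /lin /perp /=; ring.
  apply: (chain_width (perp p.2) KM) => i ni; first by split; [exact: lu|exact: nodes].
  have [l0 u0 H0] := sec i (ltnW (ltnW ni)); have [l2 u2 H2] := sec i.+2 ni.
  have [_ _ H1] := sec i.+1 (ltnW ni).
  have mid (y1 y2 : R) : K (xi i, y1) -> K (xi i.+2, y2) -> K (xi i.+1, (y1 + y2) / 2).
    move=> k1 k2; have h : 0 <= (2^-1 : R) <= 1 by rewrite invr_ge0 ler0n/= invf_le1 ?ler1n ?ltr0n.
    have := hK.2 _ _ _ k1 k2 h; congr (K _).
    by congr (_, _) => /=; rewrite /xi /GRing.scale/= -?natr1; field.
  by have /andP[a1 a2] := H1 _ (mid _ _ l0 l2); have /andP[a3 a4] := H1 _ (mid _ _ u0 u2); clear -a1 a2 a3 a4; lra.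
have t1' : 0 < 1 - t by lra.
pose Kt := [set x : plane | K ((1 - t)^-1 *: x + - (t / (1 - t)) *: c)].
have it0 : 0 < (1 - t)^-1 by rewrite invr_gt0.
have [_ aKt] := area_homothety (- (t / (1 - t)) *: c) it0 mK.
rewrite -/Kt exprVn invrK in aKt.
have KtE z : Kt z -> exists2 w, K w & z = w + t *: (c - w).
  move=> Kz; exists ((1 - t)^-1 *: z + - (t / (1 - t)) *: c) => //.
  case: (z) (c) => z1 z2 [c1 c2].
  by congr (_, _) => /=; rewrite /GRing.scale/=; field; rewrite gt_eqF.
pose V (k : nat) := [set x : plane | K x /\ lin (1, 0) x = xi k].
pose D (k : nat) := [set x : plane | K x /\ lin (- (up k.+1 - lo k) / dl, 1) x = lo k - (up k.+1 - lo k) / dl * xi k].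
have V0 k : area (V k) = 0%E.
  apply: (@line_null _ (1, 0) (xi k) M); [|by move=> x [/KM]|by move=> x []].
  by apply/eqP => -[] /eqP; rewrite oner_eq0.
have D0 k : area (D k) = 0%E.
  apply: (@line_null _ (- (up k.+1 - lo k) / dl, 1) (lo k - (up k.+1 - lo k) / dl * xi k) M); [|by move=> x [/KM]|by move=> x []].
  by apply/eqP => -[] _ /eqP; rewrite oner_eq0.
have cover : Kt `<=` G `|` (\bigcup_k V k `|` \bigcup_k D k).
  move=> z /KtE[w Kw zE]; have zb := ballK w Kw; rewrite -zE in zb.
  have Kz : K z by apply: zb; rewrite /eball/= subrr enorm0.
  have [[k zk]|nk] := pselect (exists k, z.1 = xi k).
    by right; left; exists k => //; split=> //; rewrite /lin mul1r mul0r addr0.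
  have za : xa <= z.1 by rewrite zE /= /GRing.scale/= /xa; have := Ha _ Kw => /= h; clear -h t1'; nra.
  have zb' : z.1 <= xb by rewrite zE /= /GRing.scale/= /xb; have := Hb _ Kw => /= h; clear -h t1'; nra.
  pose q := (z.1 - xa) / dl.
  have q0 : 0 <= q by rewrite divr_ge0 ?(ltW dl0)// subr_ge0.
  have qd : q * dl = z.1 - xa by rewrite /q divfK// gt_eqF.
  have /andP[i1 i2] := archimedean.Num.Theory.truncn_itv q0; set i := archimedean.Num.truncn q in i1 i2.
  have x1 : xi i < z.1.
    rewrite lt_neqAle; apply/andP; split; first by apply/eqP => E; apply: nk; exists i.
    by rewrite /xi; have : i%:R * dl <= q * dl; [rewrite ler_pM2r|clear -qd; lra].
  have x2 : z.1 < xi i.+1.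
    by rewrite /xi; have : q * dl < i.+1%:R * dl; [rewrite ltr_pM2r|clear -qd; lra].
  have hin : (i < n)%N.
    rewrite -(ltr_nat R) -(ltr_pM2r dl0) ndl; apply: lt_le_trans (_ : z.1 - xa <= _); last by rewrite lerD2r.
    by move: x1; rewrite /xi; clear; lra.
  have xs : xi i.+1 = xi i + dl by rewrite /xi -natr1; ring.
  pose eta := (r - dl) / 2; have eta0 : 0 < eta by rewrite divr_gt0// subr_gt0.
  (* At both neighbouring abscissas [K] still contains points [eta] above and below the height of
     [z], so [z] lies strictly between the interpolated chains. *)
  have near k (s : R) : `|xi k - z.1| < dl -> `|s| <= eta -> K (xi k, z.2 + s).
    move=> hk hs; apply: zb; rewrite /eball/=; apply: le_lt_trans (enorm_le _) _ => /=.
    by rewrite [z.2 + s]addrC addrK; rewrite /eta in hs; clear -hk hs dlr; lra.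
  have d1 : `|xi i - z.1| < dl by rewrite ltr0_norm ?subr_lt0//; clear -x2 xs; lra.
  have d2 : `|xi i.+1 - z.1| < dl by rewrite gtr0_norm ?subr_gt0//; clear -x1 xs; lra.
  have e1 : `|eta| <= eta by rewrite gtr0_norm.
  have e2 : `|- eta| <= eta by rewrite normrN gtr0_norm.
  have [_ _ H0] := sec i (ltnW hin); have [_ _ H1] := sec i.+1 hin.
  have /andP[_ b1] := H0 _ (near _ _ d1 e1); have /andP[b2 _] := H0 _ (near _ _ d1 e2).
  have /andP[_ b3] := H1 _ (near _ _ d2 e1); have /andP[b4 _] := H1 _ (near _ _ d2 e2).
  pose s := (z.1 - (node xa dl lo i).1) / dl.
  have sE : s * dl = z.1 - xi i by rewrite /s divfK// gt_eqF.
  have s0 : 0 < s by rewrite divr_gt0// subr_gt0.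
  have s1 : s < 1 by rewrite ltr_pdivrMr// mul1r /node /= -/(xi i); clear -x2 xs; lra.
  have [Dz|nD] := eqVneq z.2 (lo i + s * (up i.+1 - lo i)).
    right; right; exists i => //; split=> //; rewrite /lin /= mul1r Dz /s /node /= -/(xi i).
    by field; rewrite gt_eqF.
  left; have bx : (node xa dl lo i).1 < z.1 < (node xa dl lo i.+1).1 by rewrite x1.
  have : (lower_tri xa dl lo up i `|` upper_tri xa dl lo up i) z.
    apply: (slab_cover dl0 lu hin bx) nD; rewrite -/s.
    exact: (interp_between s0 s1 eta0).
  move: hin; rewrite /G; elim: (n) => // k IH; rewrite ltnS leq_eqVlt => /predU1P[<- h|h h']; first by right.
  by left; exact: IH.
have : (area Kt <= area G)%E.
  apply: le_trans (le_area cover) _; apply: le_trans (areaU _ _) _.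
  have -> : area (\bigcup_k V k `|` \bigcup_k D k) = 0%E.
    apply/eqP; rewrite eq_le area_ge0 andbT; apply: le_trans (areaU _ _) _.
    rewrite -[leRHS]adde0; apply: leeD; apply: le_trans (area_bigcup _) _;
      by rewrite eseries0// => k _ _; rewrite ?V0 ?D0.
  by rewrite adde0.
rewrite aKt (arE KM) (arE (subset_trans GK KM)) -EFinM lee_fin; clear -te t0 t1 a0; nra.
Qed.

End Competitor.

(** * Approximation of planar norms by zonotopes *)

Section Zonoid.
Context {R : realType} (phi : plane R -> R).
Local Notation plane := (plane R).
Implicit Types (x y : plane) (l : seq (R * plane)).
Hypothesis N : is_norm phi.

Lemma psi_continuous l : continuous (psi l).
Proof.
elim: l => [|p l IH].
  rewrite (_ : psi [::] = fun=> 0); last by apply/funext => x; rewrite /psi big_nil.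
  by move=> x; exact: cvg_cst.
rewrite (_ : psi (p :: l) = fun x => p.1 * `|lin p.2 x| + psi l x); last by apply/funext => x; rewrite /psi big_cons.
move=> x; apply: cvgD; last exact: IH.
by apply: cvgM; [exact: cvg_cst|apply: cvg_norm; exact: lin_continuous].
Qed.

Lemma norm_lower : exists2 kappa : R, 0 < kappa & forall x, kappa * enorm x <= phi x.
Proof.
have [Z0 Z _] := N.
pose S := [set x : plane | enorm x = 1].
have kS : compact S.
  have cS : closed S.
    have -> : S = @enorm R @^-1` [set 1] by [].
    apply: preimage_closed; last by apply: compact_closed; [exact: norm_hausdorff|exact: compact_set1].
    by move=> x _; exact (@enorm_continuous R x).
  have -> : S = box 1 `&` S.
    apply/seteqP; split=> [x Sx|x []//]; split=> //.
    by apply/boxP; rewrite -Sx; split; [exact: le_enorm1|exact: le_enorm2].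
  by apply: compact_closedI => //; exact: box_compact.
have S0 : S !=set0 by exists (1, 0); rewrite /S /= /enorm/= expr1n expr0n addr0 sqrtr1.
have [z Sz Hz] := compact_min S0 kS (is_norm_continuous N).
exists (phi z).
  rewrite lt_neqAle norm_ge0// andbT eq_sym; apply/eqP => /Z0 z0.
  by move: Sz; rewrite /S /= z0 enorm0 => /esym/eqP; rewrite oner_eq0.
move=> x; have [->|x0] := eqVneq x 0; first by rewrite enorm0 mulr0 norm0.
have e0 : 0 < enorm x by rewrite sqrtr_gt0; exact: sqr_sum_gt0.
have := Hz ((enorm x)^-1 *: x); rewrite /S /= enormZ Z gtr0_norm ?invr_gt0// mulVf ?gt_eqF// => /(_ erefl).
by rewrite mulrC ler_pdivlMr.
Qed.

(** By homogeneity [phi x] is [|x.1| g (x.2 / x.1)] off the axis, so the plane problem becomes one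
    about a convex function of one variable. Its Lipschitz constant [b] is also its asymptotic slope
    at both ends. *)
Let g (t : R) := phi (1, t).
Let b := phi (0, 1).

Let b0 : 0 < b.
Proof.
have [Z0 _ _] := N; rewrite lt_neqAle norm_ge0// andbT eq_sym; apply/eqP => /Z0.
by move=> [] /eqP; rewrite oner_eq0.
Qed.

Let g_lip s t : g s <= g t + b * `|s - t|.
Proof.
have [_ Z D] := N; rewrite /g (_ : (1, s) = (1, t) + (s - t) *: (0, 1)).
  by apply: le_trans (D _ _) _; rewrite Z [b * _]mulrC.
by congr (_, _) => /=; rewrite /GRing.scale/=; ring.
Qed.

Let g_convex s t (a : R) : 0 <= a <= 1 -> g (s + a * (t - s)) <= g s + a * (g t - g s).
Proof.
move=> /andP[a0 a1]; have [_ Z D] := N.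
rewrite /g (_ : (1, s + a * (t - s)) = (1 - a) *: (1, s) + a *: (1, t)).
  by apply: le_trans (D _ _) _; rewrite !Z !ger0_norm ?subr_ge0//; lra.
by congr (_, _) => /=; rewrite /GRing.scale/=; ring.
Qed.

Let abel (S r : nat -> R) n : \sum_(i < n.+1) (S i.+1 - S i) * r i =
  S n.+1 * r n - S 0%N * r 0%N + \sum_(i < n) S i.+1 * (r i - r i.+1).
Proof.
elim: n => [|n IH]; first by rewrite big_ord_recr !big_ord0/=; ring.
by rewrite big_ord_recr/= IH [in RHS]big_ord_recr/=; ring.
Qed.

Section Grid.
Context (T : R) (n : nat).
Hypotheses (T0 : 0 < T) (n0 : (0 < n)%N).
Let d := 2 * T / n%:R.
Let tau (i : nat) := - T + i%:R * d.
Let gi i := g (tau i).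

Let np : 0 < n%:R :> R. Proof. by rewrite ltr0n. Qed.
Let d0 : 0 < d. Proof. by apply: divr_gt0 => //; exact: mulr_gt0. Qed.
Let tauS i : tau i.+1 = tau i + d. Proof. by rewrite /tau -natr1; ring. Qed.
Let tau0 : tau 0%N = - T. Proof. by rewrite /tau mul0r addr0. Qed.
Let taun : tau n = T. Proof. by rewrite /tau /d mulrC divfK ?gt_eqF//; ring. Qed.
Let tau_le i j : (i <= j)%N -> tau i <= tau j.
Proof. by move=> ij; rewrite lerD2l ler_pM2r// ler_nat. Qed.

Let slope i := (gi i.+1 - gi i) / d.
Let Q k t := \sum_(i < k) slope i * (`|t - tau i| - `|t - tau i.+1|).

Let slope_d i : slope i * d = gi i.+1 - gi i. Proof. by rewrite divfK// gt_eqF. Qed.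

Let Q_right k t : tau k <= t -> Q k t = gi k - gi 0%N.
Proof.
elim: k => [|k IH] kt; first by rewrite /Q big_ord0 subrr.
rewrite /Q big_ord_recr/= -/(Q k t) IH; last by apply: le_trans kt; exact: tau_le.
rewrite !ger0_norm ?subr_ge0//; last by apply: le_trans kt; exact: tau_le.
by rewrite tauS (_ : _ - _ - _ = d); [rewrite slope_d; ring|ring].
Qed.

Let Q_left k t : t <= tau 0%N -> Q k t = gi 0%N - gi k.
Proof.
move=> t0; elim: k => [|k IH]; first by rewrite /Q big_ord0 subrr.
rewrite /Q big_ord_recr/= -/(Q k t) IH !ler0_norm ?subr_le0;
  try by apply: le_trans t0 _; exact: tau_le.
by rewrite tauS (_ : - (t - tau k) - - (t - (tau k + d)) = - d); [rewrite mulrN slope_d; ring|ring].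
Qed.

Let Q_cell k m t : (k < m)%N -> tau k <= t <= tau k.+1 ->
  Q m t = gi k - gi 0%N + slope k * (2 * (t - tau k) - d) - (gi m - gi k.+1).
Proof.
move=> km /andP[t1 t2]; elim: m km => // m IH; rewrite ltnS leq_eqVlt => /predU1P[<-|km].
  rewrite /Q big_ord_recr/= -/(Q k t) Q_right// ger0_norm ?subr_ge0// ler0_norm ?subr_le0//.
  by rewrite tauS; ring.
rewrite /Q big_ord_recr/= -/(Q m t) IH// !ler0_norm ?subr_le0;
  try (by apply: le_trans t2 _; apply: tau_le => //; exact: leqW).
by rewrite tauS (_ : - (t - tau m) - _ = - d); [rewrite mulrN slope_d; ring|ring].
Qed.

(** Slopes of the piecewise linear interpolant, extended by [- b] before the grid and [b] after it.
    [S i] belongs to the interval that ends at [tau i], hence the shift of index. *)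
Let S i := if i is j.+1 then if (j < n)%N then slope j else b else - b.
Let c := (gi 0%N + gi n) / 2 - b * T.

Let slope_le i : `|slope i| <= b.
Proof.
rewrite /slope normrM [`|d^-1|]gtr0_norm ?invr_gt0// ler_pdivrMr//.
have h1 := g_lip (tau i.+1) (tau i); have h2 := g_lip (tau i) (tau i.+1).
have e1 : tau i.+1 - tau i = d by rewrite tauS [tau i + d]addrC addrK.
have e2 : tau i - tau i.+1 = - d by rewrite -e1 opprB.
rewrite e1 gtr0_norm// in h1; rewrite e2 normrN gtr0_norm// in h2.
by rewrite ler_norml /gi; apply/andP; split; lra.
Qed.

Let S_mono i : 0 <= S i.+1 - S i.
Proof.
case: i => [|i] /=.
  by rewrite n0 opprK; have := slope_le 0%N; rewrite ler_norml => /andP[]; lra.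
have [h1|h1] := ltnP i.+1 n; last first.
  case: ltnP => _; last by rewrite subrr.
  by have := slope_le i; rewrite ler_norml => /andP[]; lra.
rewrite (ltn_trans _ h1)// /slope -mulrBl divr_ge0 ?(ltW d0)//.
have := @g_convex (tau i) (tau i.+2) 2^-1; rewrite invr_ge0 ler0n/= invf_le1 ?ler1n ?ltr0n// => /(_ isT).
rewrite (_ : _ + _ * _ = tau i.+1); last by rewrite !tauS; field.
by rewrite -!/(gi _); lra.
Qed.

(** A convex piecewise linear function is a combination of [|t - tau i|] whose weights are half the
    jumps of its slopes. At [(1, t)] this gives the interpolant of [g] at the nodes with slopes of
    modulus [b] outside; [c] is the remaining constant, nonnegative by the triangle inequality
    between [(1, T)] and [(1, - T)]. *)
Definition zonoid : seq (R * plane) :=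
  (c, (1, 0)) :: [seq ((S i.+1 - S i) / 2, (- tau i, 1)) | i <- iota 0 n.+1].

Lemma zonoid_pos p : p \in zonoid -> 0 <= p.1 /\ p.2 != 0.
Proof.
rewrite inE => /orP[/eqP->|/mapP[i _ ->]] /=; split.
- have [_ Z D] := N; have := D (1, T) (- (1, - T)); rewrite normNx//.
  rewrite (_ : (1, T) + _ = (2 * T) *: (0, 1)); last by congr (_, _) => /=; rewrite /GRing.scale/=; ring.
  by rewrite Z gtr0_norm ?mulr_gt0// /c /gi tau0 taun /g -/b; lra.
- by apply/eqP => -[] /eqP; rewrite oner_eq0.
- by apply: divr_ge0 => //; exact: (S_mono i).
- by apply/eqP => -[] _ /eqP; rewrite oner_eq0.
Qed.

Let psiE t : psi zonoid (1, t) = c + (b * `|t - tau n| + b * `|t - tau 0%N| + Q n t) / 2.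
Proof.
rewrite /psi /zonoid big_cons big_map; congr (_ + _).
  by rewrite /lin /= mul0r addr0 mul1r normr1 mulr1.
rewrite -[n.+1]subn0 -/(index_iota 0 n.+1) big_mkord.
have L i : lin (- tau i, 1) (1, t) = t - tau i by rewrite /lin /= mulr1 mul1r addrC.
transitivity (\sum_(i < n.+1) (S i.+1 - S i) * `|t - tau i| / 2).
  by apply: eq_bigr => i _; rewrite mulrAC -L.
have Sn : S n.+1 = b by rewrite /S ltnn.
rewrite -mulr_suml (abel S (fun i => `|t - tau i|)) Sn; congr (_ / 2).
rewrite mulNr opprK; congr (_ + _); apply: eq_bigr => i _.
by rewrite /= ltn_ord.
Qed.

Let cell t : - T <= t <= T -> exists2 k, (k < n)%N & tau k <= t <= tau k.+1.
Proof.
move=> /andP[t1 t2].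
suff H m : (m <= n)%N -> t <= tau m -> t = tau 0%N \/ exists2 k, (k < n)%N & tau k <= t <= tau k.+1.
  have tn : t <= tau n by rewrite taun.
  have [->|//] := H n (leqnn n) tn.
  by exists 0%N => //; rewrite lexx tauS; have := d0; lra.
elim: m => [|m IH] mn tm; first by left; apply/le_anti; rewrite tm tau0.
have [h|h] := leP t (tau m); first exact: IH (ltnW mn) h.
by right; exists m => //; rewrite tm (ltW h).
Qed.

(** Chords of a convex function lie above it, and outside the grid the interpolant leaves the last
    node with the largest possible slope. *)
Lemma zonoid_ge t : g t <= psi zonoid (1, t).
Proof.
rewrite psiE taun tau0 opprK; have [t1|t1] := leP t (- T).
  rewrite Q_left ?tau0// ler0_norm; last by have := T0; lra.
  rewrite ler0_norm; last by lra.
  have := g_lip t (tau 0%N); rewrite tau0 opprK ler0_norm; last by lra.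
  by rewrite /c -tau0 -/(gi _) tau0; lra.
have [t2|t2] := leP T t.
  rewrite Q_right ?taun// !ger0_norm; [|have := T0; lra|lra].
  have := g_lip t (tau n); rewrite taun ger0_norm; last by lra.
  by rewrite /c -taun -/(gi _) taun; lra.
have [|k kn tk] := @cell t; first by rewrite !ltW.
rewrite (Q_cell kn tk) ler0_norm; last by lra.
rewrite ger0_norm; last by lra.
have /andP[k1 k2] := tk.
have a01 : 0 <= (t - tau k) / d <= 1.
  rewrite divr_ge0 ?subr_ge0 ?(ltW d0)//= ler_pdivrMr// mul1r; rewrite tauS in k2; lra.
have := g_convex (tau k) (tau k.+1) a01.
rewrite tauS [tau k + d]addrC addrK divfK ?gt_eqF// [tau k + (t - _)]addrC subrK => h.
apply: le_trans h _; rewrite [d + _]addrC -tauS -!/(gi _) mulrAC -mulrA [_ / d]mulrC mulrA.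
have e1 : (t - tau k) / d * (gi k.+1 - gi k) = slope k * (t - tau k) by rewrite /slope; ring.
have := slope_d k; rewrite /c; nra.
Qed.

(** On a cell the excess is at most [b * d], below [e] times the minimum of [g]. Outside the grid it
    is at most [2 g 0], which for large [T] is below [e] times the value of [g]. *)
Lemma zonoid_le (m e : R) t : (forall t, m <= g t) -> b * d <= e * m -> 0 < e ->
  2 * g 0 <= e * (b * T - g 0) -> psi zonoid (1, t) <= (1 + e) * g t.
Proof.
move=> gm dm e0 Te.
have far s : T <= `|s| -> b * (`|s| - T) + gi (if 0 <= s then n else 0%N) <= (1 + e) * g s.
  move=> Ts; have [_ Z D] := N.
  have g1 : b * `|s| <= g s + g 0.
    have := D (1, s) (- (1, 0)); rewrite normNx// (_ : (1, s) + _ = s *: (0, 1)); last first.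
      by congr (_, _) => /=; rewrite /GRing.scale/=; ring.
    by rewrite Z mulrC.
  have g2 : gi (if 0 <= s then n else 0%N) <= g 0 + b * T.
    rewrite /gi; case: ifP => _; have := g_lip (tau n) 0; have := g_lip (tau 0%N) 0;
      rewrite taun tau0 !subr0 normrN gtr0_norm//.
  have : b * T <= b * `|s| by rewrite ler_pM2l.
  nra.
rewrite psiE taun tau0 opprK; have [t1|t1] := leP t (- T).
  rewrite Q_left ?tau0// ler0_norm; last by have := T0; lra.
  rewrite ler0_norm; last by lra.
  have := far t; rewrite ler0_norm; last by have := T0; lra.
  rewrite ifF; last by apply/negbTE; rewrite -ltNge; have := T0; lra.
  by move=> H; apply: le_trans (H _); rewrite /c; lra.
have [t2|t2] := leP T t.
  rewrite Q_right ?taun// !ger0_norm; [|have := T0; lra|lra].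
  have := far t; rewrite ger0_norm; last by have := T0; lra.
  rewrite ifT; last by have := T0; lra.
  by move=> H; apply: le_trans (H _); rewrite /c; lra.
have [|k kn tk] := @cell t; first by rewrite !ltW.
rewrite (Q_cell kn tk) ler0_norm; last by lra.
rewrite ger0_norm; last by lra.
have /andP[k1 k2] := tk; rewrite tauS in k2.
have h1 := g_lip (tau k) t; have h2 := g_lip (tau k.+1) t.
rewrite ler0_norm in h1; last by lra.
rewrite ger0_norm in h2; last by rewrite tauS; lra.
have h3 : b * (t - tau k) <= b * d by rewrite ler_pM2l//; lra.
have h4 : b * (tau k.+1 - t) <= b * d by rewrite ler_pM2l// tauS; lra.
have bd : e * m <= e * g t by rewrite ler_pM2l.
rewrite -/(gi _) in h1; rewrite -/(gi _) in h2.
pose a := (t - tau k) / d.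
have ad : a * d = t - tau k by rewrite /a divfK// gt_eqF.
have a0 : 0 <= a by rewrite divr_ge0 ?subr_ge0// ltW.
have a1 : a <= 1 by rewrite ler_pdivrMr// mul1r; lra.
have sE : slope k * (2 * (t - tau k) - d) = (2 * a - 1) * (gi k.+1 - gi k).
  by rewrite -ad -slope_d; ring.
rewrite sE.
have q1 : gi k <= g t + e * g t by lra.
have q2 : gi k.+1 <= g t + e * g t by lra.
by rewrite /c; nra.
Qed.

End Grid.

Lemma zonoid_approx (e : R) : 0 < e -> exists l, (forall p, p \in l -> 0 <= p.1 /\ p.2 != 0) /\
  forall x, phi x <= psi l x /\ psi l x <= (1 + e) * phi x.
Proof.
move=> e0; have [m m0 Hm] := norm_lower.
have g00 : 0 <= g 0 by exact: norm_ge0.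
pose T := (2 * g 0 / e + g 0) / b + 1.
have T0 : 0 < T.
  by rewrite ltr_wpDl// divr_ge0 ?(ltW b0)// addr_ge0// divr_ge0 ?(ltW e0)// mulr_ge0.
have bT : 2 * g 0 <= e * (b * T - g 0).
  have -> : b * T = 2 * g 0 / e + g 0 + b by rewrite /T mulrDr mulr1 mulrC divfK// gt_eqF.
  rewrite (_ : _ + b - g 0 = 2 * g 0 / e + b); last by ring.
  by rewrite mulrDr [e * (_ / e)]mulrC divfK ?gt_eqF// lerDl mulr_ge0// ltW.
pose n := (archimedean.Num.truncn (b * (2 * T) / (e * m))).+1.
have np : 0 < n%:R :> R by rewrite ltr0n.
have em : 0 < e * m by exact: mulr_gt0.
have dn : b * (2 * T / n%:R) <= e * m.
  rewrite mulrA ler_pdivrMr// [leRHS]mulrC -ler_pdivrMr//; apply: ltW.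
  exact: archimedean.Num.Theory.truncnS_gt.
exists (zonoid T n); split; first exact: zonoid_pos.
have gm t : m <= g t.
  apply: le_trans (Hm _); rewrite ler_peMr ?(ltW m0)//.
  by apply: le_trans (le_enorm1 _); rewrite /= normr1.
have psiZ (a : R) x : psi (zonoid T n) (a *: x) = `|a| * psi (zonoid T n) x.
  by rewrite /psi mulr_sumr; apply: eq_bigr => p _; rewrite linZ normrM mulrCA.
have [_ Z _] := N.
have main x : x.1 != 0 -> phi x <= psi (zonoid T n) x /\ psi (zonoid T n) x <= (1 + e) * phi x.
  move=> x0; have -> : x = x.1 *: (1, x.2 / x.1).
    by rewrite [LHS]surjective_pairing; congr (_, _) => /=; rewrite /GRing.scale/= ?mulr1// mulrC divfK.
  rewrite psiZ Z mulrCA; split; rewrite ler_wpM2l//; first exact: zonoid_ge.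
  have H := @zonoid_le T n T0 (ltn0Sn _) m e _ gm dn e0 bT; exact (H (x.2 / x.1)).
have cpsi : continuous (psi (zonoid T n)) by exact: psi_continuous.
have cphi := is_norm_continuous N.
(* The axis [x.1 = 0] is reached by continuity from points off it. *)
move=> x; have [x0|] := eqVneq x.1 0; last exact: main.
pose u (h : R) : plane := x + h *: (1, 0).
have u00 : u 0 = x by rewrite /u scale0r addr0.
have cu : u h @[h --> 0^'+] --> x.
  by rewrite -u00; apply: cvg_at_right_filter; exact: line_continuous.
have c1 : phi (u h) @[h --> 0^'+] --> phi x by exact: (cvg_comp _ _ cu (cphi x)).
have c2 : psi (zonoid T n) (u h) @[h --> 0^'+] --> psi (zonoid T n) x by exact: (cvg_comp _ _ cu (cpsi x)).
have u0 : \forall h \near 0^'+, (u h).1 != 0.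
  near=> h; rewrite /u /= x0 add0r /GRing.scale/= mulr1; apply: lt0r_neq0.
  by near: h; exact: nbhs_right_gt.
split.
- apply: ler_cvg_to c1 c2 _; near=> h; apply: (main (u h) _).1; near: h; exact: u0.
- have c3 : (1 + e) * phi (u h) @[h --> 0^'+] --> (1 + e) * phi x by apply: cvgMr.
  apply: ler_cvg_to c2 c3 _; near=> h; apply: (main (u h) _).2; near: h; exact: u0.
Unshelve. all: by end_near.
Qed.

End Zonoid.

(** * Lower limits of sets *)

Section Limits.
Context {R : realType}.
Local Notation plane := (plane R).
Implicit Types (A E F K D : set plane) (x y z w : plane).

Definition set_liminf (A : nat -> set plane) : set plane := \bigcup_n \bigcap_(k in [set k | (n <= k)%N]) A k.

Lemma area_le_eps A : (forall e : R, 0 < e -> (area A <= e%:E)%E) -> area A = 0%E.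
Proof.
move=> H; apply/eqP; rewrite eq_le area_ge0 andbT; apply/lee_addgt0Pr => e e0; rewrite add0e; exact: H.
Qed.

Lemma area_setY A B : (area (A `+` B) <= area (A `\` B) + area (B `\` A))%E.
Proof.
by apply: le_trans (areaU _ _); apply: le_area => x [[? ?]|[? ?]]; [left|right].
Qed.

(** [F] minus the lower limit is covered by the tails of a summable series, as in Borel-Cantelli.
    The part of each tail intersection outside [F] lies in [A m] minus [F] for all large [m], hence
    is null. *)
Lemma liminf_area F (A : nat -> set plane) n0 :
  (forall n, (n0 <= n)%N -> (area (F `+` A n) <= ((1 / 2) ^+ n)%:E)%E) -> area (F `+` set_liminf A) = 0%E.
Proof.
move=> H.
have q0 n : 0 <= (1 / 2 : R) ^+ n by rewrite exprn_ge0// divr_ge0.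
have small (e : R) : 0 < e -> exists2 n, (n0 <= n)%N & (1 / 2 : R) ^+ n <= e.
  move=> e0; have h : `|1 / 2 : R| < 1 by rewrite ger0_norm ?divr_ge0//; lra.
  have /cvgrPdist_le/(_ e e0)[N _ HN] := cvg_expr h.
  exists (maxn n0 N); first exact: leq_maxl.
  by have := HN (maxn n0 N) (leq_maxr _ _); rewrite /= sub0r normrN ger0_norm.
have tail n : (n0 <= n)%N -> (area (F `\` set_liminf A) <= ((1 / 2) ^+ n * 2)%:E)%E.
  move=> nn; apply: (@le_trans _ _ (area (\bigcup_k (F `+` A (n + k)%N)))).
    apply: le_area => x [Fx nx]; apply: contrapT => no; apply: nx; exists n => // k /= nk.
    apply: contrapT => nA; apply: no; exists (k - n)%N => //; rewrite subnKC//.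
    by left.
  apply: le_trans (area_bigcup _) _.
  apply: (@le_trans _ _ (\sum_(k <oo) ((1 / 2) ^+ n * 2 / (2 ^ k.+1)%:R)%:E)%E).
    apply: lee_nneseries; [by move=> k *; exact: area_ge0|move=> k _].
    apply: le_trans (H _ _) _; first by rewrite (leq_trans nn)// leq_addr.
    rewrite lee_fin exprD -mulrA; apply: ler_wpM2l => //.
    by rewrite expr_div_n expr1n div1r natrX exprS invfM mulrA mulfV ?mul1r.
  have := @epsilon_trick R (fun=> 0%E) ((1 / 2) ^+ n * 2) xpredT (fun _ => lexx _) (mulr_ge0 (q0 n) (ler0n _ 2)).
  by rewrite (eq_eseriesr (fun k _ => add0e _)) [X in (_ <= X + _)%E]eseries0 ?add0e.
apply/eqP; rewrite eq_le area_ge0 andbT; apply: le_trans (area_setY _ _) _.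
rewrite (_ : area (F `\` set_liminf A) = 0%E); last first.
  apply: area_le_eps => e e0; have [|n nn hn] := small (e / 2); first by rewrite divr_gt0.
  by apply: le_trans (tail n nn) _; rewrite lee_fin; lra.
rewrite add0e.
have sub : set_liminf A `\` F `<=` \bigcup_n ((\bigcap_(k in [set k | (n <= k)%N]) A k) `\` F).
  by move=> x [[n _ Hn] nF]; exists n => //; split.
apply: le_trans (le_area sub) _; apply: le_trans (area_bigcup _) _; rewrite eseries0// => n _ _.
apply: area_le_eps => e e0; have [m mm hm] := small e e0.
apply: (@le_trans _ _ (area (F `+` A (maxn n m)))).
  by apply: le_area => x [Hx nF]; right; split=> //; apply: Hx; exact: leq_maxl.
apply: le_trans (H _ _) _; first by rewrite (leq_trans mm)// leq_maxr.
rewrite lee_fin; apply: le_trans hm; apply: ler_wiXn2l; [by rewrite divr_ge0|by lra|exact: leq_maxr].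
Qed.

Lemma cvx_liminf (A : nat -> set plane) : (forall n, cvx (A n)) -> cvx (set_liminf A).
Proof.
move=> H x y t [n _ Hn] [m _ Hm] t01; exists (maxn n m) => // k /= h.
by apply: H => //; [apply: Hn|apply: Hm]; rewrite /= (leq_trans _ h)// ?leq_maxl ?leq_maxr.
Qed.

Lemma cvx_closure A : cvx A -> cvx (closure A).
Proof.
move=> cA x y t Ax Ay t01 B nB.
pose h (p : plane * plane) := p.1 + t *: (p.2 - p.1).
have ch : continuous h.
  move=> p; apply: cvgD; first exact: cvg_fst.
  by apply: cvgZr; apply: cvgB; [exact: cvg_snd|exact: cvg_fst].
have [[U V] /= [nU nV] UV] := ch (x, y) B nB.
have [x' [Ax' Ux']] := Ax U nU; have [y' [Ay' Vy']] := Ay V nV.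
by exists (h (x', y')); split; [exact: cA|exact: (UV (x', y'))].
Qed.

Lemma chull_closure A : cvx A -> chull A `<=` closure A.
Proof.
by move=> cA; apply: chull_min; [exact: closed_closure|exact: cvx_closure|exact: subset_closure].
Qed.

(** Replace [w] by a nearby [w'] of [A]; the error is compensated by moving [c] inside its ball,
    magnified by [(1 - t) / t]. *)
Lemma closure_shrink A c (rho t : R) w : cvx A -> eball c rho `<=` A -> 0 < rho -> 0 < t -> t < 1 ->
  closure A w -> A (w + t *: (c - w)).
Proof.
move=> cA cr rho0 t0 t1 Aw.
pose k := (1 - t) / t; have k0 : 0 < k by rewrite divr_gt0// subr_gt0.
have [|w' [Aw' ww']] := Aw (eball w (rho / k)).
  apply: open_nbhs_nbhs; split; first exact: eball_open.
  by rewrite /eball/= subrr enorm0 divr_gt0.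
have Ac : A (c + k *: (w - w')).
  apply: cr; rewrite /eball/= addrAC subrr add0r enormZ gtr0_norm// mulrC -ltr_pdivlMr// enormB.
  exact: ww'.
have t01 : 0 <= t <= 1 by rewrite !ltW.
have := cA _ _ t Aw' Ac t01; congr A.
have tk : t * k = 1 - t by rewrite /k mulrC divfK// gt_eqF.
rewrite scalerBr scalerDr scalerA tk.
by congr (_, _) => /=; rewrite /GRing.scale/=; ring.
Qed.

(** Copies of the hull shrunk towards an interior point lie in [A], and their areas [(1 - t)^2 area]
    approach the full area. A null set is represented by the empty set. *)
Lemma convex_closed_rep A (M : R) : cvx A -> A `<=` box M ->
  exists2 K, ccs K & area (A `+` K) = 0%E.
Proof.
move=> cA AM; have [A0|A0] := eqVneq (area A) 0%E.
  exists set0; first by split; [exact: compact0|move=> ? ?].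
  by rewrite setY0.
have hK := chull_ccs AM; exists (chull A) => //.
have KM : chull A `<=` box M by apply: chull_min => //; [exact: box_closed|exact: box_cvx].
have a0 : 0 < ar A by rewrite -lte_fin -(arE AM) lt_neqAle eq_sym A0 area_ge0.
have [x Ax] : A !=set0 by apply/set0P; apply: contraNN A0 => /eqP ->; rewrite area0.
have M0 : 0 <= M by have /boxP[h _] := AM x Ax; exact: le_trans h.
have AM' : A `<=` box (M + 1).
  by move=> y /AM/boxP[h1 h2]; apply/boxP; split; lra.
have M1 : 0 < M + 1 by lra.
have [|c cr] := cvx_has_ball cA AM' M1 a0; first by rewrite (arE AM).
have r0 : 0 < ar A / (216 * (M + 1)).
  by apply: (divr_gt0 a0); apply: mulr_gt0; [rewrite ltr0n|exact: M1].
have -> : A `+` chull A = chull A `\` A.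
  apply/seteqP; split=> y; last by move=> [Ky nA]; right.
  by move=> [[Ay nK]|//]; exfalso; apply: nK; exact: chull_sub.
have mK := ccs_measurable hK.
have k0 := ar_ge0 (chull A).
apply: area_le_eps => e e0.
pose t := Num.min 2^-1 (e / (2 * (ar (chull A) + 1))).
have t0 : 0 < t by rewrite lt_min invr_gt0 ltr0n/= divr_gt0// mulr_gt0// ltr_wpDl.
have t1 : t <= 2^-1 by rewrite /t ge_min lexx.
have te : t * (2 * (ar (chull A) + 1)) <= e.
  by rewrite -ler_pdivlMr; [rewrite /t ge_min lexx orbT|apply: mulr_gt0 => //; rewrite ltr_wpDl].
clearbody t.
have t1' : 0 < 1 - t by lra.
have it0 : 0 < (1 - t)^-1 by rewrite invr_gt0.
have [mKt aKt] := area_homothety (- (t / (1 - t)) *: c) it0 mK.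
set Kt := [set x | _] in mKt aKt.
rewrite exprVn invrK in aKt.
have KtA : Kt `<=` A.
  move=> z Kz; have -> : z = ((1 - t)^-1 *: z + - (t / (1 - t)) *: c) + t *: (c - ((1 - t)^-1 *: z + - (t / (1 - t)) *: c)).
    case: (z) (c) => z1 z2 [c1 c2].
    by congr (_, _) => /=; rewrite /GRing.scale/=; field; rewrite gt_eqF.
  by apply: (closure_shrink cA cr r0 t0); [rewrite -subr_gt0|exact: chull_closure].
have KtK : Kt `<=` chull A by move=> z /KtA; exact: chull_sub.
have sub : chull A `\` A `<=` chull A `\` Kt by move=> z [Kz nA]; split=> // /KtA.
apply: le_trans (le_area sub) _.
have DM : chull A `\` Kt `<=` box M by move=> z [/KM].
have := areaD_split (chull A) (borel_lmeasurable mKt).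
rewrite (setIidr KtK) aKt (arE KM) (arE DM) -EFinM -EFinD => -[E1].
by rewrite lee_fin; clear -E1 te t0 t1 k0; nra.
Qed.

End Limits.

(** * One step of the scheme *)

Section Step.
Context {R : realType} (phi : plane R -> R).
Local Notation plane := (plane R).
Implicit Types (A E F G K : set plane) (x y : plane).
Hypothesis N : is_norm phi.

Lemma aniso_perimeter_ge0 F : (0 <= aniso_perimeter phi F)%E.
Proof.
rewrite /aniso_perimeter; case: ifP => _; last exact: leey.
by apply: integral_hausdorff1_ge0 => x; rewrite lee_fin norm_ge0.
Qed.

Lemma scheme_energy_set0 (tau : R) E : 0 < tau -> ccs E -> (scheme_energy phi tau E set0 < +oo)%E.
Proof.
move=> t0 hE; rewrite /scheme_energy setY0.
have [M EM] := ccs_box hE; rewrite (arE EM).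
apply: (@le_lt_trans _ _ (0 + ((2 * tau)^-1)%:E * (ar E)%:E ^+ 2)%E); last by rewrite add0e -EFin_expe -EFinM ltry.
by apply: leeD => //; exact: aniso_perimeter_set0.
Qed.

Lemma energy_arith (tau V W w x b y eta g1 g2 A L sigma : R) : 0 < tau -> 0 <= w -> 0 <= b ->
  0 <= x -> x <= A -> 0 <= y -> y <= A -> 0 < eta -> eta <= 1 -> 0 <= g1 -> 0 <= g2 ->
  2 * tau * L = 2 * A + 1 + 2 * tau -> 0 <= sigma -> sigma ^+ 2 = 4 * tau * eta ->
  V + (2 * tau)^-1 * (x + b) ^+ 2 <= W + (2 * tau)^-1 * (y + eta) ^+ 2 ->
  W + L * w + g1 <= V + 2 * eta -> y + g2 <= x + eta + w ->
  [/\ w <= 2 * eta * L, g1 <= 2 * eta * L, b ^+ 2 <= sigma ^+ 2 * L, x - y - eta <= sigma &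
      g2 <= sigma + 2 * eta + w].
Proof.
move=> tau0 w0 b0 x0 xA y0 yA e0 e1 g10 g20 LE s0 sE main h1 h2.
have t2 : 0 < 2 * tau by exact: mulr_gt0.
have {}main : 2 * tau * (V - W) + (x + b) ^+ 2 <= (y + eta) ^+ 2.
  have : (V - W) + (2 * tau)^-1 * (x + b) ^+ 2 <= (2 * tau)^-1 * (y + eta) ^+ 2 by lra.
  rewrite -(ler_pM2l t2) mulrDr !mulrA mulfV ?gt_eqF// !mul1r; exact.
have h1' : 2 * tau * (L * w + g1 - 2 * eta) <= 2 * tau * (V - W) by rewrite ler_pM2l//; lra.
have q : (y + eta) ^+ 2 - x ^+ 2 <= (2 * eta + w) * (2 * A + 1).
  rewrite subr_sqr; apply: (@le_trans _ _ ((2 * eta + w) * (y + eta + x))).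
    by clear -h2 g20 x0 y0 e0; rewrite ler_wpM2r//; lra.
  by rewrite ler_wpM2l//; lra.
have xb : 0 <= 2 * (x * b) by rewrite mulr_ge0// mulr_ge0.
have tw : 0 <= 2 * tau * w by rewrite mulr_ge0// ltW.
have tg : 0 <= 2 * tau * g1 by rewrite mulr_ge0// ltW.
have key : b ^+ 2 + 2 * (x * b) + 2 * tau * g1 + 2 * tau * w <= 2 * tau * (2 * eta * L).
  have E1 : 2 * tau * (L * w + g1 - 2 * eta) = (2 * A + 1 + 2 * tau) * w + 2 * tau * g1 - 4 * tau * eta by rewrite -LE; ring.
  have E2 : 2 * tau * (2 * eta * L) = 2 * eta * (2 * A + 1 + 2 * tau) by rewrite -LE; ring.
  have E3 : (x + b) ^+ 2 = x ^+ 2 + 2 * (x * b) + b ^+ 2 by ring.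
  by rewrite E2; rewrite E1 in h1'; rewrite E3 in main; clear -q h1' main; lra.
have b2 : 0 <= b ^+ 2 by exact: sqr_ge0.
split.
- by rewrite -(ler_pM2l t2); clear -key b2 xb tg tw; lra.
- by rewrite -(ler_pM2l t2); clear -key b2 xb tg tw; lra.
- by rewrite sE; clear -key xb tg tw; lra.
- rewrite leNgt; apply/negP => lt.
  have : x ^+ 2 <= sigma ^+ 2 + (y + eta) ^+ 2.
    have : 0 <= L by rewrite -(ler_pM2l t2) mulr0 LE; lra.
    move=> L0; have : 0 <= 2 * tau * (L * w) by rewrite mulr_ge0 ?mulr_ge0// ltW.
    by rewrite sE; nra.
  by nra.
- rewrite leNgt; apply/negP => lt; pose z := g2 - 2 * eta - w.
  have zs : sigma < z by rewrite /z; lra.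
  have xz : y + eta <= x - z by rewrite /z; lra.
  have : x ^+ 2 <= sigma ^+ 2 + (y + eta) ^+ 2.
    have : 0 <= L by rewrite -(ler_pM2l t2) mulr0 LE; lra.
    move=> L0; have : 0 <= 2 * tau * (L * w) by rewrite mulr_ge0 ?mulr_ge0// ltW.
    by rewrite sE; nra.
  have : (y + eta) ^+ 2 <= (x - z) ^+ 2.
    by clear -xz y0 e0; rewrite ler_sqr ?nnegrE; lra.
  by clearbody z; nra.
Qed.

(** The errors are chosen after [gain], which is possible because [gain] involves only [E], [tau]
    and the norm. *)
Lemma step_approx (tau : R) E F : 0 < tau -> ccs E -> scheme_minimizer phi tau E F ->
  forall delta : R, 0 < delta -> exists K, [/\ ccs K, K `<=` E & (area (F `+` K) <= delta%:E)%E].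
Proof.
move=> tau0 hE [mF minF] delta delta0.
have [M0 EM0] := ccs_box hE; pose M := `|M0| + 1; have Mp : 0 < M by rewrite ltr_wpDl.
have EM : E `<=` box M.
  by move=> x /EM0/boxP[h1 h2]; apply/boxP; have := ler_norm M0; rewrite /M; split; lra.
clearbody M.
have mE := ccs_measurable hE; have lE := borel_lmeasurable mE.
have t2 : 0 < (2 * tau)^-1 by rewrite invr_gt0 mulr_gt0.
have fin : (scheme_energy phi tau E F < +oo)%E.
  apply: le_lt_trans (scheme_energy_set0 tau0 hE); apply: minF.
  exact: borel_lmeasurable measurable0.
have sq0 : (0 <= ((2 * tau)^-1)%:E * area (E `+` F) ^+ 2)%E.
  by apply: mule_ge0; [rewrite lee_fin ltW|apply: expe_ge0; exact: area_ge0].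
have Pfin : (aniso_perimeter phi F < +oo)%E.
  by apply: le_lt_trans fin; rewrite /scheme_energy leeDl.
have EFfin : (area (E `+` F) < +oo)%E.
  rewrite ltNge leye_eq; apply/negP => /eqP E1; move: fin.
  rewrite /scheme_energy E1 ltNge; apply/negP/negPn; rewrite expe2 mulyy gt0_muley ?lte_fin//.
  by rewrite addey// gt_eqF// (lt_le_trans _ (aniso_perimeter_ge0 F))// ltNyr.
have Ffin : (area F < +oo)%E.
  apply: le_lt_trans (area_le_setY F E) _; rewrite setYC lte_add_pinfty//.
  by rewrite (arE EM) ltry.
have [m [nu0 pol]] : finite_perimeter F.
  by apply: contrapT => nf; move: Pfin; rewrite /aniso_perimeter asboolF.
have [nu U _] := polar_normalize pol.
have [mnu _ _] := unit_polar_measurable U.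
have nu1 x : enorm (nu x) = 1 by have [_] := U.
pose C1 := phi (1, 0) + phi (0, 1).
have bphi : bmf (fun x => phi (nu x)).
  split; first exact: (measurableT_comp (continuous_plane_measurable (is_norm_continuous N)) mnu).
  by exists C1 => x; rewrite ger0_norm ?norm_ge0//; have := norm_le N (nu x); rewrite nu1 mulr1.
pose V := \int[m]_x phi (nu x).
have VP : (V%:E <= aniso_perimeter phi F)%E.
  by have := perimeter_lower U mF Ffin N; rewrite (rI_E m bphi).
have V0 : 0 <= V by apply: Rintegral_ge0 => x _; exact: norm_ge0.
have [kappa k0 Hk] := norm_lower N.
have C10 : 0 <= C1 by rewrite addr_ge0// norm_ge0.
pose C := 2 * C1 + 1; have C0 : 0 < C by rewrite ltr_wpDl// mulr_ge0.
pose A := ar E; have A0 : 0 <= A by exact: ar_ge0.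
pose L := (2 * A + 1) / (2 * tau) + 1.
have LE : 2 * tau * L = 2 * A + 1 + 2 * tau.
  by rewrite /L mulrDr mulr1 [2 * tau * (_ / _)]mulrC divfK// gt_eqF// mulr_gt0.
have L1 : 1 <= L by rewrite /L lerDr divr_ge0 ?mulr_ge0 ?addr_ge0 ?mulr_ge0// ltW.
have L0 : 0 < L by exact: lt_le_trans L1.
clearbody L.
have c0 : 0 < kappa ^+ 2 / L ^+ 2 by rewrite divr_gt0// exprn_gt0.
have [g [g0 gE]] : exists g, 0 < g /\ g = gain kappa C M (kappa ^+ 2 / L ^+ 2).
  by exists (gain kappa C M (kappa ^+ 2 / L ^+ 2)); split=> //; exact: gain_gt0.
pose q := (4 * tau)^-1; have q0 : 0 < q by rewrite invr_gt0 mulr_gt0.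
(* The total coefficient with which [sigma] enters the closing estimates. With [sigma * B] equal to
   the least of 1, [g] and [delta], the gains are excluded and the distance from [F] to [K] falls
   below [delta]. *)
pose B := 1 + q + 8 * q * (L + 1) + 4 + (L + 2 * q * (1 + 2 * L) + 1 + q).
have qL : 0 < q * L by exact: mulr_gt0.
have B0 : 1 <= B by rewrite /B; clear -q0 qL L1; lra.
pose mm := Num.min 1 (Num.min g delta).
have mm0 : 0 < mm by rewrite !lt_min ltr01 g0.
pose sigma := mm / B.
have B0' : 0 < B by exact: lt_le_trans B0.
have s0 : 0 < sigma by rewrite divr_gt0.
have sB : sigma * B = mm by rewrite /sigma divfK// gt_eqF.
have [m1 mg md] : [/\ mm <= 1, mm <= g & mm <= delta] by rewrite /mm; split; rewrite !ge_min lexx ?orbT.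
pose eta := sigma ^+ 2 * q.
have eta0 : 0 < eta by rewrite mulr_gt0// exprn_gt0.
have s1 : sigma <= 1 by apply: le_trans m1; rewrite -sB ler_peMr// ltW.
have es : eta <= sigma * q by rewrite /eta ler_pM2r// expr2 ler_piMl// ltW.
have sE : sigma ^+ 2 = 4 * tau * eta.
  by rewrite /eta /q mulrCA mulfV ?mulr1// gt_eqF// mulr_gt0.
clearbody eta sigma mm.
have sq : 0 < sigma * q by exact: mulr_gt0.
have sqL : 0 < sigma * q * L by exact: mulr_gt0.
have sL : 0 < sigma * L by exact: mulr_gt0.
have etaL : eta * L <= sigma * q * L by rewrite ler_pM2r.
have expand : sigma * B = sigma + sigma * q + 8 * (sigma * q * L) + 8 * (sigma * q) + 4 * sigma +
    (sigma * L + 2 * (sigma * q) + 4 * (sigma * q * L) + sigma + sigma * q) by rewrite /B; ring.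
rewrite expand in sB.
have eta1 : eta <= 1 by clear -es sB m1 sq sqL sL s0; lra.
(* The relative error of the zonotope norm, so small that it changes the total variation [V] of [F]
   by at most [eta]. *)
have [e [ep e1 eV]] : exists e : R, [/\ 0 < e, e <= 1 & e * V <= eta].
  exists (Num.min 1 (eta / (V + 1))); split.
  - by rewrite lt_min ltr01 divr_gt0// ltr_wpDl.
  - by rewrite ge_min lexx.
  - apply: (@le_trans _ _ (eta / (V + 1) * V)).
      by rewrite ler_wpM2r// ge_min lexx orbT.
    by rewrite mulrAC ler_pdivrMr ?ltr_wpDl// ler_pM2l// lerDl.
have [l [hl psil]] := zonoid_approx N ep.
have hl1 p : p \in l -> 0 <= p.1 by move=> /hl[].
have psipE x : psip l x = psi l (x.2, - x.1).
  by rewrite /psip /psi; apply: eq_bigr => p _; congr (_ * `|_|); rewrite /lin /perp /=; ring.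
have rotE x : enorm ((x.2, - x.1) : plane) = enorm x by rewrite /enorm /= sqrrN addrC.
have plo x : kappa * enorm x <= psip l x.
  by rewrite psipE -rotE; apply: le_trans (Hk _) (psil _).1.
have phi_ x : psip l x <= C * enorm x.
  rewrite psipE -rotE; apply: le_trans (psil _).2 _.
  set z : plane := (x.2, - x.1); have z0 := norm_ge0 N z; have e0 := enorm_ge0 z.
  apply: (@le_trans _ _ (2 * phi z)); first by rewrite ler_wpM2r// -[2]/(1 + 1) lerD2l.
  have := norm_le N z; rewrite -/C1 => h; apply: (@le_trans _ _ (2 * (C1 * enorm z))); first by rewrite ler_pM2l.
  by rewrite mulrA ler_wpM2r// lerDl.
have [K [w [hK KE w0 [Ww aw] alt]]] := convexify U mF Ffin hl plo phi_ k0 C0 Mp L0 eta0 hE EM.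
rewrite -gE in alt.
have Vp : \int[m]_x psi l (nu x) <= V + eta.
  have bpsi : bmf (fun x => psi l (nu x)).
    split; first exact: (measurableT_comp (continuous_plane_measurable (@psi_continuous _ l)) mnu).
    exists (2 * C1) => x; have h := norm_le N (nu x); have [p1 p2] := psil (nu x).
    have h0 := norm_ge0 N (nu x); rewrite nu1 mulr1 -/C1 in h.
    rewrite ger0_norm; last exact: le_trans p1.
    apply: (le_trans p2); apply: (@le_trans _ _ (2 * phi (nu x))); last by rewrite ler_pM2l.
    by rewrite ler_wpM2r// -[2]/(1 + 1) lerD2l.
  apply: (@le_trans _ _ (\int[m]_x ((1 + e) * phi (nu x)))).
    by apply: rI_le => //; [exact: bmfZ|move=> x; exact: (psil _).2].
  by rewrite (rI_Z m _ bphi) mulrDl mul1r lerD2l.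
have [G [mG GK PG aG]] := competitor N hl1 (fun x => (psil x).1) hK eta0.
have KM : K `<=` box M by exact: subset_trans EM.
have GE : G `<=` E by exact: subset_trans KE.
have GM : G `<=` box M by exact: subset_trans EM.
have FEM : F `&` E `<=` box M by move=> x [_ /EM].
have fFE : area (F `\` E) \is a fin_num.
  by rewrite ge0_fin_numE ?area_ge0//; apply: le_lt_trans Ffin; apply: le_area => x [].
pose a := ar (F `&` E); pose b := fine (area (F `\` E)); pose k := ar K.
have b0 : 0 <= b by exact/fine_ge0/area_ge0.
have aA : a <= A by apply: ar_le EM _ => x [].
have kA : k <= A by apply: ar_le EM KE.
have EdF : area (E `\` F) = (A - a)%:E.
  have EdFM : E `\` F `<=` box M by move=> x [/EM].
  have := areaD_split E mF; rewrite setIC -/a (arE EM) (arE FEM) (arE EdFM) -EFinD => -[E1].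
  by congr (_%:E); rewrite /A E1 /a; ring.
have EF : area (E `+` F) = (A - a + b)%:E.
  rewrite (areaD_split (E `+` F) lE).
  rewrite (_ : (E `+` F) `&` E = E `\` F); last first.
    by apply/seteqP; split=> x; [move=> [[//|[? ?]] ?]|move=> [? ?]; split=> //; left].
  rewrite (_ : (E `+` F) `\` E = F `\` E); last first.
    by apply/seteqP; split=> x; [move=> [[[? ?]|//] ?]|move=> [? ?]; split=> //; right].
  by rewrite EdF -(fineK fFE) -EFinD.
have EG : area (E `+` G) = (A - ar G)%:E.
  have EdGM : E `\` G `<=` box M by move=> x [/EM].
  rewrite (_ : E `+` G = E `\` G); last first.
    by apply/seteqP; split=> x; [move=> [//|[/GE Ex nE]]|left].
  have := areaD_split E (borel_lmeasurable mG); rewrite (setIidr GE) (arE EM) (arE GM) (arE EdGM) -EFinD => -[E1].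
  by congr (_%:E); rewrite /A E1; ring.
have arGk : ar G <= k by exact: ar_le KM GK.
have main : V + (2 * tau)^-1 * (A - a + b) ^+ 2 <= wperimeter l K + (2 * tau)^-1 * (A - k + eta) ^+ 2.
  have := minF G (borel_lmeasurable mG); rewrite /scheme_energy EF EG -!EFin_expe -!EFinM => h.
  apply: (@le_trans _ _ (wperimeter l K + (2 * tau)^-1 * (A - ar G) ^+ 2)).
    rewrite -lee_fin !EFinD; apply: le_trans (leeD VP (lexx _)) _; apply: le_trans h _.
    by apply: leeD.
  rewrite lerD2l ler_pM2l// ler_sqr ?nnegrE; rewrite -/k in aG; clear -kA arGk aG eta0; lra.
have x0 : 0 <= A - a by rewrite subr_ge0.
have y0 : 0 <= A - k by rewrite subr_ge0.
have a0 : 0 <= a by exact: ar_ge0.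
have kk0 : 0 <= k by exact: ar_ge0.
have xA : A - a <= A by rewrite gerBl.
have yA : A - k <= A by rewrite gerBl.
rewrite -/a -/k in aw alt.
have arith g1 g2 : 0 <= g1 -> 0 <= g2 -> wperimeter l K + L * w + g1 <= V + 2 * eta ->
    A - k + g2 <= A - a + eta + w -> _ :=
  fun p1 p2 => energy_arith tau0 w0 b0 x0 xA y0 yA eta0 eta1 p1 p2 LE (ltW s0) sE main.
have [||w1 _ b1 x1 _] := arith 0 0 (lexx _) (lexx _); [clear -Ww Vp; lra|clear -aw; lra|].
(* Only the first alternative survives; in the other two [g] would be bounded by a multiple of the
   errors smaller than [g]. *)
case: alt => [FK|gP|gA].
- have bL : b <= sigma * L.
    rewrite -(@ler_sqr R) ?nnegrE ?(ltW sL)//; apply: le_trans b1 _.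
    by rewrite exprMn ler_pM2l ?exprn_gt0// expr2 ler_peMr// ltW.
  exists K; split=> //.
  have mK := ccs_measurable hK.
  pose f := ar ((F `&` E) `\` K).
  have FKM : (F `&` E) `\` K `<=` box M by move=> x [/FEM].
  have KFM : K `\` F `<=` box M by move=> x [/KM].
  have KIM : K `&` F `<=` box M by move=> x [/KM].
  have e_1 : k = ar (K `&` F) + ar (K `\` F).
    by have := areaD_split K mF; rewrite (arE KM) (arE KIM) (arE KFM) -EFinD => -[].
  have e_2 : a = ar (K `&` F) + f.
    have := areaD_split (F `&` E) (borel_lmeasurable mK).
    rewrite (_ : F `&` E `&` K = K `&` F); last first.
      by apply/seteqP; split=> x; [move=> [[? ?] ?]|move=> [Kx Fx]; split=> //; split=> //; exact: KE].
    by rewrite (arE FEM) (arE KIM) (arE FKM) -EFinD => -[].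
  apply: (@le_trans _ _ (area (F `\` E) + (area ((F `&` E) `\` K) + area (K `\` F)))%E).
    apply: le_trans (_ : area ((F `\` E) `|` (((F `&` E) `\` K) `|` (K `\` F))) <= _)%E; last first.
      by apply: le_trans (areaU _ _) _; apply: leeD => //; exact: areaU.
    apply: le_area => x [[Fx nK]|[Kx nF]]; last by right; right.
    by have [Ex|nE] := pselect (E x); [right; left|left].
  rewrite -(fineK fFE) (arE FKM) (arE KFM) -!EFinD lee_fin -/b -/f.
  by rewrite -/f in FK; clear -FK bL e_1 e_2 w1 x1 sB etaL es md sq sqL sL eta0 s0; lra.
- have [|| _ g1 _ _ _] := arith g 0 (ltW g0) (lexx _); [clear -gP Vp; lra|clear -aw; lra|].
  by exfalso; clear -g1 etaL sB mg sq sqL sL s0 es eta0; lra.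
- have [|| w2 _ _ _ g2] := arith 0 g (lexx _) (ltW g0); [clear -Ww Vp; lra|clear -gA; lra|].
  by exfalso; clear -g2 w2 etaL sB mg sq sqL sL s0 es eta0; lra.
Qed.

End Step.

(** * Convex representatives of minimizers and flows *)

Section Flow.
Context {R : realType} (phi : plane R -> R).
Local Notation plane := (plane R).
Implicit Types (A E F K : set plane) (x y : plane).
Hypothesis N : is_norm phi.

Lemma scheme_minimizer_congr (tau : R) E E' F : area (E `+` E') = 0%E ->
  scheme_minimizer phi tau E F -> scheme_minimizer phi tau E' F.
Proof.
move=> EE; have en G : scheme_energy phi tau E' G = scheme_energy phi tau E G.
  rewrite /scheme_energy; suff -> : area (E' `+` G) = area (E `+` G) by [].
  apply/le_anti/andP; split.
    by have := area_setY_sub E' E G; rewrite [E' `+` E]setYC EE add0e.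
  by have := area_setY_sub E E' G; rewrite EE add0e.
by move=> [mF H]; split=> // G mG; rewrite !en; exact: H.
Qed.

(** The approximations from [step_approx] have errors [(1/2)^n], so their lower limit represents
    [F]. Passing to a closed representative restores compactness, which the next step of the scheme
    requires, and intersecting with [E] restores the inclusion. *)
Lemma convex_minimizer (tau : R) E F : 0 < tau -> ccs E -> scheme_minimizer phi tau E F ->
  exists K, [/\ ccs K, K `<=` E & area (F `+` K) = 0%E].
Proof.
move=> tau0 hE mF.
have /choice[k Hk] : forall n : nat, exists K, [/\ ccs K, K `<=` E & (area (F `+` K) <= ((1 / 2) ^+ n)%:E)%E].
  by move=> n; apply: step_approx mF _ _ => //; rewrite exprn_gt0// divr_gt0.
have a0 : area (F `+` set_liminf k) = 0%E.
  by apply: (@liminf_area _ _ _ 0%N) => n _; have [] := Hk n.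
have cD : cvx (set_liminf k) by apply: cvx_liminf => n; have [[]] := Hk n.
have DE : set_liminf k `<=` E.
  by move=> x [n _ Hn]; have [_ + _] := Hk n; apply; apply: Hn => /=.
have [M EM] := ccs_box hE.
have [K hK DK] := convex_closed_rep cD (subset_trans DE EM).
exists (K `&` E); split; last 2 first.
- by move=> x [].
- apply/eqP; rewrite eq_le area_ge0 andbT.
  apply: le_trans (area_setY_sub _ (set_liminf k) _) _; rewrite a0 add0e -DK; apply: le_area.
  by move=> x [[Dx nK]|[[Kx Ex] nD]]; [left; split=> // Kx; apply: nK; split=> //; exact: DE|right].
apply: (@ccs_sub_box _ _ M); [by apply: closedI; exact: ccs_closed|exact: cvxI hK.2 hE.2|].
by move=> x [_ /EM].
Qed.

Lemma convex_discrete_flow (tau : R) E0 (S : nat -> set plane) K0 : 0 < tau ->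
  discrete_flow phi tau E0 S -> ccs K0 -> area (E0 `+` K0) = 0%E ->
  exists C : nat -> set plane, [/\ C 0%N = K0, forall n, ccs (C n),
    forall m n, (m <= n)%N -> C n `<=` C m & forall n, area (S n `+` C n) = 0%E].
Proof.
move=> tau0 [S0 Smin] hK0 EK.
(* The representative is chosen as a function of the step and the current convex set, so that the
   sequence can be defined by recursion before its properties are proved. *)
have /choice[f Hf] : forall p : nat * set plane, exists K,
    ccs p.2 /\ area (S p.1 `+` p.2) = 0%E -> [/\ ccs K, K `<=` p.2 & area (S p.1.+1 `+` K) = 0%E].
  move=> [n A] /=; have [[hA SA]|no] := pselect (ccs A /\ area (S n `+` A) = 0%E); last by exists set0.
  by have [K HK] := convex_minimizer tau0 hA (scheme_minimizer_congr SA (Smin n)); exists K.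
pose C := fix C n := if n is n'.+1 then f (n', C n') else K0.
have CC n : ccs (C n) /\ area (S n `+` C n) = 0%E.
  elim: n => [|n IH]; first by rewrite S0.
  by have [] := Hf (n, C n) IH.
exists C; split=> //; [by move=> n; case: (CC n)| |by move=> n; case: (CC n)].
move=> m n; elim: n => [|n IH]; first by rewrite leqn0 => /eqP ->.
rewrite leq_eqVlt => /predU1P[->//|/IH sub].
by apply: subset_trans sub; have [] := Hf (n, C n) (CC n).
Qed.

End Flow.

Theorem proposition5p10 (R : realType) (phi : plane R -> R)
    (E0 : set (plane R)) (E : R -> set (plane R)) :
  is_norm phi -> smooth_norm phi -> elliptic_norm phi ->
  bounded_set E0 -> convex_set E0 ->
  limit_flow phi E0 E ->
  exists C : R -> set (plane R),
    [/\ forall t, 0 <= t -> area (E t `+` C t) = 0%E,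
        forall t, 0 <= t -> convex_set (C t),
        forall t, 0 <= t -> C t `<=` E0 &
        forall s t, 0 <= s -> s <= t -> C t `<=` C s].
Proof.
move=> N _ _ bE0 /cvxP cE0 [_ [tau [S [tau0 _ dis lim]]]].
have [M EM] : exists M, E0 `<=` box M.
  have [M0 [_ HM]] := bE0; exists (`|M0| + 1) => x Ex.
  have := HM (`|M0| + 1); rewrite ltr_pwDr ?ler_norm// => /(_ isT x Ex) => h.
  have hx : `|x| = Num.max `|x.1| `|x.2| by [].
  by rewrite /= hx ge_max in h; apply/boxP/andP.
have [K0 hK0 EK0] := convex_closed_rep cE0 EM.
have /choice[C HC] : forall k, exists C : nat -> set (plane R), [/\ C 0%N = K0, forall n, ccs (C n),
    forall m n, (m <= n)%N -> C n `<=` C m & forall n, area (S k n `+` C n) = 0%E].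
  by move=> k; exact: (convex_discrete_flow N (tau0 k) (dis k) hK0 EK0).
(* Index [k j] achieves error [(1/2)^j] up to time [j.+1]: a fixed time is eventually covered, and
   the errors are summable. *)
have /choice[k Hk] : forall j : nat, exists k, forall t, 0 <= t <= j.+1%:R ->
    (area (E t `+` S k (Num.truncn (t / tau k))) <= ((1 / 2) ^+ j)%:E)%E.
  move=> j; have T0 : 0 < j.+1%:R :> R by rewrite ltr0n.
  have p0 : (0 < ((1 / 2 : R) ^+ j)%:E)%E by rewrite lte_fin exprn_gt0// divr_gt0.
  have nb : nbhs (0 : \bar R)%E [set x | (x < ((1 / 2 : R) ^+ j)%:E)%E].
    by apply: open_nbhs_nbhs; split=> //; exact: open_ereal_lt_ereal.
  have [k _ Hk] := lim _ T0 _ nb.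
  exists k => t t01; have := Hk k (leqnn k) => /= h.
  apply: ltW; apply: le_lt_trans h; apply: ereal_sup_ubound; by exists t.
(* The indices [k j] do not depend on [t]. Nestedness within each discrete flow therefore passes
   pointwise to the lower limits, for all times at once. *)
pose A t j := C (k j) (Num.truncn (t / tau (k j))).
have AK t j : A t j `<=` K0.
  by have [<- _ H _] := HC (k j); exact: H.
have EA t j : 0 <= t <= j.+1%:R -> (area (E t `+` A t j) <= ((1 / 2) ^+ j)%:E)%E.
  move=> t01; have [_ _ _ H] := HC (k j).
  by apply: le_trans (area_setY_sub _ (S (k j) (Num.truncn (t / tau (k j)))) _) _; rewrite H adde0; exact: Hk.
(* [K0] is a closed representative of [E0] and may exceed it by a null set, hence the intersection
   with [E0]. *)
exists (fun t => set_liminf (A t) `&` E0); split.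
- move=> t t0; have a0 : area (E t `+` set_liminf (A t)) = 0%E.
    apply: (@liminf_area _ _ _ (Num.truncn t)) => j tj; apply: EA; rewrite t0/=.
    by apply: ltW; apply: lt_le_trans (Num.Theory.truncnS_gt t) _; rewrite ler_nat.
  apply/eqP; rewrite eq_le area_ge0 andbT.
  have sub : E t `+` (set_liminf (A t) `&` E0) `<=` (E t `+` set_liminf (A t)) `|` (E0 `+` K0).
    move=> x [[Ex nD]|[[Dx E0x] nE]]; last by left; right.
    have [Dx|nDx] := pselect (set_liminf (A t) x); last by left; left.
    right; right; split; last by move=> E0x; apply: nD.
    by have [n _ Hn] := Dx; apply: (AK t n); apply: Hn => /=.
  by apply: le_trans (le_area sub) _; apply: le_trans (areaU _ _) _; rewrite a0 EK0 adde0.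
- move=> t _; apply/cvxP; apply: cvxI => //; apply: cvx_liminf => j.
  by have [_ H _ _] := HC (k j); exact: (H _).2.
- by move=> t _ x [].
- move=> s t s0 st x [[n _ Hn] E0x]; split=> //; exists n => // j nj.
  have [_ _ H _] := HC (k j); apply: (H _ _ _ _ (Hn j nj)).
  by apply: Num.Theory.le_truncn; rewrite ler_pM2r// invr_gt0.
Qed.
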